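(* There exist an infinite set $A$ of integers $g\ge 2$ (with $\ln\ln\ln g$ defined and positive for $g\in A$) and, for every $g\in A$, a closed oriented hyperbolic surface $\Sigma_g$ of genus $g$ endowed with a standard hexagonal tesselation $\tau_g$, such that (1) the set of curves of $\tau_g$ is exactly the set $\mathrm{Syst}(\Sigma_g)$ of systoles of $\Sigma_g$; and (2) $$\mathrm{Card}\,\mathrm{Syst}(\Sigma_g)\le \frac{57}{\sqrt{\ln\ln\ln g}}\;\frac{g}{\sqrt{\ln g}}.$$
   Context: A systole of a hyperbolic surface $\Sigma$ is an essential closed geodesic of minimal length; $\mathrm{Syst}(\Sigma)$ is the set of all systoles (closed geodesics are regarded as unparametrized, unoriented curves). Let $P$ be the unique (up to isometry) regular right-angled hyperbolic hexagon; all its sides have length $L=\operatorname{arcosh} 2$. The decorated hexagon $\mathcal P$ is $P$, oriented, with its sides $S_1,\dots,S_6$ indexed by $\mathbb Z/6\mathbb Z$ cyclically in anti-clockwise order; $\overline{\mathcal P}$ is the same hexagon with the opposite orientation. A standard (hexagonal) tesselation of an oriented hyperbolic surface $\Sigma$ is a tesselation whose tiles are decorated hexagons $\mathcal P$ or $\overline{\mathcal P}$ such that (AX1) tiles are glued along sides of the same index, and (AX2) each vertex has valence four. A curve of a standard tesselation is a maximal geodesic contained in its $1$-skeleton. *)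

(* Defs.v *)
(* MathComp / MathComp-Analysis. *)
From HB Require Import structures.
From mathcomp Require Import all_boot all_order all_algebra.
From mathcomp Require Import all_classical all_reals all_analysis.
From mathcomp Require Import ring lra.
Import Order.TTheory GRing.Theory Num.Theory numFieldNormedType.Exports.

Set Implicit Arguments.
Unset Strict Implicit.
Unset Printing Implicit Defensive.

Local Open Scope classical_set_scope.
Local Open Scope ring_scope.

(* The hyperbolic plane is the hyperboloid sheet in Minkowski space R^{2,1},
   with its orientation seen from the positive time axis in the plane of the
   coordinates (1, 2). *)
Section HyperbolicPlane.
Context {R : realType}.
Implicit Types (x y : 'cV[R]_3) (A : 'M[R]_3).

Definition lorentz x y : R :=
  \sum_(i < 3) (if i == 0 then -1 else 1) * (x i 0 * y i 0).

Definition hyp : set 'cV[R]_3 := [set x | lorentz x x = -1 /\ 0 < x 0 0].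

Definition arcosh (a : R) : R := ln (a + Num.sqrt (a ^+ 2 - 1)).

Definition hdist x y : R := arcosh (- lorentz x y).

(* The isometries of [hyp] are the restrictions of the linear maps in
   O^+(2,1); those of determinant 1 (resp. -1) preserve (resp. reverse) the
   orientation. *)
Definition hyp_isometry A : Prop :=
  (forall x y, lorentz (A *m x) (A *m y) = lorentz x y) /\
  (forall x, hyp x -> hyp (A *m x)).

(* Complete unit-speed geodesics. *)
Definition geodesic_line (gamma : R -> 'cV[R]_3) : Prop :=
  (forall t, hyp (gamma t)) /\
  (forall s t, hdist (gamma s) (gamma t) = `|s - t|).

Definition hsegment x y : set 'cV[R]_3 :=
  [set z | hyp z /\ exists a b : R, [/\ 0 <= a, 0 <= b & z = a *: x + b *: y]].

(* Vertices of the regular right-angled hexagon centred at (1, 0, 0), in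
   anti-clockwise order (6-periodic in k); its circumradius r satisfies
   cosh r = cot (pi / 6) cot (pi / 4) = sqrt 3. See [hex_side_length] and
   [hex_right_angle] below. *)
Definition hex_vertex (k : nat) : 'cV[R]_3 :=
  \col_(i < 3) (if i == 0 then Num.sqrt 3
                else if i == 1 then Num.sqrt 2 * cos (k%:R * (pi / 3))
                else Num.sqrt 2 * sin (k%:R * (pi / 3))).

Definition hex_side (k : 'I_6) : set 'cV[R]_3 :=
  hsegment (hex_vertex k) (hex_vertex k.+1).

Definition hexagon : set 'cV[R]_3 :=
  [set x | hyp x /\ exists c : 'I_6 -> R,
     (forall k, 0 <= c k) /\ x = \sum_(k < 6) c k *: hex_vertex k].

Definition hexagon_interior : set 'cV[R]_3 :=
  [set x | hyp x /\ exists c : 'I_6 -> R,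
     (forall k, 0 < c k) /\ x = \sum_(k < 6) c k *: hex_vertex k].

Lemma lorentzE x y :
  lorentz x y = - (x 0 0 * y 0 0) + x 1 0 * y 1 0 + x (1 + 1) 0 * y (1 + 1) 0.
Proof.
rewrite /lorentz !big_ord_recl big_ord0 /= addr0 mulN1r !mul1r !addrA.
by congr (_ + _ * _ + _ * _); congr (_ _ _); apply/val_inj.
Qed.

Lemma cos_pi3 : cos (pi / 3 : R) = 1 / 2.
Proof.
have pi0 : (0 : R) < pi by exact: pi_gt0.
have c0 : 0 < cos (pi / 3 : R) by apply: cos_gt0_pihalf; apply/andP; split; lra.
have h3 : cos (pi / 3 + (pi / 3 + pi / 3) : R) = -1.
  by rewrite -(@cospi R); congr cos; field.
have h1 := cos2Dsin2 (pi / 3 : R).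
move: h3; rewrite !(cosD, sinD).
set c := cos _ in c0 h1 *; set s := sin _ in h1 *.
have -> : c * (c * c - s * s) - s * (s * c + c * s) = 
  c ^+ 3 - 3 * c * s ^+ 2 by ring.
have -> : s ^+ 2 = 1 - c ^+ 2 by rewrite -h1; ring.
move=> e.
have : (c + 1) * (2 * c - 1) ^+ 2 = 0.
  have -> : (c + 1) * (2 * c - 1) ^+ 2 = c ^+ 3 - 3 * c * (1 - c ^+ 2) + 1 by ring.
  by rewrite e; ring.
move/eqP; rewrite mulf_eq0 expf_eq0 /= => /orP[/eqP|/eqP]; lra.
Qed.

Lemma hex_vertex_lorentz j k :
  lorentz (hex_vertex j) (hex_vertex k) =
  - 3 + 2 * cos (k%:R * (pi / 3) - j%:R * (pi / 3)).
Proof.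
rewrite lorentzE !mxE /= cosB.
have h3 : Num.sqrt (3 : R) * Num.sqrt 3 = 3 by rewrite -expr2 sqr_sqrtr.
have h2 : Num.sqrt (2 : R) * Num.sqrt 2 = 2 by rewrite -expr2 sqr_sqrtr.
have acac (a b c : R) : a * b * (a * c) = (a * a) * (b * c) by ring.
by rewrite h3 !acac h2; ring.
Qed.

Lemma hex_vertex_hyp k : hyp (hex_vertex k).
Proof.
split; first by rewrite hex_vertex_lorentz subrr cos0; ring.
by rewrite mxE /= sqrtr_gt0.
Qed.

Lemma hex_side_length k : hdist (hex_vertex k) (hex_vertex k.+1) = arcosh 2.
Proof.
rewrite /hdist hex_vertex_lorentz.
have -> : k.+1%:R * (pi / 3) - k%:R * (pi / 3) = pi / 3 :> R.
  by rewrite -[k.+1%:R]natr1; ring.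
by rewrite cos_pi3; congr arcosh; field.
Qed.

(* x + <x, p> p is tangent at p to the geodesic from p to x. *)
Lemma hex_right_angle k :
  let p := hex_vertex k.+1 in
  let dir x := x + lorentz x p *: p in
  lorentz (dir (hex_vertex k)) (dir (hex_vertex k.+2)) = 0.
Proof.
move=> p dir.
have bil x y : lorentz (dir x) (dir y) =
    lorentz x y + lorentz x p * lorentz y p * (2 + lorentz p p).
  by rewrite /dir !lorentzE !mxE; ring.
rewrite bil /p !hex_vertex_lorentz subrr cos0.
have -> : k.+1%:R * (pi / 3) - k%:R * (pi / 3) = pi / 3 :> R.
  by rewrite -[k.+1%:R]natr1; ring.
have -> : k.+1%:R * (pi / 3) - k.+2%:R * (pi / 3) = - (pi / 3) :> R.
  by rewrite -[k.+2%:R]natr1; ring.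
have -> : k.+2%:R * (pi / 3) - k%:R * (pi / 3) = (pi / 3) *+ 2 :> R.
  by rewrite -[k.+2%:R]natr1 -[k.+1%:R]natr1; ring.
by rewrite cosN cos_mulr2n cos_pi3; field.
Qed.

End HyperbolicPlane.

(* A closed oriented hyperbolic surface is the quotient of [hyp] by the deck
   group of its universal covering: a group of orientation-preserving
   isometries acting freely, properly discontinuously ([deck_free]) and cocompactly. *)
Record hyp_surface (R : realType) := HypSurface {
  deck :> set 'M[R]_3;
  deck_isometry : forall h, deck h -> hyp_isometry h /\ \det h = 1;
  deck1 : deck 1%:M;
  deckM : forall h k, deck h -> deck k -> deck (h *m k);
  deckV : forall h, deck h -> deck (invmx h);
  deck_free : forall x, hyp x -> exists2 e : R, 0 < e &
    forall h, deck h -> hdist x (h *m x) < e -> h = 1%:M;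
  deck_cocompact : exists K : set 'cV[R]_3,
    [/\ compact K, K `<=` hyp &
        forall x, hyp x -> exists h y, [/\ deck h, K y & x = h *m y]]
}.

Section Surface.
Context {R : realType} (S : hyp_surface R).

(* The points of the surface are the orbits; [surf_proj] is the covering. *)
Definition surf_proj (x : 'cV[R]_3) : set 'cV[R]_3 :=
  [set y | exists2 h, deck S h & y = h *m x].

(* A finite cell (CW) structure. The k-cells are modelled on the ball of the
   sup norm of R^k, and each characteristic map, its domain being simply
   connected, is given by a lift to [hyp]. *)
Record cell_structure := CellStructure {
  cell : finType;
  cell_dim : cell -> nat;
  cell_map : forall c, 'rV[R]_(cell_dim c) -> 'cV[R]_3;
  cell_dim_le2 : forall c, (cell_dim c <= 2)%N;
  cell_map_hyp : forall c (u : 'rV[R]_(cell_dim c)), `|u| <= 1 -> hyp (@cell_map c u);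
  cell_map_continuous : forall c,
    {within [set u : 'rV[R]_(cell_dim c) | `|u| <= 1], continuous (@cell_map c)};
  cell_cover : forall x, hyp x ->
    exists c (u : 'rV[R]_(cell_dim c)), `|u| < 1 /\
      surf_proj (@cell_map c u) = surf_proj x;
  cell_inj : forall c (u v : 'rV[R]_(cell_dim c)), `|u| < 1 -> `|v| < 1 ->
    surf_proj (@cell_map c u) = surf_proj (@cell_map c v) -> u = v;
  cell_disjoint : forall c d (u : 'rV[R]_(cell_dim c)) (v : 'rV[R]_(cell_dim d)),
    `|u| < 1 -> `|v| < 1 ->
    surf_proj (@cell_map c u) = surf_proj (@cell_map d v) -> c = d;
  cell_boundary : forall c (u : 'rV[R]_(cell_dim c)), `|u| = 1 ->
    exists d (v : 'rV[R]_(cell_dim d)),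
      [/\ (cell_dim d < cell_dim c)%N, `|v| < 1 &
          surf_proj (@cell_map c u) = surf_proj (@cell_map d v)]
}.

Definition euler_char (C : cell_structure) : int :=
  \sum_(c : cell C) (-1) ^+ cell_dim c.

(* The Euler characteristic does not depend on the cell structure. *)
Definition has_genus (g : nat) : Prop :=
  exists C : cell_structure, euler_char C = 2 - 2 * g%:Z.

(* A closed geodesic of length l, given by a lift. The last clause says that
   it is essential: a loop of the surface is null-homotopic iff its lifts to
   the universal covering are closed. *)
Definition essential_closed_geodesic (gamma : R -> 'cV[R]_3) (l : R) : Prop :=
  [/\ geodesic_line gamma, 0 < l,
      forall t, surf_proj (gamma (t + l)) = surf_proj (gamma t) &
      gamma l <> gamma 0].

(* A systole, as an unparametrized and unoriented curve, is determined by its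
   trace: it is traversed once, by minimality of its length. *)
Definition Syst : set (set (set 'cV[R]_3)) :=
  [set C | exists gamma l,
     [/\ essential_closed_geodesic gamma l,
         C = range (surf_proj \o gamma) &
         forall gamma' l', essential_closed_geodesic gamma' l' -> l <= l']].

(* A standard tesselation, described by its lift to the universal covering.
   A tile is the image of [hexagon] by an isometry f, carrying the indices of
   the sides: it is a copy of the decorated hexagon if \det f = 1, and of the
   hexagon with the opposite orientation if \det f = -1. [tile_glue] is (AX1):
   each side of a tile f is glued to the side of the same index of another
   tile f', by the identity of that side. [tile_valence] is (AX2): edges are
   geodesic segments, so no edge of the lift is incident twice to a vertex,
   and valences are those of the surface. *)
Record std_tesselation := StdTesselation {
  tile :> set 'M[R]_3;
  tile_isometry : forall f, tile f -> hyp_isometry f;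
  tile_deck : forall h f, deck S h -> tile f -> tile (h *m f);
  tile_cover : forall x, hyp x ->
    exists f y, [/\ tile f, hexagon y & x = f *m y];
  tile_disjoint : forall f f' x y, tile f -> tile f' ->
    hexagon_interior x -> hexagon y -> f *m x = f' *m y -> f = f';
  tile_glue : forall f (k : 'I_6), tile f ->
    exists f', [/\ tile f', f' <> f &
                   forall x, hex_side k x -> f' *m x = f *m x];
  tile_valence : forall f (k : 'I_6), tile f ->
    ([set e : set 'cV[R]_3 | e (f *m hex_vertex k) /\
       exists f' (j : 'I_6), tile f' /\ e = mulmx f' @` hex_side j]
       #= `I_4)%card
}.

Definition skeleton (tau : std_tesselation) : set (set 'cV[R]_3) :=
  [set p | exists f (k : 'I_6) x,
     [/\ tile tau f, hex_side k x & p = surf_proj (f *m x)]].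

(* Geodesics of the surface, possibly bounded, as subsets. *)
Definition surf_geodesic (C : set (set 'cV[R]_3)) : Prop :=
  exists (gamma : R -> 'cV[R]_3) (J : set R),
    [/\ geodesic_line gamma, is_interval J,
        exists s t, [/\ J s, J t & s < t] &
        C = (surf_proj \o gamma) @` J].

Definition tess_curves (tau : std_tesselation) : set (set (set 'cV[R]_3)) :=
  [set C | [/\ surf_geodesic C, C `<=` skeleton tau &
     forall C', surf_geodesic C' -> C' `<=` skeleton tau -> C `<=` C' ->
       C' = C]].

End Surface.

(* Main.v *)
(** In the right-angled hexagon P the sides of one parity are pairwise at distance L.  Let W be
    the right-angled Coxeter group of the six reflections s_i in the sides, and F a finite prime
    field F_p.  A Burau-like cocycle P : W -> M_6(F[X]), w |-> P w, satisfies T w = 1 + a P w for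
    T the reflection representation with form a_ii = 2, a_(i,i+2) = - X^4, a_(i,i+3) = - X^3 and
    a_(i,i+1) = 0.  The surface is the quotient of the plane by the group of the words w of even
    length in the sides of each parity for which P w vanishes modulo
    Q = S_m(X^4)^2 - S_(m-1)(X^4)^2, S_m being the Chebyshev polynomials of the second kind.
    This Q makes s_i s_(i+2) of order k = 2m+1, so every curve of the tesselation closes up
    after length 2kL.

    Let z be a deck transformation translating a closed geodesic by at most 2kL, and write
    z = u v^-1 with u and v in layered normal form (each layer consists of commuting letters),
    each crossed along at most kL.  The entries of P u and P v have degree at most
    4(k-1) = deg Q and those of P u - P v are divisible by Q, hence are constant multiples of Q;
    discarding the letters i for which the row i of P u - P v vanishes amounts to replacing W by
    a parabolic subgroup containing z.  In a nonzero row the extremal degree is reached, which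
    forces one of the halves to cross at least k walls of one parity.  An integrality argument
    shows that two disjoint walls of one parity are at distance at least L, so the geodesic
    crosses these walls orthogonally, and a line orthogonal to two adjacent walls of one parity
    is itself the wall between them.  Hence the systoles are exactly the curves.

    If there are 4M hexagons then the genus is M + 1, there are at most 6M/k curves, and
    M <= p^(288 m) by counting residues modulo Q; with k of the order of p/8 this gives
    ln g = O(k ln k) and the bound. *)

Require Import Defs.
From HB Require Import structures.
From mathcomp Require Import all_boot all_order all_algebra.
From mathcomp Require Import all_classical all_reals all_analysis.
From mathcomp Require Import ring lra zify.
Import Order.TTheory GRing.Theory Num.Theory numFieldNormedType.Exports.

Set Implicit Arguments.
Unset Strict Implicit.
Unset Printing Implicit Defensive.

(** The degree in X measures length. Walls of letters i, i+2 are at distance L and contribute X^4;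
    those of i, i+3 are farther apart, yet contribute only X^3. So an extremal degree excludes steps
    of the second kind and is carried by letters of a single parity. The exponent 3 also separates
    leading terms: of two commuting letters placed next to a third one with which neither commutes,
    exactly one gains 4, so their degrees differ by one. What is left as leading coefficients are,
    up to sign, integers bounded by the number of layers. As u v^-1 has at most 4k letters, a
    characteristic above 4k suffices, while counting residues asks for a small field; a prime near
    8k serves both ends. Degrees alone cannot conclude: (s_i s_(i+2))^k is a relator of translation
    length exactly 2kL, so the extremal case does occur and has to be recognised geometrically.
    Evenness in each parity makes the action free, because a vertex is fixed by one letter of each
    parity. *)

Notation letter := 'I_6.
Notation word := (seq 'I_6).

(** * Letters, words and equality in the Coxeter group *)

Definition gap (i j : letter) : nat := (j + 6 - i) %% 6.
Definition comm (i j : letter) := (gap i j == 1) || (gap i j == 5).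
Definition apart (i j : letter) := (gap i j == 2) || (gap i j == 4).
Definition facing (i j : letter) := gap i j == 3.
Definition nc (i j : letter) := apart i j || facing i j.

Definition letters6 : seq letter :=
  [:: @Ordinal 6 0 isT; @Ordinal 6 1 isT; @Ordinal 6 2 isT;
      @Ordinal 6 3 isT; @Ordinal 6 4 isT; @Ordinal 6 5 isT].

Lemma all_letters (Q : pred letter) : all Q letters6 -> forall i, Q i.
Proof.
move=> /allP h i; apply: h; rewrite -(mem_map val_inj).
by case: i => [[|[|[|[|[|[|//]]]]]] ?].
Qed.

Lemma all_letters2 (Q : letter -> letter -> bool) :
  all (fun i => all (Q i) letters6) letters6 -> forall i j, Q i j.
Proof. by move=> /all_letters h i; apply: all_letters. Qed.

Lemma all_letters3 (Q : letter -> letter -> letter -> bool) :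
  all (fun i => all (fun j => all (Q i j) letters6) letters6) letters6 -> forall i j k, Q i j k.
Proof. by move=> /all_letters h i; apply: all_letters2. Qed.

Lemma all_letters4 (Q : letter -> letter -> letter -> letter -> bool) :
  all (fun i => all (fun j => all (fun k => all (Q i j k) letters6) letters6) letters6) letters6 ->
  forall i j k l, Q i j k l.
Proof. by move=> /all_letters h i; apply: all_letters3. Qed.

Ltac letters := repeat (match goal with
  | i : ?A |- _ => unify A 'I_6; revert i end);
  repeat (let i := fresh "i" in move=> i; case: i => [[|[|[|[|[|[|//]]]]]] ?]).

Lemma commC i j : comm i j = comm j i.
Proof. by letters. Qed.
Lemma ncC i j : nc i j = nc j i.
Proof. by letters. Qed.
Lemma apartC i j : apart i j = apart j i.
Proof. by letters. Qed.
Lemma facingC i j : facing i j = facing j i.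
Proof. by letters. Qed.
Lemma nc_comm i j : nc i j = (i != j) && ~~ comm i j.
Proof. by letters. Qed.
Lemma comm_comm_nc i j k : [==> i != k, comm j k, comm i j => nc i k].
Proof. by move: i j k; apply: all_letters3. Qed.
Lemma comm_irr i : comm i i = false.
Proof. by letters. Qed.
Lemma nc_irr i : nc i i = false.
Proof. by letters. Qed.
Lemma comm_nc i j : comm i j -> nc i j = false.
Proof. by rewrite nc_comm andbC => ->. Qed.
(* Equality in the right-angled Coxeter group of the hexagon, as a relation on words. *)
Inductive weq : word -> word -> Prop :=
| weq_refl w : weq w w
| weq_trans w1 w2 w3 : weq w1 w2 -> weq w2 w3 -> weq w1 w3
| weq_sym w1 w2 : weq w1 w2 -> weq w2 w1
| weq_cons i w1 w2 : weq w1 w2 -> weq (i :: w1) (i :: w2)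
| weq_cancel i w : weq (i :: i :: w) w
| weq_swap i j w : comm i j -> weq (i :: j :: w) (j :: i :: w).

Lemma weq_catl u w1 w2 : weq w1 w2 -> weq (u ++ w1) (u ++ w2).
Proof. by move=> h; elim: u => //= i u IH; apply: weq_cons. Qed.

Lemma weq_catr u w1 w2 : weq w1 w2 -> weq (w1 ++ u) (w2 ++ u).
Proof.
elim=> {w1 w2} /=.
- by move=> w; apply: weq_refl.
- by move=> w1 w2 w3 _ h1 _ h2; apply: weq_trans h1 h2.
- by move=> w1 w2 _ h; apply: weq_sym.
- by move=> i w1 w2 _ h; apply: weq_cons.
- by move=> i w; apply: weq_cancel.
- by move=> i j w h; apply: weq_swap.
Qed.

Lemma weq_cat u1 u2 w1 w2 : weq u1 u2 -> weq w1 w2 -> weq (u1 ++ w1) (u2 ++ w2).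
Proof. by move=> h1 h2; apply: weq_trans (weq_catr _ h1) (weq_catl _ h2). Qed.

Lemma weq_rev w1 w2 : weq w1 w2 -> weq (rev w1) (rev w2).
Proof.
elim=> {w1 w2}.
- by move=> w; apply: weq_refl.
- by move=> w1 w2 w3 _ h1 _ h2; apply: weq_trans h1 h2.
- by move=> w1 w2 _ h; apply: weq_sym.
- by move=> i w1 w2 _ h; rewrite !rev_cons -!cats1; apply: weq_catr.
- move=> i w; rewrite !rev_cons -!cats1 -catA -[X in weq _ X]cats0.
  by apply: weq_catl; apply: weq_cancel.
- move=> i j w h; rewrite !rev_cons -!cats1 -!catA.
  by apply: weq_catl; apply: weq_swap; rewrite commC.
Qed.

Lemma weq_revK w : weq (w ++ rev w) [::].
Proof.
elim/last_ind: w => [|w i IH]; first exact: weq_refl.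
rewrite rev_rcons -cats1 -catA /=.
by apply: weq_trans (weq_catl _ (weq_cancel _ _)) IH.
Qed.

Lemma weq_Krev w : weq (rev w ++ w) [::].
Proof. by have := weq_revK (rev w); rewrite revK. Qed.

Lemma weq_move i (U w : word) : all (comm i) U -> weq (i :: U ++ w) (U ++ i :: w).
Proof.
elim: U => [|j U IH] /=; first by move=> _; apply: weq_refl.
move=> /andP[cij h].
by apply: weq_trans (weq_swap _ cij) _; apply: weq_cons; apply: IH.
Qed.

Lemma weq_perm (V U : word) : pairwise comm V -> perm_eq V U -> weq V U.
Proof.
elim: U V => [|i U IH] V pV /[dup] pVU; first by move/perm_nilP ->; constructor.
move=> /perm_mem /(_ i); rewrite inE eqxx /= => iV.
have h : weq V (i :: rem i V).
  elim: V iV pV {pVU} => //= a V IHV; rewrite inE eq_sym.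
  case: (altP (a =P i)) => [->|ai] /= iV /andP[ha pV]; first by constructor.
  apply: weq_trans (weq_cons _ (IHV iV pV)) _; apply: weq_swap.
  exact: (allP ha).
apply: weq_trans h _; apply: weq_cons; apply: IH.
  exact: subseq_pairwise (rem_subseq _ _) pV.
by rewrite -(perm_cons i) -(permPl (perm_to_rem iV)).
Qed.

(** * Layered words *)

Definition clique (V : word) := (V != [::]) && pairwise comm V.
Definition supported (V U : word) := all (fun i => has (nc i) V) U.

(** This is the Cartier-Foata normal form, with each letter as far left as it can go: a letter of a
    layer is blocked by a noncommuting letter of the layer before. Blocking also prevents
    cancellation, and layered words turn out to be shortest ([lay_min]). *)
Fixpoint lay (L : seq word) :=
  if L is V :: L' then [&& clique V, supported V (head [::] L') & lay L'] else true.

Lemma pairwise_comm_inj (V : word) i j :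
  pairwise comm V -> i \in V -> j \in V -> i != j -> comm i j.
Proof.
elim: V => //= k V IH /andP[hk hV]; rewrite !inE.
move=> /predU1P[->|iV] /predU1P[->|jV]; rewrite ?eqxx // => nij.
- by rewrite (allP hk).
- by rewrite commC (allP hk).
- exact: IH.
Qed.

Lemma clique_comm V i j : clique V -> i \in V -> j \in V -> i != j -> comm i j.
Proof. by move=> /andP[_]; apply: pairwise_comm_inj. Qed.

Lemma clique_nnc V i j : clique V -> i \in V -> j \in V -> nc i j = false.
Proof.
move=> cV iV jV; case: (altP (i =P j)) => [->|nij]; first exact: nc_irr.
by apply: comm_nc; apply: clique_comm cV iV jV nij.
Qed.

Lemma clique_uniq V : clique V -> uniq V.
Proof.
case/andP=> _; elim: V => //= i V IH /andP[hi /IH ->]; rewrite andbT.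
by apply/negP=> /(allP hi); rewrite comm_irr.
Qed.

Lemma lay_cat L1 L2 : lay (L1 ++ L2) -> lay L1 /\ lay L2.
Proof.
elim: L1 => //= V L1 IH /and3P[cV sV /IH[h1 h2]]; split=> //.
by rewrite cV h1 andbT /=; case: L1 sV {IH h1} => //=.
Qed.

Lemma layers_disjoint V U i : clique V -> supported V U -> i \in V -> i \notin U.
Proof.
move=> cV sU iV; apply/negP=> /(allP sU)/hasP[j jV].
by rewrite (clique_nnc cV).
Qed.

(** The mirror image, with letters as far right as possible. In this form left multiplication by one
    letter is a recursion on the layers, and reversal leads back to [lay]. *)
Fixpoint colay (M : seq word) :=
  if M is U :: M' then
    [&& clique U, (M' == [::]) || supported (head [::] M') U & colay M']
  else true.

Lemma lay_rcons L V :
  lay L -> clique V -> (L = [::] \/ supported (last [::] L) V) -> lay (rcons L V).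
Proof.
elim: L => [|U L IH] /=; first by move=> _ ->.
move=> /and3P[cU sU lL] cV [//|sV]; rewrite cU /=.
case: L sU lL sV IH => [|W L] /= sU lL sV IH.
  by rewrite sV cV.
rewrite sU; apply: (IH lL cV); by right.
Qed.

Lemma colay_rev M : colay M -> lay (rev (map rev M)).
Proof.
have cr U : clique (rev U) = clique U.
  rewrite /clique -!size_eq0 size_rev; congr (_ && _).
  elim: U => //= i U IH; rewrite rev_cons -cats1 pairwise_cat /= IH allrel1r all_rev andbT.
  by congr (_ && _); apply: eq_all => j; rewrite commC.
have sr V U : supported (rev V) (rev U) = supported V U.
  by rewrite /supported all_rev; apply: eq_all => i; rewrite has_rev.
elim: M => //= U M IH /and3P[cU sU cM]; rewrite rev_cons.
apply: lay_rcons; [exact: IH|by rewrite cr|].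
case: M sU {IH cM} => [|W M] /= sU; first by left.
by right; rewrite rev_cons last_rcons sr.
Qed.

(** The letter slides to the right until it cancels or joins the last layer that it can reach.
    [None] says that it is blocked at once, or that there is no layer, so that it has to open a new
    layer in front. *)
Fixpoint push (i : letter) (M : seq word) : option (seq word) :=
  if M is U :: M' then
    if i \in U then Some (if rem i U is [::] then M' else rem i U :: M')
    else if has (nc i) U then None
    else if push i M' is Some N then Some (U :: N) else Some ((i :: U) :: M')
  else None.

(** The fourth conclusion carries the induction: the letter slides past a layer only if it commutes
    with all letters there, and these must stay supported by the layer behind them after it has
    changed. *)
Lemma pushP i M : colay M ->
  match push i M with
  | None => (i \notin head [::] M) && ((M == [::]) || has (nc i) (head [::] M))
  | Some N => [/\ colay N, weq (flatten N) (i :: flatten M),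
      (size (flatten N) <= (size (flatten M)).+1)%N,
      forall j, comm j i -> has (nc j) (head [::] M) -> has (nc j) (head [::] N) &
      {subset flatten N <= i :: flatten M}]
  end.
Proof.
elim: M => [|U M IH] //= /and3P[cU sU cM].
case: ifP => iU.
  have pr := perm_to_rem iU.
  have cr : rem i U != [::] -> clique (rem i U).
    move=> h; rewrite /clique h /=; case/andP: cU => _ pU.
    by apply: subseq_pairwise pU; apply: rem_subseq.
  have ci : all (comm i) (rem i U).
    apply/allP=> j jr; have jU := mem_rem jr.
    apply: (clique_comm cU iU jU); apply/eqP=> e; move: jr.
    by rewrite -e mem_rem_uniq ?inE ?eqxx //; apply: clique_uniq.
  have wU : weq (rem i U ++ flatten M) (i :: U ++ flatten M).
    elim: U iU ci {cr pr cU sU} => //= a U IHU.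
    rewrite inE eq_sym; case: (altP (a =P i)) => [->|ai] /=.
      by move=> _ _; apply: weq_sym; apply: weq_cancel.
    move=> iU /andP[cia ci].
    apply: weq_trans (weq_sym (weq_swap _ _)) => //.
    by apply: weq_cons; apply: IHU; rewrite // commC.
  have hd j : comm j i -> has (nc j) U -> has (nc j) (rem i U).
    move=> cj /hasP[l lU nl]; apply/hasP; exists l => //.
    rewrite mem_rem_uniq ?clique_uniq // inE lU andbT.
    by apply/eqP=> e; move: nl; rewrite e (comm_nc cj).
  have sz : size (rem i U) = (size U).-1 by apply: size_rem.
  case er : (rem i U) cr ci wU hd sz => [|a r] cr ci wU hd sz; split=> //=.
  - by move: sz => /=; rewrite size_cat; clear; lia.
  - by move=> j cj h; have := hd j cj h.
  - by move=> x; rewrite inE mem_cat => ->; rewrite !orbT.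
  - rewrite cr //= cM andbT.
    case: eqP sU => //= _ sU; apply/andP.
    have mr x : x \in a :: r -> x \in U by rewrite -er => /mem_rem.
    split; last by apply/allP=> x xr; apply: (allP sU); apply: mr; rewrite inE xr orbT.
    by apply: (allP sU); apply: mr; rewrite inE eqxx.
  - by move: sz => /=; rewrite !size_cat /=; clear; lia.
  - move=> x; rewrite -cat_cons mem_cat => /orP[xr|xM]; rewrite inE mem_cat ?xM ?orbT //.
    have /mem_rem -> : x \in rem i U by rewrite er.
    by rewrite orbT.
case: ifP => nU //.
have ci : all (comm i) U.
  apply/allP=> j jU; move: (hasPn (negbT nU) j jU).
  by rewrite nc_comm negb_and !negbK => /orP[/eqP e|//]; move: iU; rewrite e jU.
case e : (push i M) (IH cM) => [N|].
  case=> cN wN sN hN bN; split=> //=.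
  - rewrite cU cN andbT /=; apply/orP; right.
    case: eqP sU e => [-> //|_ /= sU _].
    by apply/allP=> j jU; apply: hN; rewrite ?(allP sU) // commC (allP ci).
  - apply: weq_trans (weq_catl _ wN) _; apply: weq_sym.
    exact: weq_move.
  - by rewrite !size_cat; lia.
  - move=> x; rewrite inE !mem_cat => /orP[->|/bN]; first by rewrite !orbT.
    by rewrite inE => /orP[->|->]; rewrite ?orbT.
move=> /andP[_ hM]; split=> //=.
- rewrite cM andbT; apply/andP; split.
    by rewrite /clique /= ci; case/andP: cU.
  by case: eqP sU hM => //= _ -> ->.
- exact: weq_refl.
- by move=> j cj h; rewrite h orbT.
Qed.

Lemma colay_nf w : exists M,
  [/\ colay M, weq (flatten M) w, (size (flatten M) <= size w)%N &
      {subset flatten M <= w}].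
Proof.
elim: w => [|i w [M [cM wM sM bM]]]; first by exists [::]; split=> //; apply: weq_refl.
have := pushP i cM; case: (push i M) => [N [cN wN sN _ bN]|/andP[_ h]].
  exists N; split=> //; last first.
  - by move=> x /bN; rewrite !inE => /orP[->//|/bM ->]; rewrite orbT.
  - by apply: leq_trans sN _; rewrite ltnS.
  by apply: weq_trans wN _; apply: weq_cons.
exists ([:: i] :: M); split=> //=; first by rewrite cM andbT /=; case: eqP h => //= _ ->.
  exact: weq_cons.
by move=> x; rewrite !inE => /orP[->//|/bM ->]; rewrite orbT.
Qed.

Lemma lay_nf w : exists L,
  [/\ lay L, weq (flatten L) w, (size (flatten L) <= size w)%N &
      {subset flatten L <= w}].
Proof.
have [M [cM wM sM bM]] := colay_nf (rev w).
exists (rev (map rev M)); split; first exact: colay_rev.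
- by rewrite -rev_flatten -[w]revK; apply: weq_rev.
- by rewrite -rev_flatten size_rev -(size_rev w).
- by move=> x; rewrite -rev_flatten mem_rev => /bM; rewrite mem_rev.
Qed.

Local Open Scope classical_set_scope.
Local Open Scope ring_scope.

Lemma det3 (R : comRingType) (A : 'M[R]_3) :   \det A = A 0 0 * (A 1 1 * A (1+1) (1+1) - A 1 (1+1) * A (1+1) 1)
   - A 0 1 * (A 1 0 * A (1+1) (1+1) - A 1 (1+1) * A (1+1) 0)
   + A 0 (1+1) * (A 1 0 * A (1+1) 1 - A 1 1 * A (1+1) 0).
Proof.
(* The entries are named by pairs of natural numbers, so that [ring] identifies entries at equal
   indices that are written differently. *)
have [b E] : exists b : nat -> nat -> R, forall i j p q, nat_of_ord i = p -> nat_of_ord j = q -> A i j = b p q.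
  by exists (fun p q => A (inord p) (inord q)) => i j p q <- <-; rewrite !inord_val.
rewrite (expand_det_row _ 0) !big_ord_recl big_ord0 /cofactor !(expand_det_row _ 0) !big_ord_recl !big_ord0 /cofactor !det_mx11 !mxE /=.
repeat match goal with |- context [fun_of_matrix A ?i ?j] => 
  let p := eval compute in (nat_of_ord i) in let q := eval compute in (nat_of_ord j) in
  rewrite (E i j p q erefl erefl) end.
rewrite /bump /=.
ring.
Qed.

(** * The Minkowski form and causal vectors *)

Section Lorentz.
Variable R : realType.
Implicit Types x y z : 'cV[R]_3.

Lemma lorentzC x y : lorentz x y = lorentz y x.
Proof. by rewrite !lorentzE; ring. Qed.
Lemma lorentzDl x y z : lorentz (x + y) z = lorentz x z + lorentz y z.
Proof. by rewrite !lorentzE !mxE; ring. Qed.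
Lemma lorentzZl a x y : lorentz (a *: x) y = a * lorentz x y.
Proof. by rewrite !lorentzE !mxE; ring. Qed.
Lemma lorentzDr x y z : lorentz z (x + y) = lorentz z x + lorentz z y.
Proof. by rewrite !lorentzE !mxE; ring. Qed.
Lemma lorentzZr a x y : lorentz y (a *: x) = a * lorentz y x.
Proof. by rewrite !lorentzE !mxE; ring. Qed.
Lemma lorentzNl x y : lorentz (- x) y = - lorentz x y.
Proof. by rewrite !lorentzE !mxE; ring. Qed.
Lemma lorentzNr x y : lorentz x (- y) = - lorentz x y.
Proof. by rewrite !lorentzE !mxE; ring. Qed.
Lemma lorentz0l x : lorentz 0 x = 0.
Proof. by rewrite !lorentzE !mxE; ring. Qed.
Lemma lorentz0r x : lorentz x 0 = 0.
Proof. by rewrite !lorentzE !mxE; ring. Qed.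
Definition lorentz_lin := (lorentzDl, lorentzDr, lorentzNl, lorentzNr, lorentzZl, lorentzZr).

Lemma lorentz_suml (I : Type) (r : seq I) (F : I -> 'cV[R]_3) y :
  lorentz (\sum_(i <- r) F i) y = \sum_(i <- r) lorentz (F i) y.
Proof. by elim/big_rec2: _ => [|i a b _ <-]; rewrite ?lorentz0l // lorentzDl. Qed.

Lemma cV3P x y : x 0 0 = y 0 0 -> x 1 0 = y 1 0 -> x (1 + 1) 0 = y (1 + 1) 0 -> x = y.
Proof.
move=> h0 h1 h2; apply/colP => i.
case: i => [[|[|[|//]]]] hi.
- by have -> : Ordinal hi = 0 by apply/val_inj.
- by have -> : Ordinal hi = 1 by apply/val_inj.
- by have -> : Ordinal hi = 1 + 1 by apply/val_inj.
Qed.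

Definition col3 (a b c : R) : 'cV[R]_3 :=
  \col_(i < 3) (if i == 0 then a else if i == 1 then b else c).

Lemma lorentz_col3 a b c a' b' c' :
  lorentz (col3 a b c) (col3 a' b' c') = - (a * a') + b * b' + c * c'.
Proof. by rewrite lorentzE !mxE. Qed.

Lemma lorentz_col3l a b c y :
  lorentz (col3 a b c) y = - (a * y 0 0) + b * y 1 0 + c * y (1 + 1) 0.
Proof. by rewrite lorentzE !mxE. Qed.

Lemma mx_act_inj (A B : 'M[R]_3) : (forall x, A *m x = B *m x) -> A = B.
Proof.
move=> h; apply/matrixP => i j.
by move/colP: (h (delta_mx j 0)) => /(_ i); rewrite -!colE !mxE.
Qed.

Lemma causal_bound x : lorentz x x <= 0 -> x 1 0 ^+ 2 + x (1 + 1) 0 ^+ 2 <= x 0 0 ^+ 2.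
Proof. by rewrite lorentzE !expr2 => h; lra. Qed.

(** Euclidean Cauchy-Schwarz bounds the mixed space term by UV, with U and V the norms of the space
    parts. The rest is the identity (|a||d| - UV)^2 - (a^2 - U^2)(d^2 - V^2) = (|a|V - U|d|)^2. *)
Lemma reverse_CauchySchwarz x y : lorentz x x <= 0 -> lorentz y y <= 0 ->
  lorentz x x * lorentz y y <= lorentz x y ^+ 2.
Proof.
move=> /causal_bound hx /causal_bound hy; rewrite !lorentzE.
set a := x 0 0 in hx *; set b := x 1 0 in hx *; set c := x _ _ in hx *.
set d := y 0 0 in hy *; set e := y 1 0 in hy *; set f := y _ _ in hy *.
have CS : (b * e + c * f) ^+ 2 <= (b ^+ 2 + c ^+ 2) * (e ^+ 2 + f ^+ 2).
  rewrite -subr_ge0.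
  have -> : (b ^+ 2 + c ^+ 2) * (e ^+ 2 + f ^+ 2) - (b * e + c * f) ^+ 2 = (b * f - c * e) ^+ 2 by ring.
  exact: sqr_ge0.
set p := b * e + c * f in CS *; set u := b ^+ 2 + c ^+ 2 in hx CS *.
set v := e ^+ 2 + f ^+ 2 in hy CS *.
have -> : - (a * a) + b * b + c * c = u - a ^+ 2 by rewrite /u; ring.
have -> : - (d * d) + e * e + f * f = v - d ^+ 2 by rewrite /v; ring.
have -> : - (a * d) + b * e + c * f = p - a * d by rewrite /p; ring.
have u0 : 0 <= u by rewrite addr_ge0 ?sqr_ge0.
have v0 : 0 <= v by rewrite addr_ge0 ?sqr_ge0.
set U := Num.sqrt u; set V := Num.sqrt v.
have uU : u = U ^+ 2 by rewrite sqr_sqrtr.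
have vV : v = V ^+ 2 by rewrite sqr_sqrtr.
have U0 : 0 <= U by exact: sqrtr_ge0.
have V0 : 0 <= V by exact: sqrtr_ge0.
have pUV : `|p| <= U * V.
  rewrite -ler_sqr ?nnegrE ?mulr_ge0 ?normr_ge0 // real_normK ?num_real //.
  by rewrite exprMn -uU -vV.
have aU : U <= `|a| by rewrite -ler_sqr ?nnegrE // real_normK ?num_real // -uU.
have dV : V <= `|d| by rewrite -ler_sqr ?nnegrE // real_normK ?num_real // -vV.
have h1 : `|a| * `|d| - U * V <= `|p - a * d|.
  apply: le_trans (_ : `|a * d| - `|p| <= _); first by rewrite normrM; lra.
  by rewrite distrC; apply: lerB_dist.
have h0 : 0 <= `|a| * `|d| - U * V by rewrite subr_ge0 ler_pM.
apply: le_trans (_ : (`|a| * `|d| - U * V) ^+ 2 <= _); last first.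
  rewrite -[X in _ <= X](real_normK (num_real _)).
  by rewrite ler_sqr ?nnegrE.
rewrite -[a ^+ 2](real_normK (num_real _)) -[d ^+ 2](real_normK (num_real _)) uU vV.
rewrite -subr_ge0.
set X := _ - _; have -> : X = (`|a| * V - U * `|d|) ^+ 2 by rewrite /X; ring.
exact: sqr_ge0.
Qed.

Lemma orth_timelike x y : lorentz x x < 0 -> lorentz y y <= 0 -> lorentz x y = 0 -> y = 0.
Proof.
move=> hx hy xy; have hx' := causal_bound (ltW hx); have hy' := causal_bound hy.
have := reverse_CauchySchwarz (ltW hx) hy; rewrite xy expr0n /= => h.
have y0 : lorentz y y = 0.
  apply/eqP; rewrite eq_le hy /=.
  by rewrite -(ler_nM2l hx) mulr0.
move: xy y0 hx hx' hy'; rewrite !lorentzE.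
set a := x 0 0; set b := x 1 0; set c := x (1 + 1) 0.
set d := y 0 0; set e := y 1 0; set f := y (1 + 1) 0 => xy y0 hx hx' hy'.
(* Lagrange's identity for the space parts. Both summands are nonnegative because [x] is timelike,
   so [d] vanishes. *)
have k : (b * f - c * e) ^+ 2 + (a ^+ 2 - b ^+ 2 - c ^+ 2) * d ^+ 2 = 0.
  have e2 : e * e + f * f = d * d by lra.
  have ad : a * d = b * e + c * f by lra.
  have -> : (b * f - c * e) ^+ 2 + (a ^+ 2 - b ^+ 2 - c ^+ 2) * d ^+ 2 =
     (b ^+ 2 + c ^+ 2) * (e * e + f * f - d * d) + (a * d) ^+ 2 - (b * e + c * f) ^+ 2 by ring.
  by rewrite ad e2; ring.
have d0 : d = 0.
  apply/eqP; rewrite -sqrf_eq0; apply/eqP.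
  have k1 : 0 <= (b * f - c * e) ^+ 2 by exact: sqr_ge0.
  have k2 : 0 < a ^+ 2 - b ^+ 2 - c ^+ 2 by rewrite !expr2; lra.
  have k3 : (a ^+ 2 - b ^+ 2 - c ^+ 2) * d ^+ 2 <= 0 by lra.
  by apply/eqP; rewrite eq_le sqr_ge0 andbT -(ler_pM2l k2) mulr0.
have e0 : e = 0.
  by apply/eqP; rewrite -sqrf_eq0 eq_le sqr_ge0 andbT; move: (sqr_ge0 e) (sqr_ge0 f) y0; rewrite d0 !expr2 => *; lra.
have f0 : f = 0.
  by apply/eqP; rewrite -sqrf_eq0 eq_le sqr_ge0 andbT; move: (sqr_ge0 e) (sqr_ge0 f) y0; rewrite d0 !expr2 => *; lra.
by apply: cV3P; rewrite mxE.
Qed.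

Lemma lorentz_time x y : lorentz x x < 0 -> lorentz y y <= 0 -> y != 0 ->
  0 < x 0 0 -> (lorentz x y < 0) = (0 < y 0 0).
Proof.
move=> hx hy yn0 x0.
have main : forall z, lorentz z z <= 0 -> 0 <= z 0 0 -> lorentz x z <= 0.
  move=> z hz z0; rewrite leNgt; apply/negP => xz.
  move: hx hz xz; rewrite !lorentzE.
  set a := x 0 0 in x0 *; set b := x 1 0; set c := x (1 + 1) 0.
  set d := z 0 0 in z0 *; set e := z 1 0; set f := z (1 + 1) 0 => hx hz xz.
  have p : 0 <= a * d by rewrite mulr_ge0 // ltW.
  have q : (a * d) ^+ 2 < (b * e + c * f) ^+ 2 by rewrite ltr_pXn2r ?nnegrE //; lra.
  have CS : (b * e + c * f) ^+ 2 <= (b ^+ 2 + c ^+ 2) * (e ^+ 2 + f ^+ 2).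
    rewrite -subr_ge0.
    have -> : (b ^+ 2 + c ^+ 2) * (e ^+ 2 + f ^+ 2) - (b * e + c * f) ^+ 2 = (b * f - c * e) ^+ 2 by ring.
    exact: sqr_ge0.
  have r : (b ^+ 2 + c ^+ 2) * (e ^+ 2 + f ^+ 2) <= a ^+ 2 * d ^+ 2.
    by apply: ler_pM; rewrite ?addr_ge0 ?sqr_ge0 // !expr2; lra.
  by move: q CS r; rewrite exprMn => *; lra.
apply/idP/idP => h.
  rewrite ltNge; apply/negP => y0.
  have := main (- y); rewrite !lorentz_lin opprK mxE oppr_ge0 => /(_ hy y0).
  by lra.
rewrite lt_neqAle main ?(ltW h) // andbT.
by apply/eqP => /(orth_timelike hx hy) e; rewrite e eqxx in yn0.
Qed.

Lemma hyp_lorentz x y : hyp x -> hyp y -> lorentz x y <= -1.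
Proof.
move=> [hx x0] [hy y0].
have xn : lorentz x x < 0 by rewrite hx ltrN10.
have yn : lorentz y y <= 0 by rewrite hy lerN10.
have yn0 : y != 0 by apply/eqP => e; rewrite e mxE ltxx in y0.
have lt0 : lorentz x y < 0 by rewrite lorentz_time.
have := reverse_CauchySchwarz (ltW xn) yn; rewrite hx hy mulrNN mulr1 => h.
rewrite leNgt; apply/negP => lt1.
have : 0 < 1 + lorentz x y by lra.
have : 0 < 1 - lorentz x y by lra.
move=> a b; have := mulr_gt0 a b.
have -> : (1 - lorentz x y) * (1 + lorentz x y) = 1 - lorentz x y ^+ 2 by ring.
lra.
Qed.

Lemma hyp_of_lorentz x y : hyp x -> lorentz y y = -1 -> lorentz x y < 0 -> hyp y.
Proof.
move=> [hx x0] hy xy; split=> //.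
rewrite -(lorentz_time _ _ _ x0) ?hx ?hy ?ltrN10 ?lerN10 //.
by apply/eqP => e; move: xy; rewrite e lorentz0r ltxx.
Qed.

(** * Normals and vertices of the hexagon *)

(* The outer normal of the side i is (1, na i * sqrt 6 / 2, nb i * sqrt 2 / 2), and the vertex
   between the sides i - 1 and i is (sqrt 3, va i * sqrt 2 / 2, vb i * sqrt 6 / 2). *)
Definition na (i : letter) : int := nth 0 [:: 1; 0; -1; -1; 0; 1] i.
Definition nb (i : letter) : int := nth 0 [:: 1; 2; 1; -1; -2; -1] i.
Definition va (i : letter) : int := nth 0 [:: 2; 1; -1; -2; -1; 1] i.
Definition vb (i : letter) : int := nth 0 [:: 0; 1; 1; 0; -1; -1] i.
(** For disjoint sides these are minus the hyperbolic cosines of their distances: 2 = cosh L if they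
    have a common neighbour, 3 if they are opposite. The value 0 is the right angle of adjacent
    sides. *)
Definition gramz (i j : letter) : int := nth 0 [:: 1; 0; -2; -3; -2; 0] (gap i j).
Definition gram (i j : letter) : R := (gramz i j)%:~R.

Definition s2 : R := Num.sqrt 2.
Definition s3 : R := Num.sqrt 3.
Lemma s2s2 : s2 * s2 = 2.
Proof. by rewrite -expr2 sqr_sqrtr. Qed.
Lemma s3s3 : s3 * s3 = 3.
Proof. by rewrite -expr2 sqr_sqrtr. Qed.
Lemma s2_gt0 : 0 < s2. Proof. by rewrite sqrtr_gt0. Qed.
Lemma s3_gt0 : 0 < s3. Proof. by rewrite sqrtr_gt0. Qed.

Definition lvec (a b c : R) := col3 a (b * (s2 * s3 / 2)) (c * (s2 / 2)).
Definition normal (i : letter) := lvec 1 (na i)%:~R (nb i)%:~R.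
Definition vertex (i : letter) := col3 s3 ((va i)%:~R * (s2 / 2)) ((vb i)%:~R * (s2 * s3 / 2)).

Lemma lorentz_lvec a b c a' b' c' :
  2 * lorentz (lvec a b c) (lvec a' b' c') = - 2 * (a * a') + 3 * (b * b') + c * c'.
Proof.
rewrite lorentz_col3.
have -> : b * (s2 * s3 / 2) * (b' * (s2 * s3 / 2)) = b * b' * ((s2 * s2) * (s3 * s3)) / 4 by field.
have -> : c * (s2 / 2) * (c' * (s2 / 2)) = c * c' * (s2 * s2) / 4 by field.
by rewrite s2s2 s3s3; field.
Qed.

Lemma lorentz_normal i j : lorentz (normal i) (normal j) = gram i j.
Proof.
apply: (@mulfI _ 2); first by rewrite pnatr_eq0.
rewrite lorentz_lvec /gram -!intrM.
have : 2 * gramz i j = -2 + 3 * (na i * na j) + nb i * nb j by letters.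
move=> /(congr1 (fun z : int => z%:~R : R)).
by rewrite !intrD !intrM => ->; rewrite !rmorphN /= mulr1; ring.
Qed.

Definition vgram (j k : letter) : int := nth 0 [:: 0; -1; -2; -2; -1; 0] ((k + 6 - j) %% 6).

Lemma lorentz_vertex j k : lorentz (normal k) (vertex j) = s3 * (vgram j k)%:~R.
Proof.
rewrite lorentz_col3.
have -> : (na k)%:~R * (s2 * s3 / 2) * ((va j)%:~R * (s2 / 2)) = (na k * va j)%:~R * s3 * (s2 * s2) / 4.
  by rewrite intrM; field.
have -> : (nb k)%:~R * (s2 / 2) * ((vb j)%:~R * (s2 * s3 / 2)) = (nb k * vb j)%:~R * s3 * (s2 * s2) / 4.
  by rewrite intrM; field.
rewrite s2s2.
have : 2 * vgram j k = - 2 + na k * va j + nb k * vb j by letters.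
move=> /(congr1 (fun z : int => z%:~R : R)).
rewrite !intrD !intrM => h.
have -> : (vgram j k)%:~R = ((-2)%:~R + (na k)%:~R * (va j)%:~R + (nb k)%:~R * (vb j)%:~R) / 2 :> R.
  by rewrite -h; field.
by rewrite rmorphN /=; field.
Qed.
End Lorentz.

(** * The reflection group of the hexagon *)

Section Reflections.
Variable R : realType.
Implicit Types (x y z : 'cV[R]_3) (i j m : letter) (w u : word) (V : word) (L : seq word).
Notation normal := (@normal R).
Notation gram := (@gram R).
Notation B i z := (lorentz (normal i) z).

Lemma gramC i j : gram i j = gram j i.
Proof. by rewrite -!lorentz_normal lorentzC. Qed.
Lemma gram_eq i : gram i i = 1.
Proof. by rewrite /gram (_ : gramz i i = 1) //; letters. Qed.
Lemma gram_comm i j : comm i j -> gram i j = 0.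
Proof. by rewrite /gram => c; rewrite (_ : gramz i j = 0) //; move: c; letters. Qed.
Lemma gram_apart i j : apart i j -> gram i j = -2.
Proof. by rewrite /gram => c; rewrite (_ : gramz i j = -2) //; move: c; letters. Qed.
Lemma gram_facing i j : facing i j -> gram i j = -3.
Proof. by rewrite /gram => c; rewrite (_ : gramz i j = -3) //; move: c; letters. Qed.
Lemma gram_nc i j : nc i j -> gram i j <= -2.
Proof. by case/orP => [/gram_apart|/gram_facing] ->; lra. Qed.
Lemma gram_neq i j : i != j -> gram i j <= 0.
Proof.
move=> ij; case c: (comm i j); first by rewrite gram_comm.
have : nc i j by rewrite nc_comm ij c.
by move/gram_nc; lra.
Qed.

Definition refl i : 'M[R]_3 := \matrix_(a, b)
  ((a == b)%:R - 2 * normal i a 0 * ((if b == 0 then -1 else 1) * normal i b 0)).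

Lemma reflE i x : refl i *m x = x - (2 * B i x) *: normal i.
Proof.
rewrite /refl; move: (normal i) => n; apply/colP => a; rewrite !mxE.
under eq_bigr do rewrite mxE mulrBl.
rewrite big_split /= sumrN; congr (_ - _).
  rewrite (bigD1 a) //= eqxx mul1r big1 ?addr0 // => b ba.
  by rewrite eq_sym (negbTE ba) mul0r.
rewrite /lorentz mulr_sumr mulr_suml; apply: eq_bigr => b _.
by case: (b == 0); ring.
Qed.

Fixpoint ev (w : word) : 'M[R]_3 := if w is i :: w' then refl i *m ev w' else 1%:M.

Lemma ev_cat u w : ev (u ++ w) = ev u *m ev w.
Proof. by elim: u => [|i u IH] /=; rewrite ?mul1mx // IH mulmxA. Qed.

Lemma ev1 i : ev [:: i] = refl i.
Proof. by rewrite /= mulmx1. Qed.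

Lemma ev_consE i w x : ev (i :: w) *m x = ev w *m x - (2 * B i (ev w *m x)) *: normal i.
Proof. by rewrite /= -mulmxA reflE. Qed.

Lemma refl_norm i x y : lorentz (refl i *m x) (refl i *m y) = lorentz x y.
Proof.
rewrite !reflE !lorentz_lin lorentz_normal gram_eq (lorentzC x (normal i)) mulr1.
by ring.
Qed.

Lemma refl_refl i x : refl i *m (refl i *m x) = x.
Proof.
rewrite !reflE !lorentz_lin lorentz_normal gram_eq.
by apply/colP => a; rewrite !mxE; ring.
Qed.

Lemma refl_comm i j x : comm i j -> refl i *m (refl j *m x) = refl j *m (refl i *m x).
Proof.
move=> c; rewrite !reflE !lorentz_lin !lorentz_normal (gramC j i) (gram_comm c).
by apply/colP => a; rewrite !mxE; ring.
Qed.

Lemma ev_weq u w : weq u w -> ev u = ev w.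
Proof.
elim=> {u w} //=.
- by move=> w1 w2 w3 _ -> _ ->.
- by move=> i w1 w2 _ ->.
- by move=> i w; apply: mx_act_inj => x; rewrite -!mulmxA refl_refl.
- by move=> i j w c; apply: mx_act_inj => x; rewrite -!mulmxA refl_comm.
Qed.

Lemma ev_revK w : ev w *m ev (rev w) = 1%:M.
Proof. by rewrite -ev_cat (ev_weq (weq_revK w)). Qed.
Lemma ev_Krev w : ev (rev w) *m ev w = 1%:M.
Proof. by rewrite -ev_cat (ev_weq (weq_Krev w)). Qed.
Lemma ev_revA w x : ev w *m (ev (rev w) *m x) = x.
Proof. by rewrite mulmxA ev_revK mul1mx. Qed.
Lemma ev_Arev w x : ev (rev w) *m (ev w *m x) = x.
Proof. by rewrite mulmxA ev_Krev mul1mx. Qed.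

Lemma ev_lorentz w x y : lorentz (ev w *m x) (ev w *m y) = lorentz x y.
Proof. by elim: w => [|i w IH] /=; rewrite ?mul1mx // -!mulmxA refl_norm. Qed.

Lemma ev_adj w x y : lorentz (ev w *m x) y = lorentz x (ev (rev w) *m y).
Proof. by rewrite -{1}[y](ev_revA w) ev_lorentz. Qed.

Definition origin : 'cV[R]_3 := col3 1 0 0.

Lemma origin_hyp : hyp origin.
Proof.
split; last by rewrite mxE.
by rewrite lorentz_col3; ring.
Qed.

Lemma origin_lorentz x : lorentz origin x = - x 0 0.
Proof. by rewrite lorentz_col3l; ring. Qed.

Lemma refl_hyp i x : hyp x -> hyp (refl i *m x).
Proof.
move=> hx; have ho : hyp (refl i *m origin).
  split; first by rewrite refl_norm; case: origin_hyp.
  have := lorentz_col3l 1 0 0 (normal i); rewrite -/origin lorentzC => h.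
  rewrite reflE h !mxE /=.
  by rewrite ?mul1r ?mul0r; lra.
apply: (hyp_of_lorentz ho); first by rewrite refl_norm; case: hx.
rewrite refl_norm; have := hyp_lorentz origin_hyp hx; lra.
Qed.

Lemma ev_hyp w x : hyp x -> hyp (ev w *m x).
Proof. by move=> hx; elim: w => [|i w IH] /=; rewrite ?mul1mx // -mulmxA; apply: refl_hyp. Qed.

Lemma ev_isometry w : hyp_isometry (ev w).
Proof. by split; [exact: ev_lorentz|exact: ev_hyp]. Qed.

Lemma ev_fix w x : {in w, forall i, B i x = 0} -> ev w *m x = x.
Proof.
elim: w => [|i w IH] h; first by rewrite mul1mx.
rewrite ev_consE IH => [|j jw]; last by apply: h; rewrite inE jw orbT.
by rewrite h ?inE ?eqxx // mulr0 scale0r subr0.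
Qed.

Lemma refl_det i : \det (refl i) = -1.
Proof.
have := lorentz_normal R i i; rewrite gram_eq lorentzE /refl.
move: (normal i) => n h; rewrite det3 !mxE /=.
set a := n 0 0 in h *; set b := n 1 0 in h *; set c := n (1 + 1) 0 in h *.
transitivity (1 - 2 * (- (a * a) + b * b + c * c)); first by ring.
by rewrite h; ring.
Qed.

Lemma ev_det w : \det (ev w) = (-1) ^+ size w.
Proof. by elim: w => [|i w IH] /=; rewrite ?det1 // det_mulmx IH refl_det exprS. Qed.

(** * Signs *)

(** The position of a point carried out of the closed hexagon by a layered word with head [V]:
    beyond the walls in [V] and beyond no other. The last clause compares its depth behind a wall
    [m] with its height over a noncommuting wall in [V]; without it the signs would not propagate
    through the next layer. *)
Definition st (V : word) z :=
  [/\ {in V, forall i, 0 <= B i z},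
      forall m, m \notin V -> B m z <= 0 &
      {in V, forall i m, nc i m -> - gram i m * B i z <= - B m z}].

Definition strict (V : word) z :=
  {in V, forall i, 0 < B i z} /\ (forall m, m \notin V -> B m z < 0).

Lemma B_ev_clique V z m : clique V -> m \notin V ->
  B m (ev V *m z) = B m z - 2 * \sum_(l <- V) gram m l * B l z.
Proof.
case/andP=> _; elim: V m => [|i V IH] m /=; first by rewrite big_nil mulr0 subr0 mul1mx.
move=> /andP[hi hV]; rewrite inE negb_or => /andP[mi mV].
rewrite -mulmxA reflE !lorentz_lin lorentz_normal IH // big_cons.
have iV : i \notin V by apply/negP => /(allP hi); rewrite comm_irr.
rewrite (IH i hV iV) [X in _ * (_ - 2 * X) * _]big1_seq ?mulr0 ?subr0; last first.
  by move=> l /= lV; rewrite gram_comm ?mul0r // (allP hi).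
by ring.
Qed.

Lemma B_ev_in V z i : clique V -> i \in V -> B i (ev V *m z) = - B i z.
Proof.
move=> cV iV; have pV := perm_to_rem iV.
have ci : all (comm i) (rem i V).
  apply/allP => j jr; apply: (clique_comm cV iV (mem_rem jr)).
  by apply/eqP => e; move: jr; rewrite -e mem_rem_uniq ?inE ?eqxx // clique_uniq.
case/andP: cV => _ {pV}.
elim: V iV ci => //= a V IH; rewrite inE eq_sym.
have fixi (U : word) : all (comm i) U -> B i (ev U *m z) = B i z.
  elim: U => [|b U IHU] /=; first by rewrite mul1mx.
  by move=> /andP[cb /IHU e]; rewrite -mulmxA reflE !lorentz_lin lorentz_normal (gram_comm cb) e; ring.
case: (altP (a =P i)) => [->|ai] /=.
  by move=> _ ci _; rewrite -mulmxA reflE !lorentz_lin lorentz_normal gram_eq fixi //; ring.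
move=> iV /andP[cia ci] /andP[_ pV].
by rewrite -mulmxA reflE !lorentz_lin lorentz_normal (gram_comm cia) (IH iV ci pV); ring.
Qed.

Lemma sum_term_le (I : eqType) (V : seq I) (F : I -> R) (i : I) :
  i \in V -> {in V, forall l, 0 <= F l} -> F i <= \sum_(l <- V) F l.
Proof.
move=> iV h; rewrite (big_rem i) //= lerDl big_seq; apply: sumr_ge0 => l /mem_rem; exact: h.
Qed.

Section Step.
Variables (V V' : word) (z : 'cV[R]_3).
Hypotheses (cV : clique V) (sV : supported V V') (hz : st V' z).

Let V_le0 i : i \in V -> B i z <= 0.
Proof. by move=> iV; case: hz => _ h _; apply: h; apply: layers_disjoint iV. Qed.

Let term_ge0 m : m \notin V -> {in V, forall l, 0 <= gram m l * B l z}.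
Proof.
move=> mV l lV; rewrite mulr_le0 ?V_le0 //; apply: gram_neq.
by apply/eqP => e; rewrite e lV in mV.
Qed.

Lemma step_out m i : m \notin V -> i \in V -> nc m i ->
  B m (ev V *m z) <= B i z - gram m i * B i z.
Proof.
move=> mV iV ni; rewrite B_ev_clique //.
have h1 := sum_term_le iV (term_ge0 mV).
have h2 := gram_nc ni; have h3 := V_le0 iV.
have h5 : 0 <= (gram m i + 2) * B i z by rewrite mulr_le0 //; lra.
(* If [m] belongs to [V'], this is the last clause of [st], the factor 1/2 coming from
   [gram m i <= -2]; otherwise the left side is nonpositive and the right side nonnegative. *)
have hm : B m z <= - (1/2) * B i z; last first.
  rewrite mulrDl in h5; rewrite /= in h1.
  have : 0 <= - B i z by lra.
  lra.
case mV' : (m \in V'); last first.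
  by case: hz => _ /(_ m (negbT mV')) h _; lra.
case: hz => /(_ m mV') h0 _ /(_ m mV' i ni) h.
have : 0 <= (- gram m i - 2) * B m z by rewrite mulr_ge0 //; lra.
rewrite mulrBl; lra.
Qed.

Lemma st_step : st V (ev V *m z).
Proof.
split.
- by move=> i iV; rewrite B_ev_in // oppr_ge0 V_le0.
- move=> m mV; case mV' : (m \in V').
    have /hasP[i iV ni] := allP sV m mV'.
    apply: le_trans (step_out mV iV ni) _.
    have h2 := gram_nc ni; have h3 := V_le0 iV.
    have : 0 <= (gram m i + 2) * B i z by rewrite mulr_le0 //; lra.
    rewrite mulrDl; lra.
  rewrite B_ev_clique //; case: hz => _ /(_ m (negbT mV')) h _.
  have : 0 <= \sum_(l <- V) gram m l * B l z.
    by rewrite big_seq; apply: sumr_ge0 => l; exact: (term_ge0 mV).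
  lra.
- move=> i iV m ni.
  have mV : m \notin V by apply/negP => mV; move: ni; rewrite (clique_nnc cV).
  rewrite B_ev_in //; have := step_out mV iV; rewrite ncC => /(_ ni).
  have := gram_nc ni; rewrite (gramC m i) => h1 h2.
  have h3 := V_le0 iV; lra.
Qed.

Lemma strict_step : strict V' z -> strict V (ev V *m z).
Proof.
move=> [h1 h2].
have Vlt i : i \in V -> B i z < 0 by move=> iV; apply: h2; apply: layers_disjoint iV.
split=> [i iV|m mV]; first by rewrite B_ev_in // oppr_gt0 Vlt.
case mV' : (m \in V').
  have /hasP[i iV ni] := allP sV m mV'.
  apply: le_lt_trans (step_out mV iV ni) _.
  have h3 := gram_nc ni; have h4 := Vlt i iV.
  have : 0 <= - (gram m i + 2) * - B i z by rewrite mulr_ge0 //; lra.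
  rewrite mulrNN mulrDl; lra.
rewrite B_ev_clique //; have := h2 m (negbT mV').
have : 0 <= \sum_(l <- V) gram m l * B l z.
  by rewrite big_seq; apply: sumr_ge0 => l; exact: (term_ge0 mV).
lra.
Qed.
End Step.
End Reflections.

(** * The closed hexagon as a strict fundamental domain *)

Section Domain.
Variable R : realType.
Implicit Types (x y z : 'cV[R]_3) (i j m : letter) (w u : word) (V : word) (L : seq word).
Notation normal := (@normal R).
Notation gram := (@gram R).
Notation B i z := (lorentz (normal i) z).
Notation ev := (@ev R).
Notation origin := (@origin R).

Definition dom z := forall i, B i z <= 0.
Definition sdom z := forall i, B i z < 0.

Lemma sdomW z : sdom z -> dom z.
Proof. by move=> h i; apply: ltW. Qed.

Lemma B_origin i : B i origin = -1.
Proof. by rewrite lorentzC origin_lorentz mxE /=. Qed.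

Lemma sdom_origin : sdom origin.
Proof. by move=> i; rewrite B_origin ltrN10. Qed.

Lemma lay_st L z : lay L -> dom z -> st (head [::] L) (ev (flatten L) *m z).
Proof.
move=> lL dz; elim: L lL => [|V L IH] /=.
  by move=> _; rewrite mul1mx; split.
by move=> /and3P[cV sV lL]; rewrite ev_cat -mulmxA; apply: st_step cV sV (IH lL).
Qed.

Lemma lay_strict L z : lay L -> sdom z -> strict (head [::] L) (ev (flatten L) *m z).
Proof.
move=> lL dz; elim: L lL => [|V L IH] /=.
  by move=> _; rewrite mul1mx; split.
move=> /and3P[cV sV lL]; rewrite ev_cat -mulmxA; apply: strict_step cV sV _ (IH lL).
exact: lay_st (sdomW dz).
Qed.

Lemma lay_sign L z i : lay L -> sdom z ->
  (0 < B i (ev (flatten L) *m z)) = (i \in head [::] L).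
Proof.
move=> lL dz; have [h1 h2] := lay_strict lL dz.
case iV: (i \in _); first exact: h1.
by apply/negbTE; rewrite -leNgt ltW // h2 // iV.
Qed.

(** On the letters of the head the values are nonnegative by [st] and nonpositive by [dom]. Their
    walls therefore contain [z], and the head can be peeled off. *)
Lemma lay_dom L y z : lay L -> dom y -> dom z -> ev (flatten L) *m y = z ->
  y = z /\ {in flatten L, forall i, B i z = 0}.
Proof.
elim: L => [|V L IH] lL dy dz /= e; first by rewrite -e mul1mx.
have := lay_st lL dy; rewrite [flatten _]/= e /= => -[h1 _ _].
move/and3P: (lL) => [cV sV lL'].
have hV i : i \in V -> B i z = 0.
  by move=> iV; apply/eqP; rewrite eq_le dz h1.
have e' : ev (flatten L) *m y = z.
  have := congr1 (mulmx (ev (rev V))) e; rewrite ev_cat -mulmxA ev_Arev => ->.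
  by apply: ev_fix => i; rewrite mem_rev; apply: hV.
have [-> h] := IH lL' dy dz e'.
by split=> // i; rewrite mem_cat => /orP[/hV|/h].
Qed.

Lemma dom_word w y z : dom y -> dom z -> ev w *m y = z ->
  y = z /\ exists2 w', weq w' w & {in w', forall i, B i z = 0}.
Proof.
have [L [lL wL _ _]] := lay_nf w.
move=> dy dz; rewrite -(ev_weq _ wL) => /(lay_dom lL dy dz)[-> h].
by split=> //; exists (flatten L).
Qed.

Lemma ev_inj_nil w : ev w = 1%:M -> weq w [::].
Proof.
move=> e; have [_ [w' ww' h]] : origin = origin /\ exists2 w', weq w' w & {in w', forall i, B i origin = 0}.
  by apply: dom_word; rewrite ?e ?mul1mx //; apply: sdomW sdom_origin.
case: w' ww' h => [|i w'] ww' h; first exact: weq_sym.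
by have /eqP := h i (mem_head _ _); rewrite B_origin oppr_eq0 oner_eq0.
Qed.

Lemma ev_inj u w : ev u = ev w -> weq u w.
Proof.
move=> e; have : weq (rev w ++ u) [::] by apply: ev_inj_nil; rewrite ev_cat e ev_Krev.
move=> h; apply: (@weq_trans _ (w ++ (rev w ++ u))).
  by rewrite catA; apply: weq_sym; apply: weq_catr (weq_revK w).
by rewrite -[X in weq _ X]cats0; apply: weq_catl.
Qed.

(** The head layer depends only on the group element: by [lay_sign] it is the set of the sides
    beyond which the image of the centre lies. *)
Lemma lay_unique L1 L2 : lay L1 -> lay L2 -> ev (flatten L1) = ev (flatten L2) ->
  size L1 = size L2 /\ perm_eq (flatten L1) (flatten L2).
Proof.
elim: L1 L2 => [|V1 L1 IH] [|V2 L2] //.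
- move=> _ lL e; case/and3P: (lL) => /andP[]; case: V2 e lL => [|i V2] e lL //.
  have := lay_sign i lL sdom_origin; rewrite -e mul1mx B_origin inE eqxx /=.
  by rewrite oppr_gt0 ltr10.
- move=> lL _ e; case/and3P: (lL) => /andP[]; case: V1 e lL => [|i V1] e lL //.
  have := lay_sign i lL sdom_origin; rewrite e mul1mx B_origin inE eqxx /=.
  by rewrite oppr_gt0 ltr10.
move=> l1 l2 e; have : V1 =i V2.
  by move=> i; have := lay_sign i l1 sdom_origin; rewrite e (lay_sign i l2 sdom_origin) /=.
case/and3P: l1 l2 => c1 s1 l1 /and3P[c2 s2 l2] h.
have p : perm_eq V1 V2 by apply: uniq_perm => //; apply: clique_uniq.
have e' : ev V1 = ev V2 by apply: ev_weq; apply: weq_perm p; case/andP: c1.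
have : ev (flatten L1) = ev (flatten L2).
  have := congr1 (mulmx (ev (rev V1))) e; rewrite /= !ev_cat e' !mulmxA.
  have -> : ev (rev V1) *m ev V2 = 1%:M by rewrite -e' ev_Krev.
  by rewrite !mul1mx.
by move=> /(IH _ l1 l2)[q1 q2]; split; [rewrite /= q1|apply: perm_cat].
Qed.

Lemma lay_min L w : lay L -> ev (flatten L) = ev w -> (size (flatten L) <= size w)%N.
Proof.
move=> lL e; have [L' [lL' wL' sL' _]] := lay_nf w.
apply: leq_trans sL'; have [|_ /perm_size ->//] := lay_unique lL lL'.
by rewrite e (ev_weq _ wL').
Qed.

Lemma B_facing i j y : facing i j -> B i y + B j y = - (2 * y 0 0).
Proof.
move=> f; rewrite !lorentz_col3l.
have -> : na j = - na i by move: f; letters.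
have -> : nb j = - nb i by move: f; letters.
by rewrite !rmorphN /=; ring.
Qed.

Lemma B_apart i j y : apart i j -> exists k, B i y + B j y = B k y - y 0 0.
Proof.
move=> a; have [k e1 e2] : exists2 k, na i + na j = na k & nb i + nb j = nb k.
  have h : [exists k, (na i + na j == na k) && (nb i + nb j == nb k)].
    move: a; letters; move=> // _; apply/existsP;
    let t k := (exists (@inord 5 k); by rewrite /na /nb !inordK) in
    first [t 0%N|t 1%N|t 2%N|t 3%N|t 4%N|t 5%N].
  by case/existsP: h => k /andP[/eqP ? /eqP ?]; exists k.
by exists k; rewrite !lorentz_col3l -e1 -e2 !rmorphD /=; ring.
Qed.

Lemma hyp_time y : hyp y -> 1 <= y 0 0.
Proof. by move=> hy; have := hyp_lorentz (@origin_hyp R) hy; rewrite origin_lorentz; lra. Qed.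

Lemma refl_time i y : (refl R i *m y) 0 0 = y 0 0 - 2 * B i y.
Proof.
have := origin_lorentz (refl R i *m y); rewrite reflE !lorentz_lin origin_lorentz.
by rewrite (lorentzC origin) B_origin; lra.
Qed.

Lemma dom_cover x : hyp x -> exists w y, [/\ hyp y, dom y & x = ev w *m y].
Proof.
move=> hx.
suff [w dw] : exists w, dom (ev w *m x).
  exists (rev w), (ev w *m x); split=> //; first exact: ev_hyp.
  by rewrite ev_Arev.
pose T : set R := [set t | exists w, t = (ev w *m x) 0 0].
have Tlb : lbound T 1 by move=> _ [w ->]; apply: hyp_time; apply: ev_hyp.
have T0 : T !=set0 by exists ((ev [::] *m x) 0 0), [::].
have Ti : has_inf T by split=> //; exists 1.
have [_ [w ->] hw] : exists2 t, T t & t < inf T + 1/10 by apply: inf_adherent => //; lra.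
have hm u : inf T <= (ev u *m (ev w *m x)) 0 0.
  by apply: ge_inf; [exists 1|exists (u ++ w); rewrite ev_cat mulmxA].
set y := ev w *m x in hw hm.
have hy : hyp y by exact: ev_hyp.
have y1 := hyp_time hy.
have Bs i : B i y <= 1/20 by have := hm [:: i]; rewrite ev1 refl_time; lra.
suff [u du] : exists u, dom (ev u *m y) by exists (u ++ w); rewrite ev_cat -mulmxA.
have [[i ip]|h] := pselect (exists i, 0 < B i y); last first.
  exists [::]; rewrite mul1mx => i; rewrite leNgt; apply/negP => h'; apply: h.
  by exists i.
have nci j m : 0 < B j y -> nc m j -> B m y <= - (9/10).
  move=> jp /orP[a|f].
    by have [k e] := B_apart y a; have := Bs k; lra.
  by have := B_facing y f; lra.
have ncg j m : nc m j -> 0 < B j y -> - (2 * gram m j * B j y) <= 3/10.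
  move=> n jp; have := Bs j.
  by case/orP: n => [/(gram_apart R)|/(gram_facing R)] ->; lra.
have [[j /andP[ji jp]]|h] := pselect (exists j, (j != i) && (0 < B j y)); last first.
  exists [:: i] => m; rewrite ev1 reflE !lorentz_lin lorentz_normal.
  have [->|mi] := eqVneq m i; first by rewrite gram_eq; lra.
  case c: (comm m i).
    rewrite (gram_comm R c) mulr0 subr0 leNgt; apply/negP => mp; apply: h.
    by exists m; rewrite mi.
  have n : nc m i by rewrite nc_comm mi c.
  by have := nci i m ip n; have := ncg i m n ip; lra.
have cij : comm i j.
  case c : (comm i j) => //; have n : nc j i by rewrite nc_comm ji commC c.
  by have := nci i j ip n; lra.
exists [:: i; j] => m.
have cl : clique [:: i; j] by rewrite /clique /= cij.
case mV : (m \in [:: i; j]).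
  rewrite B_ev_in //; move: mV; rewrite !inE => /orP[] /eqP ->; lra.
rewrite B_ev_clique ?mV // !big_cons big_nil addr0.
move: mV; rewrite !inE => /negbT; rewrite negb_or => /andP[mi mj].
case ci : (comm m i).
  rewrite (gram_comm R ci) mul0r add0r.
  have n : nc m j by have := comm_comm_nc m i j; rewrite mj cij ci.
  by have := nci j m jp n; have := ncg j m n jp; lra.
have n : nc m i by rewrite nc_comm mi ci.
have := nci i m ip n; have := ncg i m n ip.
case cj : (comm m j); first by rewrite (gram_comm R cj); lra.
have n' : nc m j by rewrite nc_comm mj cj.
by have := ncg j m n' jp; lra.
Qed.
End Domain.

(** * Rows of a reflection cocycle under a layer *)

Section Cocycle.
Variables (K : comNzRingType) (c : letter -> letter -> K) (F : word -> letter -> K).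
Hypothesis c_diag : forall i, c i i = 2.
Hypothesis c_comm : forall i j, comm i j -> c i j = 0.
Hypothesis F_cons : forall i w r, F (i :: w) r = F w r - c r i * F w i.

Lemma cocycle_fix (U : word) w r : all (comm r) U -> F (U ++ w) r = F w r.
Proof. by elim: U => //= i U IH /andP[ci /IH e]; rewrite F_cons e c_comm // mul0r subr0. Qed.

Lemma cocycle_out (V : word) w r : clique V -> r \notin V ->
  F (V ++ w) r = F w r - \sum_(m <- V) c r m * F w m.
Proof.
case/andP=> _; elim: V r => [|i V IH] r /=; first by rewrite big_nil subr0.
move=> /andP[hi pV]; rewrite inE negb_or => /andP[ri rV].
by rewrite F_cons (IH r) // (cocycle_fix _ hi) big_cons; ring.
Qed.

Lemma cocycle_in (V : word) w r : clique V -> r \in V -> F (V ++ w) r = - F w r.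
Proof.
case/andP=> _; elim: V => //= i V IH /andP[hi pV]; rewrite inE F_cons eq_sym.
case: (altP (i =P r)) => [<- _|ir /= rV].
  by rewrite (cocycle_fix _ hi) c_diag; ring.
by rewrite IH // c_comm ?mul0r ?subr0 // commC (allP hi).
Qed.
End Cocycle.

(** * The finite quotients *)

Section Burau.
Variables (K : comNzRingType) (x y : K).

Definition cox (i j : letter) : K :=
  if i == j then 2 else if apart i j then - x else if facing i j then - y else 0.

Lemma coxC i j : cox i j = cox j i.
Proof. by rewrite /cox eq_sym apartC facingC. Qed.
Lemma cox_diag i : cox i i = 2.
Proof. by rewrite /cox eqxx. Qed.
Lemma cox_comm i j : comm i j -> cox i j = 0.
Proof.
move=> h; have [h1 h2 h3] : [/\ (i == j) = false, apart i j = false & facing i j = false].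
  by move: h; letters.
by rewrite /cox h1 h2 h3.
Qed.
Lemma cox_apart i j : apart i j -> cox i j = - x.
Proof.
move=> h; have h1 : (i == j) = false by move: h; letters.
by rewrite /cox h1 h.
Qed.
Lemma cox_facing i j : facing i j -> cox i j = - y.
Proof.
move=> h; have [h1 h2] : (i == j) = false /\ apart i j = false by move: h; letters.
by rewrite /cox h1 h2 h.
Qed.

Definition coxm : 'M[K]_6 := \matrix_(i, j) cox i j.
Notation a := coxm.
Notation E i := (delta_mx i i : 'M[K]_6).

(* T is the reflection representation of the form [a], and P determines it; P is used rather than
   T because [a] may become singular in the quotients. *)
Fixpoint P (w : word) : 'M[K]_6 :=
  if w is i :: w' then P w' - E i *m (1%:M + a *m P w') else 0.
Definition T (w : word) : 'M[K]_6 := 1%:M + a *m P w.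

Lemma tr_coxm : a^T = a.
Proof. by apply/matrixP => i j; rewrite !mxE coxC. Qed.

Lemma E_mul n i (M : 'M[K]_(6, n)) r l : (E i *m M) r l = (r == i)%:R * M i l.
Proof.
rewrite mxE (bigD1 i) //= big1 ?addr0 => [|j ji]; first by rewrite mxE eqxx andbT.
by rewrite mxE (negbTE ji) andbF mul0r.
Qed.

Lemma P_cons i w r l : P (i :: w) r l = P w r l - (r == i)%:R * T w i l.
Proof. by rewrite /= mxE [X in _ + X]mxE E_mul. Qed.

Lemma T_cons' i w : T (i :: w) = T w - a *m (E i *m T w).
Proof. by rewrite /T /= mulmxBr addrA. Qed.

Lemma T_cons i w r l : T (i :: w) r l = T w r l - cox r i * T w i l.
Proof.
rewrite T_cons' [LHS]mxE [X in _ + X]mxE; congr (_ - _).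
rewrite mxE (bigD1 i) //= big1 => [|j ji]; first by rewrite addr0 E_mul eqxx mul1r mxE.
by rewrite E_mul (negbTE ji) mul0r mulr0.
Qed.

Lemma P_cons' i w : P (i :: w) = P w - E i *m T w.
Proof. by []. Qed.

(** This is 1 + a P(uv) = (1 + a P u)(1 + a P v) with a factor [a] removed. Since [a] may be
    singular, the relation is proved by induction instead of cancelling. *)
Lemma P_cat u v : P (u ++ v) = P u *m T v + P v.
Proof.
elim: u => [|i u IH]; first by rewrite mul0mx add0r.
rewrite cat_cons !P_cons' mulmxBl -mulmxA.
set h := T (u ++ v).
suff -> : h = T u *m T v by rewrite IH addrAC.
rewrite /h {1}/T IH mulmxDr.
rewrite [T u]/T mulmxDl mul1mx {2}/T -!addrA mulmxA; congr (_ + _).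
by rewrite addrC.
Qed.

Lemma T_cat u v : T (u ++ v) = T u *m T v.
Proof.
rewrite {1}/T P_cat [T u]/T mulmxDl mul1mx mulmxDr mulmxA {2}/T -!addrA; congr (_ + _).
by rewrite addrC.
Qed.

Lemma T0 : T [::] = 1%:M.
Proof. by rewrite /T mulmx0 addr0. Qed.

Lemma P1 i : P [:: i] = - E i.
Proof. by rewrite P_cons' T0 mulmx1 sub0r. Qed.
Lemma T1 i : T [:: i] = 1%:M - a *m E i.
Proof. by rewrite /T P1 mulmxN. Qed.

Lemma P_weq u w : weq u w -> P u = P w.
Proof.
elim=> {u w}.
- by move=> w.
- by move=> w1 w2 w3 _ -> _ ->.
- by move=> w1 w2 _ ->.
- by move=> i w1 w2 _ /= ->.
- move=> i w; apply/matrixP => r l; rewrite !P_cons T_cons cox_diag; ring.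
- move=> i j w c; apply/matrixP => r l.
  by rewrite !P_cons !T_cons (coxC j i) (cox_comm c); ring.
Qed.

Lemma P_revK w : P w *m T (rev w) + P (rev w) = 0.
Proof. by rewrite -P_cat (P_weq (weq_revK w)). Qed.

Lemma P_rev w : P (rev w) = (P w)^T.
Proof.
elim: w => [|i w IH]; first by rewrite /= trmx0.
rewrite rev_cons -cats1 P_cat IH T1 P1 P_cons'.
rewrite [RHS]linearB /= trmx_mul trmx_delta.
have -> : (T w)^T = 1%:M + (P w)^T *m a by rewrite /T linearD /= trmx1 trmx_mul tr_coxm.
rewrite mulmxBr mulmx1 mulmxDl mul1mx mulmxA -addrA; congr (_ + _).
by rewrite opprD addrC.
Qed.

Lemma T_rev w : T (rev w) = (1%:M + P w *m a)^T.
Proof. by rewrite /T P_rev linearD /= trmx1 trmx_mul tr_coxm. Qed.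

(* The conjugate of a generator is the reflection in the root r = (1 + P w a) e_i. *)
Definition root w i : 'cV[K]_6 := (1%:M + P w *m a) *m delta_mx i 0.

Lemma P_conj w i : P (w ++ i :: rev w) = - (root w i *m (root w i)^T).
Proof.
have -> : w ++ i :: rev w = (w ++ [:: i]) ++ rev w by rewrite -catA.
have dd : (delta_mx i 0 : 'cV[K]_6) *m (delta_mx i 0)^T = E i.
  apply/matrixP => r l; rewrite !mxE big_ord1 !mxE eqxx !andbT -natrM.
  by congr (_%:R); rewrite mulnb.
rewrite /root trmx_mul -T_rev -!mulmxA (mulmxA (delta_mx i 0)) dd.
have := P_revK w; rewrite !P_cat P1 T1 mulmxBr mulmx1 !mulmxDl !mulNmx mul1mx.
set p := P w; set t := T (rev w); set q := P (rev w) => e.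
have -> : q = - (p *m t) by apply/eqP; rewrite -addr_eq0 addrC e.
by rewrite !mulmxA [LHS]addrC !addrA addNr add0r opprD addrC.
Qed.

Lemma T_in (V : word) w r l : clique V -> r \in V -> T (V ++ w) r l = - T w r l.
Proof.
by apply: (cocycle_in cox_diag cox_comm (F := fun w r => T w r l)) => i u q; exact: T_cons.
Qed.

Lemma T_out (V : word) w r l : clique V -> r \notin V ->
  T (V ++ w) r l = T w r l - \sum_(m <- V) cox r m * T w m l.
Proof.
by apply: (cocycle_out cox_comm (F := fun w r => T w r l)) => i u q; exact: T_cons.
Qed.

(** Iterated over the layers, this writes row [r] of [P] as minus the sum of the rows [r] of [T] at
    the tails that follow an occurrence of [r]; degrees of [P] are thereby read off from [T]. *)
Lemma P_layer (V : word) w r l : clique V ->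
  P (V ++ w) r l = P w r l - (r \in V)%:R * T w r l.
Proof.
case/andP=> _; elim: V => [|i V IH]; first by rewrite mul0r subr0.
move=> /= /andP[hi pV]; rewrite P_cons IH // inE.
have -> : T (V ++ w) i l = T w i l.
  by apply: (cocycle_fix cox_comm (F := fun w r => T w r l)) => // *; exact: T_cons.
case: eqP => [->|_]; last by rewrite mul0r subr0.
have -> : (i \in V) = false by apply/negP => /(allP hi); rewrite comm_irr.
by rewrite mul0r subr0.
Qed.

(** * Dihedral relations *)

(* [cheb n] is (S_n(x), S_(n-1)(x)), S_n being the Chebyshev polynomials of the second kind. *)
Fixpoint cheb (n : nat) : K * K :=
  if n is n'.+1 then (x * (cheb n').1 - (cheb n').2, (cheb n').1) else (1, 0).

Fixpoint alt (n : nat) (i j : letter) : word :=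
  if n is n'.+1 then i :: alt n' j i else [::].

Lemma root_cons i w j : root (i :: w) j = root w j - delta_mx i i *m (a *m root w j).
Proof.
rewrite /root P_cons' mulmxBl addrA mulmxBl; congr (_ - _).
rewrite /T !mulmxA; congr (_ *m _); rewrite -!mulmxA; congr (_ *m _).
by rewrite mulmxDl mulmxDr mul1mx mulmx1 -!mulmxA.
Qed.

Definition pair_vec i j (p q : K) : 'cV[K]_6 := p *: delta_mx i 0 + q *: delta_mx j 0.

Lemma root_alt n i j : apart i j ->
  root (alt n i j) (if odd n then j else i) = pair_vec i j (cheb n).1 (cheb n).2.
Proof.
elim: n i j => [|n IH] i j ij.
  by rewrite /root /= mul0mx addr0 mul1mx /pair_vec scale1r scale0r addr0.
rewrite [alt _ _ _]/= root_cons.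
have -> : (if odd n.+1 then j else i) = (if odd n then i else j) by rewrite /=; case: (odd n).
rewrite IH; last by rewrite apartC.
have nij : (i == j) = false by move: ij; letters.
have -> : delta_mx i i *m (a *m pair_vec j i (cheb n).1 (cheb n).2) =
    (2 * (cheb n).2 - x * (cheb n).1) *: (delta_mx i 0 : 'cV[K]_6).
  apply/colP => r; rewrite E_mul !mxE.
  have -> : \sum_(k < 6) a i k * pair_vec j i (cheb n).1 (cheb n).2 k 0 =
      2 * (cheb n).2 - x * (cheb n).1.
    rewrite (bigD1 i) //= (bigD1 j) /=; last by rewrite eq_sym nij.
    rewrite big1 => [|k /andP[ki kj]].
      by rewrite !mxE !eqxx nij eq_sym nij /= cox_diag (cox_apart ij); ring.
    by rewrite !mxE (negbTE ki) (negbTE kj) /=; ring.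
  by rewrite eqxx andbT mulrC.
by apply/colP => r; rewrite !mxE /=; ring.
Qed.

Lemma alt_pal n i j :
  alt (n.*2.+1) i j = alt n i j ++ (if odd n then j else i) :: rev (alt n i j).
Proof.
have h (k : nat) p q : alt k.+1 p q = rcons (alt k p q) (if odd k then q else p).
  elim: k p q => [|k IH] p q //.
  by rewrite -[LHS]/(p :: alt k.+1 q p) IH -rcons_cons /=; case: (odd k).
elim: n i j => [|n IH] i j //.
have -> : alt (n.+1.*2.+1) i j = i :: rcons (alt (n.*2.+1) j i) i.
  by rewrite doubleS -[LHS]/(i :: alt n.*2.+2 j i) h /= odd_double.
rewrite IH [alt n.+1 i j]/= rev_cons rcons_cat /=; congr (_ :: _ ++ _ :: _).
by case: (odd n).
Qed.

Lemma alt_cat n k i j : alt (n + k) i j = alt n i j ++ (if odd n then alt k j i else alt k i j).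
Proof.
elim: n i j => [|n IH] i j //.
by rewrite addSn /= IH; case: (odd n).
Qed.

(** An alternating word of odd length is a palindrome, hence conjugate to a generator, and [P_conj]
    makes its [P] of rank one. The word of length 2k is a product of two such involutions, and in
    the difference of the two rank-one matrices the mixed terms cancel, which leaves S_n^2 -
    S_(n-1)^2. This is the origin of the modulus. *)
Lemma P_alt n i j : apart i j ->
  P (alt (n.*2.+1).*2 i j) = ((cheb n).1 ^+ 2 - (cheb n).2 ^+ 2) *:
    ((E j - E i) *m T (alt n.*2.+1 j i)).
Proof.
move=> ij; set k := n.*2.+1; set e := _ - _ ^+ 2.
have kodd : odd k by rewrite /= odd_double.
rewrite -addnn alt_cat kodd.
have pal p q : rev (alt k p q) = alt k p q.
  by rewrite /k alt_pal rev_cat rev_cons revK cat_rcons.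
have Pk p q : apart p q -> P (alt k p q) =
    - (pair_vec p q (cheb n).1 (cheb n).2 *m (pair_vec p q (cheb n).1 (cheb n).2)^T).
  by move=> pq; rewrite /k alt_pal P_conj root_alt.
have eP : P (alt k i j) - P (alt k j i) = e *: (E j - E i).
  rewrite !Pk //; last by rewrite apartC.
  apply/matrixP => r l.
  rewrite !mxE !big_ord1 !mxE.
  have nij : (i == j) = false.
    by apply/eqP=> eij; move: ij; rewrite eij /apart /gap addKn.
  case: (eqVneq r i) => [->|ri]; case: (eqVneq l i) => [->|li];
    rewrite ?nij ?(eq_sym j) ?nij ?(negbTE ri) ?(negbTE li) ?andbF /= /e;
    case: (r == j); case: (l == j); rewrite /=; ring.
rewrite P_cat.
have -> : P (alt k j i) = - (P (alt k j i) *m T (alt k j i)).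
  by apply/eqP; rewrite -addr_eq0 addrC -{2 3}(pal j i) P_revK.
by rewrite -mulmxBl eP scalemxAl.
Qed.
End Burau.

(** Commuting letters are neighbours in the hexagon, which contains no three pairwise neighbouring
    sides. *)
Lemma clique_cases (V : word) : clique V ->
  (exists i, V = [:: i]) \/ (exists i j, V = [:: i; j] /\ comm i j).
Proof.
case/andP; case: V => [|i [|j [|k V]]] // _; first by left; exists i.
  by rewrite /= !andbT => c; right; exists i, j.
by rewrite /= => /andP[/and3P[c1 c2 _] /andP[/andP[c3 _] _]]; move: c1 c2 c3; letters.
Qed.

(** * Leading coefficients along a layered word *)

Section Leading.
Variable F : fieldType.
Notation K := {poly F}.
Notation xK := ('X^4 : K).
Notation yK := ('X^3 : K).
Notation T := (T xK yK).
Notation P := (P xK yK).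
Notation cox := (cox xK yK).
Implicit Types (q : K) (i j r : letter) (V w : word).

(** The coefficient [c] may be zero, so that [lead] also expresses that a degree is not reached. *)
Definition lead q (k : nat) (c : F) := (size q <= k.+1)%N /\ q`_k = c.

Lemma lead_low q k : (size q <= k)%N -> lead q k 0.
Proof. by move=> h; split; [exact: leq_trans h _|exact: nth_default]. Qed.
Lemma lead_add q q' k c c' : lead q k c -> lead q' k c' -> lead (q + q') k (c + c').
Proof.
move=> [h1 <-] [h2 <-]; split; last by rewrite coefD.
by apply: leq_trans (size_polyD _ _) _; rewrite geq_max h1.
Qed.
Lemma lead_opp q k c : lead q k c -> lead (- q) k (- c).
Proof. by move=> [h1 <-]; split; rewrite ?size_polyN ?coefN. Qed.
Lemma size_mulXn_le q n k : (size q <= k)%N -> (size (- 'X^n * q)%R <= n + k)%N.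
Proof.
move=> h; rewrite mulNr size_polyN mulrC.
have [->|q0] := eqVneq q 0; first by rewrite mul0r size_poly0.
by rewrite size_mulXn // leq_add2l.
Qed.
Lemma lead_mulX q n k c : lead q k c -> lead (- 'X^n * q) (n + k) (- c).
Proof.
move=> [h <-]; split; first by rewrite -addnS; apply: size_mulXn_le.
by rewrite mulNr coefN mulrC coefMXn addKn ltnNge leq_addr.
Qed.

Variable U0 : word.
(** Columns are summed over [U0], later taken to be the innermost layer: all its letters then start
    from the same value -1, which is the balanced case in degree 0. *)
Definition bv w r : K := \sum_l T w r l * (l \in U0)%:R.
Definition pv w r : K := \sum_l P w r l * (l \in U0)%:R.

Lemma bv0 r : bv [::] r = (r \in U0)%:R.
Proof.
rewrite /bv T0 (bigD1 r) //= big1 ?addr0 => [|l lr]; first by rewrite mxE eqxx mul1r.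
by rewrite mxE eq_sym (negbTE lr) mul0r.
Qed.

Lemma bv_cons i w r : bv (i :: w) r = bv w r - cox r i * bv w i.
Proof.
rewrite /bv mulr_sumr -sumrB; apply: eq_bigr => l _.
by rewrite T_cons mulrBl mulrA.
Qed.

Lemma bv_in V w r : clique V -> r \in V -> bv (V ++ w) r = - bv w r.
Proof. by apply: (cocycle_in (@cox_diag _ xK yK) (@cox_comm _ xK yK)) => *; exact: bv_cons. Qed.

Lemma bv_out V w r : clique V -> r \notin V ->
  bv (V ++ w) r = bv w r - \sum_(m <- V) cox r m * bv w m.
Proof. by apply: (cocycle_out (@cox_comm _ xK yK)) => *; exact: bv_cons. Qed.

Lemma pv_layer V w r : clique V -> pv (V ++ w) r = pv w r - (r \in V)%:R * bv w r.
Proof.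
move=> cV; rewrite /pv /bv mulr_sumr -sumrB; apply: eq_bigr => l _.
by rewrite P_layer // mulrBl mulrA.
Qed.

Lemma size_cox_mul r m q k : r != m -> (size q <= k)%N -> (size (cox r m * q)%R <= 4 + k)%N.
Proof.
move=> rm h; case c : (comm r m); first by rewrite cox_comm // mul0r size_poly0.
have : nc r m by rewrite nc_comm rm c.
case/orP => [a|f]; first by rewrite cox_apart //; apply: size_mulXn_le.
rewrite cox_facing //; apply: leq_trans (size_mulXn_le _ h) _; lia.
Qed.

Lemma size_nonapart_mul r m q k : r != m -> ~~ apart r m -> (size q <= k)%N ->
  (size (cox r m * q)%R <= 3 + k)%N.
Proof.
move=> rm na h; case c : (comm r m); first by rewrite cox_comm // mul0r size_poly0.
have : nc r m by rewrite nc_comm rm c.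
by rewrite /nc (negbTE na) /= => f; rewrite cox_facing //; apply: size_mulXn_le.
Qed.

(* The leading terms on the first layer: either all letters have the same degree, or the
   layer is a pair whose lesser letter has degree one less than the main letter, and
   leading coefficient [m] times the one of the main letter, [m] counting the layers at
   which a longest chain can change its parity. *)
Definition even_type V w D := {in V, forall i, exists2 c, c != 0 & lead (bv w i) D c}.
Definition main_type (N : nat) V w D := exists D' mu la c m,
  [/\ D = D'.+1, V =i [:: mu; la], comm mu la, c != 0 & (0 < m <= N)%N] /\
  (lead (bv w mu) D c /\ lead (bv w la) D' (c * m%:R)).

(** The word [w] includes its head layer [V]. By [bv_out] and [bv_in] the difference in the second
    clause is the value of row [r] before that layer was added; so above degree D + 1 the row is
    governed by the letters of [V] alone. *)
Definition lt_inv N V w D :=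
  [/\ forall r, (size (pv w r) <= D.+1)%N,
      forall r, r \notin V -> (size (bv w r - \sum_(m <- V) cox r m * bv w m)%R <= D.+2)%N,
      {in V, forall i, pv w i != 0} &
      even_type V w D \/ main_type N V w D].

Lemma lt_inv_size N V w D : lt_inv N V w D -> {in V, forall i, (size (bv w i) <= D.+1)%N}.
Proof.
move=> [_ _ _ [h|[D' [mu [la [c [m [[-> hV _ _ _] [[h1 _] [h2 _]]]]]]]]]] i.
  by case/h => c _ [].
by rewrite hV !inE => /orP[] /eqP -> //; apply: leq_trans h2 _.
Qed.

Lemma even_type_neg V0 w D : clique V0 -> even_type V0 w D -> even_type V0 (V0 ++ w) D.
Proof.
move=> cV h i iV; have [c c0 l] := h i iV; exists (- c); first by rewrite oppr_eq0.
by rewrite bv_in //; apply: lead_opp.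
Qed.

Lemma main_type_neg N V0 w D : clique V0 -> main_type N V0 w D -> main_type N V0 (V0 ++ w) D.
Proof.
move=> cV [D' [mu [la [c [m [[e1 hV e3 e4 e5] [h1 h2]]]]]]].
exists D', mu, la, (- c), m; split; first by split; rewrite ?oppr_eq0.
by split; rewrite ?bv_in // ?hV ?inE ?eqxx ?orbT // ?mulNr; apply: lead_opp.
Qed.

Lemma lt_inv_next N N' V V0 w D D0 : clique V -> lt_inv N V w D -> clique V0 ->
  (D + 3 <= D0)%N -> even_type V0 w D0 \/ (main_type N' V0 w D0 /\ (D + 3 < D0)%N) ->
  (forall m, (0 < m <= N')%N -> m%:R != 0 :> F) ->
  lt_inv N' V0 (V0 ++ w) D0.
Proof.
move=> cV iV cV0 DD0 ty mF.
have sb r : (size (bv w r) <= D + 5)%N.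
  case rV : (r \in V); first by apply: leq_trans (lt_inv_size iV rV) _; lia.
  case: (iV) => _ /(_ r (negbT rV)) h _ _.
  rewrite -(subrK (\sum_(m <- V) cox r m * bv w m) (bv w r)).
  apply: leq_trans (size_polyD _ _) _; rewrite geq_max; apply/andP; split; first by apply: leq_trans h _; rewrite addnC; lia.
  apply: leq_trans (size_sum _ _ _) _; apply/bigmax_leqP_seq => m mV _.
  apply: leq_trans (size_cox_mul _ (lt_inv_size iV mV)) _; last by lia.
  by apply/eqP => e; rewrite e mV in rV.
have sV0 i : i \in V0 -> (size (bv w i) <= D0.+1)%N.
  move=> iV0; case: ty => [h|[[D' [mu [la [c [m [[-> hV _ _ _] [[h1 _] [h2 _]]]]]]]] _]].
    by have [c _ []] := h i iV0.
  by move: iV0; rewrite hV !inE => /orP[] /eqP -> //; apply: leq_trans h2 _.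
have sp r : (size (pv w r) <= D.+1)%N by case: iV.
have lp i : i \in V0 -> exists2 k, (D < k)%N & (bv w i)`_k != 0.
  move=> iV0; case: ty => [h|[[D' [mu [la [c [m [[e hV cml c0 hm] [[_ h1] [_ h2]]]]]]]] lt]].
    by have [c c0 [_ e]] := h i iV0; exists D0; [lia|rewrite e].
  move: iV0; rewrite hV !inE => /orP[] /eqP ->; first by exists D0; [lia|rewrite h1].
  by exists D'; [lia|rewrite h2 mulf_neq0 // mF].
split.
- move=> r; rewrite pv_layer //; apply: leq_trans (size_polyD _ _) _; rewrite geq_max.
  apply/andP; split; first by apply: leq_trans (sp r) _; lia.
  case rV : (r \in V0); last by rewrite mul0r oppr0 size_poly0.
  by rewrite mul1r size_polyN sV0.
- move=> r rV0; rewrite bv_out //.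
  have -> : \sum_(m <- V0) cox r m * bv (V0 ++ w) m = - \sum_(m <- V0) cox r m * bv w m.
    by rewrite -sumrN [LHS]big_seq [RHS]big_seq; apply: eq_bigr => m mV; rewrite bv_in // mulrN.
  by rewrite opprK subrK; apply: leq_trans (sb r) _; lia.
- move=> i iV0; rewrite pv_layer // iV0 mul1r.
  have [k Dk hk] := lp i iV0; apply/eqP => e.
  move: hk; have := congr1 (fun q : K => q`_k) e; rewrite coef0 coefB nth_default; last first.
    by apply: leq_trans (sp i) _.
  by move/eqP; rewrite sub0r oppr_eq0 => ->.
- case: ty => [h|[h _]]; [left; exact: even_type_neg|right; exact: main_type_neg].
Qed.

Lemma lead_out N V w D i : clique V -> lt_inv N V w D -> i \notin V -> forall k c, (D + 1 < k)%N ->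
  lead (\sum_(m <- V) cox i m * bv w m) k c -> lead (bv w i) k c.
Proof.
move=> cV [_ h _ _] iV k c Dk l.
rewrite -(subrK (\sum_(m <- V) cox i m * bv w m) (bv w i)) -[c]add0r.
by apply: lead_add l; apply: lead_low; apply: leq_trans (h i iV) _; lia.
Qed.

Lemma apart_of_pair i mu la : comm mu la -> i != mu -> i != la -> nc i mu || nc i la ->
  ~~ apart i mu -> apart i la.
Proof.
move=> h1 h2 h3 h4 h5; have := @all_letters3 (fun i mu la => [&& comm mu la, i != mu, i != la,
  nc i mu || nc i la & ~~ apart i mu] ==> apart i la) isT i mu la.
by rewrite h1 h2 h3 h4 h5.
Qed.

Lemma apart_one i mu la : comm mu la -> i != mu -> i != la -> nc i mu || nc i la ->
  apart i mu && ~~ apart i la || (apart i la && ~~ apart i mu).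
Proof.
move=> h1 h2 h3 h4; have := @all_letters3 (fun i mu la => [&& comm mu la, i != mu, i != la &
  nc i mu || nc i la] ==> (apart i mu && ~~ apart i la || (apart i la && ~~ apart i mu))) isT i mu la.
by rewrite h1 h2 h3 h4.
Qed.

(** Hence two commuting letters placed in front of [mu] receive degrees that differ by exactly one,
    4 against 3, and a pair has a well-defined main letter. *)
Lemma apart_split1 i j mu : comm i j -> nc i mu -> nc j mu -> apart i mu != apart j mu.
Proof.
move=> h1 h2 h3; have := @all_letters3 (fun i j mu => [&& comm i j, nc i mu & nc j mu] ==>
  (apart i mu != apart j mu)) isT i j mu.
by rewrite h1 h2 h3.
Qed.

Lemma apart_split2 i j mu la : comm i j -> comm mu la ->
  i != mu -> i != la -> j != mu -> j != la ->
  nc i mu || nc i la -> nc j mu || nc j la -> apart i mu != apart j mu.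
Proof.
move=> h1 h2 h3 h4 h5 h6 h7 h8; have := @all_letters4 (fun i j mu la => [&& comm i j, comm mu la,
  i != mu, i != la, j != mu, j != la, nc i mu || nc i la & nc j mu || nc j la] ==>
  (apart i mu != apart j mu)) isT i j mu la.
by rewrite h1 h2 h3 h4 h5 h6 h7 h8.
Qed.

Definition front (N : nat) V w D mu la c :=
  V = [:: mu] \/ [/\ perm_eq V [:: mu; la], comm mu la & exists2 D', D = D'.+1 &
    exists2 m, (0 < m <= N)%N & lead (bv w la) D' (c * m%:R)].

Definition new_lead (N : nat) w D mu c (i : letter) :=
  if apart i mu then lead (bv w i) (4 + D) (- c) else
  exists2 m, (0 < m <= N.+1)%N & lead (bv w i) (3 + D) (- c * m%:R).

(** A letter apart from [mu] gains 4 on the top degree. Any other supported letter reaches 3 + D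
    through X^3 if it faces [mu], or through X^4 applied to [la], or both; the two contributions
    have the same sign, so the multiplicity grows by at most one per layer. *)
Lemma front_step N V w D mu la c i : clique V -> lt_inv N V w D ->
  front N V w D mu la c -> lead (bv w mu) D c -> i \notin V -> has (nc i) V ->
  new_lead N w D mu c i.
Proof.
move=> cV iV hV lmu iV' sup; rewrite /new_lead.
have lo k c' : (D + 1 < k)%N -> lead (\sum_(m <- V) cox i m * bv w m) k c' -> lead (bv w i) k c'.
  by apply: lead_out cV iV iV' k c'.
have D3 : (D + 1 < 3 + D)%N by rewrite addnC ltn_add2r.
have D4 : (D + 1 < 4 + D)%N by rewrite addnC ltn_add2r.
case: hV => [eV|[pV cml [D' eD [m hm lla]]]].
  move: sup iV'; rewrite eV /= orbF inE; case: ifP => a n nim.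
    by apply: (lo _ _ D4); rewrite eV big_seq1 (cox_apart _ _ a); apply: lead_mulX.
  exists 1%N => //; rewrite mulr1; apply: (lo _ _ D3).
  have f : facing i mu by move: n; rewrite /nc a.
  by rewrite eV big_seq1 (cox_facing _ _ f); apply: lead_mulX.
have sum : \sum_(m <- V) cox i m * bv w m = cox i mu * bv w mu + cox i la * bv w la.
  by rewrite (perm_big _ pV) /= !big_cons big_nil addr0.
have [nim nil] : i != mu /\ i != la.
  by move: iV'; rewrite (perm_mem pV) !inE negb_or => /andP[].
move: sup; rewrite (perm_has _ pV) /= orbF => sup.
case: ifP => a.
  apply: (lo _ _ D4); rewrite sum -[- c]addr0; apply: lead_add.
    by rewrite (cox_apart _ _ a); apply: lead_mulX.
  by apply: lead_low; apply: leq_trans (size_cox_mul nil (proj1 lla)) _; rewrite eD.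
have al := apart_of_pair cml nim nil sup (negbT a).
have lal : lead (cox i la * bv w la) (3 + D) (- (c * m%:R)).
  have -> : (3 + D = 4 + D')%N by rewrite eD.
  by rewrite (cox_apart _ _ al); apply: lead_mulX.
case/andP: hm => m0 mN.
case ci : (comm i mu).
  exists m; first by rewrite m0 leqW.
  apply: (lo _ _ D3); rewrite sum mulNr.
  by rewrite (cox_comm _ _ ci) mul0r add0r.
have f : facing i mu by have : nc i mu; [rewrite nc_comm nim ci|rewrite /nc a].
exists m.+1; first by rewrite ltnS.
apply: (lo _ _ D3).
rewrite sum -[m.+1]addn1 natrD mulrDr mulr1 mulNr [X in lead _ _ X]addrC; apply: lead_add lal.
by rewrite (cox_facing _ _ f); apply: lead_mulX.
Qed.

Section Step.
Variables (N : nat) (V V0 w : word) (D : nat).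
Hypotheses (cV : clique V) (cV0 : clique V0) (sV : supported V V0) (iV : lt_inv N V w D).
Hypothesis mF : forall m, (0 < m <= N.+1)%N -> m%:R != 0 :> F.

Let out i : i \in V0 -> i \notin V.
Proof. by move=> iV0; apply/negP => /(layers_disjoint cV sV); rewrite iV0. Qed.

Let next D0 : (D + 3 <= D0)%N -> even_type V0 w D0 \/ (main_type N.+1 V0 w D0 /\ (D + 3 < D0)%N) ->
    exists D0, lt_inv N.+1 V0 (V0 ++ w) D0.
Proof. by move=> h1 h2; exists D0; apply: lt_inv_next cV iV cV0 h1 h2 mF. Qed.

Let D43 : (D + 3 < 4 + D)%N. Proof. by rewrite addnC ltn_add2r. Qed.

Lemma main_next c i' j' : c != 0 -> V0 =i [:: i'; j'] -> comm i' j' ->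
  lead (bv w i') (4 + D) (- c) ->
  (exists2 m, (0 < m <= N.+1)%N & lead (bv w j') (3 + D) (- c * m%:R)) ->
  exists D0, lt_inv N.+1 V0 (V0 ++ w) D0.
Proof.
move=> c0 eV0 cij' li [m hm lj]; apply: (@next (4 + D)%N); first exact: ltnW.
right; split; last exact: D43.
by exists (3 + D)%N, i', j', (- c), m; split=> //; split; rewrite ?oppr_eq0.
Qed.

Lemma lt_step_front mu la c : front N V w D mu la c -> c != 0 -> lead (bv w mu) D c ->
  exists D0, lt_inv N.+1 V0 (V0 ++ w) D0.
Proof.
move=> hV c0 lmu.
have h i : i \in V0 -> new_lead N w D mu c i.
  by move=> iV0; apply: front_step hV lmu _ _ => //; [exact: out|exact: (allP sV)].
case: (clique_cases cV0) => [[i e]|[i [j [e cij]]]].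
  have hi : i \in V0 by rewrite e inE.
  have := h i hi; rewrite /new_lead; case: ifP => a.
    move=> li; apply: (@next (4 + D)%N); first exact: ltnW.
    by left => r; rewrite e inE => /eqP ->; exists (- c); rewrite ?oppr_eq0.
  move=> [m hm li]; apply: (@next (3 + D)%N); first by rewrite addnC.
  by left => r; rewrite e inE => /eqP ->; exists (- c * m%:R); rewrite ?mulf_neq0 ?oppr_eq0 // mF.
have [hi hj] : i \in V0 /\ j \in V0 by rewrite e !inE !eqxx orbT.
have ap : apart i mu != apart j mu.
  have := out hj; have := out hi; have := allP sV j hj; have := allP sV i hi.
  case: hV => [eV|[pV cml _]].
    by rewrite eV /= !orbF => si sj _ _; apply: apart_split1.
  rewrite !(perm_has _ pV) !(perm_mem pV) /= !orbF !inE !negb_or.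
  by move=> si sj /andP[? ?] /andP[? ?]; apply: (apart_split2 cij cml).
have := h j hj; have := h i hi; rewrite /new_lead.
case ai : (apart i mu) ap; case aj : (apart j mu) => // _ li lj.
  by apply: (main_next c0 _ cij) => // r; rewrite e.
apply: (main_next c0 _ _ lj li); last by rewrite commC.
by move=> r; rewrite e !inE orbC.
Qed.

(** Beside the cases with a main letter there is a balanced pair. A letter that it supports is apart
    from exactly one of the two, so a single term reaches degree 4 + D and the next layer is
    balanced again. *)
Lemma lt_step : exists D0, lt_inv N.+1 V0 (V0 ++ w) D0.
Proof.
case: (iV) => _ _ _ [evt|[D' [mu [la [c [m [[eD eV cml c0 hm] [h1 h2]]]]]]]]; last first.
  apply: (lt_step_front (mu := mu) (la := la)) c0 h1; right; split=> //.
    apply: uniq_perm => //; first exact: clique_uniq.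
    by rewrite /= inE andbT; apply/eqP => e; move: cml; rewrite e comm_irr.
  by exists D' => //; exists m.
case: (clique_cases cV) => [[i e]|[i [j [e cij]]]].
  have [|c c0 li] := evt i; first by rewrite e inE.
  by apply: (lt_step_front (mu := i) (la := i)) c0 li; left.
apply: (@next (4 + D)%N); first exact: ltnW.
left => r rV0; have oV := out rV0; have su := allP sV r rV0.
have [|ci ci0 li] := evt i; first by rewrite e inE eqxx.
have [|cj cj0 lj] := evt j; first by rewrite e !inE eqxx orbT.
have [ri rj] : r != i /\ r != j by move: oV; rewrite e !inE negb_or => /andP[].
have D4 : (D + 1 < 4 + D)%N by rewrite addnC ltn_add2r.
have : apart r i && ~~ apart r j || (apart r j && ~~ apart r i).
  by apply: apart_one => //; move: su; rewrite e /= orbF.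
case/orP => /andP[a na].
  exists (- ci); first by rewrite oppr_eq0.
  apply: (lead_out cV iV oV D4).
  rewrite e !big_cons big_nil addr0 -[- ci]addr0; apply: lead_add.
    by rewrite (cox_apart _ _ a); apply: lead_mulX.
  by apply: lead_low; apply: leq_trans (size_nonapart_mul rj na (proj1 lj)) _.
exists (- cj); first by rewrite oppr_eq0.
apply: (lead_out cV iV oV D4).
rewrite e !big_cons big_nil addr0 -[- cj]add0r; apply: lead_add; last first.
  by rewrite (cox_apart _ _ a); apply: lead_mulX.
by apply: lead_low; apply: leq_trans (size_nonapart_mul ri na (proj1 li)) _.
Qed.
End Step.

Lemma leading_colay M : colay M -> last [::] M = U0 ->
  (forall m, (0 < m <= size M)%N -> m%:R != 0 :> F) ->
  {in head [::] M, forall i, pv (flatten M) i != 0}.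
Proof.
case: M => [|V0 M0] //.
suff H : forall M, colay M -> (forall m, (0 < m <= size M)%N -> m%:R != 0 :> F) -> M != [::] ->
    last [::] M = U0 -> exists D, lt_inv (size M) (head [::] M) (flatten M) D.
  by move=> /H h e /h /(_ isT e) [] // D [].
elim=> [|V M IH] // lM mF _; have /and3P[cV sV lM'] := lM.
have [eM|nM] := eqVneq M [::].
  rewrite eM /= cats0 => eV; exists 0%N.
  have b1 i : i \in V -> bv V i = - 1 by move=> iV; rewrite -[V]cats0 bv_in ?bv0 -?eV ?iV.
  split.
  - move=> r; rewrite -[V]cats0 pv_layer // bv0 /pv big1 => [|l _]; last by rewrite mxE mul0r.
    rewrite sub0r size_polyN -eV; case: (r \in V); rewrite ?mul0r ?size_poly0 //.
    by rewrite mulr1 size_poly1.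
  - move=> r rV; rewrite [X in X - _](_ : _ = bv [::] r - \sum_(m <- V) cox r m * bv [::] m); last first.
      by rewrite -bv_out // cats0.
    have -> : \sum_(m <- V) cox r m * bv V m = - \sum_(m <- V) cox r m * bv [::] m.
      by rewrite -sumrN [LHS]big_seq [RHS]big_seq; apply: eq_bigr => m mV; rewrite b1 // bv0 -eV mV mulrN.
    by rewrite opprK subrK bv0 -eV (negbTE rV) size_poly0.
  - move=> i iV; rewrite -[V]cats0 pv_layer // iV bv0 /pv big1 => [|l _]; last by rewrite mxE mul0r.
    by rewrite sub0r mul1r -eV iV oppr_eq0 oner_eq0.
  - left => i iV; exists (-1); first by rewrite oppr_eq0 oner_eq0.
    by rewrite b1 //; split; rewrite ?size_polyN ?size_poly1 // coefN coef1.
move=> lU; case: M sV lM' mF lM IH nM lU => [//|U M] sV lM' mF lM IH _ lU.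
have [m /andP[m0 hm]|D iM] := IH lM' _ isT lU; first by apply: mF; rewrite m0 leqW.
case/and3P: lM' => cU _ _.
exact: (lt_step cU cV sV iM mF).
Qed.
End Leading.

Lemma colay_rcons (M : seq word) (U : word) : colay M -> clique U ->
  (M = [::] \/ supported U (last [::] M)) -> colay (rcons M U).
Proof.
elim: M => [|V M IH] /=; first by move=> _ ->.
move=> /and3P[cV sV cM] cU [//|sU]; rewrite cV /=.
case: M sV cM sU IH => [|W M] /= sV cM sU IH; first by rewrite cU sU.
by rewrite sV IH //; right.
Qed.

Lemma lay_rev (L : seq word) : lay L -> colay (rev L).
Proof.
elim: L => //= V L IH /and3P[cV sV lL]; rewrite rev_cons; apply: colay_rcons (IH lL) cV _.
case: L sV {IH lL} => [|W L] /= sV; first by left.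
by right; rewrite rev_cons last_rcons.
Qed.

(* Read backwards, a layered word has its last layer in front and every letter of a layer is
   supported by the layer behind it. *)
Theorem leading_row (F : fieldType) (L : seq word) : lay L -> L != [::] ->
  (forall m, (0 < m <= size L)%N -> m%:R != 0 :> F) ->
  exists2 i, i \in head [::] L & exists l, P ('X^4 : {poly F}) 'X^3 (flatten L) i l != 0.
Proof.
move=> lL nL mF; have cM := lay_rev lL.
have eW : weq (flatten (rev L)) (rev (flatten L)).
  elim: L lL {nL mF cM} => [|V L IH] //=; first by constructor.
  move=> /and3P[cV _ lL]; rewrite rev_cons flatten_rcons rev_cat.
  apply: weq_cat (IH lL) _; apply: weq_perm; first by case/andP: cV.
  by rewrite perm_sym perm_rev.
have [i iM] : exists i, i \in head [::] (rev L).
  case: (rev L) cM (size_rev L) => [|V M] /=; first by case: L nL {lL mF eW}.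
  by case/and3P; case/andP; case: V => [|i V] // _ _ _ _ _; exists i; rewrite inE eqxx.
have e : last [::] (rev L) = head [::] L by case: (L) => // V L'; rewrite rev_cons last_rcons.
have := leading_colay cM e _ iM; rewrite size_rev => /(_ F mF).
(* The reversed word has the transposed [P]: the nonzero row sum over the innermost layer becomes a
   column sum over the head of [L], so one of its rows is nonzero. *)
rewrite /pv (P_weq _ _ eW) P_rev => h.
have [r /andP[rh nr]|h'] := pickP (fun r => (r \in head [::] L) &&
    (P ('X^4 : {poly F}) 'X^3 (flatten L) r i != 0)).
  by exists r => //; exists i.
case/eqP: h; rewrite big1 // => r _; rewrite mxE.
have := h' r; case: (r \in _) => /=; last by rewrite mulr0.
by move=> /negbFE/eqP ->; rewrite mul0r.
Qed.

(** Splitting off letters of [J] from the left while the head offers one leaves the shortest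
    representative of the coset of [w] under the parabolic subgroup of [J]. *)
Lemma strip (J : pred letter) (w : word) : exists a L,
  [/\ all J a, lay L, weq w (a ++ flatten L), (size (flatten L) <= size w)%N &
      {in head [::] L, forall i, ~~ J i}].
Proof.
have [n] := ubnP (size w); elim: n w => // n IH w wn.
have [L [lL wL sL _]] := lay_nf w.
have [/hasP[j jh Jj]|h] := boolP (has J (head [::] L)); last first.
  exists [::], L; split=> //; first exact: weq_sym.
  by move=> i ih; apply: (hasPn h).
case: L lL wL sL jh => [//|V L] lL wL sL /= jh.
have pV := perm_to_rem jh.
have wV : weq (flatten (V :: L)) (j :: rem j V ++ flatten L).
  rewrite /= -cat_cons; apply: weq_catr; apply: weq_perm pV.
  by case/and3P: lL => /andP[].
set q := rem j V ++ flatten L in wV.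
have sq : (size q < size w)%N.
  apply: leq_trans sL; rewrite /q /= !size_cat size_rem // ltn_add2r.
  by case: (V) jh.
have [a [L' [Ja lL' wq sq' hJ]]] := IH q (leq_trans sq wn).
exists (j :: a), L'; split=> //=; first by rewrite Jj.
  by apply: weq_trans (weq_sym wL) _; apply: weq_trans wV _; apply: weq_cons.
exact: leq_trans sq' (ltnW sq).
Qed.

Lemma P_letters (K : comNzRingType) (x y : K) w i l : P x y w i l != 0 -> i \in w.
Proof.
elim: w => [|j w IH]; first by rewrite mxE eqxx.
rewrite P_cons inE; case: (i == j); first by [].
rewrite mul0r subr0; exact: IH.
Qed.

Section Parabolic.
Variable F : fieldType.
Notation P := (P ('X^4 : {poly F}) 'X^3).
Notation T := (T ('X^4 : {poly F}) 'X^3).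

(** If the coset representative were nontrivial, [leading_row] would give it a nonzero row outside
    [J]. It equals a^-1 w, however, and both terms of the cocycle relation have zero rows there: [P]
    of a word in [J] by [P_letters], and [P w] by hypothesis. *)
Lemma parabolic (J : pred letter) (w : word) :
  (forall i l, P w i l != 0 -> J i) ->
  (forall m, (0 < m <= size w)%N -> m%:R != 0 :> F) ->
  exists2 a, all J a & weq w a.
Proof.
move=> hJ mF; have [a [L [Ja lL wq sL nJ]]] := strip J w.
exists a => //; suff -> : a = a ++ flatten L by [].
have [->|nL] := eqVneq L [::]; first by rewrite /= cats0.
have [|i ih [l nz]] := leading_row lL nL (F := F).
  move=> m /andP[m0 ml]; apply: mF; rewrite m0 (leq_trans ml) // (leq_trans _ sL) //.
  elim: (L) lL {nL ml sL wq nJ} => //= V L' IH /and3P[cV _ /IH h].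
  by rewrite size_cat -add1n leq_add // lt0n size_eq0; case/andP: cV.
case/negP: (nJ i ih).
have wq' : weq (flatten L) (rev a ++ w).
  apply: weq_sym; apply: weq_trans (weq_catl _ wq) _; rewrite catA.
  exact: weq_catr (weq_Krev _).
move: nz; rewrite (P_weq _ _ wq') P_cat mxE => nz.
have [e|] := eqVneq (P w i l) 0; last exact: hJ.
move: nz; rewrite e addr0 mxE => nz.
have [j nj] : exists j, P (rev a) i j != 0.
  have [j nj|h] := pickP (fun j => P (rev a) i j != 0); first by exists j.
  by case/eqP: nz; rewrite big1 // => j _; have /negbFE/eqP -> := h j; rewrite mul0r.
by have := P_letters nj; rewrite mem_rev => /(allP Ja).
Qed.
End Parabolic.

(** * Hyperbolic estimates for distances to walls *)

Section Growth.
Variable R : realType.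
Implicit Types (x y z : 'cV[R]_3) (i j m : letter) (w u : word) (V : word) (L : seq word).
Notation normal := (@normal R).
Notation gram := (@gram R).
Notation B i z := (lorentz (normal i) z).
Notation ev := (@ev R).
Notation s3 := (@s3 R).

(* [expasinh s] is exp (asinh s), and [Lam] is exp L for L = arcosh 2. *)
Definition expasinh (s : R) := s + Num.sqrt (s ^+ 2 + 1).
Definition Lam : R := 2 + s3.

Lemma s3_bounds : 17/10 < s3 /\ s3 < 18/10.
Proof.
have := s3s3 R; have := s3_gt0 R; set s := s3 => s0 ss.
split; rewrite ltNge; apply/negP => h.
  have : s * s <= (17/10) * (17/10) by apply: ler_pM => //; apply: ltW.
  by rewrite ss; lra.
have : (18/10) * (18/10) <= s * s by apply: ler_pM => //; lra.
by rewrite ss; lra.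
Qed.

Lemma Lam_gt1 : 1 < Lam.
Proof. by have := s3_bounds; rewrite /Lam; lra. Qed.

Lemma sqrt_ge1 (s : R) : 1 <= Num.sqrt (s ^+ 2 + 1).
Proof.
by rewrite -[X in X <= _]sqrtr1 ler_wsqrtr // lerDr sqr_ge0.
Qed.

Lemma expasinh_ge1 s : 0 <= s -> 1 <= expasinh s.
Proof. by move=> s0; have := sqrt_ge1 s; rewrite /expasinh; lra. Qed.

Lemma expasinh_le s t : 0 <= s -> s <= t -> expasinh s <= expasinh t.
Proof.
move=> s0 st; apply: lerD => //; rewrite ler_wsqrtr // lerD2r ler_sqr // nnegrE //.
exact: le_trans st.
Qed.

(** The addition formula for sinh (asinh s + L), with cosh L = 2 and sinh L = sqrt 3. *)
Lemma expasinh_grow s : 0 <= s ->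
  expasinh (2 * s + s3 * Num.sqrt (s ^+ 2 + 1)) = Lam * expasinh s.
Proof.
move=> s0; set q := Num.sqrt (s ^+ 2 + 1).
have q2 : q ^+ 2 = s ^+ 2 + 1 by rewrite sqr_sqrtr // addr_ge0 ?sqr_ge0.
have q0 : 0 <= q by exact: sqrtr_ge0.
have s30 := s3_gt0 R; have ss := s3s3 R.
have e : (2 * s + s3 * q) ^+ 2 + 1 = (2 * q + s3 * s) ^+ 2.
  have -> : (2 * s + s3 * q) ^+ 2 + 1 = 4 * s ^+ 2 + 4 * s3 * s * q + (s3 * s3) * q ^+ 2 + 1 by ring.
  have -> : (2 * q + s3 * s) ^+ 2 = 4 * q ^+ 2 + 4 * s3 * s * q + (s3 * s3) * s ^+ 2 by ring.
  by rewrite q2 ss; ring.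
rewrite /expasinh e sqrtr_sqr ger0_norm; last by rewrite addr_ge0 ?mulr_ge0 // ltW.
by rewrite -/q /Lam; ring.
Qed.

(** Walls of noncommuting letters are at least L apart, so a point beyond the first is farther from
    the second by at least L. The reversed Cauchy-Schwarz inequality is applied to the components
    [z'] and [b] of the point and of the normal [m] orthogonal to the normal [i]; the last clause of
    [st] supplies the sign. *)
Lemma growth V z i m : hyp z -> st V z -> i \in V -> nc i m ->
  Lam * expasinh (B i z) <= expasinh (- B m z).
Proof.
move=> [nz _] [h1 h2 h3] iV n; have s0 := h1 i iV; have k := h3 i iV m n.
have c2 := gram_nc R n.
rewrite -expasinh_grow //; apply: expasinh_le.
  by rewrite addr_ge0 ?mulr_ge0 ?sqrtr_ge0 // ltW // s3_gt0.
set s := B i z in s0 k *; set c := - gram i m in k.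
have c2' : 2 <= c by rewrite /c; lra.
pose b := normal m + c *: normal i; pose z' := z - s *: normal i.
have zz : lorentz z' z' = - (1 + s ^+ 2).
  by rewrite /z' !lorentz_lin nz (lorentzC z) -/s lorentz_normal gram_eq; ring.
have bb : lorentz b b = - (c ^+ 2 - 1).
  by rewrite /b !lorentz_lin !lorentz_normal !gram_eq (gramC R m i) /c; ring.
have zb : lorentz z' b = B m z + c * s.
  by rewrite /z' /b !lorentz_lin !lorentz_normal gram_eq !(lorentzC z) -/s /c; ring.
have c21 : 3 <= c ^+ 2 - 1.
  have : 2 * 2 <= c * c by apply: ler_pM.
  by rewrite expr2; lra.
have := reverse_CauchySchwarz (x := z') (y := b); rewrite zz bb zb.
have s2 := sqr_ge0 s; rewrite !oppr_le0 => CS.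
have {}CS := CS ltac:(lra) ltac:(lra).
have kk : 0 <= - (B m z + c * s) by lra.
suff : s3 * Num.sqrt (s ^+ 2 + 1) <= - (B m z + c * s).
  have : 2 * s <= c * s by apply: ler_wpM2r.
  lra.
rewrite -ler_sqr ?nnegrE //; last by rewrite mulr_ge0 ?sqrtr_ge0 // ltW // s3_gt0.
rewrite sqrrN exprMn [s3 ^+ 2]expr2 s3s3 sqr_sqrtr; last by lra.
apply: le_trans CS; rewrite mulrNN [X in _ <= X]mulrC [X in _ <= _ * X]addrC.
by apply: ler_wpM2r => //; lra.
Qed.

(** A segment that crosses a wall is at least as long as the distances of its ends to the wall
    together: the right-hand side is minus the hyperbolic cosine of that sum. *)
Lemma lorentz_separated i x z : hyp x -> hyp z -> B i x <= 0 -> 0 <= B i z ->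
  lorentz x z <= - (Num.sqrt (1 + B i x ^+ 2) * Num.sqrt (1 + B i z ^+ 2)) + B i x * B i z.
Proof.
move=> hx hz; set f := B i x; set s := B i z => f0 s0.
have [nx x0] := hx; have [nz z0] := hz.
pose x' := x - f *: normal i; pose z' := z - s *: normal i.
have xx : lorentz x' x' = - (1 + f ^+ 2).
  by rewrite /x' !lorentz_lin nx (lorentzC x) -/f lorentz_normal gram_eq; ring.
have zz : lorentz z' z' = - (1 + s ^+ 2).
  by rewrite /z' !lorentz_lin nz (lorentzC z) -/s lorentz_normal gram_eq; ring.
have xz : lorentz x' z' = lorentz x z - f * s.
  by rewrite /x' /z' !lorentz_lin !lorentz_normal gram_eq (lorentzC x (normal i)) -/s -/f; ring.
have f2 := sqr_ge0 f; have s2 := sqr_ge0 s.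
have xn : lorentz x' x' < 0 by rewrite xx; lra.
have zn : lorentz z' z' < 0 by rewrite zz; lra.
have z'n0 : z' != 0 by apply/eqP => e; move: zn; rewrite e lorentz0l ltxx.
have x'n0 : x' != 0 by apply/eqP => e; move: xn; rewrite e lorentz0l ltxx.
have tx : 0 < x' 0 0.
  rewrite -(lorentz_time _ (ltW xn) x'n0 x0) ?nx ?ltrN10 //.
  by rewrite /x' !lorentz_lin nx (lorentzC x) -/f -expr2; lra.
have tz : 0 < z' 0 0.
  rewrite -(lorentz_time _ (ltW zn) z'n0 z0) ?nz ?ltrN10 //.
  by rewrite /z' !lorentz_lin nz (lorentzC z) -/s -expr2; lra.
have neg : lorentz x' z' < 0 by rewrite (lorentz_time xn (ltW zn) z'n0 tx).
have := reverse_CauchySchwarz (ltW xn) (ltW zn); rewrite xx zz mulrNN xz => CS.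
rewrite xz in neg.
suff : Num.sqrt (1 + f ^+ 2) * Num.sqrt (1 + s ^+ 2) <= - (lorentz x z - f * s) by lra.
rewrite -ler_sqr ?nnegrE ?mulr_ge0 ?sqrtr_ge0 //; last by lra.
by rewrite sqrrN exprMn !sqr_sqrtr //; lra.
Qed.

(** Here [t] is the exponential of a bound for the distance of the points. The inequality is strict
    because [x] keeps a positive distance from the wall. *)
Lemma expasinh_lt_dist i x z t : hyp x -> hyp z -> B i x < 0 -> 0 < t ->
  1 <= t -> - lorentz x z <= (t + t^-1) / 2 -> expasinh (B i z) < t.
Proof.
move=> hx hz f0 t0 t1 d.
have [s0|s0] := ltP (B i z) 0.
  set s := B i z in s0 *; set q' := Num.sqrt (s ^+ 2 + 1).
  apply: lt_le_trans t1; rewrite /expasinh -/q'.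
  have : q' < 1 - s; last by lra.
  rewrite -ltr_sqr ?nnegrE ?sqrtr_ge0 //; last by lra.
  by rewrite sqr_sqrtr ?addr_ge0 ?sqr_ge0 // sqrrB expr1n; rewrite expr2; lra.
have := lorentz_separated hx hz (ltW f0) s0; set f := B i x in f0 *; set s := B i z in s0 *.
set q := Num.sqrt (1 + s ^+ 2) => h.
have q2 : q ^+ 2 = 1 + s ^+ 2 by rewrite sqr_sqrtr // addr_ge0 ?sqr_ge0.
have q1 : 1 <= q by rewrite /q addrC; exact: sqrt_ge1.
have p1 : 1 < Num.sqrt (1 + f ^+ 2).
  rewrite -[X in X < _]sqrtr1 ltr_sqrt; last by rewrite ltr_pwDl ?sqr_ge0.
  by rewrite ltrDl lt_neqAle sqr_ge0 eq_sym sqrf_eq0 lt_eqF.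
have p2 : q < Num.sqrt (1 + f ^+ 2) * q by rewrite -[X in X < _]mul1r ltr_pM2r //; lra.
have p3 : f * s <= 0 by rewrite mulr_le0_ge0 // ltW.
have qt : q < (t + t^-1) / 2 by lra.
rewrite /expasinh [s ^+ 2 + 1]addrC -/q.
have ti : t * t^-1 = 1 by rewrite mulfV // gt_eqF.
have ti0 : 0 < t^-1 by rewrite invr_gt0.
rewrite ltNge; apply/negP => tsq.
have qs : (q - s) * (s + q) = 1.
  by transitivity (q ^+ 2 - s ^+ 2); [ring|rewrite q2; ring].
have u1 : 1 <= s + q by lra.
have qs1 : q - s <= 1.
  rewrite -(ler_pM2r (_ : 0 < s + q)) ?mul1r ?qs //; lra.
have ti1 : t^-1 <= 1 by rewrite invf_le1.
have qs0 : 0 <= q - s.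
  by rewrite -(pmulr_lge0 _ (_ : 0 < s + q)) ?qs //; lra.
(* u + 1/u is increasing in u = s + q *)
have : 0 <= (s + q - t) * (1 - t^-1 * (q - s)).
  rewrite mulr_ge0 ?subr_ge0 //.
  by rewrite -[X in _ <= X]mul1r; apply: ler_pM => //; exact: ltW.
have -> : (s + q - t) * (1 - t^-1 * (q - s)) =
    (s + q) - t - t^-1 * ((q - s) * (s + q)) + (t * t^-1) * (q - s) by ring.
rewrite qs ti; lra.
Qed.
End Growth.

(** * Degrees and distances *)

Section Degrees.
Variables (R : realType) (F : fieldType).
Implicit Types (x y z : 'cV[R]_3) (i j m l : letter) (w u : word) (V : word) (L : seq word).
Notation normal := (@normal R).
Notation gram := (@gram R).
Notation B i z := (lorentz (normal i) z).
Notation ev := (@ev R).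
Notation Lam := (@Lam R).
Notation P := (P ('X^4 : {poly F}) 'X^3).
Notation T := (T ('X^4 : {poly F}) 'X^3).
Notation cox := (cox ('X^4 : {poly F}) 'X^3).
Notation E i z := (expasinh `|B i z|).

(** A further layer never brings the point closer to a side of the hexagon, even if it changes sides
    with respect to it, as happens for the letters in the head of [L]. *)
Lemma abs_mono V L z' i : lay (V :: L) -> st (head [::] L) z' ->
  `|B i z'| <= `|B i (ev V *m z')|.
Proof.
move=> /and3P[cV sV _] hz; have hz' := st_step cV sV hz.
case iV : (i \in V); first by rewrite B_ev_in // normrN.
have le0 : B i (ev V *m z') <= 0 by case: hz' => _ h _; apply: h; rewrite iV.
have V0 m : m \in V -> B m z' <= 0.
  by move=> mV; case: hz => _ h _; apply: h; apply: layers_disjoint mV.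
rewrite [X in _ <= X]ler0_norm //; case iL : (i \in head [::] L).
  have /hasP[m mV n] := allP sV i iL.
  have k2 := step_out cV sV hz (negbT iV) mV n.
  case: hz => h1 _ h3; have k1 := h3 i iL m n; have s0 := h1 i iL.
  rewrite ger0_norm //; have g2 := gram_nc R n; have b0 := V0 m mV.
  move: k2 k1 s0 g2 b0.
  set g := gram i m; set b := B m z'; set s := B i z' => k2 k1 s0 g2 b0.
  have : 0 <= (- g - 2) * s by apply: mulr_ge0 => //; lra.
  have : 0 <= (- g - 2) * - b by apply: mulr_ge0; lra.
  rewrite !mulrBl mulrN; lra.
have le1 : B i z' <= 0 by case: hz => _ h _; apply: h; rewrite iL.
rewrite ler0_norm // B_ev_clique ?iV //.
have : 0 <= \sum_(m <- V) gram i m * B m z'.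
  rewrite big_seq; apply: sumr_ge0 => m mV; apply: mulr_le0; last exact: V0.
  by apply: gram_neq; apply/eqP => e; rewrite e mV in iV.
lra.
Qed.

Lemma coef_mulX_neg (n d : nat) (q : {poly F}) : (- 'X^n * q)`_d != 0 -> (n <= d)%N /\ q`_(d - n) != 0.
Proof.
rewrite mulNr coefN oppr_eq0 mulrC coefMXn; case: ltnP => //; by rewrite eqxx.
Qed.

Lemma T_coef_out V w i l d : clique V -> i \notin V -> (T (V ++ w) i l)`_d != 0 ->
  [\/ (T w i l)`_d != 0,
      exists m, [/\ m \in V, apart i m, (4 <= d)%N & (T w m l)`_(d - 4) != 0] |
      exists m, [/\ m \in V, facing i m, (3 <= d)%N & (T w m l)`_(d - 3) != 0]].
Proof.
move=> cV iV; rewrite T_out // coefB; have [e|] := eqVneq (T w i l)`_d 0; last by constructor 1.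
rewrite e sub0r oppr_eq0 coef_sum => h.
have [m mV nm] : exists2 m, m \in V & (cox i m * T w m l)`_d != 0.
  have [/hasP//|h'] := boolP (has (fun m => (cox i m * T w m l)`_d != 0) V).
  case/eqP: h; rewrite big1_seq // => m mV; apply/eqP.
  by have := hasPn h' m mV; rewrite negbK.
have im : i != m by apply/eqP => e'; rewrite e' mV in iV.
move: nm; case c : (comm i m); first by rewrite cox_comm // mul0r coef0 eqxx.
have : nc i m by rewrite nc_comm im c.
case/orP => a; rewrite ?(cox_apart _ _ a) ?(cox_facing _ _ a) => /coef_mulX_neg[k1 k2].
  by constructor 2; exists m.
by constructor 3; exists m.
Qed.

Section Tile.
Variable y0 : 'cV[R]_3.
Hypotheses (hy0 : hyp y0) (dy0 : dom y0).
Notation pt L := (ev (flatten L) *m y0).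

Lemma pt_cons V L : pt (V :: L) = ev V *m pt L.
Proof. by rewrite /= ev_cat mulmxA. Qed.

Lemma pt_grow V L i m : lay (V :: L) -> m \in V -> nc i m ->
  Lam * E m (pt L) <= E i (pt (V :: L)).
Proof.
move=> lL mV n; have hz : hyp (pt (V :: L)) by exact: ev_hyp.
have st1 := lay_st lL dy0; rewrite ncC in n.
have := growth hz st1 mV n; case: st1 => h1 h2 _.
have -> : `|B m (pt L)| = B m (pt (V :: L)).
  have cV : clique V by case/and3P: lL.
  have := h1 m mV; rewrite pt_cons B_ev_in // oppr_ge0 => le0.
  by rewrite ler0_norm.
have iV0 : B i (pt (V :: L)) <= 0; last by rewrite ler0_norm.
apply: h2; apply/negP => iV.
by have := clique_nnc (proj1 (andP lL)) mV iV; rewrite n.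
Qed.

Lemma pt_mono V L i : lay (V :: L) -> E i (pt L) <= E i (pt (V :: L)).
Proof.
move=> lL; apply: expasinh_le => //; rewrite pt_cons; apply: abs_mono (lL) _.
by apply: lay_st => //; case/and3P: lL.
Qed.

Lemma pt_front V L i : lay (V :: L) -> i \in V -> E i (pt (V :: L)) = E i (pt L).
Proof. by move=> /and3P[cV _ _] iV; rewrite pt_cons B_ev_in // normrN. Qed.

Definition up4 d := ((d + 3) %/ 4)%N.

(** Every factor X^4 or X^3 comes from a letter that does not commute with the row index, and
    passing it adds at least L to the distance by [pt_grow]. A degree d therefore costs at least d/4
    steps. *)
Lemma T_degree L i l d : lay L -> (T (flatten L) i l)`_d != 0 -> Lam ^+ up4 d <= E i (pt L).
Proof.
elim: L i d => [|V L IH] i d lL.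
  rewrite /= T0 mxE coefMn coef1; case: d => [|d]; last by rewrite mul0rn eqxx.
  by rewrite expr0 => _; apply: expasinh_ge1.
have /and3P[cV sV lL'] := lL; case iV : (i \in V).
  by rewrite /= T_in // coefN oppr_eq0 pt_front //; apply: IH.
have st4 d' i' m : m \in V -> nc i' m -> (up4 d <= (up4 d').+1)%N ->
    (T (flatten L) m l)`_d' != 0 -> Lam ^+ up4 d <= E i' (pt (V :: L)).
  move=> mV n le h; apply: le_trans (pt_grow lL mV n).
  apply: le_trans (_ : Lam ^+ (up4 d').+1 <= _).
    by rewrite ler_eXn2l // Lam_gt1.
  by rewrite exprS ler_pM2l ?IH // (lt_trans _ (Lam_gt1 R)).
case/(T_coef_out cV (negbT iV)) => [h|[m [mV a d4 h]]|[m [mV f d3 h]]].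
- by apply: le_trans (pt_mono _ lL); apply: IH.
- by apply: (st4 (d - 4)%N i m) => //; [rewrite /nc a|rewrite /up4; move: d4; clear; lia].
- by apply: (st4 (d - 3)%N i m) => //; [rewrite /nc f orbT|rewrite /up4; move: d3; clear; lia].
Qed.

Definition parity i w := count (fun j => odd j == odd i) w.

(** At the extremal degree there is no slack: a step between opposite sides gains 3, and the
    remaining degree 4N - 3 would still cost N steps, one too many. So all steps join letters that
    are apart, hence of one parity, and each contributes an occurrence. *)
Lemma T_pure L i l N : lay L -> (T (flatten L) i l)`_(4 * N) != 0 -> E i (pt L) < Lam ^+ N.+1 ->
  (N + (i \in head [::] L) <= parity i (flatten L))%N /\
  ((0 < N)%N -> exists2 j, j \in flatten L & (odd j == odd i) && (j != i)).
Proof.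
elim: L i N => [|V L IH] i N lL.
  rewrite /= T0 mxE coefMn coef1; case: N => [|N] //.
  by rewrite mulnS /= mul0rn eqxx.
have /and3P[cV sV lL'] := lL; have Lam0 : 0 < Lam by rewrite (lt_trans _ (Lam_gt1 R)).
have par_cat m : parity m (V ++ flatten L) = (parity m V + parity m (flatten L))%N by exact: count_cat.
have par_in m j : m \in V -> odd m == odd j -> (0 < parity j V)%N.
  by move=> mV e; rewrite -has_count; apply/hasP; exists m.
case iV : (i \in V).
  rewrite [flatten _]/= T_in // coefN oppr_eq0 pt_front // => h1 h2.
  have [h3 h4] := IH i N lL' h1 h2; split.
    rewrite par_cat /=.
    rewrite addnC; apply: leq_add; first exact: par_in iV _.
    exact: leq_trans (leq_addr _ _) h3.
  by move=> /h4[j jL hj]; exists j => //; rewrite mem_cat jL orbT.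
rewrite ?[head _ _]/= ?iV addn0 [flatten _]/=.
case/(T_coef_out cV (negbT iV)) => [h|[m [mV a d4 h]]|[m [mV f d3 h]]] lt.
- have [h3 h4] := IH i N lL' h (le_lt_trans (pt_mono _ lL) lt); split.
    rewrite par_cat; apply: leq_trans (leq_addl _ _); exact: leq_trans (leq_addr _ _) h3.
  by move=> /h4[j jL hj]; exists j => //; rewrite mem_cat jL orbT.
- case: N h lt d4 => [//|N] h lt d4; rewrite mulnS addKn in h.
  have g := pt_grow lL mV (_ : nc i m); rewrite /nc a in g.
  have lt' : E m (pt L) < Lam ^+ N.+1.
    by rewrite -(ltr_pM2l Lam0) -exprS; apply: le_lt_trans (g isT) lt.
  have [h3 _] := IH m N lL' h lt'.
  have om : odd m = odd i.
    by apply/eqP; move: a; apply/implyP; move: m i {mV h h3 lt' g lt iV}; exact: all_letters2.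
  split; last first.
    move=> _; exists m; first by rewrite mem_cat mV.
    by rewrite om eqxx /=; apply/eqP => e; rewrite e iV in mV.
  rewrite par_cat -add1n; apply: leq_add; first by apply: par_in mV _; rewrite om.
  by apply: leq_trans (leq_addr _ _) (leq_trans h3 _); rewrite /parity om.
- have := T_degree lL' h; have -> : up4 (4 * N - 3) = N by rewrite /up4; clear; lia.
  have g := pt_grow lL mV (_ : nc i m); rewrite /nc f orbT in g => h'.
  exfalso; move: lt; rewrite ltNge => /negP; apply.
  by apply: le_trans (g isT); rewrite exprS ler_pM2l.
Qed.

(** Each letter of the second layer is supported by a letter of the head, whose wall is farther away
    by a factor [Lam]. *)
Lemma tail_bound V L k : lay (V :: L) ->
  {in V, forall i, E i (pt (V :: L)) < Lam ^+ k.+1} ->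
  {in head [::] L, forall i, E i (pt L) < Lam ^+ k}.
Proof.
move=> lL h i iL; have /and3P[cV sV lL'] := lL; have Lam0 : 0 < Lam by rewrite (lt_trans _ (Lam_gt1 R)).
have /hasP[m mV n] := allP sV i iL; rewrite -(ltr_pM2l Lam0) -exprS.
apply: le_lt_trans (h m mV); rewrite (pt_front lL mV).
have hz : hyp (pt L) by exact: ev_hyp.
have st1 := lay_st lL' dy0; have g := growth hz st1 iL n; case: st1 => h1 h2 _.
by rewrite (ger0_norm (h1 i iL)) (ler0_norm (h2 m (layers_disjoint cV sV mV))).
Qed.

Lemma layer_count L k : lay L -> {in head [::] L, forall i, E i (pt L) < Lam ^+ k} ->
  (size L <= k)%N.
Proof.
elim: L k => // V L IH [|k] lL h.
  have /and3P[/andP[+ _] _ _] := lL; case: V lL h => // i V lL h _.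
  have lt := h i (mem_head _ _); rewrite expr0 in lt.
  by have := lt_le_trans lt (expasinh_ge1 (normr_ge0 (B i (pt ((i :: V) :: L))))); rewrite ltxx.
rewrite /= ltnS; apply: IH; [by case/and3P: lL|exact: tail_bound h].
Qed.

(** Degree 4(k - 1) can only come from the longest tail in [P_layer]. Then [i] is in the head, and
    its occurrence there adds one to the k - 1 occurrences given by [T_pure]. *)
Lemma P_degree L i l d k : lay L -> {in head [::] L, forall i, E i (pt L) < Lam ^+ k} ->
  (P (flatten L) i l)`_d != 0 ->
  (d + 4 <= 4 * k)%N /\ ((d + 4 = 4 * k)%N ->
    [/\ i \in head [::] L, (k <= parity i (flatten L))%N &
        (1 < k)%N -> exists2 j, j \in flatten L & (odd j == odd i) && (j != i)]).
Proof.
elim: L k => [|V L IH] k lL hk; first by rewrite /= mxE coef0 eqxx.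
have := layer_count lL hk; case: k hk => // k hk _.
have /and3P[cV sV lL'] := lL; rewrite [flatten _]/= P_layer // coefB.
have [e|nz _] := eqVneq (P (flatten L) i l)`_d 0; last first.
  by have [h _] := IH k lL' (tail_bound lL hk) nz; split; lia.
rewrite e sub0r oppr_eq0; case iV : (i \in V); last by rewrite mul0r coef0 eqxx.
rewrite mul1r => h; have lt := hk i iV; rewrite pt_front // in lt.
have := le_lt_trans (T_degree lL' h) lt; rewrite ltr_eXn2l ?Lam_gt1 // => ud.
have dk : (d <= 4 * k)%N by move: ud; rewrite /up4; clear; lia.
split; first by lia.
move=> e4; have ed : d = (4 * k)%N by lia.
rewrite ed in h; have [h3 h4] := T_pure lL' h lt.
split=> //.
  rewrite /parity count_cat -add1n; apply: leq_add; last exact: leq_trans (leq_addr _ _) h3.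
  by rewrite -has_count; apply/hasP; exists i.
by move=> k1; have [j jL hj] := h4 k1; exists j => //; rewrite mem_cat jL orbT.
Qed.
End Tile.
End Degrees.

(** * Integrality of the walls *)

Section Integral.
Variable R : realType.
Implicit Types (x y z : 'cV[R]_3) (i j : letter) (w : word).
Notation normal := (@normal R).
Notation lvec := (@lvec R).
Notation ev := (@ev R).

Definition wall (o : bool) x := exists w i, odd i = o /\ x = ev w *m normal i.

(* The congruences that the coordinates of the roots of one parity satisfy. *)
Definition admissible (o : bool) (a b c : int) :=
  [/\ (b %% 2)%Z = (c %% 2)%Z, (c %% 3)%Z = ((if o then - a else a) %% 3)%Z & (a %% 3)%Z <> 0].

Lemma refl_lvec j (a b c : int) :
  let k := - (2 * a) + 3 * (na j * b) + nb j * c in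
  refl R j *m lvec a%:~R b%:~R c%:~R = lvec (a - k)%:~R (b - k * na j)%:~R (c - k * nb j)%:~R.
Proof.
move=> k; rewrite reflE -/lvec /normal.
rewrite lorentz_lvec (_ : _ + _ = k%:~R); last by rewrite /k; rewrite !rmorphD rmorphN !rmorphM /=; ring.
by apply: cV3P; rewrite !mxE /= !(rmorphB, rmorphM) /=; ring.
Qed.

Lemma wall_lvec o x : wall o x -> exists a b c : int,
  x = lvec a%:~R b%:~R c%:~R /\ admissible o a b c.
Proof.
move=> [w [i [oi ->]]]; elim: w => [|j w [a [b [c [e [h2 h3 ha]]]]]].
  rewrite mul1mx; exists 1, (na i), (nb i); split=> //.
  by case: i oi => [[|[|[|[|[|[|//]]]]]] hi] /= <-; split; vm_compute.
rewrite /= -mulmxA e refl_lvec; do 3 eexists; split; first reflexivity.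
move: h2 h3 ha; case: o {oi} => h2 h3 ha;
case: j => [[|[|[|[|[|[|//]]]]]] hi]; rewrite /na /nb /=; split; lia.
Qed.

(** Descent at 3: modulo 3 the equation reads 2a^2 = c^2 and 2 is not a square, so 3 divides [a] and
    [c], and then [b]. The bound [n] turns the descent into an induction. *)
Lemma isotropic0_bounded (n : nat) (a b c : int) : (`|a| + `|b| + `|c| < n)%N ->
  2 * (a * a) = 3 * (b * b) + c * c -> [/\ a = 0, b = 0 & c = 0].
Proof.
elim: n a b c => // n IH a b c hn e.
have sq (t : int) : (t %% 3)%Z = 0 \/ exists s, t * t = 3 * s + 1.
  have [r hr] : exists r, [\/ t = 3 * r, t = 3 * r + 1 | t = 3 * r - 1].
    exists ((t + 1) %/ 3)%Z; have : [\/ (t %% 3)%Z = 0, (t %% 3)%Z = 1 | (t %% 3)%Z = 2].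
      have : (0 <= (t %% 3)%Z < 3)%R by lia.
      case/andP; case: (t %% 3)%Z => [[|[|[|?]]]|?] //; by [constructor 1|constructor 2|constructor 3].
    by case=> h; [constructor 1|constructor 2|constructor 3]; lia.
  case: hr => ->; [by left; lia|right; exists (3 * (r * r) + 2 * r); ring|right].
  by exists (3 * (r * r) - 2 * r); ring.
have [a3|[s hs]] := sq a; last first.
  exfalso; have [c3|[s' hs']] := sq c; last by move: e hs hs'; lia.
  have [c' hc] : exists c', c = 3 * c' by exists (c %/ 3)%Z; lia.
  have hcc : c * c = 3 * (3 * (c' * c')) by rewrite hc; ring.
  by move: e hs hcc; lia.
have [a' ha] : exists a', a = 3 * a' by exists (a %/ 3)%Z; lia.
have haa : a * a = 9 * (a' * a') by rewrite ha; ring.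
have [c3|[s' hs']] := sq c; last by exfalso; move: e haa hs'; lia.
have [c' hc] : exists c', c = 3 * c' by exists (c %/ 3)%Z; lia.
have hcc : c * c = 9 * (c' * c') by rewrite hc; ring.
have [b3|[s' hs']] := sq b; last by exfalso; move: e haa hcc hs'; lia.
have [b' hb] : exists b', b = 3 * b' by exists (b %/ 3)%Z; lia.
have hbb : b * b = 9 * (b' * b') by rewrite hb; ring.
have e' : 2 * (a' * a') = 3 * (b' * b') + c' * c' by move: e haa hbb hcc; lia.
have [z|nz] := eqVneq (`|a'| + `|b'| + `|c'|)%N 0%N.
  by split; lia.
have [|z1 z2 z3] := IH a' b' c' _ e'; first by lia.
by rewrite ha hb hc z1 z2 z3.
Qed.

Lemma isotropic0 (a b c : int) :
  2 * (a * a) = 3 * (b * b) + c * c -> [/\ a = 0, b = 0 & c = 0].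
Proof. exact: isotropic0_bounded (leqnn _). Qed.

Lemma wall_unit o x : wall o x -> lorentz x x = 1.
Proof. by move=> [w [i [_ ->]]]; rewrite ev_lorentz lorentz_normal gram_eq. Qed.

Lemma wallN o x : wall o x -> wall o (- x).
Proof.
move=> [w [i [oi ->]]]; exists (w ++ [:: i]), i; split=> //.
rewrite ev_cat -mulmxA ev1 reflE lorentz_normal gram_eq mulr1 -mulmxN; congr (_ *m _).
by apply/colP => r; rewrite !mxE; ring.
Qed.

Lemma wall_ev o u x : wall o x -> wall o (ev u *m x).
Proof. by move=> [w [i [oi ->]]]; exists (u ++ w), i; rewrite ev_cat mulmxA. Qed.

(** The congruence modulo 2 makes the product an integer [g], and those modulo 3 give g = aa' modulo
    3, which is nonzero. If g were 1 or -1, then x - y or x + y would be isotropic with such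
    coordinates, hence zero. *)
Lemma wall_sep o x y : wall o x -> wall o y -> x <> y -> x <> - y -> 2 <= `|lorentz x y|.
Proof.
move=> wx wy xy xNy; have nx := wall_unit wx; have ny := wall_unit wy.
have [a [b [c [ex [h2 h3 ha]]]]] := wall_lvec wx.
have [a' [b' [c' [ey [h2' h3' ha']]]]] := wall_lvec wy.
have [p hp] : exists p, b = c + 2 * p by exists ((b - c) %/ 2)%Z; lia.
have [p' hp'] : exists p, b' = c' + 2 * p by exists ((b' - c') %/ 2)%Z; lia.
pose e : int := if o then -1 else 1.
have ee : e * e = 1 by rewrite /e; case: (o).
have [q hq] : exists q, c = e * a + 3 * q.
  by exists ((c - e * a) %/ 3)%Z; rewrite /e; move: h3; case: (o) => ?; lia.
have [q' hq'] : exists q, c' = e * a' + 3 * q.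
  by exists ((c' - e * a') %/ 3)%Z; rewrite /e; move: h3'; case: (o) => ?; lia.
pose g : int := - (a * a') + 2 * (c * c') + 3 * (c * p') + 3 * (p * c') + 6 * (p * p').
have gE : lorentz x y = g%:~R.
  apply: (@mulfI _ 2); first by rewrite pnatr_eq0.
  rewrite ex ey lorentz_lvec hp hp' /g !(rmorphD, rmorphN, rmorphM) /=; ring.
have g3 : (g %% 3)%Z <> 0.
  have -> : g = (a * a') * (2 * (e * e) - 1) + 3 * (2 * (e * a * q' + q * e * a' + 3 * (q * q')) + c * p' + p * c' + 2 * (p * p')).
    by rewrite /g hq hq'; ring.
  rewrite ee.
  have [r hr] : exists r, a = 3 * r + 1 \/ a = 3 * r - 1 by exists ((a + 1) %/ 3)%Z; lia.
  have [r' hr'] : exists r, a' = 3 * r + 1 \/ a' = 3 * r - 1 by exists ((a' + 1) %/ 3)%Z; lia.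
  have : exists s, a * a' = 3 * s + 1 \/ a * a' = 3 * s - 1.
    by case: hr => ->; case: hr' => ->;
      [exists (3 * (r * r') + r + r'); left|exists (3 * (r * r') - r + r'); right|
       exists (3 * (r * r') + r - r'); right|exists (3 * (r * r') - r - r'); left]; ring.
  by case=> s; set m := 2 * (_ + _) + _; lia.
have iso0 (u v t : int) : lorentz (lvec u%:~R v%:~R t%:~R) (lvec u%:~R v%:~R t%:~R) = 0 ->
    lvec u%:~R v%:~R t%:~R = 0.
  move=> h; have h' : 2 * (u * u) = 3 * (v * v) + t * t.
    apply: (@mulrIz R 1 _); first by rewrite oner_eq0.
    have := lorentz_lvec (u%:~R : R) v%:~R t%:~R u%:~R v%:~R t%:~R.
    rewrite h.
    rewrite !(rmorphD, rmorphM) /=; lra.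
  have [-> -> ->] := isotropic0 h'.
  by apply: cV3P; rewrite !mxE /= ?mul0r.
rewrite gE -intr_norm; have : (`|g|%N != 1%N) && (`|g|%N != 0%N); last first.
  by move=> h; rewrite (ler_int R 2 `|g|); lia.
apply/andP; split; last by apply/eqP => h; apply: g3; have -> : g = 0 by lia.
apply/eqP => h; have [g1|g1] : g = 1 \/ g = -1 by lia.
  apply: xy; apply/eqP; rewrite -subr_eq0; apply/eqP.
  have exy : x - y = lvec (a - a')%:~R (b - b')%:~R (c - c')%:~R.
    by rewrite ex ey; apply: cV3P; rewrite !mxE /= !rmorphB /=; ring.
  by rewrite exy; apply: iso0; rewrite -exy !lorentz_lin (lorentzC y x) nx ny gE g1; ring.
apply: xNy; apply/eqP; rewrite -subr_eq0 opprK; apply/eqP.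
have exy : x + y = lvec (a + a')%:~R (b + b')%:~R (c + c')%:~R.
  by rewrite ex ey; apply: cV3P; rewrite !mxE /= !rmorphD /=; ring.
by rewrite exy; apply: iso0; rewrite -exy !lorentz_lin (lorentzC y x) nx ny gE g1; ring.
Qed.
End Integral.

(** * Geodesics and walls *)

Section Lines.
Variable R : realType.
Implicit Types (x y z A B n : 'cV[R]_3) (i j : letter) (w : word) (t l : R).
Notation Lam := (@Lam R).

Definition geod A B t : 'cV[R]_3 := expR t *: A + expR (- t) *: B.

(** Lightlike directions of the two ends of a line; the value -1/2 puts [geod A B] on the
    hyperboloid with unit speed. *)
Definition null_pair A B := [/\ lorentz A A = 0, lorentz B B = 0 & lorentz A B = - 2^-1].

Lemma null_pairC A B : null_pair A B -> null_pair B A.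
Proof. by case=> h1 h2 h3; split; rewrite // lorentzC. Qed.

Lemma geodN A B t : geod B A t = geod A B (- t).
Proof. by rewrite /geod opprK addrC. Qed.

Lemma lorentz_geod A B n t : lorentz n (geod A B t) = expR t * lorentz n A + expR (- t) * lorentz n B.
Proof. by rewrite /geod !lorentz_lin. Qed.

Lemma geod_geod A B s t : null_pair A B ->
  - lorentz (geod A B s) (geod A B t) = (expR (t - s) + expR (s - t)) / 2.
Proof.
move=> [aa bb ab]; rewrite lorentz_geod (lorentzC _ A) (lorentzC _ B) !lorentz_geod aa bb ab (lorentzC B A) ab.
by rewrite !expRD; ring.
Qed.

(* Twice the distance coordinate transverse to the plane spanned by A and B. *)
Definition offset A B n : R :=
  2 * (A 0 0 * (B 1 0 * n (1 + 1) 0 - B (1 + 1) 0 * n 1 0)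
     - A 1 0 * (B 0 0 * n (1 + 1) 0 - B (1 + 1) 0 * n 0 0)
     + A (1 + 1) 0 * (B 0 0 * n 1 0 - B 1 0 * n 0 0)).

Lemma offsetC A B n : offset B A n = - offset A B n.
Proof. by rewrite /offset; ring. Qed.

(** The product of two determinants with rows A, B, n and A, B, n' is, up to sign, the determinant
    of the corresponding Lorentz products. The factor 2 in [offset] is the normalisation for a null
    pair. *)
Lemma gram_plane A B n n' : null_pair A B ->
  lorentz n n' = offset A B n * offset A B n'
    - 2 * (lorentz n A * lorentz n' B + lorentz n' A * lorentz n B).
Proof.
move=> [aa bb ab].
have key : offset A B n * offset A B n' = - 4 * (
    lorentz A A * (lorentz B B * lorentz n n' - lorentz B n' * lorentz n B)
  - lorentz A B * (lorentz A B * lorentz n n' - lorentz B n' * lorentz n A)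
  + lorentz A n' * (lorentz A B * lorentz n B - lorentz B B * lorentz n A)).
  by rewrite /offset !lorentzE; ring.
rewrite key aa bb ab (lorentzC A n') (lorentzC B n'); by field.
Qed.

(** The pairs (X, c) and (X', c') lie on the unit circle, so XX' + |cc'| <= 1. The value 2 then
    needs a hyperbolic cosine of at least 2 = cosh L, and with equality it needs X = X' = 1. *)
Lemma sep_aux (X X' c c' q : R) : 0 <= X -> 0 <= X' -> X ^+ 2 + c ^+ 2 = 1 -> X' ^+ 2 + c' ^+ 2 = 1 ->
  1 <= q -> 2 <= `|c * c' + X * X' * ((q + q^-1) / 2)| -> Lam <= q /\ (c <> 0 -> Lam < q).
Proof.
move=> X0 X0' e e' q1 h.
have q0 : 0 < q by lra.
have qq : q * q^-1 = 1 by rewrite mulfV // gt_eqF.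
have qi : 0 < q^-1 by rewrite invr_gt0.
set K := (q + q^-1) / 2 in h.
have K1 : 1 <= K.
  have : 0 <= (q - 1) * (1 - q^-1).
    by rewrite mulr_ge0 ?subr_ge0 // invf_le1.
  by rewrite mulrBl !mulrBr qq /K; lra.
have XX0 : 0 <= X * X' by exact: mulr_ge0.
have am : X * X' + `|c * c'| <= 1.
  have h1 := sqr_ge0 (X - X'); have h2 := sqr_ge0 (`|c| - `|c'|).
  rewrite normrM; move: h1 h2; rewrite !sqrrB !real_normK ?num_real //; lra.
have {}h : 2 <= `|c * c'| + X * X' * K.
  apply: le_trans h _; apply: le_trans (ler_normD _ _) _.
  by rewrite lerD2l ger0_norm // mulr_ge0 //; lra.
have Lq : (q < Lam -> K < 2) /\ (q <= Lam -> K <= 2).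
  have s3b := s3_bounds R; have ss := s3s3 R.
  have LL : (2 + s3 R) * (2 - s3 R) = 1 by rewrite mulrBr !mulrDl ss; ring.
  have ltq : 0 < q - (2 - s3 R) by lra.
  have : q * (K - 2) * 2 = - ((2 + s3 R) - q) * (q - (2 - s3 R)).
    transitivity (q ^+ 2 + q * q^-1 - 4 * q); first by rewrite /K; field; lra.
    by rewrite qq; transitivity (q ^+ 2 + (2 + s3 R) * (2 - s3 R) - 4 * q); [rewrite LL|ring].
  rewrite /Lam => E; split => hq; [rewrite ltNge|rewrite leNgt]; apply/negP => hK.
    have : 0 <= q * (K - 2) * 2 by rewrite !mulr_ge0 //; lra.
    by rewrite E mulNr oppr_ge0 leNgt mulr_gt0 //; lra.
  have : 0 < q * (K - 2) * 2 by rewrite !mulr_gt0 //; lra.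
  by rewrite E mulNr oppr_gt0 ltNge mulr_ge0 //; lra.
have nc : 0 <= `|c * c'| by [].
have p1 : 0 <= (X * X') * (K - 1) by rewrite mulr_ge0 //; lra.
have p2 : 0 <= `|c * c'| * (K - 1) by rewrite mulr_ge0 //; lra.
case: Lq => L1 L2.
split; first rewrite leNgt; last (move=> c0; rewrite ltNge); apply/negP => hq.
  have {L1 L2}K2 := L1 hq.
  have p3 : 0 <= (1 - (X * X' + `|c * c'|)) * K by rewrite mulr_ge0 //; lra.
  by move: p2 p3 h; rewrite !mulrBl !mulrBr mulrDl; lra.
have {L1 L2}K2 := L2 hq.
have p4 : 0 <= (X * X') * (2 - K) by rewrite mulr_ge0 //; lra.
have h4 : 2 <= `|c * c'| + X * X' * 2 by move: p4; rewrite mulrBr; lra.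
have cc0 : `|c * c'| = 0 by lra.
have XX1 : X * X' = 1 by lra.
have c2 : 0 < c ^+ 2 by rewrite exprn_even_gt0 //=; apply/eqP.
have c2' := sqr_ge0 c'.
have X1 : X < 1 by rewrite -(ltr_pXn2r (ltn0Sn 1)) ?nnegrE // expr1n; lra.
have X1' : X' <= 1 by rewrite -(ler_pXn2r (ltn0Sn 1)) ?nnegrE // expr1n; lra.
have : 0 <= X * (1 - X') by rewrite mulr_ge0 //; lra.
by rewrite mulrBr XX1; lra.
Qed.

Section Crossings.
Variables A B : 'cV[R]_3.
Hypothesis AB : null_pair A B.

Definition crossing n := 0 < lorentz n A /\ lorentz n B < 0.
Definition ctime n : R := ln (- lorentz n B / lorentz n A) / 2.

Lemma ctimeE n : crossing n -> - lorentz n B = lorentz n A * expR (ctime n) ^+ 2.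
Proof.
move=> [a0 b0]; have -> : expR (ctime n) ^+ 2 = - lorentz n B / lorentz n A.
  rewrite -expRM_natl /ctime (_ : 2 * (_ / 2) = ln (- lorentz n B / lorentz n A)); last by field.
  by rewrite lnK // posrE divr_gt0 ?oppr_gt0.
by field; rewrite gt_eqF.
Qed.

(** The offset vanishes exactly if the normal lies in the plane of the line, that is, if the
    crossing is orthogonal. Only then can the gap between the two crossing times be as small as
    L. *)
Lemma ctime_sep n n' : crossing n -> crossing n' -> lorentz n n = 1 -> lorentz n' n' = 1 ->
  2 <= `|lorentz n n'| ->
  ln Lam <= `|ctime n - ctime n'| /\ (offset A B n <> 0 -> ln Lam < `|ctime n - ctime n'|).
Proof.
move=> cn cn' nn nn' h; have e := ctimeE cn; have e' := ctimeE cn'.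
have [a0 _] := cn; have [a0' _] := cn'.
have u := gram_plane n n AB; have u' := gram_plane n' n' AB.
have g := gram_plane n n' AB.
have Lp : Lam \is Num.pos by rewrite posrE (lt_trans _ (Lam_gt1 R)).
have r0 := expR_gt0 (ctime n); have r0' := expR_gt0 (ctime n').
set q := expR `|ctime n - ctime n'|.
suff [h1 h2] : Lam <= q /\ (offset A B n <> 0 -> Lam < q).
  rewrite -[`|_|]expRK -/q; split; first by rewrite ler_ln // posrE expR_gt0.
  by move=> /h2; rewrite ltr_ln // posrE expR_gt0.
set r := expR (ctime n) in e r0; set r' := expR (ctime n') in e' r0'.
apply: (@sep_aux (2 * lorentz n A * r) (2 * lorentz n' A * r') (offset A B n) (offset A B n') q).
- by rewrite !mulr_ge0 // ltW.
- by rewrite !mulr_ge0 // ltW.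
- rewrite -[RHS]nn u; move: e; move: (lorentz n B) => b e.
  have -> : b = - (lorentz n A * r ^+ 2) by rewrite -e opprK.
  by ring.
- rewrite -[RHS]nn' u'; move: e'; move: (lorentz n' B) => b e'.
  have -> : b = - (lorentz n' A * r' ^+ 2) by rewrite -e' opprK.
  by ring.
- by rewrite /q -expR0 ler_expR.
- apply: le_trans h _; rewrite g le_eqVlt; apply/orP; left; apply/eqP; congr (`|_|).
  have -> : lorentz n B = - (lorentz n A * r ^+ 2) by rewrite -e opprK.
  have -> : lorentz n' B = - (lorentz n' A * r' ^+ 2) by rewrite -e' opprK.
  have -> : q + q^-1 = r / r' + r' / r.
    rewrite /q /r /r' -!expRN -!expRD.
    have [h0|h0] := leP 0 (ctime n - ctime n'); last rewrite addrC.
      by rewrite ger0_norm // opprB.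
    by rewrite ltr0_norm // opprB opprB.
  by field; rewrite !gt_eqF.
Qed.
End Crossings.
End Lines.

(** * The walls crossed by a layered word *)

Section Occurrences.
Variable R : realType.
Implicit Types (x y z : 'cV[R]_3) (i j : letter) (w V : word) (L : seq word) (o : bool).
Notation normal := (@normal R).
Notation B i z := (lorentz (normal i) z).
Notation ev := (@ev R).

(** Letters of one layer commute, so the prefix of an occurrence may stop at the end of the
    preceding layer. *)
Fixpoint occs o L : seq (word * letter) :=
  if L is V :: L' then [seq ([::], i) | i <- V & odd i == o] ++ [seq (V ++ p.1, p.2) | p <- occs o L']
  else [::].

Definition occ_wall (p : word * letter) : 'cV[R]_3 := ev p.1 *m normal p.2.

Lemma occs_parity o L p : p \in occs o L -> odd p.2 = o.
Proof.
elim: L p => //= V L IH p; rewrite mem_cat => /orP[/mapP[i iF ->]|/mapP[q qL ->]].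
  by move: iF; rewrite mem_filter => /andP[/eqP].
exact: (IH q qL).
Qed.

Lemma size_occs o L : size (occs o L) = count (fun j : letter => odd j == o) (flatten L).
Proof.
elim: L => //= V L IH.
by rewrite size_cat !size_map IH size_filter count_cat.
Qed.

Lemma occs_split o L p : p \in occs o L ->
  exists L1 V L2, [/\ L = L1 ++ V :: L2, p.1 = flatten L1 & p.2 \in V].
Proof.
elim: L p => //= V L IH p; rewrite mem_cat => /orP[/mapP[i iF ->]|/mapP[q qL ->]].
  by move: iF; rewrite mem_filter => /andP[_ iV]; exists [::], V, L.
have [L1 [U [L2 [-> e1 e2]]]] := IH q qL.
by exists (V :: L1), U, L2; split=> //=; rewrite e1.
Qed.

Lemma occ_wall_wall o L p : p \in occs o L -> wall o (occ_wall p).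
Proof. by move=> h; exists p.1, p.2; split=> //; exact: occs_parity h. Qed.

Lemma occ_wall_gt0 o L p y : lay L -> sdom y -> p \in occs o L ->
  0 < lorentz (occ_wall p) (ev (flatten L) *m y).
Proof.
move=> lL sy /occs_split[L1 [V [L2 [eL e1 e2]]]]; rewrite /occ_wall e1.
have lV : lay (V :: L2) by move: lL; rewrite eL => /lay_cat[].
rewrite eL flatten_cat ev_cat -mulmxA ev_lorentz.
by case: (lay_strict lV sy) => h _; apply: h.
Qed.

(** If [x] were beyond the wall, the letter would be in the head of the normal form of the reversed
    prefix. Appending it to the prefix would then shorten the word, although prefix and letter
    together are layered, hence shortest. *)
Lemma occ_wall_lt0 o L p x : lay L -> sdom x -> p \in occs o L -> lorentz (occ_wall p) x < 0.
Proof.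
move=> lL sx /occs_split[L1 [V [L2 [eL e1 e2]]]]; rewrite /occ_wall e1 ev_adj.
move: lL; rewrite eL => lL; have [l1 lV] := lay_cat lL.
have [L' [lL' wL' sL' _]] := lay_nf (rev (flatten L1)).
rewrite -(ev_weq _ wL'); case: (lay_strict lL' sx) => _; apply; apply/negP => iL'.
have lr : lay (rcons L1 [:: p.2]).
  apply: lay_rcons => //; case/lastP: (L1) lL => [|L3 U]; first by left.
  right; rewrite last_rcons; move: lL; rewrite -cats1 -catA => /lay_cat[_] /and3P[_ /= sU _].
  by rewrite /supported /= andbT; exact: (allP sU).
case: L' lL' wL' sL' iL' => // W L' lL' wL' sL' /= iW.
have cW : clique W by case/and3P: lL'.
have wW : weq (flatten (W :: L')) (p.2 :: rem p.2 W ++ flatten L').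
  by rewrite /= -cat_cons; apply: weq_catr; apply: weq_perm (perm_to_rem iW); case/andP: cW.
set q := rem p.2 W ++ flatten L' in wW.
have e : ev (flatten (rcons L1 [:: p.2])) = ev (rev q).
  rewrite flatten_rcons; apply: ev_weq.
  have h1 : weq (flatten L1) (rev (p.2 :: q)).
    by rewrite -[flatten L1]revK; apply: weq_rev; apply: weq_trans (weq_sym wL') wW.
  apply: weq_trans (weq_catr _ h1) _; rewrite rev_cons -cats1 -catA -[X in weq _ X]cats0.
  apply: weq_catl; exact: (weq_revK [:: p.2]).
have := lay_min lr e; rewrite flatten_rcons size_cat /= size_rev addn1 => h.
have : (size q < size (flatten L1))%N.
  move: sL'; rewrite size_rev; apply: leq_trans; rewrite /q /= !size_cat size_rem // ltn_add2r.
  by case: (W) iW.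
by move=> h'; have := ltn_trans h h'; rewrite ltnn.
Qed.

Lemma clique_parity o V i j : clique V -> i \in V -> j \in V -> odd i = o -> odd j = o -> i = j.
Proof.
move=> cV iV jV oi oj; apply/eqP; apply: contraTT isT => ij.
have := clique_comm cV iV jV ij; have : odd i == odd j by rewrite oi oj.
move=> h c; move: (conj h c) => {}/andP; apply/implyP.
by move: i j {iV jV oi oj ij h c}; exact: all_letters2.
Qed.

Lemma occs_uniq o L : lay L -> uniq (map occ_wall (occs o L)).
Proof.
elim: L => //= V L IH lL; have /and3P[cV _ lL'] := lL.
rewrite map_cat cat_uniq -!map_comp; apply/and3P; split.
- have := filter_uniq (fun j : letter => odd j == o) (clique_uniq cV).
  case E: [seq j : letter <- V | odd j == o] => [|i [|j s]] //.
  have hi : i \in [seq j : letter <- V | odd j == o] by rewrite E mem_head.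
  have hj : j \in [seq j : letter <- V | odd j == o] by rewrite E !inE eqxx orbT.
  move: hi hj; rewrite !mem_filter => /andP[/eqP oi iV] /andP[/eqP oj jV].
  by rewrite (clique_parity cV iV jV oi oj) /= inE eqxx.
- apply/hasPn => _ /mapP[p pL ->]; apply/negP => /mapP[i]; rewrite mem_filter => /andP[_ iV].
  rewrite /occ_wall /= mul1mx ev_cat -mulmxA => e.
  have [L1 [U [L2 [eL e1 e2]]]] := occs_split pL.
  have lV : lay (V :: L1) by move: lL; rewrite eL -/(lay (V :: L1 ++ U :: L2)) -cat_cons => /lay_cat[].
  have := lay_sign i lV (@sdom_origin R); rewrite /= iV -e e1 ev_cat -mulmxA !ev_lorentz.
  by rewrite B_origin oppr_gt0 ltr10 ?iV.
- rewrite (_ : map _ _ = map (mulmx (ev V)) (map occ_wall (occs o L))); last first.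
    by rewrite -map_comp; apply: eq_map => p /=; rewrite /occ_wall /= ev_cat mulmxA.
  rewrite map_inj_uniq ?IH // => a b e.
  by rewrite -[a](ev_Arev V) e ev_Arev.
Qed.
End Occurrences.

(** The values are sorted into [M] cells of length [N] by rounding down, and no cell receives two of
    them. *)
Lemma spaced_le (R : realType) (I : eqType) (W : seq I) (f : I -> R) (N a b : R) (M : nat) :
  uniq W -> 0 < N -> {in W, forall w, a < f w < b} -> b - a <= M%:R * N ->
  {in W &, forall v w, v <> w -> N <= `|f v - f w|} -> (size W <= M)%N.
Proof.
move=> uW N0 hf ba sep; pose g w := `|Num.floor ((f w - a) / N)|%N.
have g0 w : w \in W -> 0 <= (f w - a) / N by move=> /hf /andP[h _]; rewrite divr_ge0 ?ltW // subr_gt0.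
have gE w : w \in W -> (g w)%:R <= (f w - a) / N < (g w).+1%:R.
  move=> wW; have fl0 : 0 <= Num.floor ((f w - a) / N) by rewrite floor_ge0 g0.
  have e : (g w)%:R = (Num.floor ((f w - a) / N))%:~R :> R.
    by rewrite /g -[in RHS](gez0_abs fl0) pmulrn.
  by have := floorD1_gt ((f w - a) / N); rewrite -natr1 e floor_le rmorphD.
rewrite -(size_map g) -(size_iota 0 M); apply: uniq_leq_size.
  rewrite map_inj_in_uniq // => v w vW wW e; apply/eqP; apply: contraT => /eqP /(sep v w vW wW).
  have /andP[h1 h2] := gE v vW; have /andP[h3 h4] := gE w wW.
  rewrite leNgt => /negP; case; rewrite -(ltr_pM2r (_ : 0 < N^-1)) ?invr_gt0 // divff ?gt_eqF //.
  rewrite -[X in _ * X]gtr0_norm ?invr_gt0 // -normrM.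
  have -> : (f v - f w) * N^-1 = (f v - a) / N - (f w - a) / N by rewrite -mulrBl; congr (_ * _); ring.
  move: h1 h2 h3 h4; rewrite e -natr1 ltr_norml; lra.
move=> _ /mapP[w wW ->]; rewrite mem_iota /= add0n -(ltr_nat R).
have /andP[h1 _] := gE w wW; apply: le_lt_trans h1 _; rewrite ltr_pdivrMr //.
by have /andP[_ h] := hf w wW; apply: lt_le_trans ba; rewrite ltrD2r.
Qed.

(** * Lines translated by group elements *)

Section Axis.
Variable R : realType.
Implicit Types (x y n A B : 'cV[R]_3) (i j : letter) (w z : word) (t l : R).
Notation normal := (@normal R).
Notation ev := (@ev R).

Lemma crossing_between A B n s t : s < t -> lorentz n (geod A B s) < 0 -> 0 < lorentz n (geod A B t) ->
  crossing A B n /\ s < ctime A B n < t.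
Proof.
have pos r : lorentz n (geod A B r) * expR r = lorentz n A * expR r ^+ 2 + lorentz n B.
  rewrite lorentz_geod expRN; field; exact: lt0r_neq0 (expR_gt0 _).
have mono (r r' : R) : (expR r ^+ 2 < expR r' ^+ 2) = (r < r').
  by rewrite ltr_pXn2r ?nnegrE ?expR_ge0 // ltr_expR.
move=> st h1 h2.
have {}h1 : lorentz n A * expR s ^+ 2 + lorentz n B < 0 by rewrite -pos pmulr_llt0 ?expR_gt0.
have {}h2 : 0 < lorentz n A * expR t ^+ 2 + lorentz n B by rewrite -pos mulr_gt0 ?expR_gt0.
have a0 : 0 < lorentz n A.
  have : 0 < lorentz n A * (expR t ^+ 2 - expR s ^+ 2) by rewrite mulrBr; lra.
  by rewrite pmulr_lgt0 // subr_gt0 mono.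
have c : crossing A B n.
  split=> //; have : 0 <= lorentz n A * expR s ^+ 2 by rewrite mulr_ge0 ?sqr_ge0 // ltW.
  lra.
split=> //; have e := ctimeE c; rewrite -(mono s) -(mono _ t) -(ltr_pM2l a0) -[X in _ && X](ltr_pM2l a0) -e.
by apply/andP; split; lra.
Qed.

Section Translation.
Variables (A B : 'cV[R]_3) (l : R) (z : word).
Hypothesis eqv : forall t, geod A B (t + l) = ev z *m geod A B t.

(** The translation relation at the times 0 and 1 suffices to separate the growing part from the
    decaying one. *)
Lemma axis_ends : ev z *m A = expR l *: A /\ ev z *m B = expR (- l) *: B.
Proof.
have h0 := eqv 0; have h1 := eqv 1; move: h0 h1.
rewrite /geod add0r !mulmxDr -!scalemxAr oppr0 expR0 !scale1r opprD !expRD (expRN 1).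
set e := expR 1; set a := expR l; set b := expR (- l).
have e1 : 1 < e by rewrite expR_gt1.
have ei : e^-1 < 1 by rewrite invf_lt1 // (lt_trans _ e1).
move=> h0 h1.
have hA : ev z *m A = a *: A.
  apply: (@scalerI _ _ (e - e^-1)); first by rewrite lt0r_neq0 //; lra.
  rewrite scalerA; transitivity ((e * a) *: A + (e^-1 * b) *: B - e^-1 *: (a *: A + b *: B)).
    rewrite h1 h0; apply/colP => r; rewrite !mxE; ring.
  by apply/colP => r; rewrite !mxE; ring.
split=> //; move: h0; rewrite hA => /addrI; by [].
Qed.

Lemma crossing_translate n : crossing A B n ->
  crossing A B (ev z *m n) /\ ctime A B (ev z *m n) = ctime A B n + l.
Proof.
have [hA hB] := axis_ends.
have eA : lorentz (ev z *m n) A = expR (- l) * lorentz n A.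
  have := ev_lorentz z n A; rewrite hA lorentzZr => <-.
  by rewrite mulrA -expRD addNr expR0 mul1r.
have eB : lorentz (ev z *m n) B = expR l * lorentz n B.
  have := ev_lorentz z n B; rewrite hB lorentzZr => <-.
  by rewrite mulrA -expRD subrr expR0 mul1r.
move=> [a0 b0]; split.
  by split; rewrite ?eA ?eB ?mulr_gt0 ?pmulr_rlt0 ?expR_gt0.
rewrite /ctime eA eB expRN invfM invrK.
have -> : - (expR l * lorentz n B) * (expR l * (lorentz n A)^-1) = expR l ^+ 2 * (- lorentz n B / lorentz n A).
  by ring.
rewrite lnM ?posrE ?exprn_gt0 ?expR_gt0 ?divr_gt0 ?oppr_gt0 // -expRM_natl expRK.
by field.
Qed.

Lemma axis_power p t : geod A B (t + p%:R * l) = ev (flatten (nseq p z)) *m geod A B t.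
Proof.
elim: p => [|p IH]; first by rewrite mul0r addr0 mul1mx.
by rewrite -natr1 mulrDl mul1r addrA eqv IH /= ev_cat mulmxA.
Qed.
End Translation.

Lemma axis_rev A B l z : (forall t, geod A B (t + l) = ev z *m geod A B t) ->
  forall t, geod B A (t + l) = ev (rev z) *m geod B A t.
Proof.
move=> h t; rewrite (geodN A B (t + l)) (geodN A B t) opprD; have := h (- t - l).
by rewrite subrK => ->; rewrite ev_Arev.
Qed.

(** At large times the growing exponential dominates, so a positive [a] would eventually make the
    value positive. *)
Lemma negative_progression (a b l : R) : 0 < l ->
  (forall p : nat, expR (p%:R * l) * a + expR (- (p%:R * l)) * b < 0) -> a <= 0.
Proof.
move=> l0 h; rewrite leNgt; apply/negP => a0.
have [p hp] : exists p : nat, - b < p%:R * (l * a).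
  exists (Num.bound (`|b| / (l * a))).
  have la : 0 < l * a by exact: mulr_gt0.
  have := archi_boundP (divr_ge0 (normr_ge0 b) (ltW la)); rewrite ltr_pdivrMr //.
  by apply: le_lt_trans; rewrite -normrN ler_norm.
have := h p; rewrite -(pmulr_llt0 _ (expR_gt0 (p%:R * l))) mulrDl.
have -> : expR (- (p%:R * l)) * b * expR (p%:R * l) = b by rewrite mulrAC -expRD addNr expR0 mul1r.
have p0 : 0 <= p%:R * l by rewrite mulr_ge0 // ltW.
have e1 : 1 + p%:R * l <= expR (p%:R * l) by exact: expR_ge1Dx.
set e := expR _ in e1 *.
have : p%:R * l <= e * e.
  have : 1 * (p%:R * l) <= e * e by apply: ler_pM => //; lra.
  by rewrite mul1r.
rewrite -(ler_pM2r a0) => h1 h2.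
have : e * a * e = e * e * a by ring.
by move: hp h1 h2; rewrite mulrA; lra.
Qed.
End Axis.

(** * Closed geodesics cut into two halves *)

Section Loop.
Variable R : realType.
Implicit Types (x y n A B : 'cV[R]_3) (i j : letter) (w z : word) (t l : R) (Lu Lv : seq word) (k : nat).
Notation normal := (@normal R).
Notation ev := (@ev R).
Notation Lam := (@Lam R).

(** The period is centred at a point of the open hexagon, and its two ends are translates of the
    same point [y] by the words u and v of [Lu] and [Lv], so z = u v^-1. Each half has length l/2,
    at most kL in the applications, which keeps the degrees of P u and P v within the degree of the
    modulus. *)
Record loop A B l z y Lu Lv : Prop := Loop {
  loop_null : null_pair A B;
  loop_hyp : forall t, hyp (geod A B t);
  loop_start : sdom (geod A B 0);
  loop_pos : 0 < l;
  loop_eqv : forall t, geod A B (t + l) = ev z *m geod A B t;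
  loop_layu : lay Lu;
  loop_layv : lay Lv;
  loop_mid : sdom y;
  loop_end : geod A B (l / 2) = ev (flatten Lu) *m y;
  loop_front : geod A B (- (l / 2)) = ev (flatten Lv) *m y }.

Lemma loop_rev A B l z y Lu Lv : loop A B l z y Lu Lv -> loop B A l (rev z) y Lv Lu.
Proof.
case=> h1 h2 h3 h4 h5 h6 h7 h8 h9 h10; split=> //.
- exact: null_pairC.
- by move=> t; rewrite (geodN A B).
- by rewrite (geodN A B) oppr0.
- exact: axis_rev.
- by rewrite (geodN A B).
- by rewrite (geodN A B) opprK.
Qed.

Lemma expR_le_period (l : R) k : expR (l / 2) <= Lam ^+ k -> l <= (2 * k)%:R * ln Lam.
Proof.
have L0 : 0 < Lam by rewrite (lt_trans _ (Lam_gt1 R)).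
rewrite -ler_ln ?posrE ?expR_gt0 ?exprn_gt0 // expRK lnXn // -mulr_natl natrM; lra.
Qed.

Section Orthogonal.
Variables (A B : 'cV[R]_3) (l : R) (z : word) (y : 'cV[R]_3) (Lu Lv : seq word) (k : nat) (i : letter).
Hypotheses (lp : loop A B l z y Lu Lv) (len : expR (l / 2) <= Lam ^+ k) (k0 : (0 < k)%N).
Hypotheses (iu : i \in head [::] Lu) (ku : (k <= parity i (flatten Lu))%N)
  (kv : (k <= parity i (flatten Lv))%N).
Let o := odd i.
Let U := map (@occ_wall R) (occs o Lu).
(** The second half is walked backwards from the centre; the signs are changed so that all walls are
    crossed in the positive direction. *)
Let V := map (fun p => - @occ_wall R p) (occs o Lv).
Let AB := loop_null lp.
Let l0 := loop_pos lp.
Notation ct := (ctime A B).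

Let U_spec n : n \in U -> [/\ wall o n, crossing A B n & 0 < ct n < l / 2].
Proof.
move=> /mapP[p pU ->]; have w := occ_wall_wall R pU.
have h1 := occ_wall_lt0 (loop_layu lp) (loop_start lp) pU.
have := occ_wall_gt0 (loop_layu lp) (loop_mid lp) pU; rewrite -(loop_end lp) => h2.
by have [|c h] := crossing_between _ h1 h2; [rewrite divr_gt0|].
Qed.

Let V_spec n : n \in V -> [/\ wall o n, crossing A B n & - (l / 2) < ct n < 0].
Proof.
move=> /mapP[p pV ->]; have w := occ_wall_wall R pV.
have h1 := occ_wall_lt0 (loop_layv lp) (loop_start lp) pV.
have := occ_wall_gt0 (loop_layv lp) (loop_mid lp) pV; rewrite -(loop_front lp) => h2.
have [|||c h] := @crossing_between _ A B (- occ_wall R p) (- (l / 2)) 0.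
- by rewrite oppr_lt0 divr_gt0.
- by rewrite lorentzNl oppr_lt0.
- by rewrite lorentzNl oppr_gt0.
by split=> //; exact: wallN.
Qed.

Let iU : normal i \in U.
Proof.
apply/mapP; exists ([::], i); last by rewrite /occ_wall /= mul1mx.
case: (Lu) iu => // W L iW; rewrite /= mem_cat; apply/orP; left.
by apply/mapP; exists i; rewrite // mem_filter eqxx.
Qed.

Let W := rem (normal i) U ++ V.

Let W_spec n : n \in W -> [/\ wall o n, crossing A B n & - (l / 2) < ct n < l / 2].
Proof.
have l2 : 0 < l / 2 by rewrite divr_gt0.
rewrite mem_cat => /orP[/mem_rem/U_spec|/V_spec] [h1 h2 /andP[h3 h4]]; split=> //; apply/andP; split; lra.
Qed.

Let uniqU : uniq U.
Proof. exact: occs_uniq (loop_layu lp). Qed.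

Let uniqW : uniq W.
Proof.
rewrite cat_uniq rem_uniq //=; apply/andP; split.
  apply/hasPn => n /V_spec[_ _ /andP[_ h]]; apply/negP => /mem_rem/U_spec[_ _ /andP[h' _]].
  by have := lt_trans h h'; rewrite ltxx.
rewrite /V map_comp map_inj_uniq; last exact: oppr_inj.
exact: occs_uniq (loop_layv lp).
Qed.

Let W_neq n : n \in W -> n <> normal i.
Proof.
rewrite mem_cat => /orP[|/V_spec[_ _ /andP[_ h]] e].
  by rewrite mem_rem_uniq // inE => /andP[/eqP].
by have [_ _ /andP[h' _]] := U_spec iU; move: h; rewrite e ltNge ltW.
Qed.

Let size_W : ((2 * k).-1 <= size W)%N.
Proof.
rewrite size_cat size_rem // !size_map !size_occs.
have -> : (2 * k).-1 = (k.-1 + k)%N by case: (k) k0 => // k' _; rewrite mul2n -addnn.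
apply: leq_add => //; by rewrite -!subn1 leq_sub2r.
Qed.

Let sep n n' : wall o n -> crossing A B n -> wall o n' -> crossing A B n' -> n <> n' ->
  ln Lam <= `|ct n - ct n'| /\ (offset A B n <> 0 -> ln Lam < `|ct n - ct n'|).
Proof.
move=> wn cn wn' cn' nn'; apply: ctime_sep => //; try exact: wall_unit.
  by apply: wall_unit wn.
  by apply: wall_unit wn'.
apply: wall_sep wn wn' nn' _ => e; case: cn; rewrite e lorentzNl => h _; case: cn' => h' _.
by move: h; rewrite oppr_gt0 ltNge ltW.
Qed.

Let t0 := ct (normal i).
Let sg n := if ct n < t0 then ev z *m n else n.

Let sg_spec n : n \in W -> [/\ wall o (sg n), crossing A B (sg n),
  ct (sg n) = (if ct n < t0 then ct n + l else ct n) & t0 <= ct (sg n) <= t0 + l].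
Proof.
move=> nW; have [wn cn /andP[h1 h2]] := W_spec nW; rewrite /sg.
have [_ _ /andP[h3 h4]] := U_spec iU; rewrite -/t0 in h3 h4.
have l2 : 0 < l / 2 by rewrite divr_gt0.
case: ltP => h.
  have [c' e'] := crossing_translate (loop_eqv lp) cn; split=> //; first exact: wall_ev.
  by rewrite e'; apply/andP; split; lra.
by split=> //; apply/andP; split; lra.
Qed.

Let ev_inj' n n' : ev z *m n = ev z *m n' -> n = n'.
Proof. by move=> e; rewrite -[n](ev_Arev z) e ev_Arev. Qed.

Let sg_inj n n' : n \in W -> n' \in W -> n <> n' -> sg n <> sg n'.
Proof.
move=> nW nW' nn' e; have [_ _ e1 _] := sg_spec nW; have [_ _ e2 _] := sg_spec nW'.
have [_ _ /andP[h1 h2]] := W_spec nW; have [_ _ /andP[h1' h2']] := W_spec nW'.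
move: e1 e2 e; rewrite /sg; case: ifP => c; case: ifP => c' e1 e2 e.
- exact/nn'/ev_inj'.
- by move: e1; rewrite e; lra.
- by move: e2; rewrite -e; lra.
- exact: nn'.
Qed.

(** At least 2k walls of the parity of [i] are crossed in a period of length at most 2kL, with gaps
    of at least L. If the wall [i] were crossed obliquely, the gaps at it and at its translate would
    exceed L. The other 2k - 1 walls, moved by [sg] into the period that starts at this crossing,
    would then lie strictly inside an interval of length (2k - 2)L. *)
Lemma loop_orthogonal : offset A B (normal i) = 0.
Proof.
apply: contrapT => off; have [wi ci /andP[h3 h4]] := U_spec iU.
have [ci' ei'] := crossing_translate (loop_eqv lp) ci.
have wi' := wall_ev z wi.
have L0 : 0 < ln Lam by rewrite ln_gt0 // Lam_gt1.
have offz : offset A B (ev z *m normal i) <> 0.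
  have e1 := gram_plane (normal i) (normal i) AB.
  have e2 := gram_plane (ev z *m normal i) (ev z *m normal i) AB.
  have eA := ctimeE ci; have eB := ctimeE ci'.
  have [hA hB] := axis_ends (loop_eqv lp).
  move=> e0; apply: off; apply/eqP; rewrite -sqrf_eq0 expr2; apply/eqP.
  move: e2; rewrite e0 mul0r ev_lorentz e1.
  have a1 : lorentz (ev z *m normal i) A * expR l = lorentz (normal i) A.
    by rewrite -(ev_lorentz z (normal i) A) hA lorentzZr mulrC.
  have b1 : lorentz (ev z *m normal i) B * expR (- l) = lorentz (normal i) B.
    by rewrite -(ev_lorentz z (normal i) B) hB lorentzZr mulrC.
  rewrite -a1 -b1; set a := lorentz _ A; set b := lorentz _ B.
  have -> : a * expR l * (b * expR (- l)) = a * b.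
    have -> : a * expR l * (b * expR (- l)) = a * b * (expR l * expR (- l)) by ring.
    by rewrite -expRD subrr expR0 mulr1.
  lra.
have : (size W <= 2 * k - 2)%N.
  apply: (@spaced_le R _ W (fun n => ct (sg n)) (ln Lam) (t0 + ln Lam) (t0 + l - ln Lam)) => //.
  - move=> n nW; have [ws cs es /andP[h1 h2]] := sg_spec nW.
    have [_ _ /andP[h5 h6]] := W_spec nW; rewrite -/t0 in h3 h4.
    have ne1 : normal i <> sg n.
      move=> e; move: es; rewrite -e -/t0; case: ltP => h es; first by lra.
      by apply: (W_neq nW); rewrite e /sg ltNge h.
    have ne2 : ev z *m normal i <> sg n.
      move=> e; move: es; rewrite -e ei' -/t0; case: ltP => h es; last by lra.
      by apply: (W_neq nW); apply: esym; apply: ev_inj'; rewrite e /sg h.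
    have [_ /(_ off)] := sep wi ci ws cs ne1.
    have [_ /(_ offz)] := sep wi' ci' ws cs ne2.
    rewrite ei' -/t0 => g1 g2.
    move: g1; rewrite ger0_norm ?subr_ge0 // => g1.
    move: g2; rewrite ler0_norm ?subr_le0 // => g2.
    by apply/andP; split; lra.
  - have := expR_le_period len; rewrite natrB ?leq_pmulr //.
    by rewrite mulrBl; lra.
  - move=> n n' nW nW' nn'.
    have [ws cs _ _] := sg_spec nW; have [ws' cs' _ _] := sg_spec nW'.
    by have [] := sep ws cs ws' cs' (sg_inj nW nW' nn').
move=> h; have := leq_trans size_W h; case: (k) k0 => // k' _.
by rewrite mulnS addKn add2n /= ltnn.
Qed.
End Orthogonal.

(** Disjoint walls have only one common perpendicular, and for two sides that are apart it carries
    the side between them. In coordinates (am, bm) solves a homogeneous linear system with nonzero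
    determinant. *)
Lemma orthogonal_apart A B i j : null_pair A B -> apart i j ->
  offset A B (normal i) = 0 -> offset A B (normal j) = 0 ->
  exists m, forall t, lorentz (normal m) (geod A B t) = 0.
Proof.
move=> AB ap oi oj.
have [m mi mj] : exists2 m, comm m i & comm m j.
  have h : [exists m, comm m i && comm m j].
    move: ap; apply/implyP; move: i j {oi oj}; apply: all_letters2.
    apply/allP => i _; apply/allP => j _; apply/implyP => h; apply/existsP.
    have : has (fun m => comm m i && comm m j) letters6.
      by move: h; apply/implyP; move: i j; exact: all_letters2.
    by case/hasP => m _ hm; exists m.
  by case/existsP: h => m /andP[]; exists m.
exists m => t; rewrite lorentz_geod.
have e1 := gram_plane (normal i) (normal i) AB; have e2 := gram_plane (normal j) (normal j) AB.
have e3 := gram_plane (normal i) (normal j) AB.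
have e4 := gram_plane (normal m) (normal i) AB; have e5 := gram_plane (normal m) (normal j) AB.
move: e1 e2 e3 e4 e5; rewrite !lorentz_normal !gram_eq (gram_apart _ ap) !(gram_comm _ _) // oi oj !mulr0 !sub0r.
set ai := lorentz _ A; set bi := lorentz _ B; set aj := lorentz _ A; set bj := lorentz _ B.
set am := lorentz _ A; set bm := lorentz _ B => e1 e2 e3 e4 e5.
suff [-> ->] : am = 0 /\ bm = 0 by rewrite !mulr0 addr0.
have f1 : ai * bi = - 4^-1 by lra.
have f2 : aj * bj = - 4^-1 by lra.
have f3 : ai * bj + aj * bi = 1 by lra.
have f4 : am * bi + ai * bm = 0 by lra.
have f5 : am * bj + aj * bm = 0 by lra.
have prod : (ai * bj) * (aj * bi) = 16^-1.
  by rewrite (_ : _ * _ = (ai * bi) * (aj * bj)); [rewrite f1 f2; field|ring].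
have d0 : ai * bj - aj * bi <> 0.
  move=> d; have h : ai * bj = 2^-1 by lra.
  have h' : aj * bi = 2^-1 by lra.
  have q : (2^-1 * 2^-1 : R) = 4^-1 by field.
  by move: prod; rewrite h h' q; lra.
split; apply/eqP; apply: contraT => nz; exfalso; apply: d0.
  apply: (mulfI nz); rewrite mulr0 (_ : am * _ = ai * (am * bj + aj * bm) - aj * (am * bi + ai * bm)).
    by rewrite f4 f5; ring.
  by ring.
apply: (mulfI nz); rewrite mulr0 (_ : bm * _ = bj * (am * bi + ai * bm) - bi * (am * bj + aj * bm)).
  by rewrite f4 f5; ring.
by ring.
Qed.
End Loop.

(** * Short loops *)

Section Core.
Variable R : realType.
Implicit Types (x y n A B : 'cV[R]_3) (i j : letter) (w z a : word) (t l : R) (L Lu Lv : seq word).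
Notation normal := (@normal R).
Notation ev := (@ev R).
Notation Lam := (@Lam R).

Lemma sdom_word y a w : sdom y -> ev a *m y = ev w *m y -> weq a w.
Proof.
move=> sy e; have dy := sdomW sy.
have [|_ [w' ww' h]] := dom_word dy dy (w := rev w ++ a).
  by rewrite ev_cat -mulmxA e ev_Arev.
have w'0 : w' = [::].
  by case: w' h {ww'} => // i w' /(_ i (mem_head _ _)) h; have := sy i; rewrite h ltxx.
rewrite w'0 in ww'; apply: (@weq_trans _ (w ++ (rev w ++ a))).
  by rewrite catA; apply: weq_sym; exact: weq_catr (weq_revK w).
by rewrite -[X in weq _ X]cats0; apply: weq_catl; apply: weq_sym.
Qed.

Lemma clique_size V : clique V -> (size V <= 2)%N.
Proof.
by case/clique_cases => [[i ->]|[i [j [-> _]]]].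
Qed.

Lemma lay_size L : lay L -> (size (flatten L) <= 2 * size L)%N.
Proof.
elim: L => //= V L IH /and3P[cV _ /IH h]; rewrite size_cat mulnS.
exact: leq_add (clique_size cV) h.
Qed.

(** The start is strictly inside the hexagon, whence a strict inequality; this is what brings the
    degree bound down to 4(k - 1). *)
Lemma loop_bound A B l z y Lu Lv k : loop A B l z y Lu Lv -> expR (l / 2) <= Lam ^+ k ->
  forall i, i \in head [::] Lu -> expasinh `|lorentz (normal i) (ev (flatten Lu) *m y)| < Lam ^+ k.
Proof.
move=> lp len i iu; have l2 : 0 < l / 2 by rewrite divr_gt0 // (loop_pos lp).
have [h0 _ _] := lay_st (loop_layu lp) (sdomW (loop_mid lp)).
rewrite (ger0_norm (h0 i iu)) -(loop_end lp).
have e1 : 1 < expR (l / 2) by rewrite expR_gt1.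
apply: (@expasinh_lt_dist _ i (geod A B 0)).
- exact: loop_hyp lp _.
- exact: loop_hyp lp _.
- exact: loop_start lp i.
- by apply: lt_le_trans len; rewrite expR_gt0.
- by apply: le_trans len; exact: ltW.
rewrite (geod_geod _ _ (loop_null lp)) subr0 sub0r expRN.
move: len e1; set e := expR _; set t := Lam ^+ k => len e1.
have ee : e * e^-1 = 1 by rewrite divff // lt0r_neq0 //; lra.
have tt : t * t^-1 = 1 by rewrite divff // lt0r_neq0 //; lra.
have ei : 0 < e^-1 by rewrite invr_gt0; lra.
have ti : 0 < t^-1 by rewrite invr_gt0; lra.
have e1' : e^-1 <= 1 by rewrite invf_le1 ?ltW //; lra.
have t1' : t^-1 <= 1 by rewrite invf_le1; lra.
have : 0 <= (t - e) * (1 - t^-1 * e^-1).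
  by rewrite mulr_ge0 ?subr_ge0 // -[X in _ <= X]mul1r; apply: ler_pM => //; exact: ltW.
have -> : (t - e) * (1 - t^-1 * e^-1) = t - e - (t * t^-1) * e^-1 + (e * e^-1) * t^-1 by ring.
rewrite ee tt; lra.
Qed.

Lemma all_flatten_nseq (J : pred letter) p a : all J a -> all J (flatten (nseq p a)).
Proof. by move=> h; elim: p => //= p IH; rewrite all_cat h. Qed.

Lemma ev_flatten_nseq p a w : ev a = ev w -> ev (flatten (nseq p a)) = ev (flatten (nseq p w)).
Proof. by move=> e; elim: p => //= p IH; rewrite !ev_cat e IH. Qed.

(** The normal form of a^-1 b uses only letters of [J], so [i] is not in its head. *)
Lemma parabolic_sign (J : pred letter) x a b i : sdom x -> all J a -> all J b -> ~~ J i ->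
  lorentz (ev a *m normal i) (ev b *m x) < 0.
Proof.
move=> sx Ja Jb nJ; rewrite ev_adj mulmxA -ev_cat.
have [L [lL wL _ sub]] := lay_nf (rev a ++ b).
rewrite -(ev_weq _ wL); case: (lay_strict lL sx) => _; apply; apply: contra nJ => iL.
have : i \in flatten L by case: (L) iL => //= V L' iV; rewrite mem_cat iV.
by move=> /sub; rewrite mem_cat mem_rev => /orP[/(allP Ja)|/(allP Jb)].
Qed.

(* The axis of an element of a parabolic subgroup stays on the negative side of the walls
   that bound the union of the translates of the hexagon by that subgroup. *)
Lemma loop_letters A B l z y Lu Lv (J : pred letter) a : loop A B l z y Lu Lv ->
  all J a -> ev a = ev z -> all J (flatten Lu).
Proof.
move=> lp Ja ea; have [b [L [Jb lL wL _ nJ]]] := strip J (flatten Lu).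
have L0 : L = [::].
  case: L lL wL nJ => [//|V L] lL wL nJ; exfalso.
  have [i iV] : exists i, i \in V.
    by case/and3P: lL => /andP[]; case: V {wL nJ} => // i V _; exists i; rewrite mem_head.
  pose n := ev b *m normal i.
  have pos : 0 < lorentz n (geod A B (l / 2)).
    rewrite (loop_end lp) (ev_weq _ wL) ev_cat -mulmxA ev_lorentz.
    by case: (lay_strict lL (loop_mid lp)) => h _; apply: h.
  have sx := loop_start lp; have l0 := loop_pos lp.
  have nA : lorentz n A <= 0.
    apply: (@negative_progression _ _ (lorentz n B) l l0) => p.
    rewrite -lorentz_geod -[p%:R * l]add0r (axis_power (loop_eqv lp)) -(ev_flatten_nseq _ ea).
    exact: parabolic_sign sx Jb (all_flatten_nseq _ Ja) (nJ i iV).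
  have nB : lorentz n B <= 0.
    apply: (@negative_progression _ _ (lorentz n A) l l0) => p.
    rewrite -lorentz_geod -[p%:R * l]add0r.
    rewrite (axis_power (axis_rev (loop_eqv lp))).
    have er : ev (rev a) = ev (rev z).
      by rewrite -[LHS]mul1mx -(ev_Krev _ z) -mulmxA -ea ev_revK mulmx1.
    rewrite -(ev_flatten_nseq _ er) (geodN A B) oppr0.
    by apply: parabolic_sign sx Jb (all_flatten_nseq _ _) (nJ i iV); rewrite all_rev.
  move: pos; rewrite lorentz_geod ltNge => /negP; apply.
  by rewrite -[X in _ <= X]addr0 lerD // mulr_ge0_le0 ?expR_ge0.
rewrite L0 cats0 in wL.
have [L' [lL' wL' _ sub]] := lay_nf b.
have [|_ /perm_mem pe] := lay_unique (loop_layu lp) lL' (R := R).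
  by rewrite (ev_weq _ wL) (ev_weq _ wL').
by apply/allP => i; rewrite pe => /sub/(allP Jb).
Qed.

Section Quotient.
Variables (F : fieldType) (k : nat) (Q : {poly F}).
Hypotheses (k1 : (1 < k)%N) (sQ : size Q = (4 * k - 3)%N)
  (charF : forall m : nat, (0 < m <= 4 * k)%N -> m%:R != 0 :> F).
Notation P := (P ('X^4 : {poly F}) 'X^3).
Notation T := (T ('X^4 : {poly F}) 'X^3).

Definition relator w := forall i j, Q %| P w i j.

Lemma dvdp_sum (I : Type) (s : seq I) (f : I -> {poly F}) :
  (forall e, Q %| f e) -> Q %| \sum_(e <- s) f e.
Proof. by move=> h; elim/big_rec: _ => [|i q _ hq]; rewrite ?dvdp0 // dvdp_add. Qed.

Lemma relator_cat_dvd z w : relator z -> forall i j, Q %| P (z ++ w) i j - P w i j.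
Proof.
move=> rz i j; rewrite P_cat mxE addrK mxE; apply: dvdp_sum => m.
by rewrite dvdp_mulr.
Qed.

(** What [P_degree] yields for a row of extremal degree when k > 1. *)
Let good L i := [/\ i \in head [::] L, (k <= parity i (flatten L))%N &
  exists2 j, j \in flatten L & (odd j == odd i) && (j != i)].

(** The second letter [j] of the parity of [i] belongs to [J]. It is not in the head of [Lu], where
    letters of one parity coincide, so it is in the head of [Lv]. Both halves now carry k walls of
    this parity, the line is orthogonal to the walls [i] and [j], and it must be the side between
    them; but it starts inside the hexagon. *)
Lemma loop_contra A B l z y Lu Lv (J : pred letter) i : loop A B l z y Lu Lv ->
  expR (l / 2) <= Lam ^+ k -> all J (flatten Lu) -> (forall j, J j -> good Lu j \/ good Lv j) ->
  J i -> good Lu i -> False.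
Proof.
move=> lp len Ju hJ Ji [iu ku [j ju /andP[/eqP oj ji]]].
have clu : {in head [::] Lu &, forall i j, odd i = odd j -> i = j}.
  case: (Lu) (loop_layu lp) => [|V L] // /and3P[cV _ _] p q pV qV e.
  exact: clique_parity cV pV qV e erefl.
have [[jh _ _]|[jv kv _]] := hJ j (allP Ju j ju).
  by case/eqP: ji; apply: clu.
have par_eq w : parity i w = parity j w by apply: eq_count => q; rewrite oj.
have k0 : (0 < k)%N := ltnW k1.
have h1 := loop_orthogonal lp len k0 iu ku; rewrite par_eq in h1.
have h2 := loop_orthogonal (loop_rev lp) len k0 jv kv; rewrite -par_eq in h2.
have ap : apart i j.
  have : (odd j == odd i) ==> (j != i) ==> apart i j.
    by move: (i) (j); exact: all_letters2.
  by rewrite oj eqxx ji.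
have h2' : offset A B (normal j) = 0 by apply/eqP; rewrite -oppr_eq0 -offsetC h2.
have [m hm] := orthogonal_apart (loop_null lp) ap (h1 kv) h2'.
by have := loop_start lp m; rewrite hm ltxx.
Qed.
Theorem no_short_loop A B l z y Lu Lv : loop A B l z y Lu Lv ->
  expR (l / 2) <= Lam ^+ k -> relator z -> False.
Proof.
move=> lp len rz; set u := flatten Lu; set v := flatten Lv.
have lp' := loop_rev lp.
have bu := loop_bound lp len; have bv := loop_bound lp' len.
have wu : weq u (z ++ v).
  apply: sdom_word (loop_mid lp) _; rewrite ev_cat -mulmxA -(loop_end lp) -(loop_front lp).
  by rewrite -(loop_eqv lp); congr (geod _ _ _); field.
have hy : hyp y.
  by have := ev_hyp (rev u) (loop_hyp lp (l / 2)); rewrite (loop_end lp) ev_Arev.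
have dy := sdomW (loop_mid lp).
pose D i j := P u i j - P v i j.
have dD i j : Q %| D i j by rewrite /D (P_weq _ _ wu); exact: relator_cat_dvd.
have degu := fun i j d => P_degree (F := F) hy dy (i := i) (l := j) (d := d) (loop_layu lp) bu.
have degv := fun i j d => P_degree (F := F) hy dy (i := i) (l := j) (d := d) (loop_layv lp) bv.
have k4 : (4 * k - 3 = (4 * k - 4).+1)%N by lia.
(* No entry exceeds the degree 4k - 4 of [Q], so a nonzero entry, being divisible by [Q], attains
   it. *)
have szD i j : (size (D i j) <= 4 * k - 3)%N.
  apply/leq_sizeP => d hd; rewrite coefB.
  have [->|/degu[h _]] := eqVneq (P u i j)`_d 0; last by lia.
  have [->|/degv[h _]] := eqVneq (P v i j)`_d 0; last by lia.
  by rewrite subr0.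
have lead i j : D i j != 0 -> good Lu i \/ good Lv i.
  move=> nz; have sD : size (D i j) = (4 * k - 3)%N.
    by apply/eqP; rewrite eqn_leq szD -sQ dvdp_leq.
  have : (D i j)`_(4 * k - 4) != 0.
    by move: nz; rewrite -lead_coef_eq0 lead_coefE sD k4.
  rewrite coefB; have [->|/degu[_ h] _] := eqVneq (P u i j)`_(4 * k - 4) 0.
    rewrite sub0r oppr_eq0 => /degv[_ h]; right; have [|h1 h2 h3] := h; first by lia.
    by split=> //; exact: h3.
  left; have [|h1 h2 h3] := h; first by lia.
  by split=> //; exact: h3.
pose J i := [exists j, D i j != 0].
have hJ i : J i -> good Lu i \/ good Lv i by case/existsP => j; exact: lead.
(* P w0 = (P u - P v) T(v^-1), so its nonzero rows are among those of P u - P v. *)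
pose w0 := u ++ rev v.
have ew0 : ev w0 = ev z.
  by rewrite ev_cat (ev_weq _ wu) ev_cat -mulmxA ev_revK mulmx1.
have Pw0 i j : P w0 i j != 0 -> J i.
  rewrite P_cat; have -> : P (rev v) = - (P v *m T (rev v)).
    by apply/eqP; rewrite -addr_eq0 addrC P_revK.
  rewrite -mulmxBl mxE => nz; apply/existsP.
  have [m nm|h] := pickP (fun m => D i m != 0); first by exists m.
  case/eqP: nz; rewrite big1 // => m _; have := h m.
  by rewrite /D !mxE => /negbFE/eqP ->; rewrite mul0r.
(* At most k layers in each half and at most two letters in each layer; hence the 4k in the
   condition on the characteristic. *)
have sw0 : (size w0 <= 4 * k)%N.
  have lu := layer_count hy dy (loop_layu lp) bu; have lv := layer_count hy dy (loop_layv lp) bv.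
  have su := lay_size (loop_layu lp); have sv := lay_size (loop_layv lp).
  by rewrite size_cat size_rev; move: su sv; rewrite -/u -/v; lia.
have [m /andP[m0 m1]|a Ja wa] := parabolic Pw0; first by apply: charF; rewrite m0 (leq_trans m1).
have ea : ev a = ev z by rewrite -ew0 (ev_weq _ wa).
(* If all rows vanish then [z] acts as the identity, against the positive period. *)
have [i Ji|J0] := pickP J; last first.
  have a0 : a = [::] by case: (a) Ja => // i a' /= /andP[]; rewrite J0.
  have := loop_eqv lp 0; rewrite -ea a0 mul1mx add0r => e.
  have := geod_geod 0 l (loop_null lp); rewrite e.
  have [h0 _] := loop_hyp lp 0; rewrite h0 subr0 sub0r expRN => h.
  have l1 : 1 < expR l by rewrite expR_gt1 (loop_pos lp).
  have := mulfV (lt0r_neq0 (expR_gt0 l)); move: h l1; set p := expR l => h l1 hp.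
  have : (p - 1) * (p - 1) = 0.
    have : p^-1 = 2 - p by lra.
    by move=> e'; move: hp; rewrite e'; lra.
  by move/eqP; rewrite mulf_eq0 orbb; lra.
have Ju := loop_letters lp Ja ea.
have er : ev (rev a) = ev (rev z).
  by rewrite -[LHS]mul1mx -(ev_Krev _ z) -mulmxA -ea ev_revK mulmx1.
have Jv : all J v by apply: (loop_letters lp' (a := rev a)) => //; rewrite all_rev.
case: (hJ i Ji) => gi; first exact: loop_contra lp len Ju hJ Ji gi.
apply: (loop_contra lp' len Jv _ Ji gi) => j /hJ[]; by [right|left].
Qed.
End Quotient.
End Core.

(** * Words that are even in each parity *)

Section Parity.
Implicit Types (w u : word).

(** A vertex is fixed by two commuting letters, one of each parity, so evenness in both parities
    leaves only the identity in every stabilizer. The even words form a subgroup of index 4. *)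
Definition even_word w :=
  ~~ odd (count (fun j : letter => odd j) w) && ~~ odd (count (fun j : letter => ~~ odd j) w).

Lemma even_cat u w : even_word u -> even_word w -> even_word (u ++ w).
Proof.
move=> /andP[/negbTE h1 /negbTE h2] /andP[/negbTE h3 /negbTE h4].
by rewrite /even_word !count_cat !oddD h1 h2 h3 h4.
Qed.

Lemma even_rev w : even_word (rev w) = even_word w.
Proof. by rewrite /even_word !count_rev. Qed.

Lemma even_conj u w : even_word (u ++ w ++ rev u) = even_word w.
Proof.
rewrite /even_word !count_cat !count_rev !oddD ![odd (count _ w) (+) _]addbC.
by rewrite !addbA !addbb.
Qed.

Lemma even_weq u w : weq u w -> even_word u = even_word w.
Proof.
have h (p : pred letter) u' w' : weq u' w' -> odd (count p u') = odd (count p w').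
  elim=> {u' w'}.
  - by [].
  - by move=> w1 w2 w3 _ -> _ ->.
  - by move=> w1 w2 _ ->.
  - by move=> i w1 w2 _ /=; rewrite !oddD => ->.
  - by move=> i w1 /=; rewrite !oddD addbA addbb.
  - by move=> i j w1 _ /=; rewrite !oddD !addbA [_ (+) odd (p i)]addbC.
by move=> e; rewrite /even_word !(h _ _ _ e).
Qed.

Lemma even_size w : even_word w -> ~~ odd (size w).
Proof.
move=> /andP[/negbTE h1 /negbTE h2].
by rewrite -(count_predC (fun j : letter => odd j)) oddD h1 h2.
Qed.

Lemma even_alt r i j : apart i j -> even_word (alt r.*2 i j).
Proof.
move=> ap; have oij : odd i = odd j.
  apply/eqP; have : apart i j ==> (odd i == odd j) by move: (i) (j); exact: all_letters2.
  by rewrite ap.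
elim: r => // r IH; rewrite doubleS -[alt _ _ _]/([:: i; j] ++ alt r.*2 i j).
by apply: even_cat IH; rewrite /even_word /= oij; case: (odd j).
Qed.
End Parity.

Section WordDegree.
Variable F : fieldType.
Notation P := (P ('X^4 : {poly F}) 'X^3).
Notation T := (T ('X^4 : {poly F}) 'X^3).
Notation cox := (cox ('X^4 : {poly F}) 'X^3).

Lemma size_cox i j : (size (cox i j) <= 5)%N.
Proof.
rewrite /cox; case: ifP => _.
  by rewrite -[2]/(1 + 1 : {poly F}) -polyCD; apply: leq_trans (size_polyC_leq1 _) _.
by do 2 (case: ifP => _; first by rewrite size_polyN size_polyXn); rewrite size_poly0.
Qed.

Lemma size_T w i j : (size (T w i j) <= (4 * size w).+1)%N.
Proof.
elim: w i j => [|l w IH] i j.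
  rewrite T0 mxE; case: (i == j); rewrite ?size_poly1 // mulr0n size_poly0 //.
rewrite T_cons; apply: leq_trans (size_polyD _ _) _; rewrite size_polyN geq_max.
apply/andP; split; first by apply: leq_trans (IH _ _) _; rewrite /= mulnS; lia.
apply: leq_trans (size_polyMleq _ _) _; have := size_cox i l; have := IH l j.
by rewrite /= mulnS; move: (size _) (size (cox i l)) => a b; lia.
Qed.

Lemma size_P w i j : (size (P w i j) <= (4 * (size w).-1).+1)%N.
Proof.
elim: w i j => [|l w IH] i j; first by rewrite mxE size_poly0.
rewrite P_cons; apply: leq_trans (size_polyD _ _) _; rewrite size_polyN geq_max.
apply/andP; split; first by apply: leq_trans (IH _ _) _; rewrite /=; lia.
case: (i == l); rewrite ?mul0r ?size_poly0 // mul1r; exact: size_T.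
Qed.
End WordDegree.

(** * The lines that carry the sides *)

Section WallAxis.
Variable R : realType.
Implicit Types (x y n A B X : 'cV[R]_3) (i j : letter) (w z a : word) (t l : R).
Notation normal := (@normal R).
Notation vertex := (@vertex R).
Notation ev := (@ev R).
Notation Lam := (@Lam R).
Notation s3 := (@s3 R).
Notation s2 := (@s2 R).

Definition nxt i : letter := ordS i.
Definition prv i : letter := ord_pred i.

Lemma apart_nxt_prv i : apart (nxt i) (prv i).
Proof. by move: i; exact: all_letters. Qed.

Lemma vertexE i : s3 *: normal (prv i) = 2 *: vertex i - vertex (nxt i) /\
  s3 *: normal (nxt i) = 2 *: vertex (nxt i) - vertex i.
Proof.
have h : [&& 3 * na (prv i) == 2 * va i - va (nxt i), nb (prv i) == 2 * vb i - vb (nxt i),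
   3 * na (nxt i) == 2 * va (nxt i) - va i & nb (nxt i) == 2 * vb (nxt i) - vb i].
  by move: i; exact: all_letters.
case/and4P: h => /eqP h1 /eqP h2 /eqP h3 /eqP h4.
have ss := s3s3 R.
move/(congr1 (fun q : int => q%:~R : R)): h1; move/(congr1 (fun q : int => q%:~R : R)): h2.
move/(congr1 (fun q : int => q%:~R : R)): h3; move/(congr1 (fun q : int => q%:~R : R)): h4.
rewrite !(rmorphB, rmorphM) /= => h4 h3 h2 h1.
split; apply: cV3P; rewrite !mxE /=; try ring.
- rewrite (_ : _ * _ = (s3 * s3) * (na (prv i))%:~R * (s2 / 2)); last by ring.
  by rewrite ss h1; ring.
- by rewrite h2; ring.
- rewrite (_ : _ * _ = (s3 * s3) * (na (nxt i))%:~R * (s2 / 2)); last by ring.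
  by rewrite ss h3; ring.
- by rewrite h4; ring.
Qed.

Lemma vertex_lorentz i : [/\ lorentz (vertex i) (vertex i) = -1 & lorentz (vertex i) (vertex (nxt i)) = -2].
Proof.
have h : [&& va i * va i + 3 * (vb i * vb i) == 4 & va i * va (nxt i) + 3 * (vb i * vb (nxt i)) == 2].
  by move: i; exact: all_letters.
case/andP: h => /eqP h1 /eqP h2; have ss := s3s3 R; have ss2 := s2s2 R.
move/(congr1 (fun q : int => q%:~R : R)): h1; move/(congr1 (fun q : int => q%:~R : R)): h2.
rewrite !(rmorphD, rmorphM) /= => h2 h1.
have e (p q p' q' : R) : - (s3 * s3) + p * (s2 / 2) * (p' * (s2 / 2)) + q * (s2 * s3 / 2) * (q' * (s2 * s3 / 2)) =
  - 3 + (p * p' + 3 * (q * q')) / 2.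
  rewrite ss; transitivity (- 3 + (s2 * s2) * (p * p') / 4 + (s2 * s2) * (s3 * s3) * (q * q') / 4); first by field.
  by rewrite ss ss2; field.
by split; rewrite lorentz_col3 e ?h1 ?h2; field.
Qed.

Lemma vertex_hyp i : hyp (vertex i).
Proof. by split; [case: (vertex_lorentz i)|rewrite mxE /= s3_gt0]. Qed.

(** The two ends of the line through the side [i], scaled so that vertex [i] is reached at time 0
    and the next vertex at time L; 2 - sqrt 3 is the inverse of [Lam]. *)
Definition axisA i : 'cV[R]_3 := (2 * s3)^-1 *: (vertex (nxt i) - (2 - s3) *: vertex i).
Definition axisB i : 'cV[R]_3 := (2 * s3)^-1 *: (Lam *: vertex i - vertex (nxt i)).

Lemma axis_sum i : axisA i + axisB i = vertex i.
Proof.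
by apply/colP => r; rewrite !mxE /Lam; field; rewrite gt_eqF // s3_gt0.
Qed.

Lemma axis_null i : null_pair (axisA i) (axisB i).
Proof.
have [e1 e2] := vertex_lorentz i; have [e3 _] := vertex_lorentz (nxt i).
have ss := s3s3 R; have s30 := lt0r_neq0 (s3_gt0 R).
split; rewrite /axisA /axisB !lorentz_lin ?(lorentzC (vertex (nxt i)) (vertex i)) e1 e2 e3 /Lam.
- transitivity ((2 * s3)^-1 ^+ 2 * (3 - s3 * s3)); first by ring.
  by rewrite ss subrr mulr0.
- transitivity ((2 * s3)^-1 ^+ 2 * (3 - s3 * s3)); first by ring.
  by rewrite ss subrr mulr0.
- transitivity ((2 * s3)^-1 ^+ 2 * (- (s3 * s3) - 3)); first by ring.
  by rewrite exprVn exprMn [s3 ^+ 2]expr2 ss; field.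
Qed.

Lemma axis_normal i : lorentz (normal i) (axisA i) = 0 /\ lorentz (normal i) (axisB i) = 0.
Proof.
have h : (vgram i i == 0) && (vgram (nxt i) i == 0) by move: i; exact: all_letters.
case/andP: h => /eqP h1 /eqP h2.
by split; rewrite !lorentz_lin !lorentz_vertex h1 h2; ring.
Qed.

(** The two neighbours of a side are orthogonal to it at distance L, and the product of their
    reflections is the translation by 2L along it. *)
Lemma axis_step i : ev [:: nxt i; prv i] *m axisA i = Lam ^+ 2 *: axisA i /\
  ev [:: nxt i; prv i] *m axisB i = Lam ^- 2 *: axisB i.
Proof.
have h : [&& vgram i (prv i) == 0, vgram (nxt i) (prv i) == -1, vgram i (nxt i) == -1 & vgram (nxt i) (nxt i) == 0].
  by move: i; exact: all_letters.
case/and4P: h => /eqP h1 /eqP h2 /eqP h3 /eqP h4.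
have [f1 f2] := vertexE i; have ss := s3s3 R; have s30 := lt0r_neq0 (s3_gt0 R).
have r1 : refl R (prv i) *m vertex i = vertex i.
  by rewrite reflE lorentz_vertex h1 !mulr0 scale0r subr0.
have r2 : refl R (prv i) *m vertex (nxt i) = 4 *: vertex i - vertex (nxt i).
  rewrite reflE lorentz_vertex h2 (_ : 2 * _ = -2 * s3); last by ring.
  by rewrite -scalerA f1; apply/colP => r; rewrite !mxE; ring.
have r3 : refl R (nxt i) *m vertex i = 4 *: vertex (nxt i) - vertex i.
  rewrite reflE lorentz_vertex h3 (_ : 2 * _ = -2 * s3); last by ring.
  by rewrite -scalerA f2; apply/colP => r; rewrite !mxE; ring.
have r4 : refl R (nxt i) *m vertex (nxt i) = vertex (nxt i).
  by rewrite reflE lorentz_vertex h4 !mulr0 scale0r subr0.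
have e1 : ev [:: nxt i; prv i] *m vertex i = 4 *: vertex (nxt i) - vertex i.
  by rewrite /= mulmx1 -mulmxA r1 r3.
have e2 : ev [:: nxt i; prv i] *m vertex (nxt i) = 15 *: vertex (nxt i) - 4 *: vertex i.
  rewrite /= mulmx1 -mulmxA r2 mulmxBr -scalemxAr r3 r4.
  by apply/colP => r; rewrite !mxE; ring.
have Li : Lam^-1 = 2 - s3.
  have : Lam * (2 - s3) = 1 by rewrite /Lam mulrBr !mulrDl ss; ring.
  have L0 : Lam != 0 by rewrite lt0r_neq0 // (lt_trans _ (Lam_gt1 R)).
  by move=> e; apply: (mulfI L0); rewrite mulfV.
have L2 : Lam ^+ 2 = 7 + 4 * s3 by rewrite /Lam sqrrD [s3 ^+ 2]expr2 ss; ring.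
have L2' : Lam ^- 2 = 7 - 4 * s3 by rewrite -exprVn Li sqrrB [s3 ^+ 2]expr2 ss; ring.
rewrite /axisA /axisB -!scalemxAr !mulmxBr -!scalemxAr e1 e2 L2' L2 /Lam.
have k : s3 ^+ 2 = 3 by rewrite expr2.
move: (vertex i) (vertex (nxt i)) => v v'.
split; apply/colP => r; rewrite !mxE; move: (v r 0) (v' r 0) => p q.
  transitivity ((2 * s3)^-1 * ((7 + 4 * s3) * q - (2 + s3) * p)); first by ring.
  transitivity ((2 * s3)^-1 * ((7 + 4 * s3) * q - (14 + s3 - 4 * s3 ^+ 2) * p)); last by ring.
  by rewrite k; ring.
transitivity ((2 * s3)^-1 * ((4 * s3 - 7) * q + (2 - s3) * p)); first by ring.
transitivity ((2 * s3)^-1 * ((4 * s3 - 7) * q + (14 - s3 - 4 * s3 ^+ 2) * p)); last by ring.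
by rewrite k; ring.
Qed.
End WallAxis.

Section Plane.
Variable R : realType.
Implicit Types (x y n A B X : 'cV[R]_3) (t l : R).

Lemma lorentz_nondeg x : (forall y, lorentz x y = 0) -> x = 0.
Proof.
move=> h; have e a b c := h (col3 a b c).
move: (e 1 0 0) (e 0 1 0) (e 0 0 1); rewrite ![lorentz x _]lorentzC !lorentz_col3l !mul0r !mul1r.
by move=> h0 h1 h2; apply: cV3P; rewrite [RHS]mxE; lra.
Qed.

Section PlaneOf.
Variables A B n : 'cV[R]_3.
Hypotheses (AB : null_pair A B) (nn : lorentz n n = 1) (nA : lorentz n A = 0) (nB : lorentz n B = 0).

(** The difference of the two sides is orthogonal to [A], [B] and [n]; [gram_plane] makes its
    product with any vector zero. *)
Lemma plane_decomp X : lorentz n X = 0 -> X = (- 2 * lorentz X B) *: A + (- 2 * lorentz X A) *: B.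
Proof.
move=> nX; have [aa bb ab] := AB.
apply/eqP; rewrite -subr_eq0; apply/eqP; set Y := X - _; apply: lorentz_nondeg => W.
have YA : lorentz Y A = 0.
  by rewrite /Y !lorentz_lin aa (lorentzC B A) ab; field.
have YB : lorentz Y B = 0.
  by rewrite /Y !lorentz_lin bb ab; field.
have nY : lorentz n Y = 0.
  by rewrite /Y !lorentz_lin nX nA nB; ring.
have on : offset A B n * offset A B n = 1.
  by have := gram_plane n n AB; rewrite nn nA nB; lra.
have oY : offset A B Y = 0.
  have := gram_plane n Y AB; rewrite nY nA nB YA YB => h.
  have : offset A B n * (offset A B n * offset A B Y) = 0 by rewrite (_ : _ * offset A B Y = 0) ?mulr0 //; lra.
  by rewrite mulrA on mul1r.
by rewrite (gram_plane Y W AB) oY YA YB; ring.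
Qed.

Lemma plane_param x : (forall t, hyp (geod A B t)) -> hyp x -> lorentz n x = 0 ->
  exists t, x = geod A B t.
Proof.
move=> hg hx nx; have e := plane_decomp nx; have [aa bb ab] := AB.
set p := - 2 * lorentz x B in e; set q := - 2 * lorentz x A in e.
have pq : p * q = 1.
  by have [h _] := hx; move: h; rewrite e !lorentz_lin aa bb (lorentzC B A) ab; lra.
have neg := hyp_lorentz hx (hg 0); have spq : 2 <= p + q.
  move: neg; rewrite /geod oppr0 expR0 !scale1r lorentzDr /p /q; lra.
have p0 : 0 < p.
  rewrite ltNge; apply/negP => h; have q0 : 0 <= q by lra.
  by have := mulr_le0_ge0 h q0; rewrite pq; lra.
have qE : q = p^-1 by apply: (mulfI (lt0r_neq0 p0)); rewrite pq mulfV // lt0r_neq0.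
by exists (ln p); rewrite /geod expRN lnK ?posrE // -qE.
Qed.
End PlaneOf.

Lemma geod_inj A B s t : null_pair A B -> geod A B s = geod A B t -> s = t.
Proof.
move=> AB e; have := geod_geod s t AB; have := geod_geod t t AB.
rewrite e subrr expR0 => -> h.
have pos := expR_gt0 (t - s); have := mulfV (lt0r_neq0 pos).
have -> : (expR (t - s))^-1 = expR (s - t) by rewrite -expRN opprB.
set p := expR (t - s) in h pos *; have -> : expR (s - t) = 2 - p by rewrite -/p in h; lra.
move=> e2; have /eqP : (p - 1) * (p - 1) = 0 by lra.
rewrite mulf_eq0 orbb subr_eq0 => /eqP p1.
have : t - s = 0 by apply: expR_inj; rewrite -/p p1 expR0.
lra.
Qed.
End Plane.

Section WallLength.
Variable R : realType.
Implicit Types (x y n A B X : 'cV[R]_3) (i j : letter) (w z a : word) (t l : R).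
Notation normal := (@normal R).
Notation vertex := (@vertex R).
Notation axisA := (@axisA R).
Notation axisB := (@axisB R).
Notation ev := (@ev R).
Notation Lam := (@Lam R).
Notation s3 := (@s3 R).

Lemma axis_alt i r : ev (alt r.*2 (nxt i) (prv i)) *m axisA i = (Lam ^+ r.*2) *: axisA i /\
  ev (alt r.*2 (nxt i) (prv i)) *m axisB i = (Lam ^- r.*2) *: axisB i.
Proof.
have [hA hB] := axis_step R i.
elim: r => [|r [IA IB]]; first by rewrite !mul1mx invr1 !scale1r.
rewrite doubleS -[alt _ _ _]/([:: nxt i; prv i] ++ alt r.*2 _ _) ev_cat.
move: (ev [:: _; _]) (axisA i) (axisB i) hA hB IA IB => S a b hA hB IA IB.
by rewrite -!mulmxA IA IB -!scalemxAr hA hB !scalerA -[r.*2.+2]addn2 exprD (invfM (Lam ^+ r.*2)).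

Qed.

Lemma expR_lnLam (r : nat) : expR (r%:R * ln Lam) = Lam ^+ r.
Proof. by rewrite expRM_natl lnK // posrE (lt_trans _ (Lam_gt1 R)). Qed.

Lemma geod_alt i r t : geod (axisA i) (axisB i) (t + r.*2%:R * ln Lam) =
  ev (alt r.*2 (nxt i) (prv i)) *m geod (axisA i) (axisB i) t.
Proof.
have [] := axis_alt i r; move: (ev _) (axisA i) (axisB i) => S a b hA hB.
rewrite /geod mulmxDr -!scalemxAr hA hB !scalerA opprD !expRD.
by rewrite (expRN (r.*2%:R * _)) expR_lnLam.
Qed.

Lemma axis_vertex i t : geod (axisA i) (axisB i) t =
  ((expR (ln Lam - t) - expR (t - ln Lam)) / (2 * s3)) *: vertex i +
  ((expR t - expR (- t)) / (2 * s3)) *: vertex (nxt i).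
Proof.
have L0 : 0 < Lam by rewrite (lt_trans _ (Lam_gt1 R)).
have Li : Lam^-1 = 2 - s3.
  apply: (mulfI (lt0r_neq0 L0)); rewrite mulfV ?lt0r_neq0 // /Lam.
  by rewrite mulrBr !mulrDl s3s3; ring.
rewrite /geod /axisA /axisB !expRD (expRN (ln _)) lnK ?posrE // Li.
move: (vertex i) (vertex (nxt i)) => v v'.
by apply/colP => r; rewrite !mxE /Lam; field; rewrite gt_eqF // s3_gt0.
Qed.

Lemma axis_hyp i t : hyp (geod (axisA i) (axisB i) t).
Proof.
have v0 : vertex i = geod (axisA i) (axisB i) 0 by rewrite /geod oppr0 expR0 !scale1r axis_sum.
apply: (hyp_of_lorentz (vertex_hyp R i)).
  have := geod_geod t t (axis_null R i); rewrite subrr expR0; lra.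
rewrite v0; have := geod_geod 0 t (axis_null R i).
have := expR_gt0 (t - 0); have := expR_gt0 (0 - t); lra.
Qed.

Lemma vgram_le0 i j : vgram i j <= 0.
Proof. by move: i j; apply: all_letters2. Qed.

Lemma axis_dom i t : 0 <= t -> t <= ln Lam -> dom (geod (axisA i) (axisB i) t) /\
  (0 < t < ln Lam -> forall j, lorentz (normal j) (geod (axisA i) (axisB i) t) = 0 -> j = i).
Proof.
have s30 := s3_gt0 R; move=> t0 tN; rewrite axis_vertex.
set p := _ / _; set q := _ / _.
have p0 : 0 <= p by rewrite divr_ge0 ?subr_ge0 ?ler_expR ?mulr_ge0 ?(ltW s30) //; lra.
have q0 : 0 <= q by rewrite divr_ge0 ?subr_ge0 ?ler_expR ?mulr_ge0 ?(ltW s30) //; lra.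
have v0 j j' : lorentz (normal j) (vertex j') <= 0.
  by rewrite lorentz_vertex pmulr_rle0 // lerz0 vgram_le0.
split=> [j|/andP[t0' tN'] j].
  by rewrite !lorentz_lin -[X in _ <= X]addr0 lerD // mulr_ge0_le0.
rewrite !lorentz_lin => e.
have pp : 0 < p by rewrite divr_gt0 ?subr_gt0 ?ltr_expR ?mulr_gt0 //; lra.
have qp : 0 < q by rewrite divr_gt0 ?subr_gt0 ?ltr_expR ?mulr_gt0 //; lra.
have h1 := mulr_ge0_le0 p0 (v0 j i); have h2 := mulr_ge0_le0 q0 (v0 j (nxt i)).
have e1 : p * lorentz (normal j) (vertex i) = 0 by lra.
have e2 : q * lorentz (normal j) (vertex (nxt i)) = 0 by lra.
move/eqP: e1; rewrite mulf_eq0 (gt_eqF pp) lorentz_vertex mulf_eq0 (gt_eqF s30) intr_eq0 /= => v1.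
move/eqP: e2; rewrite mulf_eq0 (gt_eqF qp) lorentz_vertex mulf_eq0 (gt_eqF s30) intr_eq0 /= => v2.
apply/eqP; move: v1 v2 => /eqP v1 /eqP v2.
have : (vgram i j == 0) ==> (vgram (nxt i) j == 0) ==> (j == i) by move: i j {p q p0 q0 e pp qp h1 h2 v1 v2}; exact: all_letters2.
by rewrite v1 v2.
Qed.

Lemma ev_nseq2 s i : ev (nseq s.*2 i) = 1%:M.
Proof.
elim: s => // s IH; rewrite doubleS /= IH mulmx1.
by apply: mx_act_inj => x; rewrite -mulmxA refl_refl mul1mx.
Qed.

Section Quotient.
Variables (F : fieldType) (k : nat) (Q : {poly F}).
Hypotheses (k1 : (1 < k)%N) (sQ : size Q = (4 * k - 3)%N)
  (charF : forall m : nat, (0 < m <= 4 * k)%N -> m%:R != 0 :> F).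
Notation P := (P ('X^4 : {poly F}) 'X^3).
Notation T := (T ('X^4 : {poly F}) 'X^3).

Lemma relator_weq u w : weq u w -> relator Q u -> relator Q w.
Proof. by move=> e h i j; rewrite -(P_weq _ _ e). Qed.

Lemma relator_rev w : relator Q w -> relator Q (rev w).
Proof. by move=> h i j; rewrite P_rev mxE. Qed.

(** The word is split into halves of length r. Their [P] have degree at most 4(r - 1), less than the
    degree 4(k - 1) of [Q], so congruence modulo [Q] is equality; [parabolic] with no letters
    allowed then shows that the word is trivial. *)
Lemma relator_alt_small i r : relator Q (alt r.*2 (nxt i) (prv i)) -> (r < k)%N ->
  weq (alt r.*2 (nxt i) (prv i)) [::].
Proof.
move=> rel rk; pose u := alt r (nxt i) (prv i).
have [u' su' eu] : exists2 u', size u' = r & alt r.*2 (nxt i) (prv i) = u ++ rev u'.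
  have sa q p p' : size (alt q p p') = q by elim: q p p' => //= q IH p p'; rewrite IH.
  rewrite -addnn alt_cat; exists (rev (if odd r then alt r (prv i) (nxt i) else u)).
    by rewrite size_rev; case: (odd r); exact: sa.
  by rewrite revK.
have su : size u = r by rewrite /u; elim: (r) (nxt i) (prv i) => //= q IH p p'; rewrite IH.
pose D := P u - P u'.
have PE : P (alt r.*2 (nxt i) (prv i)) = D *m T (rev u').
  rewrite eu P_cat /D mulmxBl; congr (_ + _).
  by apply/eqP; rewrite -addr_eq0 addrC P_revK.
have TT : T (rev u') *m T u' = 1%:M.
  by rewrite -T_cat /T (P_weq _ _ (weq_Krev u')) mulmx0 addr0.
have DE : D = P (alt r.*2 (nxt i) (prv i)) *m T u' by rewrite PE -mulmxA TT mulmx1.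
have D0 : D = 0.
  apply/matrixP => p q; rewrite [RHS]mxE; apply/eqP; apply: contraT => nz.
  have dv : Q %| D p q by rewrite DE mxE; apply: dvdp_sum => m; rewrite dvdp_mulr.
  have := dvdp_leq nz dv; rewrite sQ leqNgt => /negP; case.
  rewrite /D !mxE; apply: leq_ltn_trans (size_polyD _ _) _; rewrite size_polyN gtn_max.
  have rk' : ((4 * r.-1).+1 < 4 * k - 3)%N by clear -rk k1; lia.
  have := size_P F u p q; have := size_P F u' p q; rewrite su su' => h1 h2.
  by apply/andP; split; exact: leq_ltn_trans rk'.
have [||a Ja wa] := @parabolic F pred0 (alt r.*2 (nxt i) (prv i)).
- by move=> p q; rewrite PE D0 mul0mx mxE eqxx.
- move=> m /andP[m0 m1]; apply: charF; rewrite m0 (leq_trans m1) // eu size_cat size_rev su su'; lia.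
by case: a Ja wa.
Qed.

(** Up to a power of the translation by 2L, [z] moves the side less than its length. Strictness of
    the fundamental domain and evenness make the remainder trivial, so [z] is such a power, and
    [relator_alt_small] excludes exponents below k. *)
Lemma wall_translation_length z i l : even_word z -> relator Q z -> 0 < l ->
  (forall t, geod (axisA i) (axisB i) (t + l) = ev z *m geod (axisA i) (axisB i) t) ->
  (2 * k)%:R * ln Lam <= l.
Proof.
move=> ez rz l0 eqv; set N := ln Lam.
have N0 : 0 < N by rewrite ln_gt0 // Lam_gt1.
(* The integer nearest to l / (2N), so that the remaining translation [d] is at most N in absolute
   value. *)
have [r /andP[r1 r2]] : exists r : nat, r%:R <= l / (2 * N) + 2^-1 < r.+1%:R.
  set q := l / _ + _; have q0 : 0 <= q by rewrite addr_ge0 // divr_ge0 ?mulr_ge0 // ltW.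
  have fl0 : 0 <= Num.floor q by rewrite floor_ge0.
  exists `|Num.floor q|%N.
  have e : (`|Num.floor q|%N)%:R = (Num.floor q)%:~R :> R by rewrite -[in RHS](gez0_abs fl0) pmulrn.
  by have := floorD1_gt q; rewrite -natr1 e floor_le rmorphD.
pose d := l - r.*2%:R * N.
have lE : l / (2 * N) * (2 * N) = l by rewrite divfK // lt0r_neq0 // mulr_gt0.
have rE : r.*2%:R = 2 * r%:R :> R by rewrite -mul2n natrM.
have d1 : - N <= d <= N.
  have N2 : 0 < 2 * N by rewrite mulr_gt0.
  have eN : (l / (2 * N) + 2^-1) * (2 * N) = l + N.
    by rewrite [LHS]mulrDl lE; congr (_ + _); field.
  move: r1 r2; rewrite -(ler_pM2r N2) -(ltr_pM2r N2) eN -natr1 /d rE => r1 r2.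
  by apply/andP; split; lra.
pose w := rev (alt r.*2 (nxt i) (prv i)) ++ z.
have eqw t : geod (axisA i) (axisB i) (t + d) = ev w *m geod (axisA i) (axisB i) t.
  rewrite /w ev_cat -mulmxA -eqv.
  have -> : t + l = (t + d) + r.*2%:R * N by rewrite /d; ring.
  by rewrite geod_alt ev_Arev.
(* The times (N - d)/2 and (N + d)/2 both lie in [0, N]; [w] maps the first point of the side to the
   second, so they coincide. *)
have [dm1 _] := @axis_dom i ((N - d) / 2) ltac:(lra) ltac:(rewrite -/N; lra).
have [dm2 _] := @axis_dom i ((N + d) / 2) ltac:(lra) ltac:(rewrite -/N; lra).
have [|e [w' ww' hw']] := dom_word dm1 dm2 (w := w).
  by rewrite -eqw; congr (geod _ _ _); field.
have d0 : d = 0 by have := geod_inj (axis_null R i) e; lra.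
have [_ hi] := @axis_dom i ((N + d) / 2) ltac:(lra) ltac:(rewrite -/N; lra).
have wi : w' = nseq (size w') i.
  apply/all_pred1P/allP => j jw /=; apply/eqP; apply: hi; last exact: hw'.
  by rewrite -/N d0; apply/andP; split; lra.
have ew' : even_word w'.
  rewrite (even_weq ww'); apply: even_cat ez; rewrite even_rev; apply: even_alt.
  exact: apart_nxt_prv.
have evw : ev w = 1%:M.
  rewrite -(ev_weq _ ww') wi -(odd_double_half (size w')) (negbTE (even_size ew')).
  exact: ev_nseq2.
have wz : weq z (alt r.*2 (nxt i) (prv i)).
  by apply: (@ev_inj R); rewrite -[RHS]mulmx1 -evw /w ev_cat mulmxA ev_revK mul1mx.
have [kr|rk] := leqP k r.
  have -> : l = r.*2%:R * N by move: d0; rewrite /d; lra.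
  by rewrite ler_pM2r // ler_nat -mul2n leq_mul2l.
have := relator_alt_small (relator_weq wz rz) rk => /(weq_trans wz) z0.
have := eqv 0; rewrite (ev_weq _ z0) mul1mx => /(geod_inj (axis_null R i)).
by move: l0; lra.
Qed.

(** The ends [A] and [B] are multiples of [axisA i] and [axisB i], possibly exchanged; in the
    exchanged case the inverse of [z] is used. *)
Theorem wall_length A B n0 z i l : null_pair A B -> n0 = normal i ->
  lorentz n0 A = 0 -> lorentz n0 B = 0 -> 0 < l ->
  (forall t, geod A B (t + l) = ev z *m geod A B t) -> even_word z -> relator Q z ->
  (2 * k)%:R * ln Lam <= l.
Proof.
move=> AB -> nA nB l0 eqv ez rz.
have [hA hB] := axis_ends eqv; have [aa bb ab] := AB.
have [nA' nB'] := axis_normal R i; have AB' := axis_null R i.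
have thm := @wall_translation_length _ i l _ _ l0.
move: (axisA i) (axisB i) nA' nB' AB' thm => A' B' nA' nB' AB' thm.
have [aa' bb' ab'] := AB'.
have nn : lorentz (normal i) (normal i) = 1 by rewrite lorentz_normal gram_eq.
have eA := plane_decomp AB' nn nA' nB' nA; have eB := plane_decomp AB' nn nA' nB' nB.
move: eA eB; set a1 := - 2 * _; set a2 := - 2 * _; set b1 := - 2 * _; set b2 := - 2 * _ => eA eB.
have qa : a1 * a2 = 0 by move: aa; rewrite eA !lorentz_lin aa' bb' (lorentzC B') ab'; lra.
have qb : b1 * b2 = 0 by move: bb; rewrite eB !lorentz_lin aa' bb' (lorentzC B') ab'; lra.
have qab : a1 * b2 + a2 * b1 = 1 by move: ab; rewrite eA eB !lorentz_lin aa' bb' (lorentzC B') ab'; lra.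
have unscale (c e : R) (X : 'cV[R]_3) : c != 0 -> ev z *m (c *: X) = e *: (c *: X) -> ev z *m X = e *: X.
  by move=> c0; rewrite -scalemxAr scalerA mulrC -scalerA => /(scalerI c0).
move/eqP: qa; rewrite mulf_eq0 => /orP[/eqP z1|/eqP z2].
  have a20 : a2 != 0 by apply/eqP => h; move: qab; rewrite h z1; lra.
  have b10 : b1 != 0 by apply/eqP => h; move: qab; rewrite h z1; lra.
  have b20 : b2 = 0 by apply: (mulfI b10); rewrite mulr0.
  rewrite z1 scale0r add0r in eA; rewrite b20 scale0r addr0 in eB.
  rewrite eA in hA; rewrite eB in hB.
  have {}hA := unscale _ _ _ a20 hA; have {}hB := unscale _ _ _ b10 hB.
  apply: (thm (rev z)) => //; [by rewrite even_rev|exact: relator_rev|].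
  move=> t; rewrite -[LHS](ev_Arev z); congr (_ *m _).
  rewrite /geod mulmxDr -!scalemxAr hA hB !scalerA -!expRD.
  by congr (expR _ *: _ + expR _ *: _); ring.
have a10 : a1 != 0 by apply/eqP => h; move: qab; rewrite h z2; lra.
have b20 : b2 != 0 by apply/eqP => h; move: qab; rewrite h z2; lra.
have b10 : b1 = 0 by apply: (mulIf b20); rewrite mul0r.
rewrite z2 scale0r addr0 in eA; rewrite b10 scale0r add0r in eB.
rewrite eA in hA; rewrite eB in hB.
have {}hA := unscale _ _ _ a10 hA; have {}hB := unscale _ _ _ b20 hB.
apply: (thm z) => // t.
rewrite /geod mulmxDr -!scalemxAr hA hB !scalerA -!expRD.
by congr (expR _ *: _ + expR _ *: _); ring.
Qed.
End Quotient.

(** * The modulus *)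

Section Chebyshev.
Variable F : fieldType.
Notation cheb n := (cheb ('X^4 : {poly F}) n).

Lemma cheb_size (n : nat) : [/\ (cheb n).1 \is monic, size (cheb n).1 = (4 * n).+1 & (size (cheb n).2 <= 4 * n)%N].
Proof.
elim: n => [|n [m1 h1 h2]]; first by rewrite monic1 size_poly1 size_poly0.
have sM : size ('X^4 * (cheb n).1) = (4 * n.+1).+1.
  by rewrite size_monicM ?monicXn ?monic_neq0 // size_polyXn h1 mulnS.
have lt : (size (- (cheb n).2)%R < size ('X^4 * (cheb n).1)%R)%N.
  by rewrite size_polyN sM; apply: leq_ltn_trans h2 _; rewrite ltnS leq_mul2l /= leqnSn.
split=> /=.
- by rewrite monicE lead_coefDl //= -monicE monicMl ?monicXn.
- by rewrite size_polyDl.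
- by rewrite h1 mulnS; lia.
Qed.

Definition modulus m := (cheb m).1 ^+ 2 - (cheb m).2 ^+ 2.

(** The degree is 8m = 4(k - 1) for k = 2m + 1, precisely the bound in [P_degree]. *)
Lemma size_modulus m : (0 < m)%N -> size (modulus m) = (4 * m.*2.+1 - 3)%N.
Proof.
move=> m0; have [h1 h2 h3] := cheb_size m.
have s1 : size ((cheb m).1 ^+ 2) = (8 * m).+1.
  by rewrite expr2 size_monicM ?monic_neq0 // h2 /=; lia.
rewrite /modulus size_polyDl.
  by rewrite s1; lia.
rewrite size_polyN s1 expr2; apply: leq_ltn_trans (size_polyMleq _ _) _.
by move: h3; move: (size _) => s; lia.
Qed.

Lemma relator_alt m i j : apart i j -> relator (modulus m) (alt (m.*2.+1).*2 i j).
Proof. by move=> ij p q; rewrite P_alt // mxE dvdp_mulIl. Qed.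
End Chebyshev.
End WallLength.

(** * The tiles *)

Section Hexagon.
Variable R : realType.
Implicit Types (x y n : 'cV[R]_3) (i j : letter) (w : word).
Notation normal := (@normal R).
Notation vertex := (@vertex R).
Notation B i z := (lorentz (normal i) z).
Notation ev := (@ev R).
Notation s3 := (@s3 R).
Notation s2 := (@s2 R).
Notation origin := (@origin R).

Lemma sin_pi3 : sin (pi / 3 : R) = s3 / 2.
Proof.
have s0 : 0 < sin (pi / 3 : R).
  by apply: sin_gt0_pi; have := pi_gt0 R => h; apply/andP; split; lra.
have := cos2Dsin2 (pi / 3 : R); rewrite cos_pi3 => h.
have e : sin (pi / 3 : R) ^+ 2 = (s3 / 2) ^+ 2.
  by rewrite expr_div_n [s3 ^+ 2]expr2 s3s3; move: h; rewrite expr_div_n expr1n; lra.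
by apply/eqP; rewrite -(eqrXn2 (ltn0Sn 1)) ?e // ltW // divr_gt0 // s3_gt0.
Qed.

Lemma hex_vertexE (k : nat) : hex_vertex k = vertex (inZp k).
Proof.
have : cos (k%:R * (pi / 3) : R) = (va (inZp k))%:~R / 2 /\
       sin (k%:R * (pi / 3) : R) = (vb (inZp k))%:~R * s3 / 2.
  elim: k => [|k [IH1 IH2]]; first by rewrite mul0r cos0 sin0; split; rewrite /va /vb /=; field.
  have -> : inZp k.+1 = nxt (inZp k).
    by apply/val_inj; rewrite /= -[k.+1]addn1 -[(k %% 6).+1]addn1 modnDml.
  move: (inZp k) IH1 IH2 => i IH1 IH2.
  have h : (2 * va (nxt i) == va i - 3 * vb i) && (2 * vb (nxt i) == va i + vb i).
    by move: (i); exact: all_letters.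
  case/andP: h => /eqP /(congr1 (fun q : int => q%:~R : R)) h1 /eqP /(congr1 (fun q : int => q%:~R : R)) h2.
  move: h1 h2; rewrite rmorphB !rmorphD !rmorphM /= => h1 h2.
  rewrite -natr1 mulrDl mul1r cosD sinD IH1 IH2 cos_pi3 sin_pi3; have ss := s3s3 R.
  split.
    transitivity (((va i)%:~R - (vb i)%:~R * (s3 * s3)) / 4); first by field.
    by rewrite ss; lra.
  transitivity (((va i)%:~R + (vb i)%:~R) * s3 / 4); first by field.
  by rewrite -h2; field.
case=> hc hs; apply: cV3P; rewrite !mxE //= ?hc ?hs -/(s2) -/(s3).
  by ring.
by ring.
Qed.

Lemma inZp_ord i : inZp i = i. Proof. exact: valZpK. Qed.

Lemma inZp_nxt i : inZp i.+1 = nxt i.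
Proof. exact/val_inj. Qed.

Lemma B_vertex_le0 i j : B i (vertex j) <= 0.
Proof. by rewrite lorentz_vertex pmulr_rle0 ?s3_gt0 // lerz0 vgram_le0. Qed.

Lemma hexagonE x : hexagon x <-> hyp x /\ exists c : 'I_6 -> R,
  (forall k, 0 <= c k) /\ x = \sum_(k < 6) c k *: vertex k.
Proof.
split=> -[hx [c [c0 e]]]; split=> //; exists c; split=> //; rewrite e;
  by apply: eq_bigr => k _; rewrite hex_vertexE inZp_ord.
Qed.

Lemma B_sum i (c : 'I_6 -> R) : B i (\sum_(k < 6) c k *: vertex k) = \sum_(k < 6) c k * B i (vertex k).
Proof.
rewrite lorentzC lorentz_suml; apply: eq_bigr => k _.
by rewrite lorentzC lorentzZr.
Qed.

Lemma hexagon_dom x : hexagon x -> hyp x /\ dom x.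
Proof.
move=> /hexagonE[hx [c [c0 e]]]; split=> // i.
rewrite e B_sum; apply: sumr_le0 => k _.
by rewrite mulr_ge0_le0 // B_vertex_le0.
Qed.

Lemma vgram_lt0 i : vgram (nxt (nxt i)) i < 0.
Proof. by move: i; exact: all_letters. Qed.

Lemma hexagon_interior_sdom x : hexagon_interior x -> hyp x /\ sdom x.
Proof.
move=> [hx [c [c0 e]]]; split=> // i.
have -> : x = \sum_(k < 6) c k *: vertex k.
  by rewrite e; apply: eq_bigr => k _; rewrite hex_vertexE inZp_ord.
rewrite B_sum (bigD1 (nxt (nxt i))) //=.
have h1 : c (nxt (nxt i)) * B i (vertex (nxt (nxt i))) < 0.
  by rewrite pmulr_rlt0 // lorentz_vertex pmulr_rlt0 ?s3_gt0 // ltrz0 vgram_lt0.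
have h2 : \sum_(k < 6 | k != nxt (nxt i)) c k * B i (vertex k) <= 0.
  apply: sumr_le0 => k _; by rewrite mulr_ge0_le0 ?B_vertex_le0 // ltW.
lra.
Qed.

Lemma B_vertex_nxt i : [/\ B i (vertex i) = 0, B i (vertex (nxt i)) = 0,
  B (prv i) (vertex i) = 0, B (prv i) (vertex (nxt i)) = - s3 &
  B (nxt i) (vertex i) = - s3 /\ B (nxt i) (vertex (nxt i)) = 0].
Proof.
have : [&& vgram i i == 0, vgram (nxt i) i == 0, vgram i (prv i) == 0, vgram (nxt i) (prv i) == -1,
  vgram i (nxt i) == -1 & vgram (nxt i) (nxt i) == 0] by move: i; exact: all_letters.
case/and5P => /eqP h1 /eqP h2 /eqP h3 /eqP h4 /andP[/eqP h5 /eqP h6].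
by rewrite !lorentz_vertex h1 h2 h3 h4 h5 h6 !mulr0 mulrN1.
Qed.

(* Coordinates of x in the sector spanned by the side i and the centre. *)
Lemma sector x i : x = ((B i x - B (nxt i) x) / s3) *: vertex i +
  ((B i x - B (prv i) x) / s3) *: vertex (nxt i) + (- B i x) *: origin.
Proof.
have s30 := lt0r_neq0 (s3_gt0 R); have [nA nB] := axis_normal R i.
have nn : B i (normal i) = 1 by rewrite lorentz_normal gram_eq.
have [g1 g2 g3 g4 [g5 g6]] := B_vertex_nxt i.
apply/eqP; rewrite -subr_eq0; apply/eqP.
set Y := x - _.
have YE j : B j Y = B j x - (((B i x - B (nxt i) x) / s3) * B j (vertex i) +
  ((B i x - B (prv i) x) / s3) * B j (vertex (nxt i)) + B i x).
  by rewrite /Y lorentzDr lorentzNr !lorentzDr !lorentzZr B_origin; ring.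
have Yi : B i Y = 0 by rewrite YE g1 g2; ring.
have Yn : B (nxt i) Y = 0 by rewrite YE g5 g6; field.
have Yp : B (prv i) Y = 0 by rewrite YE g3 g4; field.
have [f1 f2] := vertexE R i.
have e1 : 3 *: vertex i = s3 *: (2 *: normal (prv i) + normal (nxt i)).
  rewrite scalerDr scalerA mulrC -scalerA f1 f2.
  by apply/colP => r; rewrite !mxE; ring.
have e2 : 3 *: vertex (nxt i) = s3 *: (2 *: normal (nxt i) + normal (prv i)).
  rewrite scalerDr scalerA mulrC -scalerA f1 f2.
  by apply/colP => r; rewrite !mxE; ring.
have Y1 : lorentz Y (vertex i) = 0.
  have h : 3 * lorentz Y (vertex i) = 0.
    by rewrite -lorentzZr e1 lorentzZr lorentzDr lorentzZr lorentzC Yp lorentzC Yn; ring.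
  lra.
have Y2 : lorentz Y (vertex (nxt i)) = 0.
  have h : 3 * lorentz Y (vertex (nxt i)) = 0.
    by rewrite -lorentzZr e2 lorentzZr lorentzDr lorentzZr lorentzC Yn lorentzC Yp; ring.
  lra.
rewrite (plane_decomp (axis_null R i) nn nA nB Yi) /axisA /axisB.
rewrite !lorentzZr !lorentzDr !lorentzNr !lorentzZr Y1 Y2.
by rewrite !mulr0 subrr !mulr0 !scale0r addr0.
Qed.

Lemma origin_vertices : origin = \sum_(k < 6) (6 * s3)^-1 *: vertex k.
Proof.
have s30 := lt0r_neq0 (s3_gt0 R).
rewrite -scaler_sumr !big_ord_recl big_ord0 addr0.
by apply: cV3P; rewrite !mxE /= /va /vb /=; field.
Qed.

(** The side with maximal [B i x] is the nearest one, which makes all coefficients in [sector]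
    nonnegative: [x] lies in the cone over that side from the centre. The centre itself is a
    positive combination of the vertices. *)
Lemma dom_hexagon x : hyp x -> dom x -> hexagon x.
Proof.
move=> hx dx; apply/hexagonE; split=> //; have s30 := s3_gt0 R.
pose i := [arg max_(i > (ord0 : 'I_6)) B i x]%O.
have im j : B j x <= B i x.
  by rewrite /i; case: arg_maxP => // i0 _ h; exact: h.
exists (fun k => (k == i)%:R * ((B i x - B (nxt i) x) / s3) +
  (k == nxt i)%:R * ((B i x - B (prv i) x) / s3) + (- B i x) * (6 * s3)^-1); split.
  move=> k; rewrite !addr_ge0 // mulr_ge0 ?ler0n // ?divr_ge0 ?subr_ge0 ?im ?oppr_ge0 ?invr_ge0 ?mulr_ge0 // ltW //.
rewrite {1}[x](sector x i) origin_vertices scaler_sumr.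
under [RHS]eq_bigr do rewrite !scalerDl -[X in _ + X]scalerA.
rewrite !big_split /=; congr (_ + _ + _).
  rewrite (bigD1 i) //= eqxx mul1r big1 ?addr0 // => k /negbTE ->.
  by rewrite mul0r scale0r.
rewrite (bigD1 (nxt i)) //= eqxx mul1r big1 ?addr0 // => k /negbTE ->.
by rewrite mul0r scale0r.
Qed.

Lemma hex_sideE i x : hex_side i x <-> [/\ hyp x, dom x & B i x = 0].
Proof.
have [g1 g2 g3 g4 [g5 g6]] := B_vertex_nxt i; have s30 := s3_gt0 R.
rewrite /hex_side /hsegment /= !hex_vertexE inZp_ord inZp_nxt; split.
  move=> [hx [a [b [a0 b0 e]]]]; split=> //.
    by move=> j; rewrite e !lorentz_lin -[X in _ <= X]addr0 lerD // mulr_ge0_le0 // B_vertex_le0.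
  by rewrite e !lorentz_lin g1 g2; ring.
move=> [hx dx e]; split=> //.
exists ((B i x - B (nxt i) x) / s3), ((B i x - B (prv i) x) / s3); split.
- by rewrite divr_ge0 ?(ltW s30) // e sub0r oppr_ge0.
- by rewrite divr_ge0 ?(ltW s30) // e sub0r oppr_ge0.
- by rewrite {1}(sector x i) e oppr0 scale0r addr0.
Qed.

(** All vertices have time coordinate sqrt 3. Since the product of [x] with each vertex is at most
    -1, the coefficients of [x] add up to at most 1. *)
Lemma dom_time x : hyp x -> dom x -> x 0 0 <= s3.
Proof.
move=> hx dx; have [_ [c [c0 e]]] := (hexagonE x).1 (dom_hexagon hx dx).
have xo : x 0 0 = s3 * \sum_k c k.
  rewrite {1}e summxE mulr_sumr; apply: eq_bigr => k _; rewrite !mxE /=; ring.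
have : \sum_k c k <= 1.
  have [n1 _] := hx; have : - lorentz x x = 1 by rewrite n1 opprK.
  rewrite {1}e lorentz_suml -sumrN => <-; apply: ler_sum => k _.
  rewrite lorentzZl -mulrN -[X in X <= _]mulr1 ler_wpM2l //.
  by have := hyp_lorentz (vertex_hyp R k) hx; lra.
by move=> h; rewrite xo -[X in _ <= X]mulr1 ler_wpM2l // ltW // s3_gt0.
Qed.
End Hexagon.

(** * The deck group on words, and its finite index *)

Section Kernel.
Variables (F : fieldType) (Q : {poly F}).
Implicit Types (u w z : word) (i j : letter).
Notation P := (P ('X^4 : {poly F}) 'X^3).
Notation T := (T ('X^4 : {poly F}) 'X^3).

Definition ker w := even_word w /\ relator Q w.

Lemma relator_nil : relator Q [::].
Proof. by move=> i j; rewrite mxE dvdp0. Qed.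

Lemma relator_cat u w : relator Q u -> relator Q w -> relator Q (u ++ w).
Proof. by move=> ru rw i j; rewrite -(subrK (P w i j) (P (u ++ w) i j)) dvdp_add // relator_cat_dvd. Qed.

(** When [P z] vanishes modulo [Q], so does [T z - 1], and the cocycle relation then gives P(u z
    u^-1) = P(u u^-1) = 0 modulo [Q]. *)
Lemma relator_conj u z : relator Q z -> relator Q (u ++ z ++ rev u).
Proof.
move=> rz i j; have e0 : P (u ++ rev u) = 0 by rewrite (P_weq _ _ (weq_revK u)).
pose D := P (z ++ rev u) - P (rev u).
have -> : P (u ++ z ++ rev u) = P u *m (coxm ('X^4 : {poly F}) 'X^3 *m D) + D.
  rewrite -[LHS](subr0) -e0 !P_cat -/D (_ : _ - _ = P u *m (T (z ++ rev u) - T (rev u)) + D).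
    by congr (_ *m _ + _); rewrite /T opprD addrACA subrr add0r -mulmxBr.
  by rewrite mulmxBr /D P_cat opprD addrACA.
have dD p q : Q %| D p q by rewrite /D !mxE; exact: relator_cat_dvd.
rewrite mxE dvdp_add // mxE; apply: dvdp_sum => p.
by rewrite dvdp_mull // mxE; apply: dvdp_sum => q; rewrite dvdp_mull.
Qed.

Lemma ker_nil : ker [::]. Proof. by split=> //; exact: relator_nil. Qed.

Lemma ker_cat u w : ker u -> ker w -> ker (u ++ w).
Proof. by move=> [e1 r1] [e2 r2]; split; [exact: even_cat|exact: relator_cat]. Qed.

Lemma ker_rev w : ker w -> ker (rev w).
Proof. by move=> [e r]; split; rewrite ?even_rev //; exact: relator_rev. Qed.

Lemma ker_conj u w : ker w -> ker (u ++ w ++ rev u).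
Proof. by move=> [e r]; split; rewrite ?even_conj //; exact: relator_conj. Qed.

Lemma ker_weq u w : weq u w -> ker u -> ker w.
Proof. by move=> e [h r]; split; [rewrite -(even_weq e)|exact: relator_weq r]. Qed.
End Kernel.

Section Classes.
Variables (F : finFieldType) (Q : {poly F}).
Hypothesis Q0 : Q != 0.
Implicit Types (u w z : word) (i j : letter).
Notation P := (P ('X^4 : {poly F}) 'X^3).
Notation T := (T ('X^4 : {poly F}) 'X^3).

Definition residue w : 'M['rV[F]_(size Q).-1]_6 := \matrix_(i, j) poly_rV (P w i j %% Q).
Definition signs w : bool * bool :=
  (odd (count (fun j : letter => odd j) w), odd (count (fun j : letter => ~~ odd j) w)).

(** P u - P w = P(u w^-1) T w, and [T w] is invertible. *)
Lemma residueP u w : residue u = residue w <-> relator Q (u ++ rev w).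
Proof.
have step : residue u = residue w <-> forall i j, Q %| P u i j - P w i j.
  have szm p : (size (p %% Q)%R <= (size Q).-1)%N.
    by have := ltn_modpN0 p Q0; case: (size Q).
  split.
    move/matrixP => h i j; have := h i j; rewrite !mxE => /(congr1 rVpoly).
    rewrite !poly_rV_K // => e; rewrite /dvdp modpD modpN e subrr; exact: eqxx.
  move=> h; apply/matrixP => i j; rewrite !mxE; congr poly_rV.
  by have := h i j; rewrite /dvdp modpD modpN subr_eq0 => /eqP.
have PE : P (u ++ rev w) = (P u - P w) *m T (rev w).
  rewrite P_cat mulmxBl; congr (_ + _).
  by apply/eqP; rewrite -addr_eq0 addrC P_revK.
have DE : P u - P w = P (u ++ rev w) *m T w.
  rewrite PE -mulmxA -T_cat.
  by rewrite (_ : T (rev w ++ w) = 1%:M) ?mulmx1 // /T (P_weq _ _ (weq_Krev w)) mulmx0 addr0.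
rewrite step; split=> h i j.
  rewrite PE mxE; apply: dvdp_sum => p; rewrite dvdp_mulr //.
  by have := h i p; rewrite !mxE.
have -> : P u i j - P w i j = (P u - P w) i j by rewrite !mxE.
by rewrite DE mxE; apply: dvdp_sum => p; rewrite dvdp_mulr.
Qed.

Lemma signsP u w : signs u = signs w <-> even_word (u ++ rev w).
Proof.
rewrite /signs /even_word !count_cat !count_rev !oddD !negb_add.
by split=> [[-> ->]|/andP[/eqP -> /eqP ->]]; rewrite ?eqxx.
Qed.

Lemma classP u w : (signs u = signs w /\ residue u = residue w) <-> ker Q (u ++ rev w).
Proof. by rewrite signsP residueP. Qed.
End Classes.

(** * Discreteness and stabilizers *)

Section Discrete.
Variable R : realType.
Implicit Types (x y n : 'cV[R]_3) (i j : letter) (w V : word) (L : seq word).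
Notation normal := (@normal R).
Notation B i z := (lorentz (normal i) z).
Notation ev := (@ev R).

Lemma ev_invmx w : invmx (ev w) = ev (rev w).
Proof.
have [u _] := mulmx1_unit (ev_revK R w).
by rewrite -[LHS]mul1mx -(ev_Krev R w) -mulmxA mulmxV // mulmx1.
Qed.

Lemma hdist_ge (x y : 'cV[R]_3) c : hyp x -> hyp y -> 1 < c -> hdist x y < ln c -> - lorentz x y < c.
Proof.
move=> hx hy c1; have := hyp_lorentz hx hy; rewrite /hdist /arcosh; set a := - lorentz x y => h.
have a1 : 1 <= a by rewrite /a; lra.
have s0 : 0 <= Num.sqrt (a ^+ 2 - 1) by exact: sqrtr_ge0.
rewrite ltr_ln ?posrE; lra.
Qed.

Lemma min_gt1 (T : eqType) (s : seq T) (f : T -> R) : {in s, forall e, 1 < f e} ->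
  exists2 c, 1 < c & {in s, forall e, c <= f e}.
Proof.
elim: s => [|a s IH] h; first by exists 2; rewrite // (ltr_nat _ 1 2).
have [|c c1 hc] := IH; first by move=> e es; apply: h; rewrite inE es orbT.
exists (Num.min c (f a)); first by rewrite lt_min c1 h // mem_head.
by move=> e; rewrite inE ge_min => /orP[/eqP ->|/hc ->]; rewrite ?lexx ?orbT.
Qed.

(** The constant is the least hyperbolic cosine of the distance from [y] to a side not through it.
    If the head layer contains such a side, this side separates [y] from its image; otherwise the
    head fixes [y] and is peeled off. *)
Lemma discrete y : hyp y -> dom y -> exists2 c, 1 < c &
  forall w, - lorentz y (ev w *m y) < c -> ev w *m y = y.
Proof.
move=> hy dy.
have [|c c1 hc] := @min_gt1 _ [seq i <- enum 'I_6 | B i y < 0] (fun i => Num.sqrt (1 + B i y ^+ 2)).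
  move=> i; rewrite mem_filter => /andP[h _].
  rewrite -[X in X < _]sqrtr1 ltr_sqrt; last by rewrite ltr_pwDl ?sqr_ge0.
  by rewrite ltrDl lt_neqAle sqr_ge0 eq_sym sqrf_eq0 lt_eqF.
exists c => // w; have [L [lL wL _ _]] := lay_nf w; rewrite -(ev_weq _ wL) {w wL}.
elim: L lL => [|V L IH] lL; first by rewrite mul1mx.
move=> lt; have h0 : {in V, forall i, B i y = 0}.
  move=> i iV; apply/eqP; rewrite eq_le dy leNgt; apply/negP => neg.
  have [st1 _ _] := lay_st lL dy.
  have := lorentz_separated hy (ev_hyp (flatten (V :: L)) hy) (dy i) (st1 i iV).
  have := hc i; rewrite mem_filter neg mem_enum => /(_ isT) hci.
  have := mulr_le0_ge0 (dy i) (st1 i iV).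
  set q := Num.sqrt (1 + _); set s := B i (ev _ *m _) => h1.
  have s1 : 1 <= Num.sqrt (1 + s ^+ 2) by rewrite addrC sqrt_ge1.
  have : q * 1 <= q * Num.sqrt (1 + s ^+ 2) by rewrite ler_wpM2l // sqrtr_ge0.
  rewrite mulr1; move: lt; set z := lorentz _ _; rewrite -/q in hci => a b d.
  by move: a hci b d h1; lra.
have Vy : ev V *m y = y by exact: ev_fix.
have Vy' : ev (rev V) *m y = y by rewrite -{1}Vy ev_Arev.
move: lt; rewrite /= ev_cat -mulmxA -{1}Vy ev_lorentz => /IH -> //.
by case/and3P: lL.
Qed.

Lemma vanish_nnc y i j : hyp y -> dom y -> B i y = 0 -> B j y = 0 -> ~~ nc i j.
Proof.
move=> hy dy hi hj; have t1 := hyp_time hy; apply/negP => /orP[a|f].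
  by have [k] := B_apart y a; have := dy k; rewrite hi hj; lra.
by have := B_facing y f; rewrite hi hj; lra.
Qed.

(** Letters of one parity that are not [nc] are equal, so each letter occurs an even number of
    times, and the first one can be cancelled with its next occurrence because everything between
    commutes with it. *)
Lemma even_clique w : {in w &, forall i j, ~~ nc i j} -> even_word w -> weq w [::].
Proof.
have [n] := ubnP (size w); elim: n w => // n IH [|i w] sw h ew; first by constructor.
have iw : i \in w.
  have hi : forall j, j \in w -> (odd j == odd i) = (j == i).
    move=> j jw; have := h i j (mem_head _ _); rewrite inE jw orbT => /(_ isT).
    have : ~~ nc i j ==> ((odd j == odd i) == (j == i)) by move: (i) (j); exact: all_letters2.
    by move=> /implyP k /k /eqP.
  have : odd (count (fun j : letter => odd j == odd i) w).
    move: ew; rewrite /even_word /=; case: (odd i) => /=; rewrite ?add0n ?add1n /= negbK => /andP[h1 h2].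
      by rewrite (eq_count (a2 := fun j : letter => odd j)) // => j; case: (odd j).
    by rewrite (eq_count (a2 := fun j : letter => ~~ odd j)) // => j; case: (odd j).
  move=> od; have /hasP[j jw e] : has (fun j : letter => odd j == odd i) w.
    by rewrite has_count; case: (count _ _) od.
  by move: e; rewrite (hi j jw) => /eqP <-.
pose p := index i w; set p1 := take p w; set p2 := drop p.+1 w.
have pw : (p < size w)%N by rewrite index_mem.
have ewp : w = p1 ++ i :: p2.
  by rewrite -[LHS](cat_take_drop p) (drop_nth i) // nth_index.
have cp : all (comm i) p1.
  apply/allP => j jp; have jw : j \in w by exact: mem_take jp.
  have ji : i != j.
    by apply/eqP => e; move: jp; rewrite -e => /(index_ltn); rewrite ltnn.
  have := h i j (mem_head _ _); rewrite inE jw orbT => /(_ isT).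
  by rewrite nc_comm ji /= negbK.
have e1 : weq (i :: w) (p1 ++ p2).
  rewrite ewp; apply: weq_trans (weq_move _ cp) _.
  by apply: weq_catl; apply: weq_cancel.
apply: (weq_trans e1); apply: IH.
- by move: sw; rewrite ewp /= !size_cat /= addnS => /ltnW; rewrite ltnS.
- have sub : {subset p1 ++ p2 <= i :: w}.
    by move=> j; rewrite ewp inE !mem_cat inE => /orP[] ->; rewrite ?orbT.
  by move=> a b /sub ha /sub hb; exact: h.
- by rewrite -(even_weq e1).
Qed.

Lemma stabilizer y w : hyp y -> dom y -> ev w *m y = y -> even_word w -> ev w = 1%:M.
Proof.
move=> hy dy e ew; have [_ [w' ww' h]] := dom_word dy dy e.
rewrite -(ev_weq _ ww') (@ev_weq _ _ [::]) //; apply: even_clique.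
  by move=> i j iw jw; apply: vanish_nnc hy dy (h i iw) (h j jw).
by rewrite (even_weq ww').
Qed.

Lemma lorentz_le_time x y : hyp x -> hyp y -> - lorentz x y <= 2 * (x 0 0 * y 0 0).
Proof.
move=> hx hy; have x1 := hyp_time hx; have y1 := hyp_time hy.
have [nx _] := hx; have [ny _] := hy; move: nx ny; rewrite !lorentzE.
set a := x 0 0 in x1 *; set b := x 1 0; set c := x (1 + 1) 0.
set a' := y 0 0 in y1 *; set b' := y 1 0; set c' := y (1 + 1) 0 => nx ny.
have CS : - (b * b' + c * c') <= a * a'.
  have aa : 0 <= a * a' by rewrite mulr_ge0 //; lra.
  have [h|h] := leP (- (b * b' + c * c')) 0; first exact: le_trans h aa.
  rewrite -(ler_pXn2r (ltn0Sn 1)) ?nnegrE // ?(ltW h) // sqrrN.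
  have h1 : b ^+ 2 + c ^+ 2 <= a ^+ 2 by rewrite !expr2; lra.
  have h2 : b' ^+ 2 + c' ^+ 2 <= a' ^+ 2 by rewrite !expr2; lra.
  apply: (@le_trans _ _ ((b ^+ 2 + c ^+ 2) * (b' ^+ 2 + c' ^+ 2))).
    have -> : (b ^+ 2 + c ^+ 2) * (b' ^+ 2 + c' ^+ 2) = (b * b' + c * c') ^+ 2 + (b * c' - c * b') ^+ 2 by ring.
    by rewrite lerDl sqr_ge0.
  by rewrite exprMn; apply: ler_pM => //; rewrite addr_ge0 ?sqr_ge0.
lra.
Qed.

End Discrete.

(** * The hyperboloid as a graph over the plane *)

Section Lift.
Variable R : realType.

Definition lift3 (a b : R) : 'cV[R]_3 := col3 (Num.sqrt (1 + a ^+ 2 + b ^+ 2)) a b.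

Lemma lift3_hyp a b : hyp (lift3 a b).
Proof.
have pos : 0 < 1 + a ^+ 2 + b ^+ 2 by have := sqr_ge0 a; have := sqr_ge0 b; lra.
split; last by rewrite mxE /= sqrtr_gt0.
rewrite lorentz_col3 -expr2 sqr_sqrtr ?ltW //; ring.
Qed.

Lemma lift3_eq (x : 'cV[R]_3) : hyp x -> x = lift3 (x 1 0) (x (1 + 1) 0).
Proof.
move=> [nx x0]; apply: cV3P; rewrite !mxE //=.
rewrite -[LHS]gtr0_norm // -sqrtr_sqr; congr Num.sqrt.
by move: nx; rewrite lorentzE !expr2; lra.
Qed.

Lemma cvg_mx (T : Type) (G : set_system T) (FG : Filter G) (m n : nat) (f : T -> 'M[R]_(m, n)) (l : 'M[R]_(m, n)) :
  (forall i j, (fun x => f x i j) @ G --> l i j) -> f @ G --> l.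
Proof.
move=> h; apply/cvg_ballP => e e0.
have : \forall x \near G, forall i j, ball (l i j) e (f x i j).
  apply: filter_forall => i; apply: filter_forall => j.
  by have /cvg_ballP := h i j; apply.
by apply: filterS => x hx; split.
Qed.

Lemma lift3_cvg (T : Type) (G : set_system T) (FG : Filter G) (f g : T -> R) (a b : R) :
  f @ G --> a -> g @ G --> b -> (fun x => lift3 (f x) (g x)) @ G --> lift3 a b.
Proof.
move=> fa gb; apply: cvg_mx => i j; rewrite mxE.
have -> : (fun x => lift3 (f x) (g x) i j) = (fun x => if i == 0 then Num.sqrt (1 + f x ^+ 2 + g x ^+ 2)
    else if i == 1 then f x else g x) by apply/funext => x; rewrite mxE.
case: ifP => _; last by case: ifP.
apply: (continuous_cvg _ (@sqrt_continuous R _)).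
rewrite !expr2; apply: cvgD; last by under eq_cvg do rewrite expr2; exact: cvgM.
by apply: cvgD; [exact: cvg_cst|under eq_cvg do rewrite expr2; exact: cvgM].
Qed.

Lemma compact_lift3 (C : R) : compact [set x : 'cV[R]_3 | exists a b, [/\ `|a| <= C, `|b| <= C & x = lift3 a b]].
Proof.
have cI : forall i : 'I_2, compact (`[- C, C] : set R) by move=> _; exact: segment_compact.
have := rV_compact cI.
set K := [set v | _] => cK.
have -> : [set x : 'cV[R]_3 | exists a b, [/\ `|a| <= C, `|b| <= C & x = lift3 a b]] =
    (fun v : 'rV[R]_2 => lift3 (v 0 0) (v 0 1)) @` K.
  apply/seteqP; split=> x /=.
    move=> [a [b [ha hb ->]]]; exists (\row_i if i == 0 then a else b); last by rewrite !mxE.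
    by move=> i; rewrite mxE; case: ifP => _ /=; rewrite in_itv /= -ler_norml.
  move=> [v hv <-]; exists (v 0 0), (v 0 1); split=> //.
    by have := hv 0; rewrite /= in_itv /= -ler_norml.
  by have := hv 1; rewrite /= in_itv /= -ler_norml.
apply: continuous_compact cK; apply: continuous_subspaceT => v.
apply: lift3_cvg; first exact: nbhs_filter.
  exact: coord_continuous.
exact: coord_continuous.
Qed.
End Lift.

(** * The surface and its tesselation *)

Section Surface.
Variables (R : realType) (F : finFieldType) (Q : {poly F}).
Hypothesis Q0 : Q != 0.
Implicit Types (x y : 'cV[R]_3) (i j : letter) (w u z : word).
Notation normal := (@normal R).
Notation vertex := (@vertex R).
Notation B i z := (lorentz (normal i) z).
Notation ev := (@ev R).
Notation s3 := (@s3 R).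
Notation origin := (@origin R).

Definition deck_group : set 'M[R]_3 := [set h | exists2 w, ker Q w & h = ev w].

Lemma deck_group_isometry h : deck_group h -> hyp_isometry h /\ \det h = 1.
Proof.
move=> [w [ew _] ->]; split; first exact: ev_isometry.
by rewrite ev_det -signr_odd (negbTE (even_size ew)).
Qed.

Lemma deck_group1 : deck_group 1%:M.
Proof. by exists [::]; first exact: ker_nil. Qed.

Lemma deck_groupM h k : deck_group h -> deck_group k -> deck_group (h *m k).
Proof. by move=> [u ku ->] [w kw ->]; exists (u ++ w); [exact: ker_cat|rewrite ev_cat]. Qed.

Lemma deck_groupV h : deck_group h -> deck_group (invmx h).
Proof. by move=> [w kw ->]; exists (rev w); [exact: ker_rev|rewrite ev_invmx]. Qed.

Lemma deck_group_free x : hyp x -> exists2 e : R, 0 < e &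
  forall h, deck_group h -> hdist x (h *m x) < e -> h = 1%:M.
Proof.
move=> hx; have [u [y [hy dy ex]]] := dom_cover hx.
have [c c1 hc] := discrete hy dy.
exists (ln c); first exact: ln_gt0.
move=> _ [w kw ->] /(hdist_ge hx (ev_hyp w hx) c1).
pose w' := rev u ++ w ++ rev (rev u).
have ew' : lorentz x (ev w *m x) = lorentz y (ev w' *m y).
  by rewrite {1}ex ev_adj ex /w' revK !ev_cat !mulmxA.
rewrite ew' => /hc fix_y; have kw' : ker Q w' := ker_conj (rev u) kw.
have e1 : ev w' = 1%:M := stabilizer hy dy fix_y (proj1 kw').
have : ev u *m ev w' *m ev (rev u) = ev w.
  rewrite /w' revK !ev_cat !mulmxA ev_revK mul1mx -!mulmxA.
  by rewrite ev_revK mulmx1.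
by rewrite e1 mulmx1 ev_revK => <-.
Qed.

(** There are finitely many pairs of parities and residues, and a chosen representative of each
    carries the bounded hexagon into a bounded region. *)
Lemma bounded_representatives : exists C : R, forall w, exists w',
  ker Q (w ++ rev w') /\ forall y, hyp y -> dom y -> (ev w' *m y) 0 0 <= C.
Proof.
pose cls w := (signs w, residue Q w).
have [C hC] : exists C : (bool * bool) * 'M['rV[F]_(size Q).-1]_6 -> R,
    forall t w, cls w = t -> exists w', cls w' = t /\ forall y, hyp y -> dom y -> (ev w' *m y) 0 0 <= C t.
  apply: (@fin_all_exists _ _ (fun t c => forall w, cls w = t ->
     exists w', cls w' = t /\ forall y, hyp y -> dom y -> (ev w' *m y) 0 0 <= c)) => t.
  have [[w0 h0]|h] := pselect (exists w, cls w = t); last first.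
    by exists 0 => w hw; case: h; exists w.
  exists (2 * ((ev (rev w0) *m origin) 0 0 * s3)) => _ _; exists w0; split=> // y hy dy.
  have ho := ev_hyp (rev w0) (origin_hyp R).
  have := lorentz_le_time ho hy; rewrite ev_adj revK origin_lorentz opprK => h.
  apply: (le_trans h); rewrite ler_pM2l // ler_pM2l ?dom_time //.
  by have := hyp_time ho; lra.
exists (\sum_t `|C t|) => w; have [w' [e h]] := hC (cls w) w erefl.
exists w'; split.
  by apply/(classP Q0); split; [exact: esym (congr1 fst e)|exact: esym (congr1 snd e)].
move=> y hy dy; apply: le_trans (h y hy dy) _; apply: le_trans (ler_norm _) _.
by rewrite (bigD1 (cls w)) //= lerDl sumr_ge0.
Qed.

Lemma deck_group_cocompact : exists K : set 'cV[R]_3,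
  [/\ compact K, K `<=` hyp &
      forall x, hyp x -> exists h y, [/\ deck_group h, K y & x = h *m y]].
Proof.
have [C hC] := bounded_representatives.
exists [set x : 'cV[R]_3 | exists a b, [/\ `|a| <= C, `|b| <= C & x = lift3 a b]]; split.
- exact: compact_lift3.
- by move=> _ [a [b [_ _ ->]]]; exact: lift3_hyp.
move=> x hx; have [w [y [hy dy ex]]] := dom_cover hx; have [w' [kw h]] := hC w.
exists (ev (w ++ rev w')), (ev w' *m y); split; first by exists (w ++ rev w').
  have hz := ev_hyp w' hy; have := h y hy dy; move: hz; set z := ev w' *m y => hz zC.
  have [nz z0] := hz.
  have k c : c ^+ 2 <= z 0 0 ^+ 2 -> `|c| <= C.
    move=> hc; apply: le_trans zC; rewrite -(ler_pXn2r (ltn0Sn 1)) ?nnegrE ?(ltW z0) //.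
    by rewrite real_normK // num_real.
  move: nz; rewrite lorentzE -!expr2 => nz.
  have s1 := sqr_ge0 (z 1 0); have s2 := sqr_ge0 (z (1 + 1) 0).
  exists (z 1 0), (z (1 + 1) 0); split; last exact: lift3_eq.
    by apply: k; lra.
  by apply: k; lra.
by rewrite ev_cat -mulmxA ev_Arev.
Qed.

Definition surface : hyp_surface R :=
  HypSurface deck_group_isometry deck_group1 deck_groupM deck_groupV deck_group_free
    deck_group_cocompact.

Definition tiles : set 'M[R]_3 := [set f | exists w, f = ev w].

Lemma tiles_cover x : hyp x -> exists f y, [/\ tiles f, hexagon y & x = f *m y].
Proof.
move=> /dom_cover[w [y [hy dy ->]]]; exists (ev w), y; split=> //; first by exists w.
exact: dom_hexagon.
Qed.

Lemma tiles_disjoint f f' x y : tiles f -> tiles f' ->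
  hexagon_interior x -> hexagon y -> f *m x = f' *m y -> f = f'.
Proof.
move=> [w ->] [u ->] /hexagon_interior_sdom[hx sx] /hexagon_dom[hy dy] e.
have [|xy _] := dom_word (sdomW sx) dy (w := rev u ++ w).
  by rewrite ev_cat -mulmxA e ev_Arev.
by apply: ev_weq; apply: sdom_word sx _; rewrite e xy.
Qed.

Lemma refl_fix i x : B i x = 0 -> refl R i *m x = x.
Proof. by move=> h; rewrite reflE h mulr0 scale0r subr0. Qed.

Lemma tiles_glue f (k : 'I_6) : tiles f ->
  exists f', [/\ tiles f', f' <> f & forall x, hex_side k x -> f' *m x = f *m x].
Proof.
move=> [w ->]; exists (ev (w ++ [:: k])); split; first by exists (w ++ [:: k]).
  move=> /(congr1 determinant) /eqP; rewrite !ev_det size_cat addn1 exprS mulN1r.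
  by rewrite eq_sym -subr_eq0 opprK -mulr2n mulrn_eq0 /= signr_eq0.
by move=> x /hex_sideE[_ _ h]; rewrite ev_cat -mulmxA ev1 refl_fix.
Qed.

Lemma vertex_vanish j i : B j (vertex i) = 0 -> j = i \/ j = prv i.
Proof.
move/eqP; rewrite lorentz_vertex mulf_eq0 (gt_eqF (s3_gt0 R)) intr_eq0 /= => h.
have : (vgram i j == 0) ==> ((j == i) || (j == prv i)) by move: (i) (j); exact: all_letters2.
by rewrite h /= => /orP[] /eqP; [left|right].
Qed.

Lemma ev_two a b w : comm a b -> {in w, forall j, j = a \/ j = b} ->
  exists2 c, c \in [:: [::]; [:: a]; [:: b]; [:: a; b]] & weq w c.
Proof.
move=> cab; elim: w => [|j w IH] h; first by exists [::]; [rewrite mem_head|constructor].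
have [|c hc wc] := IH; first by move=> l lw; apply: h; rewrite inE lw orbT.
have {wc} wc := weq_cons j wc.
have k c' : weq (j :: c) c' -> weq (j :: w) c' by apply: weq_trans.
move: k (h j (mem_head _ _)) => /[swap] -[] -> k; move: hc k {wc}; rewrite !inE => /or4P[] /eqP -> k.
- by exists [:: a]; rewrite ?inE ?eqxx ?orbT //; apply: k; constructor.
- by exists [::]; rewrite ?inE ?eqxx ?orbT //; apply: k; constructor.
- by exists [:: a; b]; rewrite ?inE ?eqxx ?orbT //; apply: k; constructor.
- by exists [:: b]; rewrite ?inE ?eqxx ?orbT //; apply: k; constructor.
- by exists [:: b]; rewrite ?inE ?eqxx ?orbT //; apply: k; constructor.
- by exists [:: a; b]; rewrite ?inE ?eqxx ?orbT //; apply: k; apply: weq_swap; rewrite commC.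
- by exists [::]; rewrite ?inE ?eqxx ?orbT //; apply: k; constructor.
- exists [:: a]; rewrite ?inE ?eqxx ?orbT //; apply: k.
  apply: (@weq_trans _ [:: b; b; a]); last by constructor.
  by apply: weq_cons; apply: weq_swap.
Qed.

(** The tiles at the vertex are those of w, wk, wb and wkb with [b] the side before [k]. Each
    contributes its sides [k] and [b], and the eight sides coincide in pairs. *)
Lemma tiles_valence f (k : 'I_6) : tiles f ->
  ([set e : set 'cV[R]_3 | e (f *m hex_vertex k) /\
     exists f' (j : 'I_6), tiles f' /\ e = mulmx f' @` hex_side j] #= `I_4)%card.
Proof.
move=> [w ->]; rewrite hex_vertexE inZp_ord; set b := prv k.
pose ed (c : word) j : set 'cV[R]_3 := mulmx (ev (w ++ c)) @` hex_side j.
have kb : comm k b by rewrite /b; move: (k); exact: all_letters.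
have hv : hyp (vertex k) by exact: vertex_hyp.
have dv : dom (vertex k) by move=> j; exact: B_vertex_le0.
have [g1 g2 g3 g4 [g5 g6]] := B_vertex_nxt R k.
have nb : nxt b = k by apply/eqP; rewrite /b; move: (k); exact: all_letters.
have [f1 f2 f3 f4 [f5 f6]] := B_vertex_nxt R b; rewrite nb in f1 f2 f3 f4 f5 f6.
have s30 := s3_gt0 R.
have ed_fix c j : ed (c ++ [:: j]) j = ed c j.
  have h x : hex_side j x -> ev (w ++ (c ++ [:: j])) *m x = ev (w ++ c) *m x.
    by move=> /hex_sideE[_ _ e]; rewrite catA ev_cat -mulmxA ev1 refl_fix.
  apply/seteqP; split=> y [x hx <-]; exists x => //; rewrite ?h //.
have edk : ed [:: b; k] k = ed [:: b] k := ed_fix [:: b] k.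
have edswap j : ed [:: b; k] j = ed [:: k; b] j.
  rewrite /ed; congr (mulmx _ @` _); apply: ev_weq; apply: weq_catl; apply: weq_swap.
  by rewrite commC.
pose e (n : nat) := nth (ed [::] k) [:: ed [::] k; ed [:: b] k; ed [::] b; ed [:: k] b] n.
have side_k : hex_side k (vertex k) by apply/hex_sideE.
have side_b : hex_side b (vertex k) by apply/hex_sideE; split=> //; rewrite f2.
have fixk c j : {in c, forall l, l = k \/ l = b} -> hex_side j (vertex k) -> ed c j (ev w *m vertex k).
  move=> hc hj; exists (vertex k) => //; rewrite ev_cat -mulmxA (@ev_fix _ c) // => l /hc[] ->.
    by rewrite g1.
  by rewrite f2.
have -> : [set e : set 'cV[R]_3 | e (ev w *m vertex k) /\
    exists f' (j : 'I_6), tiles f' /\ e = mulmx f' @` hex_side j] = e @` `I_4.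
  apply/seteqP; split=> E /=.
    move=> [Ep [_ [j [[u ->] EE]]]]; rewrite EE in Ep *; case: Ep => x xj ux.
    have [hx dx jx] := (hex_sideE j x).1 xj.
    have [|xv [w' ww' hw']] := dom_word dx dv (w := rev w ++ u).
      by rewrite ev_cat -mulmxA ux ev_Arev.
    have [c hc wc] : exists2 c, c \in [:: [::]; [:: k]; [:: b]; [:: k; b]] & weq w' c.
      by apply: ev_two => // l /hw'; exact: vertex_vanish.
    have -> : ev u = ev (w ++ c).
      by rewrite ev_cat -(ev_weq _ wc) (ev_weq _ ww') ev_cat mulmxA ev_revK mul1mx.
    rewrite -/(ed c j); have jk : j = k \/ j = b by apply: vertex_vanish; rewrite -xv.
    move: hc; rewrite !inE => /or4P[] /eqP ->; case: jk => ->.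
    - by exists 0%N.
    - by exists 2%N.
    - by exists 0%N => //; rewrite (ed_fix [::]).
    - by exists 3%N.
    - by exists 1%N.
    - by exists 2%N => //; rewrite (ed_fix [::]).
    - by exists 1%N => //; rewrite -edswap edk.
    - by exists 3%N => //; rewrite (ed_fix [:: k]).
  have tl c j : tiles (ev (w ++ c)) /\ ed c j = mulmx (ev (w ++ c)) @` hex_side j.
    by split=> //; exists (w ++ c).
  have in1 (l0 l : letter) : l \in [:: l0] -> l = l0 by rewrite inE => /eqP.
  case=> -[|[|[|[|//]]]] _ <-; split.
  - exact: fixk.
  - by exists (ev (w ++ [::])), k; exact: tl.
  - by apply: fixk => // l /in1 ->; right.
  - by exists (ev (w ++ [:: b])), k; exact: tl.
  - exact: fixk.
  - by exists (ev (w ++ [::])), b; exact: tl.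
  - by apply: fixk => // l /in1 ->; left.
  - by exists (ev (w ++ [:: k])), b; exact: tl.
apply: inj_card_eq => n m nI mI.
(* The far ends of the four edges; the signs of [Bw k] and [Bw b] at them tell the edges apart. *)
pose q (n : nat) : 'cV[R]_3 := ev w *m nth 0 [:: vertex (nxt k); ev [:: b] *m vertex (nxt k); vertex b; ev [:: k] *m vertex b] n.
have sd_k : hex_side k (vertex (nxt k)).
  by apply/hex_sideE; split=> //; [exact: vertex_hyp|move=> j; exact: B_vertex_le0].
have sd_b : hex_side b (vertex b).
  by apply/hex_sideE; split=> //; [exact: vertex_hyp|move=> j; exact: B_vertex_le0].
have qe n' : (n' < 4)%N -> e n' (q n').
  case: n' => [|[|[|[|//]]]] _; rewrite /e /q /=.
  - by exists (vertex (nxt k)); rewrite // cats0.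
  - by exists (vertex (nxt k)); rewrite // ev_cat -mulmxA.
  - by exists (vertex b); rewrite // cats0.
  - by exists (vertex b); rewrite // ev_cat -mulmxA.
pose Bw i x := B i (ev (rev w) *m x).
have kbg : gram R k b = 0 by exact: gram_comm.
have sg n' x : (n' < 4)%N -> e n' x -> match n' with
    | 0%N => Bw k x = 0 /\ Bw b x <= 0 | 1%N => Bw k x = 0 /\ 0 <= Bw b x
    | 2%N => Bw b x = 0 /\ Bw k x <= 0 | _ => Bw b x = 0 /\ 0 <= Bw k x end.
  case: n' => [|[|[|[|//]]]] _; rewrite /e /= /Bw; case=> y /hex_sideE[hy dy y0] <-;
    rewrite ev_cat -mulmxA ev_Arev ?mul1mx ?ev1.
  - by split.
  - rewrite !reflE !lorentz_lin !lorentz_normal kbg gram_eq y0.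
    by split; [ring|have := dy b; lra].
  - by split.
  - rewrite !reflE !lorentz_lin !lorentz_normal gramC kbg gram_eq y0.
    by split; [ring|have := dy k; lra].
have sq n' : (n' < 4)%N -> match n' with
    | 0%N => Bw b (q n') < 0 | 1%N => 0 < Bw b (q n')
    | 2%N => Bw k (q n') < 0 | _ => 0 < Bw k (q n') end.
  case: n' => [|[|[|[|//]]]] _; rewrite /Bw /q /= ev_Arev ?mulmx1.
  - by rewrite g4 oppr_lt0.
  - by rewrite reflE !lorentz_lin lorentz_normal gram_eq g4; lra.
  - by rewrite f5 oppr_lt0.
  - by rewrite reflE !lorentz_lin lorentz_normal gram_eq f5; lra.
move=> E; have nI' : (n < 4)%N by move: nI; rewrite inE.
have mI' : (m < 4)%N by move: mI; rewrite inE.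
have h1 := sg m (q n) mI'; rewrite -E in h1; have {h1} := h1 (qe n nI').
have h2 := sg n (q m) nI'; rewrite E in h2; have {h2} := h2 (qe m mI').
have := sq n nI'; have := sq m mI'; clear -nI' mI'.
by move: nI' mI'; case: n => [|[|[|[|//]]]] _; case: m => [|[|[|[|//]]]] _ //; (intros; exfalso; lra).
Qed.

Definition tesselation : std_tesselation surface.
Proof.
apply: (@StdTesselation _ surface tiles).
- by move=> _ [w ->]; exact: ev_isometry.
- by move=> _ _ [u _ ->] [w ->]; exists (u ++ w); rewrite ev_cat.
- exact: tiles_cover.
- exact: tiles_disjoint.
- exact: tiles_glue.
- exact: tiles_valence.
Defined.
End Surface.

Section RowNorm.
Variables (R : realType) (n : nat).
Implicit Type u : 'rV[R]_n.

Lemma rV_norm_lt u (c : R) : 0 < c -> (`|u| < c) <-> (forall e, `|u 0 e| < c).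
Proof.
move=> c0; rewrite /Num.norm /= mx_normrE; split.
  move=> h e; apply: le_lt_trans h.
  exact: (le_bigmax _ (fun ij : 'I_1 * 'I_n => `|u ij.1 ij.2|) (0, e)).
move=> h; apply/bigmax_ltP; split=> // -[e1 e2] _ /=.
by rewrite (ord1 e1); exact: h.
Qed.

Lemma rV_norm_le u (c : R) : 0 <= c -> (`|u| <= c) <-> (forall e, `|u 0 e| <= c).
Proof.
move=> c0; rewrite /Num.norm /= mx_normrE; split.
  move=> h e; apply: le_trans h.
  exact: (le_bigmax _ (fun ij : 'I_1 * 'I_n => `|u ij.1 ij.2|) (0, e)).
by move=> h; apply/bigmax_leP; split=> // -[e1 e2] _ /=; rewrite (ord1 e1); exact: h.
Qed.

Lemma rV_norm_eq1 u : `|u| = 1 -> (forall e, `|u 0 e| <= 1) /\ exists e, `|u 0 e| = 1.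
Proof.
move=> h; have le := (rV_norm_le u ler01).1; rewrite h lexx in le; have {}le := le isT.
split=> //; apply: contrapT => ne.
have : `|u| < 1; last by rewrite h ltxx.
apply/rV_norm_lt => // e; rewrite lt_neqAle le andbT.
by apply/eqP => e1; apply: ne; exists e.
Qed.
End RowNorm.

(** * Cells and genus *)

Section LocalCells.
Variable R : realType.
Implicit Types (x y : 'cV[R]_3) (i j : letter).
Notation normal := (@normal R).
Notation vertex := (@vertex R).
Notation B i z := (lorentz (normal i) z).
Notation s3 := (@s3 R).
Notation s2 := (@s2 R).
Notation Lam := (@Lam R).

(* The hexagon in the Klein model is the image of a square, its sides 1 and 4 being two
   opposite sides of the square. *)
Definition face_radius (p q : R) := Num.sqrt (Num.max 3^-1 (1 - (2 / 3) * p ^+ 2 - 2 * q ^+ 2)).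
Definition face_point (p q : R) : 'cV[R]_3 :=
  lift3 (p * (s2 * s3 / 3) / face_radius p q) (q * s2 / face_radius p q).
Definition face_map (u : 'rV[R]_2) : 'cV[R]_3 :=
  face_point (u 0 0 * (1 - `|u 0 1 / 2|)) (u 0 1 / 2).

Lemma face_radius_gt0 p q : 0 < face_radius p q.
Proof. by rewrite sqrtr_gt0 lt_max invr_gt0 ltr0n. Qed.

Lemma face_pointE p q : `|p| <= 1 - `|q| -> `|q| <= 2^-1 ->
  face_point p q = (face_radius p q)^-1 *: col3 1 (p * (s2 * s3 / 3)) (q * s2).
Proof.
move=> hp hq; have D0 := face_radius_gt0 p q; set D := face_radius p q in D0 *.
(* On the hexagon the radicand is at least 1/3, its value at the vertices. Bounding it below by 1/3
   in [face_radius] keeps the formula continuous on the whole plane. *)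
have le : 3^-1 <= 1 - (2 / 3) * p ^+ 2 - 2 * q ^+ 2.
  have q0 := normr_ge0 q; have p0 := normr_ge0 p.
  have h1 : p ^+ 2 <= (1 - `|q|) ^+ 2.
    by rewrite -[p ^+ 2]real_normK ?num_real // ler_pXn2r ?nnegrE //; lra.
  have h2 : q ^+ 2 = `|q| ^+ 2 by rewrite real_normK ?num_real.
  have h3 : 0 <= `|q| * (2^-1 - `|q|) by rewrite mulr_ge0 //; lra.
  move: h1; rewrite h2 sqrrB expr1n mul1r => h1.
  move: h3; rewrite mulrBr -expr2 => h3; lra.
have D2 : D ^+ 2 = 1 - (2 / 3) * p ^+ 2 - 2 * q ^+ 2.
  rewrite /D /face_radius (max_idPr _) // sqr_sqrtr //; apply: le_trans le.
  by rewrite invr_ge0.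
have Dn : D != 0 by rewrite lt0r_neq0.
have e2 := s2s2 R; have e3 := s3s3 R.
rewrite [RHS]lift3_eq; first by congr lift3; rewrite !mxE /= -/D; ring.
split; last by rewrite !mxE /= mulr1 invr_gt0.
rewrite lorentzZl lorentzZr lorentz_col3.
transitivity (D ^- 2 * (- 1 + p ^+ 2 * ((s2 * s2) * (s3 * s3)) / 9 + q ^+ 2 * (s2 * s2))).
  by field.
rewrite e2 e3 (_ : - 1 + _ + _ = - D ^+ 2); last by rewrite D2; field.
by rewrite mulrN mulVf // expf_neq0.
Qed.

Lemma face_bounds (u : 'rV[R]_2) : `|u| <= 1 ->
  let q := u 0 1 / 2 in let p := u 0 0 * (1 - `|q|) in `|p| <= 1 - `|q| /\ `|q| <= 2^-1.
Proof.
move=> /(rV_norm_le _ ler01) h q p; have h0 := h 0; have h1 := h 1.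
have hq : `|q| <= 2^-1.
  by rewrite normrM (ger0_norm (_ : 0 <= 2^-1)) ?invr_ge0 //; lra.
split=> //; rewrite /p normrM (ger0_norm (_ : 0 <= 1 - `|q|)); last by lra.
by rewrite -[X in _ <= X]mul1r ler_wpM2r //; lra.
Qed.

Lemma B_face i p q : `|p| <= 1 - `|q| -> `|q| <= 2^-1 ->
  B i (face_point p q) = (face_radius p q)^-1 * (- 1 + (na i)%:~R * p + (nb i)%:~R * q).
Proof.
move=> hp hq; rewrite face_pointE // lorentzZr lorentz_col3; congr (_ * _).
have e2 := s2s2 R; have e3 := s3s3 R.
transitivity (- 1 + (na i)%:~R * p * ((s2 * s2) * (s3 * s3)) / 6 + (nb i)%:~R * q * (s2 * s2) / 2).
  by field.
by rewrite e2 e3; field.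
Qed.

Lemma forms_bound i (p q : R) : `|p| <= 1 - `|q| -> `|q| <= 2^-1 ->
  (na i)%:~R * p + (nb i)%:~R * q <= 1.
Proof.
rewrite !ler_norml => /andP[] + + /andP[].
case: (ger0P q) => ?; case: i => [[|[|[|[|[|[|//]]]]]] hi]; rewrite /na /nb /=; lra.
Qed.

Lemma face_map_dom u : `|u| <= 1 -> dom (face_map u).
Proof.
move=> hu i; have [h1 h2] := face_bounds hu; rewrite /face_map B_face //.
rewrite pmulr_rle0 ?invr_gt0 ?face_radius_gt0 //.
by have := forms_bound i h1 h2; lra.
Qed.

Lemma face_map_hyp u : hyp (face_map u).
Proof. exact: lift3_hyp. Qed.

Lemma face_map_sdom (u : 'rV[R]_2) : `|u| <= 1 -> sdom (face_map u) <-> `|u| < 1.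
Proof.
move=> hu; have [h1 h2] := face_bounds hu.
have D0 := face_radius_gt0 (u 0 0 * (1 - `|u 0 1 / 2|)) (u 0 1 / 2).
have key : sdom (face_map u) <->
    forall i, (na i)%:~R * (u 0 0 * (1 - `|u 0 1 / 2|)) + (nb i)%:~R * (u 0 1 / 2) < 1.
  by split=> h i; have := h i; rewrite /face_map B_face // pmulr_rlt0 ?invr_gt0 //; lra.
rewrite key rV_norm_lt //; have hb := (rV_norm_le u ler01).1 hu.
split.
  move=> h; have l0 := h (@Ordinal 6 0 isT); have l1 := h (@Ordinal 6 1 isT).
  have l2 := h (@Ordinal 6 2 isT); have l3 := h (@Ordinal 6 3 isT).
  have l4 := h (@Ordinal 6 4 isT); have l5 := h (@Ordinal 6 5 isT).
  move: l0 l1 l2 l3 l4 l5; rewrite /na /nb /=; set q := u 0 1 / 2 in h1 h2 *; move=> l0 l1 l2 l3 l4 l5.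
  have uq : u 0 1 = 2 * q by rewrite /q; field.
  have q1 : `|u 0 1| < 1 by rewrite ltr_norml uq; apply/andP; split; lra.
  have p1 : `|u 0 0| < 1.
    have d0 : 0 < 1 - `|q| by have := h2; lra.
    have : `|u 0 0 * (1 - `|q|)| < 1 - `|q|.
      move: l0 l2 l3 l5; rewrite ltr_norml; set p := _ * (1 - _); clear.
      by case: (ger0P q) => _ *; apply/andP; split; lra.
    by rewrite normrM (gtr0_norm d0) -[X in _ < X]mul1r ltr_pM2r.
  move=> e; have [->|->] // : e = 0 \/ e = 1.
  by case: e => [[|[|//]]] he; [left|right]; exact/val_inj.
move=> hl i; have l0 := hl 0; have l1 := hl 1; set q := u 0 1 / 2 in h1 h2 *.
have hq : `|q| < 2^-1.
  by rewrite normrM (ger0_norm (_ : 0 <= 2^-1)) ?invr_ge0 //; lra.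
have d0 : 0 < 1 - `|q| by lra.
have : `|u 0 0 * (1 - `|q|)| < 1 - `|q|.
  by rewrite normrM (gtr0_norm d0) -[X in _ < X]mul1r ltr_pM2r.
move: hq; set p := _ * (1 - _); rewrite !ltr_norml => /andP[] + + /andP[]; clear.
by case: (ger0P q) => ?; case: i => [[|[|[|[|[|[|//]]]]]] hi]; rewrite /na /nb /=; lra.
Qed.

Lemma face_map_inj (u v : 'rV[R]_2) : `|u| <= 1 -> `|v| <= 1 -> face_map u = face_map v -> u = v.
Proof.
move=> hu hv e; have [h1 h2] := face_bounds hu; have [h1' h2'] := face_bounds hv.
move: e; rewrite /face_map; set q := u 0 1 / 2 in h1 h2 *; set q' := v 0 1 / 2 in h1' h2' *.
set p := u 0 0 * (1 - `|q|) in h1 *; set p' := v 0 0 * (1 - `|q'|) in h1' *.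
rewrite !face_pointE //; have D0 := face_radius_gt0 p q; have D0' := face_radius_gt0 p' q'.
move: D0 D0'; set D := face_radius p q; set D' := face_radius p' q' => D0 D0' e.
have e0 := congr1 (fun x : 'cV[R]_3 => x 0 0) e; have e1 := congr1 (fun x : 'cV[R]_3 => x 1 0) e.
have e2 := congr1 (fun x : 'cV[R]_3 => x (1 + 1) 0) e.
move: e0 e1 e2; rewrite !mxE /= !mulr1 => e0; rewrite e0.
have Dn : D'^-1 != 0 by rewrite invr_eq0 lt0r_neq0.
have s20 := lt0r_neq0 (s2_gt0 R); have s30 := lt0r_neq0 (s3_gt0 R).
move=> /(mulfI Dn) /mulIf e1 /(mulfI Dn) /(mulIf s20) eq.
have ep : p = p' by apply: e1; rewrite !mulf_neq0 // invr_eq0 pnatr_eq0.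
have d0 : 1 - `|q'| != 0 by rewrite lt0r_neq0 //; lra.
have eu0 : u 0 0 = v 0 0 by apply: (mulIf d0); rewrite -/p' -ep /p eq.
have eu1 : u 0 1 = v 0 1 by move: eq; rewrite /q /q'; lra.
apply/rowP => k; have [->|->] // : k = 0 \/ k = 1.
by case: k => [[|[|//]]] he; [left|right]; exact/val_inj.
Qed.

Lemma face_map_onto x : hyp x -> sdom x -> exists2 u, `|u| < 1 & x = face_map u.
Proof.
move=> hx sx; have [nx x0] := hx; have x0n := lt0r_neq0 x0.
have e2 := s2s2 R; have e3 := s3s3 R; have s20 := lt0r_neq0 (s2_gt0 R); have s30 := lt0r_neq0 (s3_gt0 R).
pose p := x 1 0 / x 0 0 * (s2 * s3 / 2); pose q := x (1 + 1) 0 / x 0 0 * (s2 / 2).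
have Bx i : B i x = x 0 0 * (- 1 + (na i)%:~R * p + (nb i)%:~R * q).
  by rewrite lorentz_col3l /p /q; field.
have lt i : (na i)%:~R * p + (nb i)%:~R * q < 1.
  by have := sx i; rewrite Bx pmulr_rlt0 //; lra.
have l0 := lt (@Ordinal 6 0 isT); have l1 := lt (@Ordinal 6 1 isT).
have l2 := lt (@Ordinal 6 2 isT); have l3 := lt (@Ordinal 6 3 isT).
have l4 := lt (@Ordinal 6 4 isT); have l5 := lt (@Ordinal 6 5 isT).
move: l0 l1 l2 l3 l4 l5; rewrite /na /nb /= => l0 l1 l2 l3 l4 l5.
have hq : `|q| < 2^-1 by rewrite ltr_norml; apply/andP; split; lra.
have hp : `|p| < 1 - `|q|.
  by rewrite ltr_norml; case: (ger0P q) => ?; apply/andP; split; lra.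
have d0 : 0 < 1 - `|q| by lra.
pose u : 'rV[R]_2 := \row_k if k == 0 then p / (1 - `|q|) else 2 * q.
have u0 : u 0 0 = p / (1 - `|q|) by rewrite mxE.
have u1 : u 0 1 = 2 * q by rewrite mxE.
have qE : u 0 1 / 2 = q by rewrite u1; field.
have pE : u 0 0 * (1 - `|u 0 1 / 2|) = p by rewrite qE u0 divfK // lt0r_neq0.
exists u.
  apply/rV_norm_lt => // k; have [->|->] : k = 0 \/ k = 1.
    by case: k => [[|[|//]]] he; [left|right]; exact/val_inj.
    by rewrite u0 normrM normfV (gtr0_norm d0) ltr_pdivrMr // mul1r.
  by rewrite u1 normrM gtr0_norm //; lra.
rewrite /face_map pE qE.
have nx' : x = x 0 0 *: col3 1 (p * (s2 * s3 / 3)) (q * s2).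
  apply: cV3P; rewrite !mxE /=.
  - by rewrite mulr1.
  - transitivity (x 1 0 * ((s2 * s2) * (s3 * s3)) / 6); first by rewrite e2 e3; field.
    by rewrite /p; field.
  - transitivity (x (1 + 1) 0 * (s2 * s2) / 2); first by rewrite e2; field.
    by rewrite /q; field.
rewrite face_pointE ?(ltW hp) ?(ltW hq) //.
have hf := lift3_hyp (p * (s2 * s3 / 3) / face_radius p q) (q * s2 / face_radius p q).
rewrite -/(face_point p q) face_pointE ?(ltW hp) ?(ltW hq) // in hf.
set v := col3 1 _ _ in nx' hf *; have D0 := face_radius_gt0 p q.
set D := face_radius p q in D0 hf *.
have vv : lorentz v v = - D ^+ 2.
  have [h _] := hf; move: h; rewrite lorentzZl lorentzZr => h.
  have -> : lorentz v v = D * D * (D^-1 * (D^-1 * lorentz v v)) by field; rewrite lt0r_neq0.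
  by rewrite h mulrN1.
have xx : (x 0 0) ^+ 2 * D ^+ 2 = 1.
  by move: nx; rewrite nx' lorentzZl lorentzZr vv !mxE /=; lra.
have -> : D^-1 = x 0 0; last exact: nx'.
have xD : x 0 0 * D = 1.
  apply/eqP; rewrite -(eqrXn2 (ltn0Sn 1)) ?mulr_ge0 ?ltW // exprMn expr1n xx //.
by apply: (mulIf (lt0r_neq0 D0)); rewrite mulVf ?lt0r_neq0 // xD.
Qed.
End LocalCells.

(** * The cells of one closed hexagon *)

Section Shapes.
Variable R : realType.
Implicit Types (x y : 'cV[R]_3) (i j : letter).
Notation normal := (@normal R).
Notation vertex := (@vertex R).
Notation axisA := (@axisA R).
Notation axisB := (@axisB R).
Notation B i z := (lorentz (normal i) z).
Notation s3 := (@s3 R).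
Notation s2 := (@s2 R).
Notation Lam := (@Lam R).

Lemma mulmx_cvg (T : Type) (G : set_system T) (FG : Filter G) (A : 'M[R]_3) (f : T -> 'cV[R]_3) (l : 'cV[R]_3) :
  f @ G --> l -> (fun t => A *m f t) @ G --> A *m l.
Proof.
move=> fl; apply: cvg_mx => p q; rewrite mxE.
have -> : (fun t => (A *m f t) p q) = (fun t => \sum_k A p k * f t k q) by apply/funext => t; rewrite mxE.
have h k : (fun t => A p k * f t k q) @ G --> A p k * l k q.
  apply: cvgMr; exact: (continuous_cvg _ (@coord_continuous _ _ _ k q l) fl).
rewrite !big_ord_recl big_ord0.
under eq_cvg do rewrite !big_ord_recl big_ord0.
do 3 (apply: cvgD; first exact: h).
exact: cvg_cst.
Qed.

Lemma geod_continuous A B : continuous (@geod R A B).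
Proof.
move=> t; apply: cvg_mx => p q; rewrite !mxE.
have -> : (fun t => geod A B t p q) = (fun t => expR t * A p q + expR (- t) * B p q).
  by apply/funext => r; rewrite !mxE.
apply: cvgD; apply: cvgMl; first exact: continuous_expR.
by apply: continuous_cvg; [exact: continuous_expR|exact: cvgN].
Qed.

Lemma face_point_cvg (T : Type) (G : set_system T) (FG : Filter G) (f g : T -> R) (a b : R) :
  f @ G --> a -> g @ G --> b -> (fun t => face_point (f t) (g t)) @ G --> face_point a b.
Proof.
move=> fa gb.
have sq (h : T -> R) (c : R) : h @ G --> c -> (fun t => h t ^+ 2) @ G --> c ^+ 2.
  by move=> hc; rewrite expr2; under eq_cvg do rewrite expr2; exact: cvgM.
have cD : (fun t => face_radius (f t) (g t)) @ G --> face_radius a b.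
  apply: continuous_cvg; first exact: sqrt_continuous.
  rewrite maxr_absE; under eq_cvg do rewrite maxr_absE.
  have c2 : (fun t => 1 - (2 / 3) * f t ^+ 2 - 2 * g t ^+ 2) @ G --> 1 - (2 / 3) * a ^+ 2 - 2 * b ^+ 2.
    apply: cvgB; last by apply: cvgMr; exact: sq.
    by apply: cvgB; [exact: cvg_cst|apply: cvgMr; exact: sq].
  apply: cvgMl; apply: cvgD; first by apply: cvgD => //; exact: cvg_cst.
  by apply: cvg_norm; apply: cvgB => //; exact: cvg_cst.
have cV : (fun t => (face_radius (f t) (g t))^-1) @ G --> (face_radius a b)^-1.
  by apply: cvgV => //; rewrite lt0r_neq0 // face_radius_gt0.
by apply: lift3_cvg; apply: cvgM => //; apply: cvgMl.
Qed.

Lemma square_cvg (T : Type) (G : set_system T) (FG : Filter G) (f g : T -> R) (a b : R) :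
  f @ G --> a -> g @ G --> b ->
  (fun t => face_point (f t * (1 - `|g t / 2|)) (g t / 2)) @ G --> face_point (a * (1 - `|b / 2|)) (b / 2).
Proof.
move=> fa gb; have cq : (fun t => g t / 2) @ G --> b / 2 by apply: cvgMl.
apply: face_point_cvg => //; apply: cvgM => //.
by apply: cvgB; [exact: cvg_cst|exact: cvg_norm].
Qed.

Lemma face_map_continuous : continuous (@face_map R).
Proof.
move=> u; apply: square_cvg; first exact: nbhs_filter.
  exact: coord_continuous.
exact: coord_continuous.
Qed.

Lemma edge_cvg A B (T : Type) (G : set_system T) (FG : Filter G) (f : T -> R) (a : R) :
  f @ G --> a -> (fun t => geod A B ((1 + f t) / 2 * ln Lam)) @ G --> geod A B ((1 + a) / 2 * ln Lam).
Proof.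
move=> fa; apply: continuous_cvg; first exact: geod_continuous.
by do 2 apply: cvgMl; apply: cvgD => //; exact: cvg_cst.
Qed.

Definition edge_map i (u : 'rV[R]_1) := geod (axisA i) (axisB i) ((1 + u 0 0) / 2 * ln Lam).

Lemma lnLam_gt0 : 0 < ln Lam. Proof. by rewrite ln_gt0 // Lam_gt1. Qed.

Lemma axis_start i : geod (axisA i) (axisB i) 0 = vertex i.
Proof. by rewrite /geod oppr0 expR0 !scale1r axis_sum. Qed.

Lemma axis_end i : geod (axisA i) (axisB i) (ln Lam) = vertex (nxt i).
Proof.
have s30 := lt0r_neq0 (s3_gt0 R); have L0 : 0 < Lam by rewrite (lt_trans _ (Lam_gt1 R)).
rewrite axis_vertex subrr mul0r scale0r add0r expRN lnK ?posrE //.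
have Li : Lam^-1 = 2 - s3.
  apply: (mulfI (lt0r_neq0 L0)); rewrite mulfV ?lt0r_neq0 //.
  by have ss := s3s3 R; rewrite mulrBr !mulrDl ss; ring.
rewrite Li (_ : _ / _ = 1) ?scale1r //.
by rewrite (_ : Lam - (2 - s3) = 2 * s3) ?divff ?mulf_neq0 ?pnatr_eq0 //; rewrite /Lam; ring.
Qed.

Lemma edge_time (u : 'rV[R]_1) : `|u| <= 1 -> 0 <= (1 + u 0 0) / 2 * ln Lam <= ln Lam.
Proof.
move=> /(rV_norm_le _ ler01) /(_ 0); rewrite ler_norml => /andP[h1 h2]; have L0 := lnLam_gt0.
apply/andP; split; first by rewrite mulr_ge0 ?(ltW L0) //; lra.
by rewrite -[X in _ <= X]mul1r ler_wpM2r ?(ltW L0) //; lra.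
Qed.

Lemma edge_time_lt (u : 'rV[R]_1) : `|u| < 1 -> 0 < (1 + u 0 0) / 2 * ln Lam < ln Lam.
Proof.
move=> /(rV_norm_lt _ ltr01) /(_ 0); rewrite ltr_norml => /andP[h1 h2]; have L0 := lnLam_gt0.
apply/andP; split; first by rewrite mulr_gt0 //; lra.
by rewrite -[X in _ < X]mul1r ltr_pM2r //; lra.
Qed.

Lemma edge_onto i y : hyp y -> dom y -> (forall j, B j y = 0 <-> j = i) ->
  exists2 u : 'rV[R]_1, `|u| < 1 & y = edge_map i u.
Proof.
move=> hy dy hB; have [nA nB] := axis_normal R i; have L0 := lnLam_gt0.
have nn : B i (normal i) = 1 by rewrite lorentz_normal gram_eq.
have [t et] := plane_param (axis_null R i) nn nA nB (axis_hyp i) hy ((hB i).2 erefl).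
have [g1 g2 g3 g4 [g5 g6]] := B_vertex_nxt R i; have s30 := s3_gt0 R.
have lt j : j != i -> B j y < 0.
  by move=> ji; rewrite lt_neqAle dy andbT; apply/eqP => /hB e; rewrite e eqxx in ji.
have ni : nxt i != i by move: (i); exact: all_letters.
have pi_ : prv i != i by move: (i); exact: all_letters.
have ln_ := lt _ ni; have lp := lt _ pi_.
have t1 : t < ln Lam.
  move: ln_; rewrite et axis_vertex !lorentz_lin g5 g6 mulr0 addr0 mulrN oppr_lt0.
  rewrite pmulr_lgt0 // pmulr_lgt0 ?invr_gt0 ?mulr_gt0 // subr_gt0 ltr_expR; lra.
have t0 : 0 < t.
  move: lp; rewrite et axis_vertex !lorentz_lin g3 g4 mulr0 add0r mulrN oppr_lt0.
  rewrite pmulr_lgt0 // pmulr_lgt0 ?invr_gt0 ?mulr_gt0 // subr_gt0 ltr_expR; lra.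
exists (\row__ (2 * (t / ln Lam) - 1)).
  apply/rV_norm_lt => // e; rewrite mxE.
  have h1 : t / ln Lam < 1 by rewrite ltr_pdivrMr // mul1r.
  have h2 : 0 < t / ln Lam by rewrite divr_gt0.
  by rewrite ltr_norml; apply/andP; split; lra.
rewrite /edge_map mxE et; congr geod.
have -> : (1 + (2 * (t / ln Lam) - 1)) / 2 = t / ln Lam by field; rewrite gt_eqF.
by rewrite divfK // gt_eqF.
Qed.

Lemma vertex_unique i y : hyp y -> B i y = 0 -> B (prv i) y = 0 -> y = vertex i.
Proof.
move=> hy h1 h2; have [n1 n2] := hy; have := sector y i.
rewrite h1 h2 subrr mul0r scale0r addr0 oppr0 scale0r addr0 sub0r; set c := _ / _ => e.
have [v1 v2] := vertex_hyp R i.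
have cc : c ^+ 2 = 1 by move: n1; rewrite e lorentzZl lorentzZr v1; lra.
have c0 : 0 < c by move: n2; rewrite e mxE pmulr_lgt0.
rewrite e (_ : c = 1) ?scale1r //; apply/eqP.
by rewrite -(eqrXn2 (ltn0Sn 1)) ?ltW // cc expr1n.
Qed.

Inductive shape := Face | Edge of letter | Vertex of letter.

Definition shape_dim s := match s with Face => 2%N | Edge _ => 1%N | Vertex _ => 0%N end.
(** The walls through the open cell; they generate its stabilizer and, by [shape_letters_inj],
    determine the cell. *)
Definition shape_letters s : word :=
  match s with Face => [::] | Edge i => [:: i] | Vertex i => [:: i; prv i] end.
Definition shape_map s : 'rV[R]_(shape_dim s) -> 'cV[R]_3 :=
  match s with
  | Face => @face_map R
  | Edge i => edge_map i
  | Vertex i => fun _ => vertex i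
  end.

Lemma shape_letters_inj s s' : shape_letters s =i shape_letters s' -> s = s'.
Proof.
case: s => [|i|i]; case: s' => [|j|j] //= h.
- by have := h j; rewrite !inE eqxx.
- by have := h j; rewrite !inE eqxx.
- by have := h i; rewrite !inE eqxx.
- by have := h i; rewrite !inE eqxx => /esym/eqP ->.
- have h1 := h j; have h2 := h (prv j); move: h1 h2; rewrite !inE !eqxx orbT => /eqP -> /eqP.
  by move=> e; have : prv i != i by [move: (i); exact: all_letters]; rewrite e eqxx.
- by have := h i; rewrite !inE eqxx.
- have h1 := h i; have h2 := h (prv i); move: h1 h2; rewrite !inE !eqxx orbT => /esym/eqP -> /esym/eqP.
  by move=> e; have : prv j != j by [move: (j); exact: all_letters]; rewrite e eqxx.
- have h1 := h i; have h2 := h (prv i); move: h1 h2; rewrite !inE !eqxx orbT => /esym h1 /esym h2.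
  congr Vertex; apply/eqP; move: h1 h2.
  have : ((i == j) || (i == prv j)) ==> ((prv i == j) || (prv i == prv j)) ==> (i == j).
    by move: (i) (j); exact: all_letters2.
  by move=> /implyP k /k /implyP k2 /k2.
Qed.

Lemma shape_map_hyp s u : hyp (@shape_map s u).
Proof. by case: s u => [|i|i] u /=; [exact: face_map_hyp|exact: axis_hyp|exact: vertex_hyp]. Qed.

Lemma shape_map_dom s u : `|u| <= 1 -> dom (@shape_map s u).
Proof.
case: s u => [|i|i] u /= hu; first exact: face_map_dom.
  by have /andP[t0 t1] := edge_time hu; have [] := axis_dom i t0 t1.
by move=> j; exact: B_vertex_le0.
Qed.

Lemma shape_map_continuous s : continuous (@shape_map s).
Proof.
case: s => [|i|i] /= u; first exact: face_map_continuous.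
  by apply: edge_cvg; [exact: nbhs_filter|exact: coord_continuous].
exact: cst_continuous.
Qed.

Lemma shape_map_wall s u j : `|u| < 1 -> B j (@shape_map s u) = 0 <-> j \in shape_letters s.
Proof.
case: s u => [|i|i] u /= hu; split.
- by have := (face_map_sdom (ltW hu)).2 hu j => h e; rewrite e ltxx in h.
- by [].
- have /andP[t0 t1] := edge_time (ltW hu); have [_ h] := axis_dom i t0 t1.
  by move=> /(h (edge_time_lt hu)) ->; rewrite inE.
- rewrite inE => /eqP ->; have [nA nB] := axis_normal R i.
  by rewrite lorentz_geod nA nB !mulr0 addr0.
- by move/vertex_vanish; rewrite !inE => -[] ->; rewrite eqxx ?orbT.
- have [g1 _ g3 _ _] := B_vertex_nxt R i.
  by rewrite !inE => /orP[] /eqP ->.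
Qed.

Lemma shape_map_inj s (u v : 'rV[R]_(shape_dim s)) : `|u| < 1 -> `|v| < 1 ->
  shape_map u = shape_map v -> u = v.
Proof.
case: s u v => [|i|i] u v /= hu hv e.
- by apply: face_map_inj e; exact: ltW.
- have := geod_inj (axis_null R i) e => /(mulIf (lt0r_neq0 lnLam_gt0)) h.
  by apply/rowP => k; rewrite (ord1 k); lra.
- by apply/rowP => -[].
Qed.

Lemma shape_locate y : hyp y -> dom y -> exists s (u : 'rV[R]_(shape_dim s)), `|u| < 1 /\ y = shape_map u.
Proof.
move=> hy dy.
have [[i hi]|h] := pselect (exists i, B i y = 0); last first.
  have sy : sdom y.
    by move=> i; rewrite lt_neqAle dy andbT; apply/eqP => e; apply: h; exists i.
  by have [u hu e] := face_map_onto hy sy; exists Face, u.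
have vtx k : exists s (u : 'rV[R]_(shape_dim s)), `|u| < 1 /\ vertex k = shape_map u.
  by exists (Vertex k), 0; rewrite normr0.
have [[j [ji hj]]|h] := pselect (exists j, j != i /\ B j y = 0).
  have n1 := vanish_nnc hy dy hi hj.
  have : (j == prv i) || (i == prv j).
    have : ~~ nc i j ==> (j != i) ==> ((j == prv i) || (i == prv j)) by move: (i) (j); exact: all_letters2.
    by rewrite n1 ji.
  case/orP => /eqP e.
    by rewrite (vertex_unique hy hi) -?e.
  by rewrite (vertex_unique hy hj) -?e.
have [|u hu e] := edge_onto hy dy (i := i); last by exists (Edge i), u.
move=> j; split=> [hj|->//]; apply/eqP; apply: contrapT => /negP ji.
by apply: h; exists j.
Qed.

Lemma shape_boundary s (u : 'rV[R]_(shape_dim s)) : `|u| = 1 ->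
  exists s' (v : 'rV[R]_(shape_dim s')), [/\ (shape_dim s' < shape_dim s)%N, `|v| < 1 & shape_map u = shape_map v].
Proof.
case: s u => [|i|i] u /= hu.
- have lu : `|u| <= 1 by rewrite hu.
  have [s [v [hv e]]] := shape_locate (face_map_hyp u) (face_map_dom lu).
  exists s, v; split=> //; case: s v hv e => //= v hv e.
  have := (face_map_sdom lu).1; rewrite hu ltxx e => h.
  by have := h ((face_map_sdom (ltW hv)).2 hv).
- have [_ [k]] := rV_norm_eq1 hu; rewrite (ord1 k) => h.
  have vtx k' : exists s' (v : 'rV[R]_(shape_dim s')), [/\ (shape_dim s' < 1)%N, `|v| < 1 & vertex k' = shape_map v].
    by exists (Vertex k'), 0; rewrite normr0.
  have [e|e] : u 0 0 = 1 \/ u 0 0 = -1.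
    by move/eqP: h; rewrite eqr_norml ler01 andbT => /orP[] /eqP; [left|right].
    by rewrite /edge_map e (_ : _ * _ = ln Lam) ?axis_end //; field.
  by rewrite /edge_map e (_ : _ * _ = 0) ?axis_start //; field.
- have [_ [[]]] := rV_norm_eq1 hu; by [].
Qed.
End Shapes.

(** * The cells of the surface *)

Section Genus.
Variables (R : realType) (F : finFieldType) (Q : {poly F}).
Hypothesis Q0 : Q != 0.
Implicit Types (x y : 'cV[R]_3) (i j : letter) (w u z : word).
Notation normal := (@normal R).
Notation B i z := (lorentz (normal i) z).
Notation ev := (@ev R).
Notation S := (surface R Q0).

Lemma surf_projP x y : surf_proj S x = surf_proj S y <-> exists2 z, ker Q z & y = ev z *m x.
Proof.
split=> [e|[z kz ->]].
  have : surf_proj S y y by exists 1%:M; [exact: deck1|rewrite mul1mx].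
  by rewrite -e => -[_ [z kz ->] h]; exists z.
apply/seteqP; split=> p [_ [w kw ->] ->].
  exists (ev (w ++ rev z)); first by exists (w ++ rev z) => //; apply: ker_cat => //; exact: ker_rev.
  by rewrite ev_cat -mulmxA ev_Arev.
exists (ev (w ++ z)); first by exists (w ++ z) => //; exact: ker_cat.
by rewrite ev_cat -mulmxA.
Qed.

(** These are the classes of even words modulo the deck group, M in number. Together with
    [sign_word], which realises the four pairs of parities, they represent all 4M hexagons. *)
Definition even_residue : Type :=
  {c : 'M['rV[F]_(size Q).-1]_6 | `[< exists2 w, even_word w & residue Q w = c >]}.
HB.instance Definition _ := Finite.on even_residue.

Definition even_rep (c : even_residue) : word := s2val (cid2 (asboolW (valP c))).

Lemma even_repP c : even_word (even_rep c) /\ residue Q (even_rep c) = val c.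
Proof. by rewrite /even_rep; case: cid2. Qed.

Definition sign_word (s : bool * bool) : word :=
  (if s.1 then [:: @Ordinal 6 1 isT] else [::]) ++ (if s.2 then [:: @Ordinal 6 0 isT] else [::]).

Definition rep (c : even_residue) (s : bool * bool) := even_rep c ++ sign_word s.

Definition addbb2 (s t : bool * bool) := (s.1 (+) t.1, s.2 (+) t.2).

Lemma signs_cat u w : signs (u ++ w) = addbb2 (signs u) (signs w).
Proof. by rewrite /signs !count_cat !oddD. Qed.

Lemma signs_rev w : signs (rev w) = signs w.
Proof. by rewrite /signs !count_rev. Qed.

Lemma signs_even w : even_word w <-> signs w = (false, false).
Proof. by rewrite /even_word /signs; do 2 case: (odd _); split. Qed.

Lemma signs_weq u w : weq u w -> signs u = signs w.
Proof.
move=> e; have : even_word (u ++ rev w).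
  by rewrite (even_weq (weq_catr _ e)) (even_weq (weq_revK w)).
move/signs_even; rewrite signs_cat signs_rev /addbb2.
by case: (signs u) (signs w) => [[] []] [[] []].
Qed.

Lemma signs_rep c s : signs (rep c s) = s.
Proof.
rewrite signs_cat (signs_even _).1; last by case: (even_repP c).
by case: s => [[] []].
Qed.

Lemma rep_exists w : exists c, ker Q (w ++ rev (rep c (signs w))).
Proof.
pose w' := w ++ rev (sign_word (signs w)).
have ew' : even_word w'.
  apply/signs_even; rewrite signs_cat signs_rev; case: (signs w) => [[] []] //.
have hc : `[< exists2 w, even_word w & residue Q w = residue Q w' >] by apply/asboolP; exists w'.
pose c : even_residue := exist (fun c => is_true `[< exists2 w, even_word w & residue Q w = c >]) (residue Q w') hc.
exists c.
have [h1 h2] := even_repP c.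
have : ker Q (w' ++ rev (even_rep c)).
  by apply/(classP Q0); split; [rewrite (signs_even _).1 // (signs_even _).1|rewrite h2].
by rewrite /w' /rep rev_cat catA.
Qed.

Lemma rep_inj c c' s : ker Q (rep c s ++ rev (rep c' s)) -> c = c'.
Proof.
have [h1 h2] := even_repP c; have [h1' h2'] := even_repP c'.
move=> k; have : ker Q (even_rep c ++ rev (even_rep c')).
  apply: ker_weq k; rewrite /rep rev_cat -catA; apply: weq_catl; rewrite catA -[X in weq _ X]cat0s.
  by apply: weq_catr; apply: weq_revK.
by move/(classP Q0) => [_]; rewrite h2 h2' => /val_inj.
Qed.

Definition local_cell : Type := (((bool * bool) + (bool * 'I_6)) + 'I_6)%type.
HB.instance Definition _ := Finite.on local_cell.

Definition local_shape (a : local_cell) : shape :=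
  match a with inl (inl _) => Face | inl (inr (_, i)) => Edge i | inr i => Vertex i end.

(* The parities of the letters of the representatives: those that the stabilizer of the cell
   can change are normalised to be even. *)
Definition local_signs (a : local_cell) : bool * bool :=
  match a with
  | inl (inl s) => s
  | inl (inr (b, i)) => if odd i then (false, b) else (b, false)
  | inr _ => (false, false)
  end.

Definition cells : Type := (even_residue * local_cell)%type.
HB.instance Definition _ := Finite.on cells.

Definition cells_dim (c : cells) := shape_dim (local_shape c.2).
Definition cells_map (c : cells) (u : 'rV[R]_(cells_dim c)) : 'cV[R]_3 :=
  ev (rep c.1 (local_signs c.2)) *m shape_map u.

(** Right multiplication by letters of the stabilizer leaves the cell in place and corrects the
    parities that the stabilizer can change. *)
Lemma normalise s w : exists v a,
  [/\ {subset v <= shape_letters s}, local_shape a = s & signs (w ++ v) = local_signs a].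
Proof.
case: s => [|i|i].
- by exists [::], (inl (inl (signs w))); rewrite cats0.
- pose b := if odd i then (signs w).1 else (signs w).2.
  pose o := if odd i then (signs w).2 else (signs w).1.
  exists (if b then [:: i] else [::]), (inl (inr (o, i))); split=> //.
    by case: b.
  rewrite signs_cat /local_signs /addbb2 /b /o; case: (signs w) => p q.
  by case oi : (odd i); case: p; case: q; rewrite /= ?oi.
- have op : odd (prv i) = ~~ odd i by apply/eqP; move: (i); exact: all_letters.
  pose bi := if odd i then (signs w).1 else (signs w).2.
  pose bp := if odd i then (signs w).2 else (signs w).1.
  exists ((if bi then [:: i] else [::]) ++ (if bp then [:: prv i] else [::])), (inr i); split=> //.
    by move=> j; rewrite mem_cat => /orP[]; [case: bi|case: bp]; rewrite ?inE // => /eqP ->; rewrite eqxx ?orbT.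
  rewrite !signs_cat /local_signs /addbb2 /bi /bp; case: (signs w) => p q.
  by case oi : (odd i); case: p; case: q; rewrite /= ?op ?oi.
Qed.

Lemma locate w y : hyp y -> dom y -> exists (c : cells) (u : 'rV[R]_(cells_dim c)), [/\ `|u| < 1,
  surf_proj S (cells_map u) = surf_proj S (ev w *m y) & y = shape_map u].
Proof.
move=> hy dy; have [s [u [hu e]]] := shape_locate hy dy.
have [v [a [hv ha sg]]] := normalise s w.
move: u hu e hv; rewrite -ha => u hu e hv {s ha}.
have [c hc] := rep_exists (w ++ v); rewrite sg in hc.
exists (c, a), u; split=> //; apply/surf_projP; exists ((w ++ v) ++ rev (rep c (local_signs a))) => //.
have fv : ev v *m y = y by apply: ev_fix => i iv; rewrite e; apply/(shape_map_wall _ hu); exact: hv.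
by rewrite /cells_map /= [in RHS]ev_cat -e -mulmxA ev_Arev ev_cat -mulmxA fv.
Qed.

(** Equivalent points of the closed hexagon are equal, so the shapes agree. The word that compares
    the representatives lies in the stabilizer of the cell; the normalised parities make it even,
    hence trivial, and the residues agree too. *)
Lemma cells_same (c d : cells) (u : 'rV[R]_(cells_dim c)) (v : 'rV[R]_(cells_dim d)) : `|u| < 1 -> `|v| < 1 ->
  surf_proj S (cells_map u) = surf_proj S (cells_map v) ->
  c = d /\ shape_map u = shape_map v.
Proof.
case: c u => c a u; case: d v => d b v hu hv /surf_projP[z kz]; rewrite /cells_map /= => e.
have hx := shape_map_hyp u; have dx := shape_map_dom (ltW hu).
have dy := shape_map_dom (ltW hv).
set r := rep c _ in e; set r' := rep d _ in e.
have [|xy [w' ww' hw']] := dom_word dx dy (w := rev r' ++ z ++ r).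
  by rewrite (ev_cat _ (rev r')) (ev_cat _ z) -!mulmxA -e ev_Arev.
split=> //.
have sh : local_shape a = local_shape b.
  apply: shape_letters_inj => j; apply/idP/idP => h.
    by apply/(shape_map_wall _ hv); rewrite -xy; apply/(shape_map_wall _ hu).
  by apply/(shape_map_wall _ hu); rewrite xy; apply/(shape_map_wall _ hv).
have wl : {in w', forall i, i \in shape_letters (local_shape b)}.
  by move=> i /hw' h; apply/(shape_map_wall _ hv).
have sw : signs w' = addbb2 (local_signs b) (local_signs a).
  rewrite (signs_weq ww') (signs_cat (rev r')) (signs_cat z) signs_rev !signs_rep ((signs_even z).1 (proj1 kz)).
  by rewrite /addbb2.
have ab : a = b.
  move: sh sw wl {u hu hx dx e xy v hv dy r r' ww' hw'}; case: a => [[[p q]|[p i]]|i]; case: b => [[[p' q']|[p' i']]|i'] //=.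
  - move=> _ sw wl; have w0 : w' = [::] by case: (w') wl => // i w1 /(_ i (mem_head _ _)).
    by move: sw; rewrite w0 /signs /addbb2 /= => -[]; case: p; case: q; case: p'; case: q'.
  - case=> ii; rewrite -{}ii => sw wl; congr (inl (inr (_, _))).
    have nz (o : pred letter) : ~~ o i -> count o w' = 0%N.
      move=> oi; apply/eqP; rewrite -leqn0 leqNgt -has_count; apply/hasPn => j /wl.
      by rewrite inE => /eqP ->.
    move: sw; rewrite /signs /addbb2; case oi : (odd i) => /= -[h1 h2].
      by move: h2; rewrite nz ?oi //=; case: p; case: p'.
    by move: h1; rewrite nz ?oi //=; case: p; case: p'.
  - by case=> ->.
subst b.
have ew' : even_word w'.
  by apply/signs_even; rewrite sw /addbb2 !addbb.
have w0 : weq w' [::].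
  apply: even_clique ew' => i j iw jw; apply: vanish_nnc hx dx _ _.
    by apply/(shape_map_wall _ hu); have := wl i iw.
  by apply/(shape_map_wall _ hu); have := wl j jw.
congr (_, _); apply: (@rep_inj _ _ (local_signs a)).
apply: (@ker_weq _ _ (rev z)); last exact: ker_rev.
have h : weq (rev r' ++ z ++ r) [::] by apply: weq_trans (weq_sym ww') w0.
have h2 : weq (z ++ r) r'.
  rewrite -[X in weq X _]cat0s; apply: weq_trans (weq_catr _ (weq_sym (weq_revK r'))) _.
  by rewrite -catA -[X in weq _ X]cats0; apply: weq_catl.
have h3 : weq r (rev z ++ r').
  rewrite -[X in weq X _]cat0s; apply: weq_trans (weq_catr _ (weq_sym (weq_Krev z))) _.
  by rewrite -catA; apply: weq_catl.
apply: weq_sym; apply: weq_trans (weq_catr _ h3) _.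
by rewrite -catA -[X in weq _ X]cats0; apply: weq_catl; apply: weq_revK.
Qed.

Definition cellulation : cell_structure S.
Proof.
apply: (@CellStructure R S cells cells_dim cells_map).
- by move=> [c [[s|[p i]]|i]].
- by move=> c u _; apply: ev_hyp; apply: shape_map_hyp.
- move=> c; apply: continuous_subspaceT => u.
  by apply: mulmx_cvg; [exact: nbhs_filter|exact: shape_map_continuous].
- move=> x /dom_cover[w [y [hy dy ->]]].
  by have [c [u [h1 h2 _]]] := locate w hy dy; exists c, u.
- by move=> c u v hu hv /(cells_same hu hv)[_]; exact: shape_map_inj.
- by move=> c d u v hu hv /(cells_same hu hv)[].
- move=> c u hu; have lu : `|u| <= 1 by rewrite hu.
  have [s' [v' [lt hv' e]]] := shape_boundary hu.
  have [d [v [hv e1 e2]]] := locate (rep c.1 (local_signs c.2)) (shape_map_hyp u) (shape_map_dom lu).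
  have ss : s' = local_shape d.2.
    by apply: shape_letters_inj => j; apply/idP/idP => h;
      [apply/(shape_map_wall _ hv); rewrite -e2 e; apply/(shape_map_wall _ hv')|
       apply/(shape_map_wall _ hv'); rewrite -e e2; apply/(shape_map_wall _ hv)].
  exists d, v; split; [|exact: hv|exact: esym e1].
  by move: lt; rewrite ss.
Defined.

Lemma surface_genus : has_genus S (#|{: even_residue}|).+1.
Proof.
exists cellulation; rewrite /euler_char /=.
(* Each even residue carries 4 faces, 12 edges and 6 vertices, and 4 - 12 + 6 = -2. *)
transitivity (\sum_(c : even_residue) (-2 : int)).
  rewrite -(pair_bigA _ (fun (c : even_residue) (a : local_cell) => (-1) ^+ shape_dim (local_shape a))) /=.
  apply: eq_bigr => c _; rewrite !big_sumType /=.
  rewrite (eq_bigr (fun=> 1)); last by [].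
  rewrite sumr_const card_prod card_bool.
  rewrite (eq_bigr (fun=> -1)); last by case.
  rewrite sumr_const card_prod card_bool card_ord.
  by rewrite sumr_const card_ord.
rewrite sumr_const; set M := #|_|; rewrite -mulr_natr natz; lia.
Qed.
End Genus.

(** * Geodesics and countable covers of intervals *)

Section Geodesics.
Variable R : realType.
Implicit Types (x y A B n : 'cV[R]_3) (s t l : R).

(** Otherwise the interval would be countable and of Lebesgue measure zero. Walls and deck
    transformations are indexed by words, so this replaces local finiteness arguments. *)
Lemma pigeonhole_itv (I : countType) (Z : I -> set R) s t : s < t ->
  (forall r, s <= r <= t -> exists e, Z e r) ->
  exists e r r', [/\ r <> r', Z e r & Z e r'].
Proof.
move=> st cover; apply: contrapT => h.
have : countable (`[s, t]%classic : set R).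
  apply: (@sub_countable _ _ _ (\bigcup_(e in [set: I]) Z e)).
    apply: subset_card_le => r /=; rewrite in_itv /= => /cover[e Zr]; by exists e.
  apply: bigcup_countable => [|e _]; first exact: countableP.
  have [[r Zr]|ne] := pselect (exists r, Z e r); last first.
    by rewrite (_ : Z e = set0) //; apply/seteqP; split=> // r Zr; case: ne; exists r.
  rewrite (_ : Z e = [set r]); first exact: countable1.
  apply/seteqP; split=> [r' Zr'|_ ->//] /=.
  by apply: contrapT => rr'; apply: h; exists e, r', r.
move=> /countable_lebesgue_measure0; rewrite lebesgue_measure_itv /= lte_fin st.
by rewrite -EFinB => -[] /eqP; rewrite subr_eq0 (gt_eqF st).
Qed.

(** Some wall is met at two different times, and a line that meets a wall twice lies in it. *)
Lemma geod_in_wall (I : countType) (n : I -> 'cV[R]_3) A B s t : s < t ->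
  (forall r, s <= r <= t -> exists e, lorentz (n e) (geod A B r) = 0) ->
  exists e, lorentz (n e) A = 0 /\ lorentz (n e) B = 0.
Proof.
move=> st /(pigeonhole_itv (Z := fun e r => lorentz (n e) (geod A B r) = 0) st).
move=> [e [r [r' [rr' h h']]]]; exists e; move: h h'; rewrite !lorentz_geod.
set a := lorentz _ A; set b := lorentz _ B => h h'.
have k q : expR q * a + expR (- q) * b = 0 -> expR q ^+ 2 * a + b = 0.
  move=> e0; have : expR q * (expR q * a + expR (- q) * b) = 0 by rewrite e0 mulr0.
  by rewrite mulrDr !mulrA -expr2 -expRD subrr expR0 mul1r.
have {}h := k _ h; have {}h' := k _ h'.
have d : (expR r ^+ 2 - expR r' ^+ 2) * a = 0 by rewrite mulrBl; lra.
have a0 : a = 0.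
  move/eqP: d; rewrite mulf_eq0 => /orP[|/eqP//].
  rewrite subr_eq0 eqrXn2 ?expR_ge0 // => /eqP /expR_inj e'.
  by case: rr'.
by split=> //; move: h; rewrite a0 mulr0 add0r.
Qed.

Lemma arcosh_cosh (a d : R) : 1 <= a -> 0 <= d -> arcosh a = d <-> a = (expR d + expR (- d)) / 2.
Proof.
move=> a1 d0; rewrite /arcosh; have a2 : 0 <= a ^+ 2 - 1.
  have : 1 * 1 <= a * a by apply: ler_pM.
  by rewrite expr2; lra.
split=> [e|ea].
  have q0 : 0 <= Num.sqrt (a ^+ 2 - 1) by exact: sqrtr_ge0.
  have ed : expR d = a + Num.sqrt (a ^+ 2 - 1) by rewrite -e lnK // posrE; lra.
  have ed' : expR (- d) = a - Num.sqrt (a ^+ 2 - 1).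
    apply: (mulfI (lt0r_neq0 (expR_gt0 d))); rewrite -expRD subrr expR0 ed.
    set q := Num.sqrt _; have q2 : q ^+ 2 = a ^+ 2 - 1 by rewrite sqr_sqrtr.
    by transitivity (a ^+ 2 - q ^+ 2); [rewrite q2; ring|ring].
  by rewrite ed ed'; field.
have pq : expR d * expR (- d) = 1 by rewrite -expRD subrr expR0.
have e1 : 1 <= expR d by rewrite -[X in X <= _]expR0 ler_expR.
have e2 : expR (- d) <= 1 by rewrite -[X in _ <= X]expR0 ler_expR; lra.
have -> : a ^+ 2 - 1 = ((expR d - expR (- d)) / 2) ^+ 2.
  by rewrite ea; transitivity (((expR d + expR (- d)) / 2) ^+ 2 - expR d * expR (- d)); [rewrite pq|field].
rewrite sqrtr_sqr ger0_norm; last by rewrite divr_ge0 // subr_ge0; lra.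
by rewrite ea (_ : _ + _ = expR d) ?expRK //; field.
Qed.

Lemma geod_line A B : null_pair A B -> (forall t, hyp (geod A B t)) -> geodesic_line (geod A B).
Proof.
move=> AB hg; split=> // s t; apply/arcosh_cosh => //.
  by have := hyp_lorentz (hg s) (hg t); lra.
rewrite geod_geod //; congr (_ / _).
by case: (ger0P (s - t)) => _; rewrite ?opprB // addrC.
Qed.

(** [A] and [B] are solved from the points at times 0 and 1. The distances to these points fix the
    products of [gamma t] with [A] and [B], and the difference from the model curve is a null vector
    orthogonal to a timelike one, hence zero. *)
Lemma geodesic_line_geod (gamma : R -> 'cV[R]_3) : geodesic_line gamma ->
  exists A B, [/\ null_pair A B, forall t, hyp (geod A B t) & gamma = geod A B].
Proof.
move=> [hg hd].
have ip s t : - lorentz (gamma s) (gamma t) = (expR (t - s) + expR (s - t)) / 2.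
  have /(arcosh_cosh _ (normr_ge0 _)).1 -> := hd s t; last by have := hyp_lorentz (hg s) (hg t); lra.
  congr (_ / _).
  by case: (ger0P (s - t)) => _; rewrite ?opprB // addrC.
pose e : R := expR 1; pose f : R := expR (-1).
have ef : e * f = 1 by rewrite -expRD subrr expR0.
have e1 : 1 < e by rewrite expR_gt1.
have f1 : f < 1 by rewrite -[X in _ < X]expR0 ltr_expR; lra.
have efn : e - f != 0 by rewrite lt0r_neq0 // subr_gt0; lra.
pose x := gamma 0; pose y := gamma 1.
have xx : lorentz x x = -1 by case: (hg 0).
have yy : lorentz y y = -1 by case: (hg 1).
have xy : lorentz x y = - (e + f) / 2.
  by have := ip 0 1; rewrite subr0 sub0r -/x -/y -/e -/f; lra.
pose A := (e - f)^-1 *: (y - f *: x); pose B := (e - f)^-1 *: (e *: x - y).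
have AB : null_pair A B.
  split; rewrite /A /B !lorentz_lin ?(lorentzC y x) xx yy xy.
  - transitivity ((e - f)^-1 ^+ 2 * (e * f - 1)); first by field.
    by rewrite ef subrr mulr0.
  - transitivity ((e - f)^-1 ^+ 2 * (e * f - 1)); first by field.
    by rewrite ef subrr mulr0.
  - transitivity ((e - f)^-1 ^+ 2 * (1 + e * f - (e + f) ^+ 2 / 2)); first by field.
    rewrite (_ : 1 + e * f - _ = - (e - f) ^+ 2 / 2); last first.
      transitivity (1 - e * f + 2 * (e * f) - (e + f) ^+ 2 / 2); first by ring.
      by rewrite ef; transitivity (2 * (e * f) - (e + f) ^+ 2 / 2); [rewrite ef; ring|field].
    by field.
have xE : x = A + B by apply/colP => r; rewrite !mxE; field.
have yE : y = e *: A + f *: B.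
  by apply/colP => r; rewrite !mxE; field.
have [aa bb ab] := AB.
have eq t : gamma t = geod A B t.
  have tx : lorentz (gamma t) x = - (expR t + expR (- t)) / 2.
    by have := ip t 0; rewrite subr0 sub0r -/x; lra.
  have ty : lorentz (gamma t) y = - (expR t * f + expR (- t) * e) / 2.
    by have := ip t 1; rewrite -/y !expRD -/e -/f; lra.
  have tA : lorentz (gamma t) A = - expR (- t) / 2.
    by rewrite /A lorentzZr lorentzDr lorentzNr lorentzZr tx ty; field.
  have tB : lorentz (gamma t) B = - expR t / 2.
    by rewrite /B lorentzZr lorentzDr lorentzNr lorentzZr tx ty; field.
  apply/eqP; rewrite -subr_eq0; apply/eqP; set Y := gamma t - geod A B t.
  have YA : lorentz Y A = 0.
    by rewrite /Y lorentzDl lorentzNl tA (lorentzC _ A) lorentz_geod aa ab; field.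
  have YB : lorentz Y B = 0.
    by rewrite /Y lorentzDl lorentzNl tB (lorentzC _ B) lorentz_geod bb (lorentzC B) ab; field.
  have tt : lorentz (gamma t) (gamma t) = -1 by case: (hg t).
  have pp : expR t * expR (- t) = 1 by rewrite -expRD subrr expR0.
  have Yg : lorentz Y (geod A B t) = 0 by rewrite lorentz_geod YA YB !mulr0 addr0.
  have YY : lorentz Y Y = 0.
    have gg : lorentz (geod A B t) (geod A B t) = -1.
      by have := geod_geod t t AB; rewrite subrr expR0; lra.
    have -> : lorentz Y Y = lorentz Y (gamma t) by rewrite {2}/Y lorentzDr lorentzNr Yg subr0.
    rewrite lorentzC /Y lorentzDr lorentzNr tt lorentz_geod tA tB.
    by transitivity (- 1 + expR t * expR (- t)); [field|rewrite pp; ring].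
  apply: (@orth_timelike _ x) => //; first by rewrite xx ltrN10.
    by rewrite YY.
  by rewrite xE lorentzDl !(lorentzC _ Y) YA YB addr0.
exists A, B; split=> //; last exact/funext.
by move=> t; rewrite -eq.
Qed.
End Geodesics.

(** * Systoles and curves *)

Section Systoles.
Variables (R : realType) (F : finFieldType) (m : nat).
Hypothesis m0 : (0 < m)%N.
Notation Q := (modulus F m).
Notation k := m.*2.+1.
Hypothesis charF : forall q : nat, (0 < q <= 4 * k)%N -> q%:R != 0 :> F.
Hypothesis Q0 : Q != 0.
Implicit Types (x y A B : 'cV[R]_3) (i j : letter) (w u z : word) (s t l : R).
Notation normal := (@normal R).
Notation axisA := (@axisA R).
Notation axisB := (@axisB R).
Notation ev := (@ev R).
Notation Lam := (@Lam R).
Notation S := (surface R Q0).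
Notation tau := (tesselation R Q0).

Let k1 : (1 < k)%N. Proof. by move: m0; clear; case: m. Qed.
Let sQ : size Q = (4 * k - 3)%N. Proof. exact: size_modulus. Qed.

Definition wline w i : set 'cV[R]_3 := [set x | hyp x /\ lorentz (ev w *m normal i) x = 0].
Definition curve w i : set (set 'cV[R]_3) := surf_proj S @` wline w i.

Lemma wline_range w i A B : null_pair A B -> (forall t, hyp (geod A B t)) ->
  lorentz (ev w *m normal i) A = 0 -> lorentz (ev w *m normal i) B = 0 ->
  range (geod A B) = wline w i.
Proof.
move=> AB hg nA nB; apply/seteqP; split=> x /=.
  by move=> [t _ <-]; split=> //; rewrite lorentz_geod nA nB !mulr0 addr0.
move=> [hx nx]; have nn : lorentz (ev w *m normal i) (ev w *m normal i) = 1.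
  by rewrite ev_lorentz lorentz_normal gram_eq.
by have [t ->] := plane_param AB nn nA nB hg hx nx; exists t.
Qed.

Lemma ev_geod w A B t : ev w *m geod A B t = geod (ev w *m A) (ev w *m B) t.
Proof. by rewrite /geod mulmxDr -!scalemxAr. Qed.

Lemma ev_null_pair w A B : null_pair A B -> null_pair (ev w *m A) (ev w *m B).
Proof. by case=> h1 h2 h3; split; rewrite ev_lorentz. Qed.

Definition wgeod w i := geod (ev w *m axisA i) (ev w *m axisB i).

Lemma wgeod_null w i : null_pair (ev w *m axisA i) (ev w *m axisB i).
Proof. by apply: ev_null_pair; exact: axis_null. Qed.

Lemma wgeod_hyp w i t : hyp (wgeod w i t).
Proof. by rewrite /wgeod -ev_geod; apply: ev_hyp; exact: axis_hyp. Qed.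

Lemma wgeod_wall w i : lorentz (ev w *m normal i) (ev w *m axisA i) = 0 /\
  lorentz (ev w *m normal i) (ev w *m axisB i) = 0.
Proof. by rewrite !ev_lorentz; exact: axis_normal. Qed.

Lemma wgeod_range w i : range (wgeod w i) = wline w i.
Proof.
by have [h1 h2] := wgeod_wall w i; apply: wline_range (wgeod_null w i) (wgeod_hyp w i) h1 h2.
Qed.

Lemma curveE w i : curve w i = range (surf_proj S \o wgeod w i).
Proof. by rewrite /curve -wgeod_range image_comp. Qed.

(** The reflection in the wall would fix [x], so its word would be trivial; but it contains an odd
    number of letters of the parity of [i]. *)
Lemma wall_sdom w i x : sdom x -> lorentz (ev w *m normal i) x <> 0.
Proof.
move=> sx h; have : ev (w ++ i :: rev w) *m x = ev [::] *m x.
  rewrite -[i :: rev w]/([:: i] ++ rev w) (ev_cat _ w) (ev_cat _ [:: i]) ev1 -!mulmxA refl_fix.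
    by rewrite ev_revA mul1mx.
  by rewrite -h ev_adj.
move=> /(sdom_word sx) /signs_weq; rewrite -[i :: rev w]/([:: i] ++ rev w) (signs_cat w) (signs_cat [:: i]) signs_rev /addbb2.
by case: (signs w) => p q; rewrite /signs /=; case: (odd i) => /= -[]; case: p; case: q.
Qed.

Lemma wall_off_sdom u y : hyp y -> dom y ->
  (forall w i, lorentz (ev w *m normal i) (ev u *m y) <> 0) -> sdom y.
Proof.
move=> hy dy h i; rewrite lt_neqAle dy andbT; apply/eqP => e.
by apply: (h u i); rewrite ev_lorentz.
Qed.

Lemma skeletonP x : hyp x -> skeleton tau (surf_proj S x) <-> exists w i, wline w i x.
Proof.
move=> hx; split.
  move=> [f [i [y [[u ->] /hex_sideE[hy dy e] /surf_projP[z kz h]]]]].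
  have [z' kz' ex] : exists2 z', ker Q z' & x = ev z' *m (ev u *m y).
    by exists (rev z); [exact: ker_rev|rewrite h ev_Arev].
  exists (z' ++ u), i; split=> //.
  by rewrite ex mulmxA -ev_cat ev_lorentz.
move=> [w [i [_ h]]]; have [u [y [hy dy ex]]] := dom_cover hx.
have [[j hj]|ne] := pselect (exists j, lorentz (normal j) y = 0); last first.
  have sy : sdom y by move=> j; rewrite lt_neqAle dy andbT; apply/eqP => e; apply: ne; exists j.
  case: (@wall_sdom (rev u ++ w) i y sy).
  by rewrite ev_cat -mulmxA ev_adj revK -ex.
exists (ev u), j, y; split; [by exists u|exact/hex_sideE|by rewrite ex].
Qed.

(** A priori the deck transformation depends on the time. One of the countably many occurs at two
    times, and two times determine the images of both ends, hence the relation at all times. *)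
Lemma period_word A B l : null_pair A B -> (forall t, hyp (geod A B t)) ->
  (forall t, surf_proj S (geod A B (t + l)) = surf_proj S (geod A B t)) ->
  exists2 z, ker Q z & forall t, geod A B (t + l) = ev z *m geod A B t.
Proof.
move=> AB hg h.
pose Z (z : word) : set R := [set t | ker Q z /\ geod A B (t + l) = ev z *m geod A B t].
have [|z [r [r' [rr' [kz h1] [_ h2]]]]] := pigeonhole_itv (Z := Z) (ltr01 : (0 : R) < 1).
  move=> t _; have /esym/surf_projP[z kz e] := h t; by exists z.
exists z => // t; rewrite ev_geod.
move: h1 h2; rewrite !ev_geod; move: (ev z *m A) (ev z *m B) => A' B' h1 h2.
have split2 q : geod A B (q + l) = geod A' B' q ->
    expR q ^+ 2 *: (expR l *: A - A') = B' - expR (- l) *: B.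
  rewrite /geod opprD !expRD => e.
  have pq : expR q * expR (- q) = 1 by rewrite -expRD subrr expR0.
  apply/colP => p; have /colP/(_ p) := congr1 (fun v => expR q *: v) e; rewrite !mxE.
  set x1 := A p 0; set x2 := B p 0; set x3 := A' p 0; set x4 := B' p 0 => e'.
  have k1' : expR q * (expR q * expR l * x1 + expR (- q) * expR (- l) * x2) =
    expR q ^+ 2 * (expR l * x1) + (expR q * expR (- q)) * (expR (- l) * x2) by ring.
  have k2' : expR q * (expR q * x3 + expR (- q) * x4) =
    expR q ^+ 2 * x3 + (expR q * expR (- q)) * x4 by ring.
  by move: e'; rewrite k1' k2' pq !mul1r mulrBr; lra.
have {h1} e1 := split2 _ h1; have {h2} e2 := split2 _ h2.
have U0 : expR l *: A - A' = 0.
  have : (expR r ^+ 2 - expR r' ^+ 2) *: (expR l *: A - A') = 0 by rewrite scalerBl e1 e2 subrr.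
  move/eqP; rewrite scaler_eq0 => /orP[|/eqP//].
  by rewrite subr_eq0 eqrXn2 ?expR_ge0 // => /eqP /expR_inj.
have V0 : B' - expR (- l) *: B = 0 by rewrite -e1 U0 scaler0.
rewrite /geod opprD !expRD -!scalerA.
by move/eqP: U0; rewrite subr_eq0 => /eqP ->; move/eqP: V0; rewrite subr_eq0 => /eqP ->.
Qed.

Lemma geod_shift A B s t : geod (expR s *: A) (expR (- s) *: B) t = geod A B (t + s).
Proof. by rewrite /geod !scalerA opprD !expRD. Qed.

Lemma null_pair_shift A B s : null_pair A B -> null_pair (expR s *: A) (expR (- s) *: B).
Proof.
move=> [h1 h2 h3]; split; rewrite lorentzZl lorentzZr ?h1 ?h2 ?h3 ?mulr0 //.
by rewrite mulrA -expRD subrr expR0 mul1r.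
Qed.

Lemma ker_conjV u z : ker Q z -> ker Q (rev u ++ z ++ u).
Proof. by move=> kz; have := ker_conj (rev u) kz; rewrite revK. Qed.

Lemma eqv_conj A B l z u : (forall t, geod A B (t + l) = ev z *m geod A B t) ->
  forall t, geod (ev (rev u) *m A) (ev (rev u) *m B) (t + l) =
    ev (rev u ++ z ++ u) *m geod (ev (rev u) *m A) (ev (rev u) *m B) t.
Proof.
move=> h t; rewrite -!ev_geod h !ev_cat -!mulmxA.
by rewrite ev_revA.
Qed.

(** A line outside the walls can be started at a time at which both the start and the point half a
    period later avoid all walls. Conjugation brings the start into the hexagon, and the resulting
    [loop] contradicts [no_short_loop]. *)
Lemma short_in_wall A B l : null_pair A B -> (forall t, hyp (geod A B t)) -> 0 < l ->
  (forall t, surf_proj S (geod A B (t + l)) = surf_proj S (geod A B t)) ->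
  l <= (2 * k)%:R * ln Lam ->
  exists w i, lorentz (ev w *m normal i) A = 0 /\ lorentz (ev w *m normal i) B = 0.
Proof.
move=> AB hg l0 per lk; apply: contrapT => off.
have [z kz eqv] := period_word AB hg per.
pose nn (e : (word * letter) * bool) := ev e.1.1 *m normal e.1.2.
have [t0 [off1 off2]] : exists t0, (forall w i, lorentz (ev w *m normal i) (geod A B t0) <> 0) /\
    (forall w i, lorentz (ev w *m normal i) (geod A B (t0 + l / 2)) <> 0).
  apply: contrapT => bad.
  (* The flag selects the line itself or the line shifted by half a period, so that one countable
     family covers both conditions. *)
  pose A2 (b : bool) := if b then expR (l / 2) *: A else A.
  pose B2 (b : bool) := if b then expR (- (l / 2)) *: B else B.
  have [||e [r [r' [rr' h1 h2]]]] := @pigeonhole_itv R _ (fun (e : (word * letter) * bool) t =>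
      lorentz (nn e) (geod (A2 e.2) (B2 e.2) t) = 0) 0 1.
  - exact: ltr01.
  - move=> r _; apply: contrapT => ne; apply: bad; exists r; split=> w i h; apply: ne.
      by exists (w, i, false).
    by exists (w, i, true); rewrite /A2 /B2 geod_shift.
  have zero : exists e', lorentz (nn e') (A2 e.2) = 0 /\ lorentz (nn e') (B2 e.2) = 0.
    have := @geod_in_wall R _ (fun=> nn e).
    move: h1 h2; rewrite !lorentz_geod; set a := lorentz _ (A2 _); set b := lorentz _ (B2 _) => h1 h2 _.
    have kk q : expR q * a + expR (- q) * b = 0 -> expR q ^+ 2 * a + b = 0.
      move=> e0; have : expR q * (expR q * a + expR (- q) * b) = 0 by rewrite e0 mulr0.
      by rewrite mulrDr !mulrA -expr2 -expRD subrr expR0 mul1r.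
    have {}h1 := kk _ h1; have {}h2 := kk _ h2.
    have d : (expR r ^+ 2 - expR r' ^+ 2) * a = 0 by rewrite mulrBl; lra.
    have a0 : a = 0.
      move/eqP: d; rewrite mulf_eq0 => /orP[|/eqP//].
      by rewrite subr_eq0 eqrXn2 ?expR_ge0 // => /eqP /expR_inj.
    by exists e; split=> //; move: h1; rewrite -/a a0 mulr0 add0r.
  move: zero => [[[w i] b'] [hA hB]]; apply: off; exists w, i.
  move: hA hB; rewrite /nn /A2 /B2 /=; case: (e.2) => //.
  move=> /eqP; rewrite lorentzZr mulf_eq0 expR_eq0 /= => /eqP hA.
  by move=> /eqP; rewrite lorentzZr mulf_eq0 expR_eq0 /= => /eqP hB.
have [w0 [x [hx dx ex]]] := dom_cover (hg t0).
have sx : sdom x by apply: (wall_off_sdom (u := w0)) => // w i; rewrite -ex.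
pose A0 := expR t0 *: A; pose B0 := expR (- t0) *: B.
pose A1 := ev (rev w0) *m A0; pose B1 := ev (rev w0) *m B0; pose z1 := rev w0 ++ z ++ w0.
have g1 t : geod A1 B1 t = ev (rev w0) *m geod A B (t + t0) by rewrite -ev_geod geod_shift.
have eqv0 t : geod A0 B0 (t + l) = ev z *m geod A0 B0 t.
  by rewrite !geod_shift -eqv; congr geod; ring.
have eqv1 := eqv_conj w0 eqv0.
have hg1 t : hyp (geod A1 B1 t) by rewrite g1; exact: ev_hyp.
have [u [y [hy dy ey]]] := dom_cover (hg1 (l / 2)).
have sy : sdom y.
  apply: (wall_off_sdom (u := u)) => // w i; rewrite -ey g1 => h.
  by apply: (off2 (w0 ++ w) i); rewrite ev_cat -mulmxA ev_adj [t0 + _]addrC.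
have [Lu [lLu wLu _ _]] := lay_nf u; have [Lv [lLv wLv _ _]] := lay_nf (rev z1 ++ u).
have lp : loop A1 B1 l z1 y Lu Lv.
  split=> //.
  - by apply: ev_null_pair; exact: null_pair_shift.
  - by rewrite g1 add0r ex ev_Arev.
  - by rewrite (ev_weq _ wLu).
  - rewrite (ev_weq _ wLv) ev_cat -mulmxA -ey.
    have h := eqv1 (- (l / 2)); rewrite (_ : - (l / 2) + l = l / 2) in h; last by field.
    by rewrite h ev_Arev.
have len : expR (l / 2) <= Lam ^+ k.
  rewrite -expR_lnLam ler_expR; move: lk; rewrite natrM => lk.
  by rewrite ler_pdivrMr // mulrC mulrA.
by apply: (no_short_loop k1 sQ charF lp len); case: (ker_conjV w0 kz).
Qed.

(** A closed geodesic of length at most 2kL lies in a wall, and there [wall_length] gives the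
    opposite inequality. *)
Lemma essential_bound (gamma : R -> 'cV[R]_3) l : essential_closed_geodesic S gamma l ->
  (2 * k)%:R * ln Lam <= l /\
  (l <= (2 * k)%:R * ln Lam -> exists w i, range gamma = wline w i).
Proof.
move=> [/geodesic_line_geod[A [B [AB hg ->]]] l0 per _].
have inw : l <= (2 * k)%:R * ln Lam ->
    exists w i, lorentz (ev w *m normal i) A = 0 /\ lorentz (ev w *m normal i) B = 0.
  exact: short_in_wall.
split; last by move=> /inw[w [i [nA nB]]]; exists w, i; exact: wline_range.
have [le|/ltW//] := leP l ((2 * k)%:R * ln Lam).
have [w [i [nA nB]]] := inw le; have [z kz eqv] := period_word AB hg per.
have [e r] := ker_conjV w kz.
apply: (wall_length k1 sQ charF (ev_null_pair (rev w) AB) (erefl (normal i)) _ _ l0 (eqv_conj w eqv) e r).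
  by rewrite lorentzC ev_adj revK lorentzC.
by rewrite lorentzC ev_adj revK lorentzC.
Qed.

Lemma wgeod_essential w i : essential_closed_geodesic S (wgeod w i) ((2 * k)%:R * ln Lam).
Proof.
have L0 : 0 < (2 * k)%:R * ln Lam by rewrite mulr_gt0 ?ltr0n ?lnLam_gt0.
have k2 : (2 * k)%:R = k.*2%:R :> R by rewrite mul2n.
have ap := apart_nxt_prv i.
split=> //.
- by apply: geod_line; [exact: wgeod_null|exact: wgeod_hyp].
- move=> t; apply: esym; apply/surf_projP.
  exists (w ++ alt k.*2 (nxt i) (prv i) ++ rev w).
    by apply: ker_conj; split; [exact: even_alt|exact: relator_alt].
  by rewrite /wgeod -!ev_geod k2 geod_alt !ev_cat -!mulmxA ev_Arev.
- by move=> /(geod_inj (wgeod_null w i)) e; move: L0; rewrite e ltxx.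
Qed.

Theorem Syst_curves : Syst S = [set C | exists w i, C = curve w i].
Proof.
apply/seteqP; split=> C /=.
  move=> [gamma [l [ess -> min]]].
  have [_ /(_ (min _ _ (wgeod_essential [::] ord0)))[w [i e]]] := essential_bound ess.
  by exists w, i; rewrite /curve -e image_comp.
move=> [w [i ->]]; exists (wgeod w i), ((2 * k)%:R * ln Lam); split.
- exact: wgeod_essential.
- exact: curveE.
- by move=> gamma' l' /essential_bound[].
Qed.

Lemma curve_geodesic w i : surf_geodesic S (curve w i).
Proof.
exists (wgeod w i), setT; split=> //.
- by apply: geod_line; [exact: wgeod_null|exact: wgeod_hyp].
- by exists 0, 1.
- exact: curveE.
Qed.

Lemma curve_skeleton w i : curve w i `<=` skeleton tau.
Proof. by move=> _ [x [hx nx] <-]; apply/skeletonP => //; exists w, i. Qed.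

Lemma skeleton_curve C : surf_geodesic S C -> C `<=` skeleton tau -> exists w i, C `<=` curve w i.
Proof.
move=> [gamma [J [/geodesic_line_geod[A [B [AB hg ->]]] itv [s [t [Js Jt st]]] ->]]] sk.
have [|[w i] [nA nB]] := @geod_in_wall R _ (fun e : word * letter => ev e.1 *m normal e.2) A B s t st.
  move=> r hr; have Jr : J r by apply: (itv s t).
  have /(skeletonP (hg r))[w [i [_ e]]] : skeleton tau (surf_proj S (geod A B r)) by apply: sk; exists r.
  by exists (w, i).
exists w, i => _ [r Jr <-] /=; exists (geod A B r) => //.
by rewrite -(wline_range AB hg nA nB); exists r.
Qed.

Lemma curve_sub w i w' i' : curve w i `<=` curve w' i' -> curve w i = curve w' i'.
Proof.
move=> sub.
(* Words outside the deck group are assigned the vector A + B of the line; its product with A is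
   -1/2, so the wall found cannot come from such a word. *)
have [|z [nA nB]] := @geod_in_wall R _ (fun z : word => if `[< ker Q z >] then ev (z ++ w') *m normal i'
    else ev w *m axisA i + ev w *m axisB i) (ev w *m axisA i) (ev w *m axisB i) 0 1 ltr01.
  move=> r _; have : curve w i (surf_proj S (wgeod w i r)) by rewrite curveE; exists r.
  move=> /sub[x [hx nx] /surf_projP[z kz e]].
  exists z; rewrite asboolT //; rewrite -/(wgeod w i r) e ev_cat -mulmxA ev_lorentz.
  exact: nx.
have kz : ker Q z.
  apply: contrapT => nkz; move: nA; rewrite asboolF //.
  have [h1 h2 h3] := wgeod_null w i.
  rewrite lorentzDl h1 (lorentzC (_ *m axisB i)) h3; lra.
rewrite asboolT // in nA nB.
have e : wline w i = wline (z ++ w') i'.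
  by rewrite -wgeod_range; apply: wline_range nA nB; [exact: wgeod_null|exact: wgeod_hyp].
rewrite /curve e; apply/seteqP; split=> _ [x [hx nx] <-].
  exists (ev (rev z) *m x).
    by split; [exact: ev_hyp|rewrite lorentzC ev_adj revK mulmxA -ev_cat lorentzC].
  by apply/surf_projP; exists z => //; rewrite ev_revA.
exists (ev z *m x).
  by split; [exact: ev_hyp|rewrite ev_cat -mulmxA ev_lorentz].
by apply: esym; apply/surf_projP; exists z.
Qed.

Theorem tess_curves_curves : tess_curves tau = [set C | exists w i, C = curve w i].
Proof.
apply/seteqP; split=> C /=.
  move=> [gC sC maxC]; have [w [i sub]] := skeleton_curve gC sC.
  by exists w, i; apply: esym; apply: maxC sub; [exact: curve_geodesic|exact: curve_skeleton].
move=> [w [i ->]]; split; [exact: curve_geodesic|exact: curve_skeleton|].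
move=> C' gC' sC' sub; have [w' [i' sub']] := skeleton_curve gC' sC'.
apply/seteqP; split=> //.
by rewrite (curve_sub (subset_trans sub sub')).
Qed.
End Systoles.

Lemma card_image_fibers (X : finType) (T : Type) (f : X -> T) (k : nat) :
  (forall x, k <= #|[pred y | `[< f y = f x >]]|)%N ->
  exists2 n, (range f #= `I_n)%card & (n * k <= #|X|)%N.
Proof.
move=> fib.
have ex x : exists y, `[< f y = f x >] by exists x; apply/asboolP.
pose r x := xchoose (ex x).
have rP x : f (r x) = f x by apply/asboolP; exact: (xchooseP (ex x)).
have rE x y : f x = f y -> r x = r y.
  by move=> e; apply: eq_xchoose => z; rewrite e.
have rr x : r (r x) = r x by apply: rE; exact: rP.
pose reps := [pred x | r x == x].
exists #|reps|.
  have [[x0 _]|none] := pselect (exists x : X, True); last first.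
    have -> : #|reps| = 0%N by apply: eq_card0 => x; case: none; exists x.
    have -> : range f = set0 by apply/seteqP; split=> // y [x _ _]; case: none; exists x.
    by rewrite II0.
  have -> : range f = (fun q => f (nth x0 (enum reps) q)) @` `I_#|reps|.
    apply/seteqP; split=> y [x h <-]; last by exists (nth x0 (enum reps) x).
    have xr : r x \in enum reps by rewrite mem_enum inE rr.
    exists (index (r x) (enum reps)); last by rewrite nth_index.
    by rewrite /= cardE index_mem.
  apply: inj_card_eq => p q; rewrite !inE /= cardE => hp hq e.
  have h a : (a < size (enum reps))%N -> r (nth x0 (enum reps) a) = nth x0 (enum reps) a.
    by move=> /(mem_nth x0); rewrite mem_enum inE => /eqP.
  by have := rE _ _ e; rewrite !h // => /eqP; rewrite nth_uniq ?enum_uniq // => /eqP.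
have -> : #|X| = (\sum_(x in reps) \sum_(y | r y == x) 1)%N.
  rewrite -sum1_card (partition_big r (fun x => x \in reps)) //=.
  by move=> y _; rewrite inE rr.
rewrite -sum_nat_const; apply: leq_sum => x; rewrite inE => /eqP rx.
apply: leq_trans (fib x) _; rewrite sum1_card; apply: subset_leq_card.
apply/fintype.subsetP => y; rewrite !inE => e.
apply/eqP; rewrite -rx.
exact: (rE _ _ e).
Qed.

(** * Counting *)

Section Counting.
Variables (R : realType) (F : finFieldType) (m : nat).
Hypothesis m0 : (0 < m)%N.
Notation Q := (modulus F m).
Notation k := m.*2.+1.
Hypothesis charF : forall q : nat, (0 < q <= 4 * k)%N -> q%:R != 0 :> F.
Hypothesis Q0 : Q != 0.
Implicit Types (i j : letter) (w u z : word).
Notation normal := (@normal R).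
Notation ev := (@ev R).
Notation S := (surface R Q0).
Notation curve := (@curve R F m Q0).
Notation even_residue := (even_residue Q).

Let k1 : (1 < k)%N. Proof. by move: m0; clear; case: m. Qed.
Let sQ : size Q = (4 * k - 3)%N. Proof. exact: size_modulus. Qed.

Lemma ev_comm_normal w i : all (comm i) w -> ev w *m normal i = normal i.
Proof.
by move=> h; apply: ev_fix => j jw; rewrite lorentz_normal gramC gram_comm // (allP h).
Qed.

Lemma curve_cat w u i : all (comm i) u -> curve (w ++ u) i = curve w i.
Proof. by move=> h; rewrite /curve /wline ev_cat -mulmxA ev_comm_normal. Qed.

Lemma curve_refl w i : curve (w ++ [:: i]) i = curve w i.
Proof.
rewrite /curve; congr (_ @` _); apply/seteqP.
have e x : lorentz (ev (w ++ [:: i]) *m normal i) x = - lorentz (ev w *m normal i) x.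
  rewrite ev_cat -mulmxA ev1 reflE lorentz_normal gram_eq mulr1.
  rewrite -lorentzNl -mulmxN; congr (lorentz (_ *m _) _).
  by apply/colP => r; rewrite !mxE; ring.
by split=> x [hx]; rewrite ?e => nx; split=> //; rewrite ?e; lra.
Qed.

Lemma curve_ker z w i : ker Q z -> curve (z ++ w) i = curve w i.
Proof.
move=> kz; apply/seteqP; split=> _ [x [hx nx] <-].
  exists (ev (rev z) *m x).
    by split; [exact: ev_hyp|rewrite lorentzC ev_adj revK mulmxA -ev_cat lorentzC].
  by apply/surf_projP; exists z => //; rewrite ev_revA.
exists (ev z *m x).
  by split; [exact: ev_hyp|rewrite ev_cat -mulmxA ev_lorentz].
by apply: esym; apply/surf_projP; exists z.
Qed.

Lemma curve_weq u w i : weq u w -> curve u i = curve w i.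
Proof. by move=> e; rewrite /curve /wline (ev_weq _ e). Qed.

Definition curve_of (e : even_residue * 'I_6) := curve (even_rep e.1) e.2.

Lemma even_exists w : even_word w -> exists c : even_residue, ker Q (w ++ rev (even_rep c)).
Proof.
move=> /signs_even sw; have [c] := rep_exists Q0 w; rewrite sw /rep cats0 => h.
by exists c.
Qed.

Lemma curve_even w i c : ker Q (w ++ rev (even_rep c)) -> curve_of (c, i) = curve w i.
Proof.
move=> h; rewrite /curve_of /= -(curve_ker _ _ h); apply: curve_weq.
by rewrite -catA -[X in weq _ X]cats0; apply: weq_catl; apply: weq_Krev.
Qed.

(** Appending [i] or its neighbour [nxt i] does not change the wall; these letters have opposite
    parities, so the word can be made even. *)
Lemma curve_of_onto w i : exists e, curve_of e = curve w i.
Proof.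
have ci : comm i (nxt i) by move: (i); exact: all_letters.
have oi : odd (nxt i) = ~~ odd i by apply/eqP; move: (i); exact: all_letters.
have [w' ew' <-] : exists2 w', even_word w' & curve w' i = curve w i.
  have cn u : curve (u ++ [:: nxt i]) i = curve u i by rewrite curve_cat //= ci.
  have sg u j : signs (u ++ [:: j]) = addbb2 (signs u) (odd j, ~~ odd j).
    by rewrite signs_cat; congr addbb2; rewrite /signs /= !addn0; case: (odd j).
  have : [\/ even_word w, even_word (w ++ [:: i]), even_word (w ++ [:: nxt i]) |
      even_word ((w ++ [:: nxt i]) ++ [:: i])].
    have ew u : signs u = (false, false) -> even_word u by move/signs_even.
    case e : (signs w) => [p q]; case o : (odd i) oi => oi; case: p e; case: q => e.
    - by constructor 4; apply: ew; rewrite !sg e o oi.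
    - by constructor 2; apply: ew; rewrite !sg e o.
    - by constructor 3; apply: ew; rewrite !sg e oi.
    - by constructor 1; apply: ew.
    - by constructor 4; apply: ew; rewrite !sg e o oi.
    - by constructor 3; apply: ew; rewrite !sg e oi.
    - by constructor 2; apply: ew; rewrite !sg e o.
    - by constructor 1; apply: ew.
  case=> h.
  - by exists w.
  - by exists (w ++ [:: i]); rewrite ?curve_refl.
  - by exists (w ++ [:: nxt i]); rewrite ?cn.
  - by exists ((w ++ [:: nxt i]) ++ [:: i]); rewrite ?curve_refl ?cn.
have [c hc] := even_exists ew'.
by exists (c, i); exact: curve_even.
Qed.

Lemma alt_not_relator i r : (0 < r < k)%N -> ~ relator Q (alt r.*2 (nxt i) (prv i)).
Proof.
move=> /andP[r0 rk] /(relator_alt_small k1 sQ charF) /(_ rk) h.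
have := @geod_alt R i r 0; rewrite (ev_weq _ h) mul1mx => /(geod_inj (axis_null R i)) /eqP.
rewrite add0r mulf_eq0 pnatr_eq0 double_eq0 (gt_eqF (lnLam_gt0 R)) orbF => /eqP e.
by rewrite e in r0.
Qed.

Lemma alt_inj w i r r' : (r < k)%N -> (r' < k)%N ->
  relator Q ((w ++ alt r.*2 (nxt i) (prv i)) ++ rev (w ++ alt r'.*2 (nxt i) (prv i))) -> r = r'.
Proof.
wlog le : r r' / (r' <= r)%N.
  move=> h; have [le|/ltnW le] := leqP r' r; first exact: h.
  move=> hr hr' /relator_rev; rewrite rev_cat revK => /(h _ _ le hr' hr); exact: esym.
move=> rk _ rel; apply/eqP; rewrite eqn_leq le andbT leqNgt; apply/negP => lt.
apply: (@alt_not_relator i (r - r')); first by rewrite subn_gt0 lt (leq_ltn_trans (leq_subr _ _) rk).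
have := relator_conj (rev w) rel; rewrite revK; apply: relator_weq.
set a := alt r.*2 _ _; set b := alt r'.*2 _ _; set c := alt (r - r').*2 _ _.
have eab : a = c ++ b.
  by rewrite /a -(subnK le) doubleD alt_cat odd_double.
have cancel u X : weq (rev u ++ u ++ X) X.
  by rewrite catA -[X in weq _ X]cat0s; apply: weq_catr; apply: weq_Krev.
rewrite rev_cat eab -!catA; apply: weq_trans (cancel _ _) _.
rewrite -[X in weq _ X]cats0; apply: weq_catl.
apply: weq_trans (weq_catl _ (weq_catl _ (weq_Krev w))) _.
by rewrite cats0; apply: weq_revK.
Qed.

(** The translations by 2rL along the side [i], for r < k, are even and preserve its wall, while
    [alt_inj] keeps them distinct modulo the deck group. Each curve thus arises from at least k of
    the 6M pairs. *)
Lemma curve_fiber e : (k <= #|[pred e' | `[< curve_of e' = curve_of e >]]|)%N.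
Proof.
case: e => c i; have [ew _] := even_repP c.
pose wr (r : 'I_k) := even_rep c ++ alt r.*2 (nxt i) (prv i).
have ewr r : even_word (wr r) by apply: even_cat => //; apply: even_alt; exact: apart_nxt_prv.
have [h hP] := choice (fun r => even_exists (ewr r)).
have inj : injective h.
  move=> r r' e; apply/val_inj; apply: (@alt_inj (even_rep c) i); try exact: ltn_ord.
  have [_ h1] := hP r; have [_ h2] := hP r'; rewrite -e in h2.
  have := relator_cat h1 (relator_rev h2); rewrite rev_cat revK; apply: relator_weq.
  rewrite -catA; apply: weq_catl; rewrite catA -[X in weq _ X]cat0s; apply: weq_catr.
  exact: weq_Krev.
rewrite -[X in (X <= _)%N](card_ord k) -cardsT -(card_imset _ (f := fun r => (h r, i))); last first.
  by move=> r r' [/inj].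
apply: subset_leq_card; apply/fintype.subsetP => _ /imsetP[r _ ->]; rewrite inE.
rewrite (curve_even i (hP r)).
rewrite /curve_of /=.
apply: curve_cat.
have c1 : comm i (nxt i) by move: (i); exact: all_letters.
have c2 : comm i (prv i) by move: (i); exact: all_letters.
move: (nat_of_ord r).*2 (nxt i) (prv i) c1 c2; elim=> //= q IH p p' h1 h2.
by rewrite h1 IH.
Qed.

Theorem Syst_card : exists2 n, (Syst S #= `I_n)%card & (0 < n)%N /\ (n * k <= 6 * #|{: even_residue}|)%N.
Proof.
have [n hn le] := card_image_fibers curve_fiber.
have eS : Syst S = range curve_of.
  rewrite Syst_curves //; apply/seteqP; split=> C /=.
    by move=> [w [i ->]]; have [e <-] := curve_of_onto w i; exists e.
  by move=> [e _ <-]; exists (even_rep e.1), e.2.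
exists n; first by rewrite eS.
split; last by rewrite (mulnC 6); move: le; rewrite card_prod card_ord.
rewrite lt0n; apply/eqP => n0; move: hn; rewrite n0 II0 card_eq0 => /eqP/seteqP[h _].
have [e _] := curve_of_onto [::] ord0.
by apply: (h (curve_of e)); exists e.
Qed.

(** A residue has 36 entries with 8m coefficients each, and 36 times 8 is 288. *)
Lemma card_even_residue : (#|{: even_residue}| <= #|F| ^ (288 * m))%N.
Proof.
have -> : #|{: even_residue}| = #|[pred c | `[< exists2 w, even_word w & residue Q w = c >]]|.
  by rewrite card_sig.
apply: leq_trans (max_card _) _.
rewrite card_mx card_mx sQ mul1n -expnM leq_exp2l //; first by lia.
exact: card_finNzRing_gt1.
Qed.
End Counting.

(** The choice m = p/16, rounded down, keeps 4k = 8m + 4 below the characteristic [p], while k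
    remains of order p/8. *)
Lemma prime_surface (R : realType) (p : nat) : prime p -> (16 < p)%N ->
  exists M n (S : hyp_surface R) (tau : std_tesselation S),
    [/\ has_genus S M.+1, tess_curves tau = Syst S, (Syst S #= `I_n)%card &
        [/\ (0 < n)%N, (n * (p %/ 16).*2.+1 <= 6 * M)%N & (M <= p ^ (288 * (p %/ 16)))%N]].
Proof.
move=> pp p16; set m := (p %/ 16)%N; pose F := 'F_p.
have m0 : (0 < m)%N by rewrite divn_gt0 // ltnW.
have charF (q : nat) : (0 < q <= 4 * m.*2.+1)%N -> q%:R != 0 :> F.
  move=> /andP[q0 q1]; rewrite -(dvdn_pcharf (pchar_Fp pp)).
  apply/negP => /(dvdn_leq q0) h.
  have := leq_trans h q1; have : (m * 16 <= p)%N := leq_divM p 16.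
  by move: p16; rewrite -mul2n; lia.
have Q0 : modulus F m != 0 by rewrite -size_poly_eq0 size_modulus // -mul2n; lia.
have [n hn [n0 nk]] := @Syst_card R F m m0 charF Q0.
exists #|{: even_residue (modulus F m)}|, n, (surface R Q0), (tesselation R Q0); split=> //.
- exact: surface_genus.
- by rewrite (Syst_curves R m0 charF Q0) (tess_curves_curves R Q0).
- split=> //; have := @card_even_residue F m m0 Q0; by rewrite (card_Fp pp).
Qed.

(** * Asymptotics of the genus *)

Section Asymptotics.
Variable R : realType.

Lemma ln_le_root4 (x : R) : 0 < x -> ln x <= 4 * Num.sqrt (Num.sqrt x).
Proof.
move=> x0; set s := Num.sqrt _; have s0 : 0 < s by rewrite !sqrtr_gt0.
have -> : x = s ^+ 4.
  by rewrite -[4%N]/(2 * 2)%N exprM !sqr_sqrtr // ?sqrtr_ge0 // ltW.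
rewrite lnXn // -[ln s *+ 4]mulr_natl; apply: ler_wpM2l => //.
by rewrite ltW // ln_sublinear.
Qed.

(** With G = M + 1 it suffices that ln G times ln ln ln G is at most (19K/2)^2, since nK <= 6M and
    57 = 6 times 19/2. As ln G is O(x ln x) and K is of order x, a crude bound ln x <= 4 x^(1/4) is
    enough. *)
Lemma asymptotic_bound (p M n : nat) (x := p%:R : R) :
  48 * (expR (expR 1) + 1) <= x -> 1000 * 1000 <= x -> (0 < n)%N ->
  (n * (p %/ 16).*2.+1 <= 6 * M)%N -> (M <= p ^ (288 * (p %/ 16)))%N ->
  [/\ 0 < ln (ln (ln (M.+1%:R : R))), x <= 48 * M.+1%:R &
   n%:R <= 57 / Num.sqrt (ln (ln (ln (M.+1%:R : R)))) * (M.+1%:R / Num.sqrt (ln (M.+1%:R : R)))].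
Proof.
move=> xe x6 n0 nk Mp; set m := (p %/ 16)%N in nk Mp.
pose K : R := (m.*2.+1)%:R; pose G : R := M.+1%:R.
have xm : x < 16 * (m%:R + 1).
  have : (p < 16 * m.+1)%N by rewrite mulnC -ltn_divLR.
  by rewrite -(ltr_nat R) natrM -[m.+1%:R]natr1.
have mx : 16 * m%:R <= x.
  have : (16 * m <= p)%N by rewrite mulnC leq_divM.
  by rewrite -(ler_nat R) natrM.
have KE : K = 2 * m%:R + 1 by rewrite /K -[m.*2.+1%:R]natr1 -mul2n natrM.
have Kx : x / 8 - 1 <= K by lra.
have n1 : 1 <= n%:R :> R by rewrite ler1n.
have nK : n%:R * K <= 6 * M%:R.
  by move: nk; rewrite -(ler_nat R) !natrM.
have GE : G = M%:R + 1 by rewrite /G natr1.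
have K0 : 0 <= K by rewrite ler0n.
have KM : K <= 6 * M%:R by apply: le_trans nK; rewrite ler_peMl.
have xG : x <= 48 * G by clear -Kx KM GE; lra.
have ee0 : 0 < expR (expR 1) :> R by exact: expR_gt0.
have Ge : expR (expR 1) < G by clear -xe xG; lra.
have G0 : 0 < G by clear -ee0 Ge; lra.
set a := ln G; set b := ln a; set c := ln b.
have a1 : expR 1 < a by rewrite /a -[X in X < _]expRK ltr_ln // posrE.
have a0 : 0 < a by apply: lt_trans a1; exact: expR_gt0.
have b1 : 1 < b by rewrite /b -[X in X < _]expRK ltr_ln // posrE expR_gt0.
have c0 : 0 < c by rewrite ln_gt0.
split=> //.
have x0 : 0 < x by clear -x6; lra.
have x1 : 1 < x by clear -x6; lra.
set L := ln x.
have L0 : 0 < L by exact: ln_gt0.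
(* 288m <= 18x because 16m <= x; one more factor [p] absorbs the passage from M to M + 1, whence
   19. *)
have aL : a <= 19 * x * L.
  have : G <= x ^+ (288 * m).+1.
    have : (M.+1 <= p ^ (288 * m).+1)%N.
      have M0 : (0 < M)%N.
        by rewrite lt0n; apply/eqP => M0; move: nk n0; rewrite M0 muln0 leqn0 muln_eq0 /= orbF => /eqP ->.
      have p2 : (1 < p)%N.
        by rewrite -(ltr_nat R); clear -x1; lra.
      rewrite expnS; apply: leq_trans (_ : (2 * M <= _)%N).
        by rewrite mul2n -addnn -add1n leq_add2r.
      exact: leq_mul.
    by rewrite -(ler_nat R) natrX.
  rewrite -ler_ln ?posrE ?exprn_gt0 // lnXn // -[_ *+ (288 * m).+1]mulr_natl => h; apply: le_trans h _.
  rewrite -/L ler_pM2r // -[(288 * m).+1%:R]natr1 natrM.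
  have : 288 * m%:R <= 18 * x by clear -mx; lra.
  by move=> h'; clear -h' x1; lra.
have bL : b <= 3 * L.
  have Lx : L < x by exact: ln_sublinear.
  have : a <= x ^+ 3.
    apply: le_trans aL _; rewrite exprS expr2 mulrC [X in _ <= X]mulrA [X in _ <= X]mulrC mulrA.
    have h1 : L * 19 <= x * x.
      by apply: ler_pM; [exact: ltW | by [] | exact: ltW | clear -x6; lra].
    by rewrite -subr_ge0 (_ : _ - _ = x * (x * x - L * 19)) ?mulr_ge0 ?subr_ge0 ?(ltW x0) //; ring.
  by rewrite -ler_ln ?posrE ?exprn_gt0 // lnXn // -[_ *+ 3]mulr_natl.
have cL : c <= 3 * L by apply: le_trans bL; rewrite ltW // ln_sublinear // (lt_trans ltr01 b1).
set r := Num.sqrt x; have r2 : r ^+ 2 = x by rewrite sqr_sqrtr // ltW.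
have r0 : 0 <= r by exact: sqrtr_ge0.
have r1000 : 1000 <= r.
  rewrite leNgt; apply/negP => h; have : r * r < 1000 * 1000 by apply: ltr_pM.
  by rewrite -expr2 r2 ltNge x6.
have LL : L ^+ 2 <= 16 * r.
  have := ln_le_root4 x0; rewrite -/L -/r => h.
  have : L ^+ 2 <= (4 * Num.sqrt r) ^+ 2 by rewrite ler_pXn2r ?nnegrE ?mulr_ge0 ?sqrtr_ge0 // ltW.
  by rewrite exprMn sqr_sqrtr // -natrX.
have ac : a * c <= (19 / 2 * K) ^+ 2.
  have h1 : a * c <= (19 * x * L) * (3 * L) by apply: ler_pM => //; exact: ltW.
  have h2 : (19 * x * L) * (3 * L) <= 57 * x * (16 * r).
    rewrite (_ : _ * (3 * L) = 57 * x * L ^+ 2); last by ring.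
    by rewrite ler_pM2l // mulr_gt0.
  have Kx' : x / 9 <= K by lra.
  have h3 : (x / 9) ^+ 2 <= K ^+ 2 by rewrite ler_pXn2r ?nnegrE // divr_ge0 // ltW.
  have h4 : x * (1000 * r) <= x ^+ 2.
    rewrite expr2 ler_pM2l // -r2 expr2 ler_wpM2r //.
  have h5 : 0 <= x * r by rewrite mulr_ge0 // ltW.
  have e9 : (x / 9) ^+ 2 = x ^+ 2 / 81 by field.
  have e19 : (19 / 2 * K) ^+ 2 = 361 / 4 * K ^+ 2 by field.
  rewrite e9 in h3; rewrite e19; lra.
have sq : Num.sqrt c * Num.sqrt a <= 19 / 2 * K.
  rewrite -sqrtrM ?(ltW c0) // mulrC -[X in _ <= X]ger0_norm; last by rewrite mulr_ge0 // divr_ge0.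
  by rewrite -sqrtr_sqr ler_wsqrtr.
have sc : 0 < Num.sqrt c by rewrite sqrtr_gt0.
have sa : 0 < Num.sqrt a by rewrite sqrtr_gt0.
rewrite -/G -/a -/b -/c (_ : _ * (G / _) = 57 * G / (Num.sqrt c * Num.sqrt a)); last by field; rewrite !gt_eqF.
rewrite ler_pdivlMr ?mulr_gt0 //; apply: le_trans (ler_wpM2l _ sq) _; first by rewrite ler0n.
lra.
Qed.
End Asymptotics.

Theorem theorem25 (R : realType) :
  exists A : set nat,
    infinite_set A /\
    (forall g : nat, A g -> (2 <= g)%N /\ 0 < ln (ln (ln (g%:R : R)))) /\
    forall g : nat, A g ->
      exists (S : hyp_surface R) (tau : std_tesselation S),
        [/\ has_genus S g,
            tess_curves tau = Syst S &
            exists n : nat, (Syst S #= `I_n)%card /\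
              (n%:R : R) <= 57 / Num.sqrt (ln (ln (ln g%:R)))
                            * (g%:R / Num.sqrt (ln g%:R))].
Proof.
pose good (S : hyp_surface R) (tau : std_tesselation S) (g : nat) := [/\ has_genus S g,
    tess_curves tau = Syst S & exists n : nat, (Syst S #= `I_n)%card /\
      (n%:R : R) <= 57 / Num.sqrt (ln (ln (ln g%:R))) * (g%:R / Num.sqrt (ln g%:R))].
(* All genera with the required properties are collected, so only the infiniteness of the set
   remains. *)
exists [set g | [/\ (2 <= g)%N, 0 < ln (ln (ln (g%:R : R))) & exists S tau, @good S tau g]].
split; last by split=> g [g2 g3 [S [tau h]]] //; exists S, tau.
move=> /finite_seqP[s sE].
(* The first two summands are the hypotheses of [asymptotic_bound]. As the genus is at least p/48,
   the last one puts it above every element of the supposed finite list. *)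
pose bnd : R := 48 * (expR (expR 1) + 1) + 1000 * 1000 + 48 * (sumn s).+1%:R.
have e0 : 0 < expR (expR 1) :> R by exact: expR_gt0.
have s0 : 0 <= (sumn s).+1%:R :> R by rewrite ler0n.
have [p pb pp] := prime_above (Num.bound bnd).
have px : bnd < p%:R.
  have := archi_boundP (_ : 0 <= bnd); rewrite /bnd; move=> h; apply: lt_trans (h _) _; first by lra.
  by rewrite ltr_nat.
have x1 : 48 * (expR (expR 1) + 1) <= p%:R :> R by move: px; rewrite /bnd; lra.
have x2 : 1000 * 1000 <= p%:R :> R by move: px; rewrite /bnd; lra.
have p16 : (16 < p)%N by rewrite -(ltr_nat R); lra.
have [M [n [S [tau [h1 h2 h3 [n0 nk Mp]]]]]] := prime_surface R pp p16.
have [g3 gx gn] := asymptotic_bound x1 x2 n0 nk Mp.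
have Ms : (sumn s < M)%N.
  by rewrite -ltnS -(ltr_nat R); move: px; rewrite /bnd; lra.
have : [set` s] M.+1.
  rewrite -sE; split=> //; first by rewrite ltnS (leq_ltn_trans _ Ms).
  by exists S, tau; split=> //; exists n.
rewrite /= => Min; have : (M.+1 <= sumn s)%N.
  elim: (s) Min => //= q s' IH; rewrite inE => /orP[/eqP ->|/IH h]; first exact: leq_addr.
  exact: leq_trans h (leq_addl _ _).
by move=> h; have := ltn_trans h Ms; rewrite ltnn.
Qed.
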